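(* Let $(M^4, g(t))$, $-\infty<t\le 0$, be an oriented $4$-dimensional complete ancient solution to the Ricci flow such that $g(t)$ has nonnegative isotropic curvature for every $t$. Then $g(t)$ has $2$-nonnegative Ricci curvature and satisfies the curvature estimate $$|Rm|\le R .$$ Furthermore, if $g(t)$ has positive isotropic curvature, then it has $2$-positive Ricci curvature.
   Context: A complete ancient solution to the Ricci flow on $M$ is a smooth family $g(t)$, $t\in(-\infty,0]$, of complete Riemannian metrics with $\partial_t g=-2Rc$; no curvature bound is assumed. Let $(M^4,g)$ be an oriented Riemannian $4$-manifold with curvature tensor $R_{ijkl}$ (sign convention: $R_{ijij}$ is the sectional curvature of the plane spanned by orthonormal $e_i,e_j$), scalar curvature $R$ and Weyl curvature $W=W^++W^-$. Equip $\wedge^2(M)$ with the inner product for which $\{e_i\wedge e_j\}_{i<j}$ is orthonormal whenever $\{e_i\}$ is, and view the curvature operator as $Rm(e_i\wedge e_j,e_k\wedge e_l)=R_{ijkl}$. With respect to $\wedge^2(M)=\wedge^+(M)\oplus\wedge^-(M)$ (self-dual and anti-self-dual $2$-forms), $$Rm=\begin{pmatrix}A&B\\ {}^tB&C\end{pmatrix},\quad A=W^++\tfrac{R}{12}I,\quad C=W^-+\tfrac{R}{12}I,$$ with $B$ determined by the traceless Ricci tensor. $|Rm|$ is the Hilbert–Schmidt norm of this operator on $\wedge^2(M)$. Let $A_1\le A_2\le A_3$ and $C_1\le C_2\le C_3$ be the eigenvalues of $A$ and $C$. Positive (resp. nonnegative) isotropic curvature means $A_1+A_2>0$ and $C_1+C_2>0$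 (resp. $A_1+A_2\ge0$ and $C_1+C_2\ge0$) at every point; equivalently $R_{1313}+R_{1414}+R_{2323}+R_{2424}-2R_{1234}>0$ (resp. $\ge0$) for all orthonormal four-frames. The Ricci curvature is $2$-nonnegative (resp. $2$-positive) if the sum of the two smallest eigenvalues of $Rc$ is $\ge 0$ (resp. $>0$) at every point. *)

(* Defs.v *)
From HB Require Import structures.
From mathcomp Require Import all_boot all_order all_algebra.
From mathcomp Require Import all_classical all_reals all_analysis.

Set Implicit Arguments.
Unset Strict Implicit.
Unset Printing Implicit Defensive.

Import Order.TTheory GRing.Theory Num.Theory.
Import numFieldNormedType.Exports.

Local Open Scope classical_set_scope.
Local Open Scope ring_scope.

Section Smooth.
Variables (R : realType) (V W : normedModType R).

(* Meaningful for open U: all iterated directional derivatives of order <= k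
   exist and are continuous on U, which for finite-dimensional V is C^k. *)
Fixpoint Ck_open (k : nat) (U : set V) (f : V -> W) : Prop :=
  (forall x, U x -> {for x, continuous f}) /\
  if k is k'.+1 then
    forall v, (forall x, U x -> derivable f x v) /\ Ck_open k' U ('D_v f)
  else True.

(* The set A need not be open (space-time has a boundary at t = 0): a map is
   smooth on A when it locally extends to a smooth map on an open set. *)
Definition smooth_on (A : set V) (f : V -> W) : Prop :=
  forall x, A x -> exists U : set V, exists h : V -> W,
    [/\ open U, U x, forall k, Ck_open k U h &
        forall y, A y -> U y -> h y = f y].

End Smooth.

(* Smooth manifolds without boundary, of dimension n.+1 (row vectors 'rV[R]_n.+1
   are normed only for a successor size).  A chart i is the homeomorphism
   [phi i] from the open set [dom i] onto the open set [img i], with inverse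
   [psi i]; both maps are total, with irrelevant values elsewhere. *)
Record manifold (R : realType) (n : nat) := Manifold {
  point :> topologicalType;
  chart : Type;
  dom : chart -> set point;
  phi : chart -> point -> 'rV[R]_n.+1;
  psi : chart -> 'rV[R]_n.+1 -> point;
  chart_at : point -> chart;
  point_hausdorff : hausdorff_space point;
  point_second_countable : @second_countable point;
  dom_chart_at : forall p, dom (chart_at p) p;
  dom_open : forall i, open (dom i);
  img_open : forall i, open (phi i @` dom i);
  phiK : forall i p, dom i p -> psi i (phi i p) = p;
  phi_continuous : forall i, {within dom i, continuous (phi i)};
  psi_continuous : forall i, {within phi i @` dom i, continuous (psi i)};
  transition_smooth : forall i j,
    smooth_on (phi i @` (dom i `&` dom j)) (phi j \o psi i)
}.

Section Geometry.
Variables (R : realType) (n : nat) (M : manifold R n).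

Definition img (i : chart M) : set 'rV[R]_n.+1 := @phi R n M i @` dom i.
Definition overlap (i j : chart M) : set 'rV[R]_n.+1 :=
  @phi R n M i @` (dom i `&` dom j).
Definition transition (i j : chart M) : 'rV[R]_n.+1 -> 'rV[R]_n.+1 :=
  @phi R n M j \o @psi R n M i.

(* An oriented manifold is given by an atlas of positively oriented charts. *)
Definition oriented : Prop :=
  forall i j x, overlap i j x -> 0 < \det (jacobian (transition i j) x).

(* The components of a covariant 2-tensor, chart by chart, as functions of the
   coordinates. *)
Definition tensor2 := chart M -> 'rV[R]_n.+1 -> 'M[R]_n.+1.

(* Vectors are rows, so [jacobian f x] has (a, b) entry the a-th partial
   derivative of the b-th component of f. *)
Definition riemannian (g : tensor2) : Prop :=
  [/\ forall i, smooth_on (img i) (g i),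
      forall i x, img i x -> (g i x)^T = g i x,
      forall i x, img i x -> forall v : 'rV[R]_n.+1, v != 0 ->
        0 < (v *m g i x *m v^T) 0 0 &
      forall i j x, overlap i j x ->
        g i x = jacobian (transition i j) x *m g j (transition i j x)
                *m (jacobian (transition i j) x)^T].

Definition C1_curve (c : R -> M) : Prop :=
  continuous c /\
  forall s i, dom i (c s) ->
    (\forall r \near s, derivable (@phi R n M i \o c) r 1) /\
    {for s, continuous (derive1 (@phi R n M i \o c))}.

Definition speed (g : tensor2) (c : R -> M) (s : R) : R :=
  let i := chart_at (c s) in
  let v := derive1 (@phi R n M i \o c) s in
  Num.sqrt ((v *m g i (phi i (c s)) *m v^T) 0 0).

Definition curve_length (g : tensor2) (c : R -> M) : \bar R :=
  (\int[@lebesgue_measure R]_(s in `[0%R, 1%R]) (speed g c s)%:E)%E.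

(* Curves need not be regular, so, up to reparametrization, these are the
   same as piecewise C^1 curves on [0, 1].  The distance between two different
   components is +oo. *)
Definition riem_dist (g : tensor2) (p q : M) : \bar R :=
  ereal_inf [set l | exists c : R -> M,
    [/\ C1_curve c, c 0 = p, c 1 = q & l = curve_length g c]].

Definition riem_complete (g : tensor2) : Prop :=
  forall u : nat -> M,
    (forall e : R, 0 < e -> exists N : nat, forall k l : nat,
       (N <= k)%N -> (N <= l)%N -> (riem_dist g (u k) (u l) < e%:E)%E) ->
    exists p : M, forall e : R, 0 < e -> exists N : nat, forall k : nat,
       (N <= k)%N -> (riem_dist g (u k) p < e%:E)%E.

End Geometry.

Section Curvature.
Variables (R : realType) (n : nat).
Variable G : 'rV[R]_n.+1 -> 'M[R]_n.+1.
Implicit Types (x : 'rV[R]_n.+1) (a b c d e : 'I_n.+1).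

Definition partial a (f : 'rV[R]_n.+1 -> R) x : R := 'D_(delta_mx 0 a) f x.

(* [christoffel c a b] is Gamma^c_ab. *)
Definition christoffel c a b x : R :=
  2^-1 * \sum_d (invmx (G x)) c d *
    (partial a (fun y => G y b d) x + partial b (fun y => G y a d) x
     - partial d (fun y => G y a b) x).

(* The component along d_e of
   nabla_a nabla_b d_c - nabla_b nabla_a d_c. *)
Definition riem_up e a b c x : R :=
  partial a (christoffel e b c) x - partial b (christoffel e a c) x
  + \sum_d (christoffel d b c x * christoffel e a d x
            - christoffel d a c x * christoffel e b d x).

(* R_abcd = <R(d_a, d_b) d_d, d_c>: with this order of the last two indices
   R_abab is the sectional curvature for orthonormal d_a, d_b. *)
Definition riem a b c d x : R := \sum_e G x c e * riem_up e a b d x.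

Definition ricci x : 'M[R]_n.+1 :=
  \matrix_(b, d) \sum_a \sum_c (invmx (G x)) a c * riem a b c d x.

Definition scal x : R := \sum_b \sum_d (invmx (G x)) b d * ricci x b d.

(* The rows of E are the coordinates of the frame vectors. *)
Definition orthonormal_frame x (E : 'M[R]_n.+1) : Prop :=
  E *m G x *m E^T = 1%:M.

Definition riem_frame x (E : 'M[R]_n.+1) (i j k l : 'I_n.+1) : R :=
  \sum_a \sum_b \sum_c \sum_d
    E i a * E j b * E k c * E l d * riem a b c d x.

Definition ricci_frame x (E : 'M[R]_n.+1) : 'M[R]_n.+1 :=
  E *m ricci x *m E^T.

End Curvature.

(* The eigenvalues of a matrix with split characteristic polynomial (e.g. a
   real symmetric one), with multiplicity, in nondecreasing order. *)
Definition eigenvalues (R : realType) (m : nat) (A : 'M[R]_m) : seq R :=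
  sort <=%R (xget [::] [set s : seq R |
                        char_poly A = \prod_(a <- s) ('X - a%:P)]).

Definition sum_two_smallest (R : realType) (m : nat) (A : 'M[R]_m) : R :=
  (eigenvalues A)`_0 + (eigenvalues A)`_1.

Section Dimension4.
Variable R : realType.

(* The orthonormal basis e01, e02, e03, e23, e31, e12 of 2-vectors; the Hodge
   star exchanges its k-th and (3 + k)-th elements. *)
Definition bivector (k : 'I_(3 + 3)) : 'I_4 * 'I_4 :=
  nth (0, 0) [:: (0, 1); (0, 2); (0, 3); (2, 3); (3, 1); (1, 2)] k.

Section Frame.
Variables (G : 'rV[R]_4 -> 'M[R]_4) (x : 'rV[R]_4) (E : 'M[R]_4).

(* Rm on 2-vectors, in the above orthonormal basis. *)
Definition curv_op : 'M[R]_(3 + 3) :=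
  \matrix_(k, l) riem_frame G x E (bivector k).1 (bivector k).2
                                  (bivector l).1 (bivector l).2.

Definition curv_norm : R := Num.sqrt (\sum_k \sum_l curv_op k l ^+ 2).

(* The rows of [sd_basis] (resp. [asd_basis]) are an orthonormal basis of the
   self-dual (resp. anti-self-dual) 2-vectors when E is positively oriented. *)
Definition sd_basis : 'M[R]_(3, 3 + 3) :=
  (Num.sqrt 2)^-1 *: row_mx 1%:M 1%:M.
Definition asd_basis : 'M[R]_(3, 3 + 3) :=
  (Num.sqrt 2)^-1 *: row_mx 1%:M (- 1%:M).

Definition curv_A : 'M[R]_3 := sd_basis *m curv_op *m sd_basis^T.
Definition curv_C : 'M[R]_3 := asd_basis *m curv_op *m asd_basis^T.

End Frame.

Variable M : manifold R 3.
Implicit Type g : tensor2 M.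

Definition nonneg_isotropic_curvature g : Prop :=
  forall i x E, img i x -> orthonormal_frame (g i) x E -> 0 < \det E ->
    0 <= sum_two_smallest (curv_A (g i) x E) /\
    0 <= sum_two_smallest (curv_C (g i) x E).

Definition pos_isotropic_curvature g : Prop :=
  forall i x E, img i x -> orthonormal_frame (g i) x E -> 0 < \det E ->
    0 < sum_two_smallest (curv_A (g i) x E) /\
    0 < sum_two_smallest (curv_C (g i) x E).

Definition two_nonneg_ricci g : Prop :=
  forall i x E, img i x -> orthonormal_frame (g i) x E ->
    0 <= sum_two_smallest (ricci_frame (g i) x E).

Definition two_pos_ricci g : Prop :=
  forall i x E, img i x -> orthonormal_frame (g i) x E ->
    0 < sum_two_smallest (ricci_frame (g i) x E).

Definition curvature_estimate g : Prop :=
  forall i x E, img i x -> orthonormal_frame (g i) x E ->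
    curv_norm (g i) x E <= scal (g i) x.

End Dimension4.

(* Only the times t <= 0 matter; at t = 0 the time derivative is one-sided. *)
Definition complete_ancient_ricci_flow (R : realType) (n : nat)
    (M : manifold R n) (g : R -> tensor2 M) : Prop :=
  [/\ forall t, t <= 0 -> riemannian (g t) /\ riem_complete (g t),
      forall i : chart M, smooth_on (img i `*` [set t : R | t <= 0])
        (fun z : 'rV[R]_n.+1 * R => g z.2 i z.1) &
      forall t, t <= 0 -> forall i x, img i x ->
        (fun s : R => (s - t)^-1 *: (g s i x - g t i x))
          @ within [set s : R | s <= 0] t^' --> - 2 *: ricci (g t i) x].

(* Main.v *)
(** Where it is negative, the sum of the two smallest Ricci eigenvalues is a
    supersolution of u_t = Lap u + u^2, by nonnegative isotropic curvature. On
    an ancient solution this should give u >= -1/(t - T) for every T, hence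
    u >= 0; as no curvature bound is assumed, u is localized to a ball of the
    changing distance to a center. Frames are propagated along a nearly
    minimizing path from the minimum point to the center, and both ends are
    moved along geodesics by h in all frame directions, and back in time by
    h^2/(2 dim M): the second variation terms cancel against the Ricci flow, so
    that the distance grows by o(h^2) on average, without any bound on the
    curvature. Hence a localized minimum is bounded below as in the discrete
    maximum principle. The norm estimate is then linear algebra. *)
Require Import Defs.
From HB Require Import structures.
From mathcomp Require Import all_boot all_order all_algebra.
From mathcomp Require Import all_classical all_reals all_analysis.
From mathcomp Require Import ring lra zify.

Set Implicit Arguments.
Unset Strict Implicit.
Unset Printing Implicit Defensive.

Import Order.TTheory GRing.Theory Num.Theory.
Import numFieldNormedType.Exports.

Local Open Scope classical_set_scope.
Local Open Scope ring_scope.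

(** A cutoff by the distance to a fixed center usually rests on a comparison for the distance
    function: the variation is damped to zero at the center, which costs a Ricci bound near it, and
    cut points need extra care. Here the center is a variable as well. It roams over a coordinate
    ball, at the price of a quadratic penalty, and is displaced by the same propagated frame as the
    far end, so nothing is damped. What remains is the cost of moving a point in a fixed chart
    during a compact time interval, a constant independent of the cutoff radius, and its influence
    vanishes as the radius grows. Minimizing geodesics and parallel frames are not constructed. On a
    short piece, a field whose covariant derivative vanishes at one point is parallel up to an
    arbitrarily small error per unit length, and the pieces are joined by the triangle inequality.
    The sum of two eigenvalues and the distance are both nonsmooth. They are replaced by relations,
    the trace over some orthonormal pair and some upper bound of the distance, which are stable
    under limits and are compared only through finite differences. *)

Lemma near_open (T : topologicalType) (U : set T) (x : T) : open U -> U x -> nbhs x U.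
Proof. by move=> oU Ux; exact: open_nbhs_nbhs. Qed.

Lemma near_dist (R : realType) (V : normedModType R) (x : V) (P : set V) : nbhs x P ->
  exists2 r : R, 0 < r & forall y, `|y - x| < r -> P y.
Proof. by move=> /nbhs_ballP[r /= r0 H]; exists r => // y yr; apply: H; rewrite -ball_normE /= distrC. Qed.

Lemma sum_cst (R : pzSemiRingType) N (z : R) : \sum_(k < N) z = N%:R * z.
Proof. by rewrite sumr_const card_ord mulr_natl. Qed.

Lemma le_of_eq (R : numDomainType) (x y : R) : x = y -> x <= y.
Proof. by move=> ->. Qed.

(** * Smooth scalar functions on open sets: increments, chain rule, closure under algebra and
    composition *)

Section Calculus.
Variable R : realType.
Implicit Types V : normedModType R.

Definition smooth V (U : set V) (f : V -> R) : Prop := forall k, Ck_open k U f.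

Lemma is_derive_line V (f : V -> R) (p e : V) (s : R) :
  derivable f (p + s *: e) e ->
  is_derive s 1 (fun r : R => f (p + r *: e)) ('D_e f (p + s *: e)).
Proof.
move=> df.
have E : (fun h : R => h^-1 *: (f (h *: e + (p + s *: e)) - f (p + s *: e))) =
  (fun h : R => h^-1 *: ((fun r : R => f (p + r *: e)) (h *: (1 : R) + s)
     - f (p + s *: e))).
  apply/funext => h; congr (_ *: (f _ - _)).
  by rewrite [_ *: 1]mulr1 scalerDl addrCA addrC -addrA [s *: e + _]addrC.
split; first by rewrite /derivable -E.
by rewrite /derive -E.
Qed.

Lemma derivable_continuous1 (f : R -> R) (x : R) :
  derivable f x 1 -> {for x, continuous f}.
Proof. by move=> /derivable1_diffP; exact: differentiable_continuous. Qed.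

Lemma mvt_from0 (f df : R -> R) (c : R) :
  (forall s : R, `|s| <= `|c| -> is_derive s 1 f (df s)) ->
  exists2 s : R, `|s| <= `|c| & f c - f 0 = df s * c.
Proof.
move=> H.
have cf (a b : R) : (forall x, x \in `[a, b] -> `|x| <= `|c|) ->
    {within `[a, b], continuous f}.
  by move=> hs; apply: derivable_within_continuous => x /hs /H [? _].
have sub (a b x : R) : x \in `]a, b[ -> x \in `[a, b].
  by rewrite !in_itv /= => /andP[? ?]; rewrite !ltW.
have [c0|c0] := lerP 0 c.
  have hs x : x \in `[0, c] -> `|x| <= `|c|.
    by rewrite in_itv /= => /andP[x1 x2]; rewrite !ger0_norm.
  have df' x : x \in `]0, c[ -> is_derive x 1 f (df x) by move=> /sub /hs /H.
  have [s /hs sc E] := MVT_segment c0 df' (cf _ _ hs).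
  by exists s => //; rewrite E subr0.
have hs x : x \in `[c, 0] -> `|x| <= `|c|.
  by rewrite in_itv /= => /andP[x1 x2]; rewrite ler0_norm // ltr0_norm // lerN2.
have df' x : x \in `]c, 0[ -> is_derive x 1 f (df x) by move=> /sub /hs /H.
have [s /hs sc E] := MVT_segment (ltW c0) df' (cf _ _ hs).
by exists s => //; rewrite -opprB E sub0r mulrN opprK.
Qed.

Lemma segment_increment V (f : V -> R) (p e : V) (c a eps : R) :
  (forall s, `|s| <= `|c| -> derivable f (p + s *: e) e /\
     `|'D_e f (p + s *: e) - a| <= eps) ->
  `|f (p + c *: e) - f p - c * a| <= eps * `|c|.
Proof.
move=> H.
have dg (s : R) : `|s| <= `|c| ->
    is_derive s 1 (fun r : R => f (p + r *: e)) ('D_e f (p + s *: e)).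
  by move=> /H [? _]; exact: is_derive_line.
have [s sc] := mvt_from0 dg.
rewrite scale0r addr0 => ->.
have [_ Ds] := H s sc.
by rewrite [c * a]mulrC -mulrBl normrM ler_wpM2r.
Qed.

Lemma near_eq_continuous V (f g : V -> R) x : (\forall y \near x, f y = g y) ->
  {for x, continuous f} -> {for x, continuous g}.
Proof.
rewrite /prop_for /continuous_at => fg; rewrite -(nbhs_singleton fg) => cf.
by apply: cvg_trans cf; apply: near_eq_cvg; apply: filterS fg => y ->.
Qed.

Lemma Ck_open_ext V (U : set V) (f g : V -> R) k : open U ->
  (forall x, U x -> f x = g x) -> Ck_open k U f -> Ck_open k U g.
Proof.
move=> oU; elim: k f g => [|k IH] f g fg /= [cf Df].
  split=> // x Ux.
  have fgx : \forall y \near x, f y = g y.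
    by near=> y; apply: fg; near: y; exact: open_nbhs_nbhs.
  exact: near_eq_continuous fgx (cf _ Ux).
have near_fg x : U x -> \forall y \near x, f y = g y.
  by move=> Ux; near=> y; apply: fg; near: y; exact: open_nbhs_nbhs.
split=> [x Ux|v].
  exact: near_eq_continuous (near_fg _ Ux) (cf _ Ux).
have [dv Cv] := Df v; split=> [x Ux|].
  by apply: near_eq_derivable (dv x Ux); exact: near_fg.
apply: IH Cv => x Ux; apply: near_eq_derive; exact: near_fg.
Unshelve. all: by end_near. Qed.

Lemma smooth_ext V (U : set V) (f g : V -> R) : open U ->
  (forall x, U x -> f x = g x) -> smooth U f -> smooth U g.
Proof. by move=> oU fg sf k; exact: Ck_open_ext (sf k). Qed.

Lemma Ck_open_sub V (U U' : set V) (f : V -> R) k :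
  U' `<=` U -> Ck_open k U f -> Ck_open k U' f.
Proof.
move=> UU; elim: k f => [|k IH] f /= [cf Df]; first by split=> // x /UU; exact: cf.
split=> [x /UU|v]; first exact: cf.
by have [dv Cv] := Df v; split=> [x /UU|]; [exact: dv|exact: IH].
Qed.

Lemma smooth_sub V (U U' : set V) (f : V -> R) :
  U' `<=` U -> smooth U f -> smooth U' f.
Proof. by move=> UU sf k; exact: Ck_open_sub (sf k). Qed.

Lemma smooth_continuous V (U : set V) (f : V -> R) x :
  smooth U f -> U x -> {for x, continuous f}.
Proof. by move=> /(_ 0%N) [cf _]; exact: cf. Qed.

Lemma smooth_derivable V (U : set V) (f : V -> R) x v :
  smooth U f -> U x -> derivable f x v.
Proof. by move=> /(_ 1%N) [_ /(_ v)] [df _]; exact: df. Qed.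

Lemma smooth_derive V (U : set V) (f : V -> R) v :
  smooth U f -> smooth U ('D_v f).
Proof. by move=> sf k; have [_ /(_ v) []] := sf k.+1. Qed.

(** Induction on the order of differentiability once and for all: after it, a closure property only
    requires that the derivatives of a class stay in the class, up to equality on [U]. *)
Lemma smooth_coind V (U : set V) (P : (V -> R) -> Prop) : open U ->
  (forall f, P f -> (forall x, U x -> {for x, continuous f}) /\
    forall v, (forall x, U x -> derivable f x v) /\
      exists2 g, P g & forall x, U x -> 'D_v f x = g x) ->
  forall f, P f -> smooth U f.
Proof.
move=> oU H f Pf k; elim: k f Pf => [|k IH] f /H [cf Df]; split=> // v.
have [dv [g Pg E]] := Df v; split=> //.
by apply: (Ck_open_ext (f := g)) => //; [move=> x /E|exact: IH].
Qed.

(* Coordinates bounded by the norm, as for the sup norms of row vectors and of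
   products. *)
Record fbasis V := FBasis {
  fdim : nat;
  fvec : 'I_fdim -> V;
  fcoord : 'I_fdim -> V -> R;
  fcoordP : forall i a u v, fcoord i (a *: u + v) = a * fcoord i u + fcoord i v;
  fcoord_le : forall i v, `|fcoord i v| <= `|v|;
  fcoordK : forall v, v = \sum_i fcoord i v *: fvec i
}.

Arguments fdim {V} _.
Arguments fvec {V} _ _.
Arguments fcoord {V} _ _ _.

Lemma fcoordB V (fb : fbasis V) i (u v : V) :
  fcoord fb i (u - v) = fcoord fb i u - fcoord fb i v.
Proof. by rewrite addrC -scaleN1r fcoordP mulN1r addrC. Qed.

(** The increment is telescoped over a polygon whose edges follow the coordinate vectors, with one
    mean value theorem per edge; continuity of the partial derivatives then gives the linear
    approximation in all directions at once. *)
Lemma C1_increment V (fb : fbasis V) (U : set V) (f : V -> R) y eps :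
  open U -> smooth U f -> U y -> 0 < eps ->
  \forall z \near y, `|f z - f y - \sum_i fcoord fb i (z - y) * 'D_(fvec fb i) f y|
     <= eps * \sum_i `|fcoord fb i (z - y)|.
Proof.
move=> oU sf Uy e0.
have : \forall z \near y, U z /\ forall i, `|'D_(fvec fb i) f z - 'D_(fvec fb i) f y| <= eps.
  near=> z; split; first by near: z; exact: open_nbhs_nbhs.
  near: z; apply: filter_forall => i.
  have /cvgrPdist_le /(_ _ e0) := smooth_continuous (smooth_derive (fvec fb i) sf) Uy.
  by apply: filterS => z; rewrite distrC.
move=> /nbhs_ballP [r /= r0 Hr].
(* With |z - y| C < r, the whole coordinate polygon from [y] to [z] lies in the ball where the
   partial derivatives are controlled. *)
pose C := 1 + \sum_i `|fvec fb i : V|.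
have C0 : 0 < C by rewrite ltr_pwDl // sumr_ge0.
near=> z.
have zr : `|z - y| * C < r.
  rewrite -ltr_pdivlMr //.
  by near: z; apply: cvgr_distC_lt; rewrite ?divr_gt0.
pose c i := fcoord fb i (z - y).
pose p (k : nat) := y + \sum_(i < fdim fb | (i < k)%N) c i *: fvec fb i.
have main k : (k <= fdim fb)%N ->
   `|f (p k) - f y - \sum_(i < fdim fb | (i < k)%N) c i * 'D_(fvec fb i) f y|
     <= eps * \sum_(i < fdim fb | (i < k)%N) `|c i|.
  elim: k => [_|k IH lk].
    by rewrite /p !big_pred0_eq addr0 subrr subr0 normr0 mulr0.
  pose ik := Ordinal lk.
  have S (W : nmodType) (F : 'I_(fdim fb) -> W) : \sum_(i < fdim fb | (i < k.+1)%N) F i =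
      F ik + \sum_(i < fdim fb | (i < k)%N) F i.
    rewrite (bigD1 ik) //=; congr (_ + _); apply: eq_bigl => i.
    by rewrite ltnS -val_eqE /= ltn_neqAle andbC.
  have -> : p k.+1 = p k + c ik *: fvec fb ik.
    by rewrite /p S addrA addrAC.
  rewrite !S mulrDr.
  have -> : f (p k + c ik *: fvec fb ik) - f y - (c ik * 'D_(fvec fb ik) f y +
    \sum_(i < fdim fb | (i < k)%N) c i * 'D_(fvec fb i) f y) =
    (f (p k + c ik *: fvec fb ik) - f (p k) - c ik * 'D_(fvec fb ik) f y) +
    (f (p k) - f y - \sum_(i < fdim fb | (i < k)%N) c i * 'D_(fvec fb i) f y) by ring.
  apply: le_trans (ler_normD _ _) _; apply: lerD; last exact/IH/ltnW.
  apply: segment_increment => s sc.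
  have Hb : ball y r (p k + s *: fvec fb ik).
    rewrite -ball_normE /= /p -addrA opprD addrA subrr sub0r normrN.
    apply: le_lt_trans zr.
    apply: le_trans (ler_normD _ _) _.
    have : `|\sum_(i < fdim fb | (i < k)%N) c i *: fvec fb i| + `|s *: fvec fb ik| <=
       \sum_(i < fdim fb | (i < k)%N) `|z - y| * `|fvec fb i| + `|z - y| * `|fvec fb ik|.
      apply: lerD.
        apply: le_trans (ler_norm_sum _ _ _) _; apply: ler_sum => i _.
        by rewrite normrZ ler_wpM2r // fcoord_le.
      by rewrite normrZ ler_wpM2r // (le_trans sc) // fcoord_le.
    move/le_trans; apply.
    rewrite addrC -S -mulr_sumr ler_wpM2l // /C.
    apply: (@le_trans _ _ (\sum_i `|fvec fb i : V|)); last by rewrite lerDr.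
    by rewrite [leRHS](bigID (fun i : 'I_(fdim fb) => (i < k.+1)%N)) /= lerDl sumr_ge0.
  by have [Uz Dz] := Hr _ Hb; split; [exact: smooth_derivable sf Uz|exact: Dz].
have := main (fdim fb) (leqnn _).
have Sd (W : nmodType) (F : 'I_(fdim fb) -> W) : \sum_(i < fdim fb | (i < fdim fb)%N) F i = \sum_i F i.
  by apply: eq_bigl => i; rewrite ltn_ord.
by rewrite /p !Sd -(fcoordK fb (z - y)) subrKC.
Unshelve. all: by end_near. Qed.

(** [phi] enters only through its continuity and the derivatives of its coordinates; [C1_increment]
    supplies the linear approximation of [f]. *)
Lemma chain_rule V V' (fb : fbasis V') (U' : set V') (f : V' -> R) (phi : V -> V') x v
    (d : 'I_(fdim fb) -> R) :
  open U' -> smooth U' f -> U' (phi x) ->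
  {for x, continuous phi} ->
  (forall i, is_derive x v (fun y => fcoord fb i (phi y)) (d i)) ->
  is_derive x v (f \o phi) (\sum_i d i * 'D_(fvec fb i) f (phi x)).
Proof.
move=> oU sf Ux cphi dphi.
pose q i (h : R) := h^-1 *: (fcoord fb i (phi (h *: v + x)) - fcoord fb i (phi x)).
have qd i : q i h @[h --> 0^'] --> d i.
  by have [dd <-] := dphi i; exact: dd.
have lin : continuous (fun h : R => h *: v + x).
  by move=> h; apply: cvgD; [exact: cvgZr_tmp cvg_id|exact: cvg_cst].
suff Q : h^-1 *: ((f \o phi) (h *: v + x) - (f \o phi) x) @[h --> 0^'] -->
   \sum_i d i * 'D_(fvec fb i) f (phi x).
  split; first by apply/cvg_ex; eexists; exact: Q.
  by apply: cvg_lim.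
have Q1 : \sum_i q i h * 'D_(fvec fb i) f (phi x) @[h --> 0^'] -->
   \sum_i d i * 'D_(fvec fb i) f (phi x).
  apply: cvg_big => [|i _]; [exact: add_continuous|apply: cvgMl; exact: qd].
rewrite -[X in _ --> X]addr0.
have -> : (fun h => h^-1 *: ((f \o phi) (h *: v + x) - (f \o phi) x)) =
  (fun h => \sum_i q i h * 'D_(fvec fb i) f (phi x) + (h^-1 *: ((f \o phi) (h *: v + x) - (f \o phi) x) - \sum_i q i h * 'D_(fvec fb i) f (phi x))).
  by apply/funext => h; rewrite [RHS]addrC subrK.
apply: cvgD Q1 _.
apply/cvgr0Pnorm_le => eps e0.
pose D := 1 + \sum_i (`|d i| + 1).
have D0 : 0 < D by rewrite ltr_pwDl // sumr_ge0 // => i _; rewrite addr_ge0.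
have e1 : 0 < eps / D by rewrite divr_gt0.
have : \forall h \near 0^', forall i, `|q i h| <= `|d i| + 1.
  apply: filter_forall => i.
  move/cvgrPdist_le: (qd i) => /(_ _ ltr01); apply: filterS => h Hh.
  rewrite -lerBlDl; apply: le_trans Hh; rewrite distrC; exact: lerB_dist.
have N1 := C1_increment fb oU sf Ux e1.
have cp0 : (phi (h *: v + x) @[h --> (0 : R)]) --> phi x.
  have := lin 0; rewrite /continuous_at scale0r add0r => l0.
  exact: (continuous_cvg _ cphi l0).
have N3 : \forall h \near 0^', 
   `|f (phi (h *: v + x)) - f (phi x) -
       \sum_i fcoord fb i (phi (h *: v + x) - phi x) * 'D_(fvec fb i) f (phi x)| <=
     eps / D * (\sum_i `|fcoord fb i (phi (h *: v + x) - phi x)|).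
  have N2 := cp0 _ N1; exact: (nbhs_dnbhs N2).
have N4 : \forall h \near 0^', (h : R) != 0 by exact: nbhs_dnbhs_neq.
move: N3 N4; apply: filterS3 => h H3 h0 H.
have -> : h^-1 *: ((f \o phi) (h *: v + x) - (f \o phi) x) - \sum_i q i h * 'D_(fvec fb i) f (phi x)
  = h^-1 * (f (phi (h *: v + x)) - f (phi x) -
       \sum_i fcoord fb i (phi (h *: v + x) - phi x) * 'D_(fvec fb i) f (phi x)).
  rewrite mulrBr mulr_sumr; congr (_ - _); apply: eq_bigr => i _.
  by rewrite /q fcoordB mulrA.
rewrite normrM; apply: le_trans (ler_wpM2l (normr_ge0 _) H3) _.
rewrite mulrCA mulr_sumr.
rewrite -[leRHS](divfK (lt0r_neq0 D0)) ler_wpM2l ?(ltW e1) //.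
apply: (@le_trans _ _ (\sum_i (`|d i| + 1))); last by rewrite /D lerDr.
apply: ler_sum => i _; apply: le_trans (H i).
by rewrite /q fcoordB normrZ.
Qed.

Lemma continuous_fcoord V V' (fb : fbasis V') (phi : V -> V') x :
  (forall i, {for x, continuous (fun y => fcoord fb i (phi y))}) ->
  {for x, continuous phi}.
Proof.
move=> H.
have -> : phi = (fun y => \sum_i fcoord fb i (phi y) *: fvec fb i).
  by apply/funext => y; exact: fcoordK.
by apply: cvg_big => [|i _]; [exact: add_continuous|apply: cvgZr_tmp; exact: H].
Qed.

(** The closure of the smooth functions under the operations needed later. Derivatives of its
    members are again of these forms, so [smooth_coind] treats the whole class at once; the rules
    for products and for compositions, taken separately, would call for each other. *)
Inductive smooth_alg V (U : set V) : (V -> R) -> Prop :=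
| SA_smooth f : smooth U f -> smooth_alg U f
| SA_add f g : smooth_alg U f -> smooth_alg U g -> smooth_alg U (fun x => f x + g x)
| SA_mul f g : smooth_alg U f -> smooth_alg U g -> smooth_alg U (fun x => f x * g x)
| SA_inv f : (forall x, U x -> f x != 0) -> smooth_alg U f ->
    smooth_alg U (fun x => (f x)^-1)
| SA_comp V' (fb : fbasis V') (U' : set V') f (phi : V -> V') :
    open U' -> smooth U' f -> (forall x, U x -> U' (phi x)) ->
    (forall i, smooth_alg U (fun x => fcoord fb i (phi x))) ->
    smooth_alg U (fun x => f (phi x)).

Lemma smooth_cst V (U : set V) (a : R) : open U -> smooth U (fun _ => a).
Proof.
move=> oU; apply: (smooth_coind (P := fun f => exists b : R, f = fun _ => b)) oU _ _ _.
  move=> _ [b ->]; split=> [x _|v]; first exact: cst_continuous.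
  split=> [x _|]; first exact: derivable_cst.
  by exists (fun _ => 0); [exists 0|move=> x _; exact: derive_cst].
by exists a.
Qed.

Lemma is_deriveVR V (f : V -> R) x v (d : R) : f x != 0 -> is_derive x v f d ->
  is_derive x v (fun y => (f y)^-1) (- ((f x)^-1 * (f x)^-1) * d).
Proof.
move=> f0 [df <-]; split; first exact: derivableV.
rewrite (deriveV f0 df); congr (_ * _).
by rewrite -exprVn expr2.
Qed.

Lemma is_deriveMR V (f g : V -> R) x v (d e : R) :
  is_derive x v f d -> is_derive x v g e ->
  is_derive x v (fun y => f y * g y) (f x * e + d * g x).
Proof.
move=> [df <-] [dg <-]; split; first exact: (derivableM df dg).
by have /= -> := deriveM df dg; rewrite [X in _ + X = _]mulrC.
Qed.

Lemma is_deriveDR V (f g : V -> R) x v (d e : R) :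
  is_derive x v f d -> is_derive x v g e ->
  is_derive x v (fun y => f y + g y) (d + e).
Proof.
move=> [df <-] [dg <-]; split; first exact: derivableD.
exact: deriveD.
Qed.

Lemma smooth_alg_smooth V (U : set V) f : open U -> smooth_alg U f -> smooth U f.
Proof.
move=> oU; apply: smooth_coind => // {}f.
suff H : smooth_alg U f -> (forall x, U x -> {for x, continuous f}) /\
  forall v, exists2 g, smooth_alg U g & forall x, U x -> is_derive x v f (g x).
  move=> /H [cf df]; split=> // v; have [g sg dg] := df v.
  split=> [x Ux|]; first by have [] := dg x Ux.
  by exists g => // x Ux; have [] := dg x Ux.
have acst a : smooth_alg U (fun _ => a) by exact/SA_smooth/smooth_cst.
elim=> {f} [f sf|f g _ [cf df] _ [cg dg]|f g sf [cf df] sg [cg dg]|f f0 sf [cf df]|V' fb U' f phi oU' sf UU sphi IH].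
- split=> [x|v]; first exact: smooth_continuous.
  exists ('D_v f); first exact/SA_smooth/smooth_derive.
  by move=> x Ux; split=> //; exact: smooth_derivable sf Ux.
- split=> [x Ux|v]; first by apply: cvgD; [exact: cf|exact: cg].
  have [f' sf' df'] := df v; have [g' sg' dg'] := dg v.
  exists (fun x => f' x + g' x); first exact: SA_add.
  by move=> x Ux; apply: is_deriveDR; [exact: df'|exact: dg'].
- split=> [x Ux|v]; first by apply: cvgM; [exact: cf|exact: cg].
  have [f' sf' df'] := df v; have [g' sg' dg'] := dg v.
  exists (fun x => f x * g' x + f' x * g x); first by apply: SA_add; exact: SA_mul.
  by move=> x Ux; apply: is_deriveMR; [exact: df'|exact: dg'].
- split=> [x Ux|v]; first by apply: cvgV; [exact: f0|exact: cf].
  have [f' sf' df'] := df v.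
  exists (fun x => (-1 * ((f x)^-1 * (f x)^-1)) * f' x).
    by do 2?[apply: SA_mul => //]; apply: SA_mul; exact: SA_inv.
  by move=> x Ux; rewrite mulN1r; apply: is_deriveVR; [exact: f0|exact: df'].
- have cphi x : U x -> {for x, continuous phi}.
    move=> Ux; have K := @continuous_fcoord _ _ fb phi x; apply: K => i.
    by have [c _] := IH i; exact: c.
  split=> [x Ux|v].
    have := smooth_continuous sf (UU _ Ux).
    exact: (continuous_comp (cphi _ Ux)).
  have H i : exists g, smooth_alg U g /\ forall x, U x -> is_derive x v (fun y => fcoord fb i (phi y)) (g x).
    by have [_ /(_ v) [g ? ?]] := IH i; exists g.
  have [G HG] := choice H.
  exists (fun x => \sum_i G i x * 'D_(fvec fb i) f (phi x)).
    have -> : (fun x => \sum_i G i x * 'D_(fvec fb i) f (phi x)) =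
      \sum_i (fun x => G i x * 'D_(fvec fb i) f (phi x)).
      by apply/funext => x; rewrite fct_sumE.
    apply: (big_ind (smooth_alg U)) => [|a b sa sb|i _].
    + exact: acst.
    + exact: SA_add.
    + apply: SA_mul; first by have [] := HG i.
      have := SA_comp (f := 'D_(fvec fb i) f) oU' (smooth_derive _ sf) UU sphi; exact.
  move=> x Ux; apply: (chain_rule (U' := U')) => //; [exact: UU|exact: cphi|].
  by move=> i; have [_] := HG i; exact.
Qed.

End Calculus.
Arguments fdim {R V} _.
Arguments fvec {R V} _ _.
Arguments fcoord {R V} _ _ _.

(** * Closure properties of smooth functions, and symmetry of second derivatives *)

Section SmoothClosure.
Variable R : realType.
Implicit Types V : normedModType R.

Lemma smooth_is_derive V (U : set V) (f : V -> R) x v :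
  smooth U f -> U x -> is_derive x v f ('D_v f x).
Proof. by move=> sf Ux; split=> //; exact: smooth_derivable sf Ux. Qed.

Lemma smoothD V (U : set V) (f g : V -> R) : open U ->
  smooth U f -> smooth U g -> smooth U (fun x => f x + g x).
Proof.
by move=> oU sf sg; apply: smooth_alg_smooth => //; apply: SA_add; exact: SA_smooth.
Qed.

Lemma smoothM V (U : set V) (f g : V -> R) : open U ->
  smooth U f -> smooth U g -> smooth U (fun x => f x * g x).
Proof.
by move=> oU sf sg; apply: smooth_alg_smooth => //; apply: SA_mul; exact: SA_smooth.
Qed.

Lemma smoothV V (U : set V) (f : V -> R) : open U ->
  (forall x, U x -> f x != 0) -> smooth U f -> smooth U (fun x => (f x)^-1).
Proof.
by move=> oU f0 sf; apply: smooth_alg_smooth => //; apply: SA_inv => //; exact: SA_smooth.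
Qed.

Lemma smooth_comp V V' (fb : fbasis V') (U : set V) (U' : set V') (f : V' -> R)
    (phi : V -> V') :
  open U -> open U' -> smooth U' f -> (forall x, U x -> U' (phi x)) ->
  (forall i, smooth U (fun x => fcoord fb i (phi x))) -> smooth U (fun x => f (phi x)).
Proof.
move=> oU oU' sf UU sphi; apply: smooth_alg_smooth => //.
by have := SA_comp oU' sf UU (fun i => SA_smooth (sphi i)); apply.
Qed.

Lemma smoothN V (U : set V) (f : V -> R) : open U ->
  smooth U f -> smooth U (fun x => - f x).
Proof.
move=> oU sf; apply: (smooth_ext (f := fun x => -1 * f x)) => // [x _|].
  by rewrite mulN1r.
by apply: smoothM => //; exact: smooth_cst.
Qed.

Lemma smoothB V (U : set V) (f g : V -> R) : open U ->
  smooth U f -> smooth U g -> smooth U (fun x => f x - g x).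
Proof. by move=> oU sf sg; apply: smoothD => //; exact: smoothN. Qed.

Lemma smooth_sum V (U : set V) (I : Type) (r : seq I) (P : pred I) (F : I -> V -> R) :
  open U -> (forall i, P i -> smooth U (F i)) ->
  smooth U (fun x => \sum_(i <- r | P i) F i x).
Proof.
move=> oU sF; elim: r => [|i r IH].
  by apply: (smooth_ext (f := fun _ => 0)) => // [x _|]; [rewrite big_nil|exact: smooth_cst].
apply: (smooth_ext (f := fun x => (if P i then F i x else 0) + \sum_(j <- r | P j) F j x)) => //.
  by move=> x _; rewrite big_cons; case: (P i); rewrite ?add0r.
apply: smoothD => //; case Pi: (P i); [exact: sF|exact: smooth_cst].
Qed.

Lemma smooth_prod V (U : set V) (I : Type) (r : seq I) (P : pred I) (F : I -> V -> R) :
  open U -> (forall i, P i -> smooth U (F i)) ->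
  smooth U (fun x => \prod_(i <- r | P i) F i x).
Proof.
move=> oU sF; elim: r => [|i r IH].
  by apply: (smooth_ext (f := fun _ => 1)) => // [x _|]; [rewrite big_nil|exact: smooth_cst].
apply: (smooth_ext (f := fun x => (if P i then F i x else 1) * \prod_(j <- r | P j) F j x)) => //.
  by move=> x _; rewrite big_cons; case: (P i); rewrite ?mul1r.
apply: smoothM => //; case Pi: (P i); [exact: sF|exact: smooth_cst].
Qed.

Lemma is_derive_lin V (L : V -> R) x v :
  (forall a u w, L (a *: u + w) = a * L u + L w) -> is_derive x v L (L v).
Proof.
move=> LP.
suff C : (fun h : R => h^-1 *: (L (h *: v + x) - L x)) @ 0^' --> L v.
  split; first by apply/cvg_ex; eexists; exact: C.
  exact: cvg_lim C.
apply/cvgrPdist_le => e e0; near=> h.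
have h0 : h != 0 by near: h; exact: nbhs_dnbhs_neq.
by rewrite LP addrK [_ *: _]mulKf // subrr normr0 ltW.
Unshelve. all: by end_near. Qed.

Lemma smooth_lin V (U : set V) (L : V -> R) : open U -> continuous L ->
  (forall a u w, L (a *: u + w) = a * L u + L w) -> smooth U L.
Proof.
move=> oU cL LP k; case: k => [|k]; first by split=> // x _; exact: cL.
split=> [x _|v]; first exact: cL.
split=> [x _|]; first by have [] := is_derive_lin x v LP.
apply: (Ck_open_ext (f := fun _ => L v)) => //; last exact: smooth_cst.
by move=> x _; have [_ ->] := is_derive_lin x v LP.
Qed.

Lemma smooth_fcoord V (fb : fbasis V) (U : set V) i : open U -> smooth U (fcoord fb i).
Proof.
move=> oU; apply: smooth_lin => //; last exact: fcoordP.
move=> x; apply/cvgrPdist_le => e e0.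
move/cvgrPdist_le: (@cvg_id V (nbhs x)) => /(_ e e0); apply: filterS => z H.
by rewrite -fcoordB; apply: le_trans H; exact: fcoord_le.
Qed.

Lemma derive_dirE V (fb : fbasis V) (U : set V) (f : V -> R) x v :
  open U -> smooth U f -> U x -> 'D_v f x = \sum_i fcoord fb i v * 'D_(fvec fb i) f x.
Proof.
move=> oU sf Ux.
have H i : is_derive x v (fun y => fcoord fb i y) (fcoord fb i v).
  exact: is_derive_lin (fcoordP i).
have c : {for x, continuous (fun y : V => y)} by exact: cvg_id.
by have [_ <-] := chain_rule (phi := id) oU sf Ux c H.
Qed.

Lemma double_increment V (U : set V) (f : V -> R) (x u v : V) (h : R) :
  smooth U f ->
  (forall s r : R, `|s| <= `|h| -> `|r| <= `|h| -> U (x + s *: u + r *: v)) ->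
  exists s r : R, [/\ `|s| <= `|h|, `|r| <= `|h| &
    f (x + h *: u + h *: v) - f (x + h *: u) - f (x + h *: v) + f x =
    'D_v ('D_u f) (x + s *: u + r *: v) * h * h].
Proof.
move=> sf HU.
pose g (s : R) := f (x + h *: v + s *: u) - f (x + s *: u).
have h0 : `|0 : R| <= `|h| by rewrite normr0.
have dg (s : R) : `|s| <= `|h| ->
    is_derive s 1 g ('D_u f (x + h *: v + s *: u) - 'D_u f (x + s *: u)).
  move=> sh.
  have U1 : U (x + h *: v + s *: u) by rewrite addrAC; exact: HU.
  have U2 : U (x + s *: u) by have := HU s 0 sh h0; rewrite scale0r addr0.
  have D1 := is_derive_line (smooth_derivable (v := u) sf U1).
  have D2 := is_derive_line (smooth_derivable (v := u) sf U2).
  exact: is_deriveB.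
have [s sh] := mvt_from0 dg.
rewrite /g !scale0r !addr0 [x + h *: v + h *: u]addrAC => E.
pose k (r : R) := 'D_u f (x + s *: u + r *: v).
have dk (r : R) : `|r| <= `|h| -> is_derive r 1 k ('D_v ('D_u f) (x + s *: u + r *: v)).
  move=> rh; apply: is_derive_line.
  exact: (smooth_derivable (smooth_derive u sf) (HU s r sh rh)).
have [r rh] := mvt_from0 dk.
rewrite /k !scale0r !addr0 => E2.
exists s, r; split=> //.
rewrite -E2 [x + s *: u + h *: v]addrAC -E; ring.
Qed.

Lemma near_close2 V (U : set V) (F G : V -> R) x e : open U -> U x -> 0 < e ->
  {for x, continuous F} -> {for x, continuous G} ->
  \forall z \near x, [/\ U z, `|F x - F z| <= e & `|G x - G z| <= e].
Proof.
move=> oU Ux e0 /cvgrPdist_le /(_ _ e0) cF /cvgrPdist_le /(_ _ e0) cG.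
have nU : nbhs x U by exact: open_nbhs_nbhs.
exact: filterS3 nU cF cG.
Qed.

Lemma close_aux (a0 b0 a b e h X Y : R) : `|b0 - a| <= e / 2 -> `|a0 - b| <= e / 2 ->
  X = a * h * h -> Y = b * h * h -> X = Y -> h != 0 -> `|a0 - b0| <= e.
Proof.
move=> A1 A2 -> -> E h0; have ab : a = b by do 2!apply: (mulIf h0).
rewrite (_ : _ - _ = (a0 - b) - (b0 - a)); last by rewrite ab; ring.
apply: le_trans (ler_normB _ _) _; rewrite [e]splitr; exact: lerD.
Qed.

(** The second difference over a small parallelogram is h ^ 2 times a value of either mixed
    derivative, by two mean value theorems in either order ([double_increment]); both values are
    close to those at [x]. *)
Lemma schwarz V (U : set V) (f : V -> R) x u v :
  open U -> smooth U f -> U x -> 'D_u ('D_v f) x = 'D_v ('D_u f) x.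
Proof.
move=> oU sf Ux.
apply/eqP; rewrite -subr_eq0 -normr_le0; apply/ler_addgt0Pl => e e0.
rewrite addr0.
have e2 : 0 < e / 2 by rewrite divr_gt0.
have cu := smooth_continuous (smooth_derive u (smooth_derive v sf)) Ux.
have cv := smooth_continuous (smooth_derive v (smooth_derive u sf)) Ux.
have N : \forall z \near x, [/\ U z, `|'D_u ('D_v f) x - 'D_u ('D_v f) z| <= e / 2 &
    `|'D_v ('D_u f) x - 'D_v ('D_u f) z| <= e / 2].
  exact (near_close2 oU Ux e2 cu cv).
move/nbhs_ballP: N => [r /= r0 Hr].
pose C := 1 + `|u| + `|v|.
have C0 : 0 < C by rewrite ltr_pwDl // ltr_pwDl.
pose h := r / 2 / C.
have h0 : 0 < h by rewrite !divr_gt0.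
have Hb (s t : R) (u' v' : V) : `|u'| + `|v'| <= C -> `|s| <= `|h| -> `|t| <= `|h| ->
    ball x r (x + s *: u' + t *: v').
  move=> uv sh th; rewrite -ball_normE /= -addrA opprD addrA subrr sub0r normrN.
  apply: le_lt_trans (ler_normD _ _) _; rewrite !normrZ.
  apply: (@le_lt_trans _ _ (h * C)); last by rewrite /h divfK ?gt_eqF // ltr_pdivrMr // mulr2n mulrDr mulr1 ltrDl.
  rewrite (gtr0_norm h0) in sh th.
  apply: le_trans (lerD (ler_wpM2r (normr_ge0 _) sh) (ler_wpM2r (normr_ge0 _) th)) _.
  by rewrite -mulrDr ler_wpM2l // ltW.
have uvC : `|u| + `|v| <= C by rewrite /C -addrA lerDr.
have vuC : `|v| + `|u| <= C by rewrite addrC.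
have [|s [t [sh th E1]]] := double_increment (x := x) (u := u) (v := v) (h := h) sf.
  by move=> s t sh th; have [] := Hr _ (Hb s t u v uvC sh th).
have [|s' [t' [sh' th' E2]]] := double_increment (x := x) (u := v) (v := u) (h := h) sf.
  by move=> s' t' sh' th'; have [] := Hr _ (Hb s' t' v u vuC sh' th').
have [_ _ A1] := Hr _ (Hb s t u v uvC sh th).
have [_ A2 _] := Hr _ (Hb s' t' v u vuC sh' th').
refine (close_aux A1 A2 E1 E2 _ _); last by rewrite gt_eqF.
by rewrite [x + h *: v + h *: u]addrAC; ring.
Qed.

Program Definition R_fbasis : fbasis R :=
  @FBasis R R 1 (fun _ => 1) (fun _ v => v) _ _ _.
Next Obligation. by []. Qed.
Next Obligation. by []. Qed.
Next Obligation. by move=> v /=; rewrite big_ord1 [_ *: 1]mulr1. Qed.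

Lemma coord_le_norm m n (v : 'M[R]_(m.+1, n.+1)) i j : `|v i j| <= `|v|.
Proof.
rewrite [leRHS]/Num.Def.normr /= mx_normrE.
exact: (le_bigmax _ (fun k : 'I_m.+1 * 'I_n.+1 => `|v k.1 k.2|) (i, j)).
Qed.

Program Definition rV_fbasis n : fbasis 'rV[R]_n.+1 :=
  @FBasis R 'rV[R]_n.+1 n.+1 (fun i => delta_mx 0 i) (fun i v => v 0 i) _ _ _.
Next Obligation. by move=> n i a u v /=; rewrite !mxE. Qed.
Next Obligation. by move=> n i v /=; exact: coord_le_norm. Qed.
Next Obligation. by move=> n v /=; exact: row_sum_delta. Qed.

Program Definition prod_fbasis V W (fV : fbasis V) (fW : fbasis W) : fbasis (V * W)%type :=
  @FBasis R (V * W)%type (fdim fV + fdim fW)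
    (fun i => match fintype.split i with inl j => (fvec fV j, 0) | inr j => (0, fvec fW j) end)
    (fun i v => match fintype.split i with inl j => fcoord fV j v.1 | inr j => fcoord fW j v.2 end)
    _ _ _.
Next Obligation. by move=> V W fV fW i a u v /=; case: fintype.split => j; rewrite fcoordP. Qed.
Next Obligation.
move=> V W fV fW i [v w] /=; rewrite prod_normE /= le_max.
by case: fintype.split => j; rewrite fcoord_le ?orbT.
Qed.
Next Obligation.
move=> V W fV fW [v w]; rewrite /= big_split_ord /=.
under eq_bigr do rewrite (unsplitK (inl _)).
under [X in _ + X]eq_bigr do rewrite (unsplitK (inr _)).
rewrite [LHS](_ : _ = (v, 0) + (0, w)); last first.
  by apply/pair_equal_spec; rewrite /= addr0 add0r.
congr (_ + _).
  rewrite [in LHS](fcoordK fV v) (big_morph (fun a : V => (a, 0 : W)) (op1 := +%R) (id1 := 0)) //.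
    by apply: eq_bigr => i _; apply/pair_equal_spec; rewrite /= scaler0.
  by move=> a b; apply/pair_equal_spec; rewrite /= addr0.
rewrite [in LHS](fcoordK fW w) (big_morph (fun a : W => (0 : V, a)) (op1 := +%R) (id1 := 0)) //.
  by apply: eq_bigr => i _; apply/pair_equal_spec; rewrite /= scaler0.
by move=> a b; apply/pair_equal_spec; rewrite /= addr0.
Qed.

End SmoothClosure.

(** * Matrix-valued maps, differentiated entry by entry *)

HB.lock Definition dmx (R : realType) (V : normedModType R) p q (v : V)
    (F : V -> 'M[R]_(p, q)) : V -> 'M[R]_(p, q) :=
  fun x => \matrix_(i, j) 'D_v (fun y => F y i j) x.

Lemma frame_unitmx (R : comUnitRingType) m (K E : 'M[R]_m) : E *m K *m E^T = 1%:M -> E \in unitmx.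
Proof. by move=> EK; move: (unitmx1 R m); rewrite -EK !unitmx_mul => /andP[/andP[]]. Qed.

Section MatrixCalculus.
Variable R : realType.
Implicit Types V : normedModType R.

Definition msmooth V p q (U : set V) (F : V -> 'M[R]_(p, q)) : Prop :=
  forall i j, smooth U (fun x => F x i j).

Lemma dmxE V p q (v : V) (F : V -> 'M[R]_(p, q)) x i j :
  dmx v F x i j = 'D_v (fun y => F y i j) x.
Proof. by rewrite dmx.unlock mxE. Qed.

Lemma dmx_entry V p q (v : V) (F : V -> 'M[R]_(p, q)) i j :
  (fun x => dmx v F x i j) = 'D_v (fun y => F y i j).
Proof. by apply/funext => x; rewrite dmxE. Qed.

Lemma dmx_is_derive V p q (U : set V) (v : V) (F : V -> 'M[R]_(p, q)) x i j :
  msmooth U F -> U x -> is_derive x v (fun y => F y i j) (dmx v F x i j).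
Proof. by move=> sF Ux; rewrite dmxE; exact: smooth_is_derive (sF i j) Ux. Qed.

Lemma dmx_eq V p q (v : V) (F : V -> 'M[R]_(p, q)) x (D : 'M[R]_(p, q)) :
  (forall i j, is_derive x v (fun y => F y i j) (D i j)) -> dmx v F x = D.
Proof. by move=> H; apply/matrixP => i j; rewrite dmxE; have [_ ->] := H i j. Qed.

Lemma msmooth_ext V p q (U : set V) (F G : V -> 'M[R]_(p, q)) : open U ->
  (forall x, U x -> F x = G x) -> msmooth U F -> msmooth U G.
Proof. by move=> oU FG sF i j; apply: smooth_ext (sF i j) => // x /FG ->. Qed.

Lemma msmooth_sub V p q (U U' : set V) (F : V -> 'M[R]_(p, q)) :
  U' `<=` U -> msmooth U F -> msmooth U' F.
Proof. by move=> UU sF i j; exact: smooth_sub (sF i j). Qed.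

Lemma dmx_ext V p q (U : set V) (v : V) (F G : V -> 'M[R]_(p, q)) x : open U ->
  (forall x, U x -> F x = G x) -> U x -> dmx v F x = dmx v G x.
Proof.
move=> oU FG Ux; apply/matrixP => i j; rewrite !dmxE.
by apply: near_eq_derive; apply: filterS (near_open oU Ux) => y /FG ->.
Qed.

Lemma msmooth_dmx V p q (U : set V) v (F : V -> 'M[R]_(p, q)) :
  msmooth U F -> msmooth U (dmx v F).
Proof. by move=> sF i j; rewrite dmx_entry; exact: smooth_derive (sF i j). Qed.

Lemma dmxC V p q (U : set V) u v (F : V -> 'M[R]_(p, q)) x : open U ->
  msmooth U F -> U x -> dmx u (dmx v F) x = dmx v (dmx u F) x.
Proof.
move=> oU sF Ux; apply/matrixP => i j; rewrite !dmxE !dmx_entry.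
exact: (schwarz _ _ oU (sF i j) Ux).
Qed.

Lemma msmooth_cst V p q (U : set V) (A : 'M[R]_(p, q)) : open U ->
  msmooth U (fun _ => A).
Proof. by move=> oU i j; exact: smooth_cst. Qed.

Lemma dmx_cst V p q (v : V) (A : 'M[R]_(p, q)) x : dmx v (fun _ => A) x = 0.
Proof.
by apply: dmx_eq => i j; rewrite mxE; split; [exact: derivable_cst|exact: derive_cst].
Qed.

Lemma msmoothD V p q (U : set V) (F G : V -> 'M[R]_(p, q)) : open U ->
  msmooth U F -> msmooth U G -> msmooth U (fun x => F x + G x).
Proof.
move=> oU sF sG i j; apply: (smooth_ext (f := fun x => F x i j + G x i j)) => //.
  by move=> x _; rewrite mxE.
exact: smoothD.
Qed.

Lemma dmxD V p q (U : set V) v (F G : V -> 'M[R]_(p, q)) x :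
  msmooth U F -> msmooth U G -> U x ->
  dmx v (fun x => F x + G x) x = dmx v F x + dmx v G x.
Proof.
move=> sF sG Ux; apply: dmx_eq => i j.
have := is_deriveDR (dmx_is_derive v i j sF Ux) (dmx_is_derive v i j sG Ux).
rewrite (_ : (fun y => (F y + G y) i j) = (fun y => F y i j + G y i j)) ?mxE //.
by apply/funext => y; rewrite mxE.
Qed.

Lemma msmoothN V p q (U : set V) (F : V -> 'M[R]_(p, q)) : open U ->
  msmooth U F -> msmooth U (fun x => - F x).
Proof.
move=> oU sF i j; apply: (smooth_ext (f := fun x => - F x i j)) => //.
  by move=> x _; rewrite mxE.
exact: smoothN.
Qed.

Lemma dmxN V p q (U : set V) v (F : V -> 'M[R]_(p, q)) x :
  msmooth U F -> U x -> dmx v (fun x => - F x) x = - dmx v F x.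
Proof.
move=> sF Ux; apply: dmx_eq => i j.
have D := dmx_is_derive v i j sF Ux.
rewrite (_ : (fun y => (- F y) i j) = - (fun y => F y i j)); last first.
  by apply/funext => y; rewrite mxE.
by rewrite mxE; exact: is_deriveN.
Qed.

Lemma msmoothB V p q (U : set V) (F G : V -> 'M[R]_(p, q)) : open U ->
  msmooth U F -> msmooth U G -> msmooth U (fun x => F x - G x).
Proof. by move=> oU sF sG; apply: msmoothD => //; exact: msmoothN. Qed.

Lemma dmxB V p q (U : set V) v (F G : V -> 'M[R]_(p, q)) x : open U ->
  msmooth U F -> msmooth U G -> U x ->
  dmx v (fun x => F x - G x) x = dmx v F x - dmx v G x.
Proof.
move=> oU sF sG Ux; rewrite (dmxD _ sF (msmoothN oU sG) Ux).
by rewrite (dmxN _ sG Ux).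
Qed.

Lemma msmoothM V p q r (U : set V) (F : V -> 'M[R]_(p, q)) (G : V -> 'M[R]_(q, r)) :
  open U -> msmooth U F -> msmooth U G -> msmooth U (fun x => F x *m G x).
Proof.
move=> oU sF sG i j; apply: (smooth_ext (f := fun x => \sum_k F x i k * G x k j)) => //.
  by move=> x _; rewrite mxE.
by apply: smooth_sum => // k _; exact: smoothM.
Qed.

Lemma is_derive_sumR V (I : Type) (r : seq I) (F : I -> V -> R) x v (d : I -> R) :
  (forall i, is_derive x v (F i) (d i)) ->
  is_derive x v (fun y => \sum_(i <- r) F i y) (\sum_(i <- r) d i).
Proof.
move=> H; elim: r => [|i r IH].
  rewrite big_nil (_ : (fun y => _) = fun _ => 0); first exact: is_derive_cst.
  by apply/funext => y; rewrite big_nil.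
rewrite big_cons (_ : (fun y => _) = fun y => F i y + \sum_(j <- r) F j y).
  exact: is_deriveDR.
by apply/funext => y; rewrite big_cons.
Qed.

Lemma dmxM V p q r (U : set V) v (F : V -> 'M[R]_(p, q)) (G : V -> 'M[R]_(q, r)) x :
  msmooth U F -> msmooth U G -> U x ->
  dmx v (fun x => F x *m G x) x = dmx v F x *m G x + F x *m dmx v G x.
Proof.
move=> sF sG Ux; apply: dmx_eq => i j.
rewrite (_ : (fun y => (F y *m G y) i j) = (fun y => \sum_k F y i k * G y k j)); last first.
  by apply/funext => y; rewrite mxE.
rewrite !mxE addrC -big_split /=; apply: is_derive_sumR => k.
exact: (is_deriveMR (dmx_is_derive v i k sF Ux) (dmx_is_derive v k j sG Ux)).
Qed.

Lemma msmoothT V p q (U : set V) (F : V -> 'M[R]_(p, q)) : open U ->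
  msmooth U F -> msmooth U (fun x => (F x)^T).
Proof.
move=> oU sF i j; apply: (smooth_ext (f := fun x => F x j i)) => //.
by move=> x _; rewrite mxE.
Qed.

Lemma dmxT V p q v (F : V -> 'M[R]_(p, q)) x : dmx v (fun x => (F x)^T) x = (dmx v F x)^T.
Proof.
apply/matrixP => i j; rewrite mxE !dmxE; congr ('D_v _ x).
by apply/funext => y; rewrite mxE.
Qed.

Lemma msmoothZ V p q (U : set V) (f : V -> R) (F : V -> 'M[R]_(p, q)) : open U ->
  smooth U f -> msmooth U F -> msmooth U (fun x => f x *: F x).
Proof.
move=> oU sf sF i j; apply: (smooth_ext (f := fun x => f x * F x i j)) => //.
  by move=> x _; rewrite mxE.
exact: smoothM.
Qed.

Lemma dmxZ V p q (U : set V) v (f : V -> R) (F : V -> 'M[R]_(p, q)) x :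
  smooth U f -> msmooth U F -> U x ->
  dmx v (fun x => f x *: F x) x = 'D_v f x *: F x + f x *: dmx v F x.
Proof.
move=> sf sF Ux; apply: dmx_eq => i j.
rewrite (_ : (fun y => (f y *: F y) i j) = (fun y => f y * F y i j)); last first.
  by apply/funext => y; rewrite mxE.
rewrite !mxE addrC.
exact: (is_deriveMR (smooth_is_derive v sf Ux) (dmx_is_derive v i j sF Ux)).
Qed.

Lemma msmooth_sum V p q (U : set V) (I : Type) (r : seq I) (F : I -> V -> 'M[R]_(p, q)) :
  open U -> (forall i, msmooth U (F i)) -> msmooth U (fun x => \sum_(i <- r) F i x).
Proof.
move=> oU sF i j; apply: (smooth_ext (f := fun x => \sum_(k <- r) F k x i j)) => //.
  by move=> x _; rewrite summxE.
by apply: smooth_sum => // k _; exact: sF.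
Qed.

Lemma dmx_sum V p q (U : set V) v (I : Type) (r : seq I) (F : I -> V -> 'M[R]_(p, q)) x :
  (forall i, msmooth U (F i)) -> U x ->
  dmx v (fun x => \sum_(i <- r) F i x) x = \sum_(i <- r) dmx v (F i) x.
Proof.
move=> sF Ux; apply: dmx_eq => i j.
rewrite (_ : (fun y => (\sum_(k <- r) F k y) i j) = (fun y => \sum_(k <- r) F k y i j)).
  by rewrite summxE; apply: is_derive_sumR => k; exact: dmx_is_derive (sF k) Ux.
by apply/funext => y; rewrite summxE.
Qed.

Lemma dmx_row V p q v (F : V -> 'M[R]_(p, q)) i x :
  dmx v (fun x => row i (F x)) x = row i (dmx v F x).
Proof.
apply/matrixP => j k; rewrite mxE !dmxE; congr ('D_v _ x).
by apply/funext => y; rewrite mxE.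
Qed.

Lemma smooth_det V p (U : set V) (F : V -> 'M[R]_p) : open U ->
  msmooth U F -> smooth U (fun x => \det (F x)).
Proof.
move=> oU sF; apply: smooth_sum => // s _; apply: smoothM => //; first exact: smooth_cst.
by apply: smooth_prod => // i _.
Qed.

Lemma msmooth_inv V p (U : set V) (F : V -> 'M[R]_p) : open U ->
  msmooth U F -> (forall x, U x -> F x \in unitmx) -> msmooth U (fun x => invmx (F x)).
Proof.
move=> oU sF uF.
apply: (msmooth_ext (F := fun x => (\det (F x))^-1 *: \adj (F x))) => //.
  by move=> x /uF; rewrite /invmx => ->.
apply: msmoothZ => //.
  apply: smoothV => // [x /uF|]; last exact: smooth_det.
  by rewrite unitmxE unitfE.
move=> i j; apply: (smooth_ext (f := fun x => (-1) ^+ (j + i) * \det (row' j (col' i (F x))))) => //.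
  by move=> x _; rewrite mxE.
apply: smoothM => //; first exact: smooth_cst.
apply: smooth_det => // a b.
apply: (smooth_ext (f := fun x => F x (lift j a) (lift i b))) => //.
by move=> x _; rewrite !mxE.
Qed.

Lemma dmx_dirE V (fb : fbasis V) p q (U : set V) v (F : V -> 'M[R]_(p, q)) x :
  open U -> msmooth U F -> U x ->
  dmx v F x = \sum_i fcoord fb i v *: dmx (fvec fb i) F x.
Proof.
move=> oU sF Ux; apply/matrixP => i j; rewrite summxE dmxE (derive_dirE fb v oU (sF i j) Ux).
by apply: eq_bigr => k _; rewrite mxE dmxE.
Qed.

Lemma msmooth_comp V V' (fb : fbasis V') p q (U : set V) (U' : set V')
    (F : V' -> 'M[R]_(p, q)) (phi : V -> V') :
  open U -> open U' -> msmooth U' F -> (forall x, U x -> U' (phi x)) ->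
  (forall i, smooth U (fun x => fcoord fb i (phi x))) -> msmooth U (fun x => F (phi x)).
Proof. by move=> oU oU' sF UU sphi i j; exact: (smooth_comp oU oU' (sF i j) UU sphi). Qed.

Lemma dmx_comp V V' (fb : fbasis V') p q (U' : set V')
    (F : V' -> 'M[R]_(p, q)) (phi : V -> V') x v (d : 'I_(fdim fb) -> R) :
  open U' -> msmooth U' F -> U' (phi x) ->
  (forall i, is_derive x v (fun y => fcoord fb i (phi y)) (d i)) ->
  {for x, continuous phi} ->
  dmx v (fun x => F (phi x)) x = \sum_i d i *: dmx (fvec fb i) F (phi x).
Proof.
move=> oU' sF Ux dphi cphi; apply: dmx_eq => i j; rewrite summxE.
have := chain_rule oU' (sF i j) Ux cphi dphi.
rewrite (eq_bigr (fun k => (d k *: dmx (fvec fb k) F (phi x)) i j)) //.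
by move=> k _; rewrite mxE dmxE.
Qed.

Lemma msmooth_continuous V p q (U : set V) (F : V -> 'M[R]_(p.+1, q.+1)) x :
  msmooth U F -> U x -> {for x, continuous F}.
Proof.
move=> sF Ux; apply/cvgrPdist_le => e e0.
have : \forall t \near x, forall ij : 'I_p.+1 * 'I_q.+1, `|F x ij.1 ij.2 - F t ij.1 ij.2| <= e.
  apply: filter_forall => -[i j].
  by have /cvgrPdist_le /(_ _ e0) := smooth_continuous (sF i j) Ux.
apply: filterS => t H.
rewrite /Num.Def.normr/= mx_normrE (bigmax_le _ (ltW e0))//= => ij _.
by rewrite !mxE; exact: H.
Qed.

End MatrixCalculus.
Section MatrixEntries.
Variables (R : realType) (p q : nat).
Implicit Types A B : 'M[R]_(p, q).

Lemma addmxE A B i j : (A + B) i j = A i j + B i j. Proof. by rewrite mxE. Qed.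
Lemma oppmxE A i j : (- A) i j = - A i j. Proof. by rewrite mxE. Qed.
Lemma scalemxE a A i j : (a *: A) i j = a * A i j. Proof. by rewrite mxE. Qed.
Lemma zeromxE i j : (0 : 'M[R]_(p, q)) i j = 0. Proof. by rewrite mxE. Qed.
Lemma rowDE i A B : row i (A + B) = row i A + row i B. Proof. exact: linearD. Qed.
Lemma rowNE i A : row i (- A) = - row i A. Proof. exact: linearN. Qed.
Lemma trmxE A i j : A^T i j = A j i. Proof. by rewrite mxE. Qed.
Lemma trmxD A B : (A + B)^T = A^T + B^T. Proof. exact: linearD. Qed.
Lemma trmxN A : (- A)^T = - A^T. Proof. exact: linearN. Qed.
Lemma trmxZ a A : (a *: A)^T = a *: A^T. Proof. exact: linearZ. Qed.

End MatrixEntries.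

Ltac mx_abel := apply/matrixP => ? ?; rewrite ?(addmxE, oppmxE, scalemxE, zeromxE); ring.
Ltac mx_expand := rewrite ?(trmxD, trmxN, trmxZ, trmxK, trmx_mul, mulmxDl, mulmxDr,
  mulmxBl, mulmxBr, mulNmx, mulmxN, mulmxA).

(** * Connection and curvature of a metric *)

Definition christoffel_low (R : realType) (V : normedModType R) m (eps : 'I_m -> V)
    (G : V -> 'M[R]_m) (a : 'I_m) x : 'M[R]_m :=
  \matrix_(b, d) (2^-1 * (dmx (eps a) G x b d + dmx (eps b) G x a d - dmx (eps d) G x a b)).

(** Row [b] holds the components of nabla_a d_b, so that nabla_a v = d_a v + v Gam_a for a row v.
    The directions [eps] need not span [V]: in space-time they are the spatial ones, and time is a
    parameter that can still be differentiated. *)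
HB.lock Definition Gam (R : realType) (V : normedModType R) m (eps : 'I_m -> V)
    (G : V -> 'M[R]_m) (a : 'I_m) (x : V) : 'M[R]_m :=
  christoffel_low eps G a x *m invmx (G x).

(* The row of index c of [Rc eps G a b] is the image of the c-th coordinate
   vector under R(d_a, d_b). *)
HB.lock Definition Rc (R : realType) (V : normedModType R) m (eps : 'I_m -> V)
    (G : V -> 'M[R]_m) (a b : 'I_m) (x : V) : 'M[R]_m :=
  dmx (eps a) (Gam eps G b) x - dmx (eps b) (Gam eps G a) x
  + Gam eps G b x *m Gam eps G a x - Gam eps G a x *m Gam eps G b x.

Section Connection.
Variables (R : realType) (V : normedModType R) (m : nat).
Variable eps : 'I_m -> V.
Local Notation Gam := (Gam eps).
Local Notation Rc := (Rc eps).
Local Notation christoffel_low := (christoffel_low eps).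
Implicit Types (G : V -> 'M[R]_m) (U : set V) (a b c d : 'I_m).

Definition Ric G x : 'M[R]_m := \matrix_(b, d) \sum_a Rc G a b x d a.

Definition metric_on U G : Prop :=
  [/\ open U, msmooth U G, forall x, U x -> (G x)^T = G x & forall x, U x -> G x \in unitmx].

Variables (U : set V) (G : V -> 'M[R]_m).
Hypothesis mG : metric_on U G.

Lemma GamE G' a : Gam G' a = fun x => christoffel_low G' a x *m invmx (G' x).
Proof. by apply/funext => x; rewrite Gam.unlock. Qed.

Lemma RcE G' a b : Rc G' a b = fun x => dmx (eps a) (Gam G' b) x - dmx (eps b) (Gam G' a) x
  + Gam G' b x *m Gam G' a x - Gam G' a x *m Gam G' b x.
Proof. by apply/funext => x; rewrite Rc.unlock. Qed.

Lemma dmx_metric_sym v x : U x -> (dmx v G x)^T = dmx v G x.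
Proof.
have [oU sG symG _] := mG; move=> Ux; rewrite -dmxT.
exact: (dmx_ext v oU symG Ux).
Qed.

Lemma dmx_metric_symE v x i j : U x -> dmx v G x i j = dmx v G x j i.
Proof. by move=> Ux; rewrite -[in LHS](dmx_metric_sym v Ux) trmxE. Qed.

Lemma Gam_low a x : U x -> Gam G a x *m G x = christoffel_low G a x.
Proof. by have [_ _ _ uG] := mG; move=> Ux; rewrite GamE mulmxKV //; exact: uG. Qed.

Lemma christoffel_low_msmooth a : msmooth U (christoffel_low G a).
Proof.
have [oU sG _ _] := mG => b d.
have sd e i j : smooth U (fun x => dmx (eps e) G x i j) by exact: msmooth_dmx.
apply: (smooth_ext (f := fun x => 2^-1 * (dmx (eps a) G x b d + dmx (eps b) G x a d - dmx (eps d) G x a b))) => //.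
  by move=> x _; rewrite mxE.
apply: smoothM => //; first exact: smooth_cst.
by apply: smoothB => //; apply: smoothD.
Qed.

Lemma Gam_msmooth a : msmooth U (Gam G a).
Proof.
have [oU sG _ uG] := mG; rewrite GamE; apply: msmoothM => //; first exact: christoffel_low_msmooth.
exact: msmooth_inv.
Qed.

Lemma Rc_msmooth a b : msmooth U (Rc G a b).
Proof.
have [oU _ _ _] := mG; have sG := Gam_msmooth; rewrite RcE.
apply: msmoothB => //; last exact: msmoothM.
apply: msmoothD => //; last exact: msmoothM.
by apply: msmoothB => //; exact: msmooth_dmx.
Qed.

Lemma Ric_msmooth : msmooth U (Ric G).
Proof.
have [oU _ _ _] := mG => b d.
apply: (smooth_ext (f := fun x => \sum_a Rc G a b x d a)) => //.
  by move=> x _; rewrite mxE.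
by apply: smooth_sum => // a _; exact: Rc_msmooth.
Qed.

Lemma metric_connection a x : U x ->
  dmx (eps a) G x = Gam G a x *m G x + (Gam G a x *m G x)^T.
Proof.
move=> Ux; rewrite Gam_low //; apply/matrixP => b d; rewrite !mxE.
rewrite (dmx_metric_symE (eps a) d b Ux); lra.
Qed.

Lemma metric_connectionE a x : U x ->
  dmx (eps a) G x = Gam G a x *m G x + G x *m (Gam G a x)^T.
Proof.
by move=> Ux; rewrite metric_connection // trmx_mul; have [_ _ -> //] := mG.
Qed.

Lemma torsion_free a b x c : U x -> Gam G a x b c = Gam G b x a c.
Proof.
move=> Ux; rewrite !GamE !mxE; apply: eq_bigr => d _; congr (_ * _).
by rewrite !mxE (dmx_metric_symE (eps d) b a Ux); ring.
Qed.

Lemma Gam_swap x (u v : 'rV[R]_m) : U x ->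
  \sum_c u 0 c *: (v *m Gam G c x) = \sum_c v 0 c *: (u *m Gam G c x).
Proof.
move=> Ux; apply/rowP => d; rewrite !summxE.
under eq_bigr do rewrite mxE mxE mulr_sumr.
under [RHS]eq_bigr do rewrite mxE mxE mulr_sumr.
rewrite exchange_big; apply: eq_bigr => b _; apply: eq_bigr => c _ /=.
by rewrite (torsion_free _ _ _ Ux); ring.
Qed.

(** Koszul's argument. It lets a connection be recognized by its two properties, without computing
    its Christoffel symbols, as in the law for a change of coordinates. *)
Lemma connection_unique (A : 'I_m -> 'M[R]_m) x : U x ->
  (forall a, dmx (eps a) G x = A a *m G x + (A a *m G x)^T) ->
  (forall a b c, A a b c = A b a c) -> forall a, A a = Gam G a x.
Proof.
have [_ _ _ uG] := mG; move=> Ux mA tA a.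
suff E : A a *m G x = christoffel_low G a x by rewrite GamE -E mulmxK //; exact: uG.
have tM e f h : (A e *m G x) f h = (A f *m G x) e h.
  by rewrite !mxE; apply: eq_bigr => i _; rewrite tA.
apply/matrixP => b d; rewrite [RHS]mxE !mA !addmxE !trmxE.
rewrite (tM b a d) (tM a d b) (tM b d a); lra.
Qed.

Lemma Rc_antiC a b x : Rc G b a x = - Rc G a b x.
Proof. by rewrite !RcE; mx_abel. Qed.

(** The commutator of two derivatives of the metric vanishes; expanded by metric compatibility, it
    is the lowered curvature plus its transpose. *)
Lemma Rc_low_anti a b x : U x -> (Rc G a b x *m G x)^T = - (Rc G a b x *m G x).
Proof.
have [oU sG symG _] := mG; have sGam := Gam_msmooth; move=> Ux.
have sGT e : msmooth U (fun x => (Gam G e x)^T) by exact: msmoothT.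
have D e f : dmx (eps e) (dmx (eps f) G) x =
  dmx (eps e) (Gam G f) x *m G x + Gam G f x *m dmx (eps e) G x +
  (dmx (eps e) G x *m (Gam G f x)^T + G x *m (dmx (eps e) (Gam G f) x)^T).
  have -> : dmx (eps e) (dmx (eps f) G) x =
      dmx (eps e) (fun y => Gam G f y *m G y + G y *m (Gam G f y)^T) x.
    by apply: (dmx_ext _ oU _ Ux) => y Uy; exact: metric_connectionE.
  rewrite (dmxD (U := U)) //; [|exact: msmoothM|exact: msmoothM].
  by rewrite (dmxM (U := U)) // (dmxM (U := U)) // dmxT.
have E := dmxC (eps a) (eps b) oU sG Ux.
rewrite !D !metric_connectionE // in E.
rewrite RcE; mx_expand; rewrite symG //.
move: E; mx_expand => E.
apply/eqP; rewrite -addr_eq0; apply/eqP.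
apply/matrixP => i j; move/matrixP: E => /(_ i j).
rewrite !(addmxE, oppmxE, zeromxE); lra.
Qed.

Lemma first_bianchi a b c x : U x ->
  row c (Rc G a b x) + row a (Rc G b c x) + row b (Rc G c a x) = 0.
Proof.
have [oU sG symG _] := mG; move=> Ux.
have T e f y : U y -> row e (Gam G f y) = row f (Gam G e y).
  by move=> Uy; apply/rowP => k; rewrite !mxE; exact: torsion_free.
have DT v e f : row e (dmx v (Gam G f) x) = row f (dmx v (Gam G e) x).
  by rewrite -!dmx_row; apply: (dmx_ext _ oU _ Ux) => y Uy; exact: T.
rewrite !RcE !(rowDE, rowNE) !row_mul.
rewrite (DT _ a c) (DT _ b c) (DT _ b a) (T a c) // (T b c) // (T b a) //; mx_abel.
Qed.

(** [D] corrects the derivative for the endomorphism only. The corrections for the two form indices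
    are absent because they cancel in the cyclic sum of a torsion-free connection. *)
Lemma second_bianchi a b c x : U x ->
  let D e f h := dmx (eps e) (Rc G f h) x + Rc G f h x *m Gam G e x - Gam G e x *m Rc G f h x in
  D a b c + D b c a + D c a b = 0.
Proof.
have [oU sG symG _] := mG; have sGam := Gam_msmooth; move=> Ux D.
have sdG e f : msmooth U (dmx (eps e) (Gam G f)) by exact: msmooth_dmx.
have sGG e f : msmooth U (fun y => Gam G e y *m Gam G f y) by exact: msmoothM.
have E e f h : dmx (eps e) (Rc G f h) x =
   dmx (eps e) (dmx (eps f) (Gam G h)) x - dmx (eps e) (dmx (eps h) (Gam G f)) x
   + (dmx (eps e) (Gam G h) x *m Gam G f x + Gam G h x *m dmx (eps e) (Gam G f) x)
   - (dmx (eps e) (Gam G f) x *m Gam G h x + Gam G f x *m dmx (eps e) (Gam G h) x).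
  rewrite RcE (dmxB _ (U := U)) //; last by apply: msmoothD => //; exact: msmoothB.
  rewrite (dmxD _ (U := U)) //; last exact: msmoothB.
  rewrite (dmxB _ (U := U)) // (dmxM _ (sGam h) (sGam f) Ux).
  by rewrite (dmxM _ (sGam f) (sGam h) Ux).
rewrite /D !E (dmxC (eps b) (eps a) oU (sGam c) Ux) (dmxC (eps c) (eps a) oU (sGam b) Ux)
  (dmxC (eps c) (eps b) oU (sGam a) Ux) !RcE; mx_expand; mx_abel.
Qed.

End Connection.

(** * Agreement with the chart formulas for the Christoffel symbols and the curvature tensors *)

Section RiemannIdentification.
Variables (R : realType) (n : nat) (U : set 'rV[R]_n.+1) (G : 'rV[R]_n.+1 -> 'M[R]_n.+1).
Let eps (a : 'I_n.+1) : 'rV[R]_n.+1 := delta_mx 0 a.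
Hypothesis mG : metric_on U G.

Lemma christoffelE a b c x : U x -> christoffel G c a b x = Gam eps G a x b c.
Proof.
have [oU sG symG uG] := mG; move=> Ux.
rewrite /christoffel GamE mulr_sumr mxE; apply: eq_bigr => d _.
have -> : invmx (G x) c d = invmx (G x) d c.
  by rewrite -[in LHS](symG x Ux) -trmx_inv trmxE.
by rewrite mxE /partial !dmxE; ring.
Qed.

Lemma riem_upE e a b c x : U x -> riem_up G e a b c x = Rc eps G a b x c e.
Proof.
have [oU sG symG uG] := mG; move=> Ux.
have D f g h : partial f (christoffel G e g h) x = dmx (eps f) (Gam eps G g) x h e.
  rewrite dmxE; apply: near_eq_derive.
  by apply: filterS (near_open oU Ux) => y Uy; exact: christoffelE.
rewrite /riem_up !D RcE !mxE -addrA; congr (_ + _).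
rewrite -sumrB; apply: eq_bigr => d _; rewrite !christoffelE //; ring.
Qed.

Lemma riemE a b c d x : U x -> riem G a b c d x = (Rc eps G a b x *m G x) d c.
Proof.
have [oU sG symG uG] := mG; move=> Ux.
rewrite /riem mxE; apply: eq_bigr => e _; rewrite riem_upE // mulrC.
by rewrite -[in LHS](symG x Ux) trmxE.
Qed.

Lemma ricciE x : U x -> ricci G x = Ric eps G x.
Proof.
have [oU sG symG uG] := mG; move=> Ux.
apply/matrixP => b d; rewrite !mxE; apply: eq_bigr => a _.
transitivity ((Rc eps G a b x *m G x *m invmx (G x)) d a); last first.
  by rewrite mulmxK //; exact: uG.
rewrite [RHS]mxE; apply: eq_bigr => c _; rewrite riemE // mulrC; congr (_ * _).
by rewrite -[in LHS](symG x Ux) -trmx_inv trmxE.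
Qed.

End RiemannIdentification.

(** * Change of spatial coordinates for the connection and the curvature *)

Section CoordinateChange.
Variables (R : realType) (V V' : normedModType R) (m : nat).
Variables (eps : 'I_m -> V) (eps' : 'I_m -> V') (phi : V -> V').
Variables (U : set V) (U' : set V') (J : V -> 'M[R]_m) (G' : V' -> 'M[R]_m).
Implicit Types (a b c d : 'I_m).
Hypothesis oU : open U.
Hypothesis phiU : forall x, U x -> U' (phi x).
Hypothesis phi_smooth : forall F : V' -> 'M[R]_m, msmooth U' F -> msmooth U (fun x => F (phi x)).
Hypothesis phi_chain : forall (F : V' -> 'M[R]_m) a x, msmooth U' F -> U x ->
  dmx (eps a) (fun y => F (phi y)) x = \sum_b J x a b *: dmx (eps' b) F (phi x).
Hypothesis sJ : msmooth U J.
Hypothesis uJ : forall x, U x -> J x \in unitmx.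
Hypothesis cJ : forall a b c x, U x -> dmx (eps a) J x b c = dmx (eps b) J x a c.
Hypothesis mG' : metric_on U' G'.

(** The map [phi], its matrix [J] and their chain rule are kept abstract to serve twice: for the
    transition maps of the manifold, and for normal coordinates in space-time, where [phi] also
    carries the time but only spatial directions are transformed. *)
Definition pullback_metric (x : V) : 'M[R]_m := J x *m G' (phi x) *m (J x)^T.
Local Notation G := pullback_metric.

Lemma pullback_metric_on : metric_on U G.
Proof.
have [oU' sG' symG' uG'] := mG'; split=> // [|x Ux|x Ux].
- by apply: msmoothM => //; [apply: msmoothM => //; exact: phi_smooth|exact: msmoothT].
- by rewrite /G !trmx_mul trmxK symG' ?mulmxA //; exact: phiU.
- by rewrite !unitmx_mul unitmx_tr uJ // uG' //; exact: phiU.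
Qed.

Definition pulled_Gam a x : 'M[R]_m := \sum_b J x a b *: Gam eps' G' b (phi x).
Local Notation P := pulled_Gam.

Lemma pulled_Gam_msmooth a : msmooth U (P a).
Proof.
by apply: msmooth_sum => // b; apply: msmoothZ => //; exact/phi_smooth/Gam_msmooth.
Qed.

(** The right-hand side, multiplied by the inverse of [J], is compatible with the metric, and
    symmetric because the derivative of [J] is ([cJ]); [connection_unique] identifies it. *)
Lemma Gam_law a x : U x -> Gam eps G a x *m J x = dmx (eps a) J x + J x *m P a x.
Proof.
move=> Ux; have [oU' sG' symG' uG'] := mG'.
pose A e := (dmx (eps e) J x + J x *m P e x) *m invmx (J x).
suff <- : A a = Gam eps G a x by rewrite /A mulmxKV // uJ.
apply: (connection_unique pullback_metric_on Ux) => [e|e b c].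
  have -> : A e *m G x = (dmx (eps e) J x + J x *m P e x) *m G' (phi x) *m (J x)^T.
    by rewrite /A /G !mulmxA mulmxKV // uJ.
  have sGp := phi_smooth sG'.
  rewrite (dmxM _ (msmoothM oU sJ sGp) (msmoothT oU sJ) Ux) (dmxM _ sJ sGp Ux) dmxT.
  have -> : dmx (eps e) (fun y => G' (phi y)) x =
      P e x *m G' (phi x) + G' (phi x) *m (P e x)^T.
    rewrite phi_chain // /P mulmx_suml linear_sum mulmx_sumr -big_split.
    apply: eq_bigr => b _ /=; rewrite (metric_connectionE eps' mG' b (phiU Ux)).
    by rewrite scalerDr scalemxAl trmxZ scalemxAr.
  by mx_expand; rewrite (symG' _ (phiU Ux)); mx_abel.
rewrite /A !mxE; apply: eq_bigr => f _; congr (_ * _).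
rewrite !addmxE cJ //; congr (_ + _).
rewrite !mxE /P.
under eq_bigr do rewrite summxE mulr_sumr.
under [RHS]eq_bigr do rewrite summxE mulr_sumr.
rewrite exchange_big; apply: eq_bigr => h _; apply: eq_bigr => k _ /=.
by rewrite !scalemxE (torsion_free eps' mG' _ _ _ (phiU Ux)); ring.
Qed.

Local Notation pulled_Rc a b x := (\sum_c \sum_d (J x a c * J x b d) *: Rc eps' G' c d (phi x)).

(** A derivative of [Gam_law]: the second derivatives of [J] commute and cancel in the
    antisymmetrization, and the products of first derivatives cancel against the quadratic terms of
    the curvature. *)
Lemma Rc_law a b x : U x -> Rc eps G a b x *m J x =
  J x *m pulled_Rc a b x.
Proof.
move=> Ux.
have sGam e : msmooth U (Gam eps G e) := Gam_msmooth eps pullback_metric_on e.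
have sP := pulled_Gam_msmooth.
have E e f : dmx (eps e) (Gam eps G f) x *m J x + Gam eps G f x *m dmx (eps e) J x =
    dmx (eps e) (dmx (eps f) J) x + (dmx (eps e) J x *m P f x + J x *m dmx (eps e) (P f) x).
  rewrite -(dmxM _ (sGam f) sJ Ux) -(dmxM _ sJ (sP f) Ux).
  rewrite -(dmxD _ (msmooth_dmx _ sJ) (msmoothM oU sJ (sP f)) Ux).
  by apply: (dmx_ext _ oU _ Ux) => y Uy; exact: Gam_law.
have X e f : Gam eps G e x *m Gam eps G f x *m J x =
    Gam eps G e x *m dmx (eps f) J x + (dmx (eps e) J x + J x *m P e x) *m P f x.
  by rewrite -mulmxA Gam_law // mulmxDr mulmxA Gam_law.
have PP e f : P e x *m P f x = \sum_c \sum_d (J x e c * J x f d) *: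
     (Gam eps' G' c (phi x) *m Gam eps' G' d (phi x)).
  rewrite /P mulmx_suml; apply: eq_bigr => c _; rewrite mulmx_sumr; apply: eq_bigr => d _.
  by rewrite -scalemxAl -scalemxAr scalerA.
have DP e f : dmx (eps e) (P f) x = \sum_d dmx (eps e) J x f d *: Gam eps' G' d (phi x) +
   \sum_c \sum_d (J x e c * J x f d) *: dmx (eps' c) (Gam eps' G' d) (phi x).
  rewrite /P (dmx_sum _ (U := U)) //; last first.
    by move=> d; apply: msmoothZ => //; exact/phi_smooth/Gam_msmooth.
  rewrite [X in _ + X]exchange_big -big_split; apply: eq_bigr => d _ /=.
  rewrite (dmxZ _ (sJ f d) (phi_smooth (Gam_msmooth eps' mG' d)) Ux) -dmxE; congr (_ + _).
  rewrite phi_chain //; last exact: Gam_msmooth.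
  by rewrite scaler_sumr; apply: eq_bigr => c _; rewrite scalerA mulrC.
have -> : pulled_Rc a b x =
    dmx (eps a) (P b) x - dmx (eps b) (P a) x + P b x *m P a x - P a x *m P b x.
  have swap (F : 'I_m -> 'I_m -> 'M[R]_m) : \sum_c \sum_d (J x b c * J x a d) *: F c d =
      \sum_c \sum_d (J x a c * J x b d) *: F d c.
    rewrite exchange_big; apply: eq_bigr => c _; apply: eq_bigr => d _.
    by rewrite mulrC.
  have -> : pulled_Rc a b x =
     \sum_c \sum_d (J x a c * J x b d) *: dmx (eps' c) (Gam eps' G' d) (phi x)
     - \sum_c \sum_d (J x a c * J x b d) *: dmx (eps' d) (Gam eps' G' c) (phi x)
     + \sum_c \sum_d (J x a c * J x b d) *: (Gam eps' G' d (phi x) *m Gam eps' G' c (phi x))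
     - \sum_c \sum_d (J x a c * J x b d) *: (Gam eps' G' c (phi x) *m Gam eps' G' d (phi x)).
    rewrite -!sumrN -!big_split; apply: eq_bigr => c _ /=.
    rewrite -!sumrN -!big_split; apply: eq_bigr => d _ /=.
    by rewrite RcE -!scalerN -!scalerDr.
  rewrite !DP !PP !swap.
  have -> : \sum_d dmx (eps b) J x a d *: Gam eps' G' d (phi x) =
      \sum_d dmx (eps a) J x b d *: Gam eps' G' d (phi x).
    by apply: eq_bigr => d _; rewrite cJ.
  by mx_abel.
have Eab := E a b; have Eba := E b a.
rewrite (dmxC (eps b) (eps a) oU sJ Ux) in Eba.
rewrite RcE !mulmxDl !mulNmx !X.
have -> : dmx (eps a) (Gam eps G b) x *m J x = dmx (eps a) (dmx (eps b) J) x +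
  (dmx (eps a) J x *m P b x + J x *m dmx (eps a) (P b) x) - Gam eps G b x *m dmx (eps a) J x.
  by rewrite -Eab addrK.
have -> : dmx (eps b) (Gam eps G a) x *m J x = dmx (eps a) (dmx (eps b) J) x +
  (dmx (eps b) J x *m P a x + J x *m dmx (eps b) (P a) x) - Gam eps G a x *m dmx (eps b) J x.
  by rewrite -Eba addrK.
by mx_expand; mx_abel.
Qed.

Lemma Rc_low_law a b x : U x -> Rc eps G a b x *m G x =
  J x *m pulled_Rc a b x *m G' (phi x) *m (J x)^T.
Proof. by move=> Ux; rewrite /G !mulmxA Rc_law. Qed.

Lemma Ric_law x : U x -> Ric eps G x = J x *m Ric eps' G' (phi x) *m (J x)^T.
Proof.
move=> Ux.
pose K := invmx (J x).
have KJ : K *m J x = 1%:M by rewrite mulVmx // uJ.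
have RK a b : Rc eps G a b x = J x *m pulled_Rc a b x *m K.
  by rewrite -Rc_law // mulmxK // uJ.
apply/matrixP => b d; rewrite mxE.
transitivity (\sum_l (J x *m \sum_f J x b f *: Rc eps' G' l f (phi x)) d l).
  transitivity (\sum_a \sum_l K l a *
      (J x *m pulled_Rc a b x) d l).
    by apply: eq_bigr => a _; rewrite RK mxE; apply: eq_bigr => l _; rewrite mulrC.
  rewrite exchange_big; apply: eq_bigr => l _ /=.
  transitivity ((J x *m \sum_a K l a *: pulled_Rc a b x) d l).
    by rewrite mulmx_sumr summxE; apply: eq_bigr => a _; rewrite -scalemxAr scalemxE.
  congr ((J x *m _) d l).
  transitivity (\sum_c \sum_a (K l a * J x a c) *: \sum_f J x b f *: Rc eps' G' c f (phi x)).
    rewrite exchange_big; apply: eq_bigr => a _; rewrite scaler_sumr; apply: eq_bigr => c _.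
    rewrite !scaler_sumr.
    by apply: eq_bigr => f _; rewrite !scalerA; congr (_ *: _); ring.
  transitivity (\sum_c (l == c)%:R *: \sum_f J x b f *: Rc eps' G' c f (phi x)).
    apply: eq_bigr => c _; rewrite -scaler_suml; congr (_ *: _).
    by have := congr1 (fun A : 'M[R]_m => A l c) KJ; rewrite !mxE => <-.
  rewrite (bigD1 l) //= eqxx scale1r [X in _ + X]big1 ?addr0 // => c cl.
  by rewrite eq_sym (negPf cl) scale0r.
transitivity (\sum_l \sum_k \sum_f J x d k * (J x b f * Rc eps' G' l f (phi x) k l)).
  apply: eq_bigr => l _; rewrite mxE; apply: eq_bigr => k _.
  by rewrite summxE mulr_sumr; apply: eq_bigr => f _; rewrite scalemxE.
rewrite !mxE exchange_big; apply: eq_bigr => k _ /=.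
rewrite trmxE mxE mulr_suml exchange_big; apply: eq_bigr => f _ /=.
rewrite mxE mulr_sumr mulr_suml; apply: eq_bigr => l _; ring.
Qed.

End CoordinateChange.

(** * Second differences along lines, with a displacement of second order *)

Section SecondDifference.
Variables (R : realType) (V : normedModType R).

Lemma dist_le_upper (a b e : R) : `|a - b| <= e -> b <= a + e.
Proof. by rewrite ler_norml => /andP[A _]; lra. Qed.

Lemma parabolic_aux (a b c d h2 Du Dw Dws e : R) : 0 <= h2 -> 0 <= e ->
  a + b - 2 * c <= (Du + e / 4) * h2 -> c - d = Dws * h2 -> Dws <= Dw + e / 4 ->
  a + b - 2 * d <= h2 * (Du + 2 * Dw + e).
Proof. by move=> h0 e0 H E D; nra. Qed.

Lemma second_difference_le (f f1 f2 : R -> R) (h M : R) : 0 <= h ->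
  (forall s : R, `|s| <= h -> is_derive s 1 f (f1 s)) ->
  (forall s : R, `|s| <= h -> is_derive s 1 f1 (f2 s)) ->
  (forall s : R, `|s| <= h -> f2 s <= M) ->
  f h + f (- h) - 2 * f 0 <= M * h ^+ 2.
Proof.
move=> h0 df df1 f2M.
have odd (s : R) : 0 <= s -> s <= h -> f1 s - f1 (- s) <= 2 * M * s.
  move=> s0 sh.
  have sn : `|s| <= h by rewrite ger0_norm.
  have D (r : R) : `|r| <= `|s| -> is_derive r 1 f1 (f2 r).
    by move=> rs; apply: df1; exact: le_trans rs sn.
  have D' (r : R) : `|r| <= `|- s| -> is_derive r 1 f1 (f2 r) by rewrite normrN; exact: D.
  have [r rs E] := mvt_from0 D; have [r' rs' E'] := mvt_from0 D'.
  rewrite normrN in rs'.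
  have A : f2 r <= M by apply: f2M; exact: le_trans rs sn.
  have B : f2 r' <= M by apply: f2M; exact: le_trans rs' sn.
  nra.
(* By [odd] the derivative of [g] is nonpositive for s >= 0, hence g h <= g 0. *)
pose g (s : R) := f s + f (- s) - M * s ^+ 2.
have dg (s : R) : `|s| <= h -> is_derive s 1 g (f1 s - f1 (- s) - 2 * M * s).
  move=> sh.
  have D1 := df s sh.
  have D2 : is_derive s 1 (fun r : R => f (- r)) (- f1 (- s)).
    have sh' : `|- s| <= h by rewrite normrN.
    have D3 := df _ sh'.
    have D4 : is_derive s 1 (fun r : R => - r) (-1 : R).
      by apply: is_derive_eq; rewrite ?mulr1.
    have := @is_derive1_comp _ f (fun r : R => - r) s _ _ D3 D4.
    by rewrite mulrN1.
  have D5 : is_derive s 1 (fun r : R => M * r ^+ 2) (M * (s + s)).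
    have I : is_derive s 1 (fun r : R => r) 1 by exact: is_derive_id.
    have := is_deriveMR (is_derive_cst M s 1) (is_deriveMR I I).
    rewrite (_ : (fun y : R => _) = (fun r => M * r ^+ 2)); last by apply/funext => r; rewrite expr2.
    by rewrite mulr1 mul1r mul0r addr0.
  have := is_deriveB (is_deriveDR D1 D2) D5.
  by rewrite (_ : f1 s - f1 (- s) - 2 * M * s = f1 s + - f1 (- s) - M * (s + s)) //; ring.
have cg : {within `[0, h], continuous g}.
  apply: derivable_within_continuous => x; rewrite in_itv /= => /andP[x0 xh].
  by have [] := dg x; rewrite ?ger0_norm.
have dg' (x : R) : x \in `]0, h[ -> is_derive x 1 g (f1 x - f1 (- x) - 2 * M * x).
  by rewrite in_itv /= => /andP[x0 xh]; apply: dg; rewrite ger0_norm ltW.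
have [s sh E] := MVT_segment h0 dg' cg.
have : g h - g 0 <= 0.
  rewrite E; move: sh; rewrite in_itv /= => /andP[s0 sh].
  apply: mulr_le0_ge0; last by rewrite subr0.
  by rewrite subr_le0; exact: odd.
by rewrite /g oppr0 [0 ^+ 2]expr2 mul0r mulr0; lra.
Qed.

Lemma second_difference_line (U : set V) (T : V -> R) (p u : V) (h M : R) :
  0 <= h -> smooth U T -> (forall s : R, `|s| <= h -> U (p + s *: u)) ->
  (forall s : R, `|s| <= h -> 'D_u ('D_u T) (p + s *: u) <= M) ->
  T (p + h *: u) + T (p - h *: u) - 2 * T p <= M * h ^+ 2.
Proof.
move=> h0 sT HU HM.
have := @second_difference_le (fun s => T (p + s *: u)) (fun s => 'D_u T (p + s *: u))
  (fun s => 'D_u ('D_u T) (p + s *: u)) h M h0.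
rewrite scale0r addr0 scaleNr; apply.
- by move=> s sh; apply: is_derive_line; exact: smooth_derivable sT (HU s sh).
- move=> s sh; apply: is_derive_line.
  exact: (smooth_derivable (smooth_derive _ sT) (HU s sh)).
- exact: HM.
Qed.

Lemma parabolic_second_difference (U : set V) (T : V -> R) (z u w : V) (e : R) :
  open U -> smooth U T -> U z -> 0 < e ->
  exists2 r : R, 0 < r & forall h : R, 0 < h -> h < r ->
    T (z + h ^+ 2 *: w + h *: u) + T (z + h ^+ 2 *: w - h *: u) - 2 * T z <=
    h ^+ 2 * ('D_u ('D_u T) z + 2 * 'D_w T z + e).
Proof.
move=> oU sT Uz e0.
have e4 : 0 < e / 4 by rewrite divr_gt0.
have cu := smooth_continuous (smooth_derive u (smooth_derive u sT)) Uz.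
have cw := smooth_continuous (smooth_derive w sT) Uz.
have /nbhs_ballP[r /= r0 Hr] := near_close2 oU Uz e4 cu cw.
pose C := 1 + `|u| + `|w|.
have C1 : 1 <= C by rewrite /C -addrA lerDl addr_ge0.
have C0 : 0 < C by apply: lt_le_trans C1.
exists (Num.min 1 (r / 2 / C)); first by rewrite lt_min ltr01 !divr_gt0.
move=> h h0; rewrite lt_min => /andP[h1 hr].
have Hb (s t : R) : `|s| <= h -> `|t| <= h -> ball z r (z + t *: w + s *: u).
  move=> sh th; rewrite -ball_normE /= -addrA opprD addrA subrr sub0r normrN.
  apply: le_lt_trans (ler_normD _ _) _; rewrite !normrZ.
  have A := ler_wpM2r (normr_ge0 u) sh; have B := ler_wpM2r (normr_ge0 w) th.
  have D : h * C < r by move: hr; rewrite -!ltr_pdivlMr ?divfK ?gt_eqF // => hr; nra.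
  by move: D; rewrite /C; lra.
have h2 : h ^+ 2 <= h by rewrite expr2 ger_pMl // ltW.
have h2n : `|h ^+ 2| <= h by rewrite ger0_norm // exprn_ge0 // ltW.
have P1 : T (z + h ^+ 2 *: w + h *: u) + T (z + h ^+ 2 *: w - h *: u) - 2 * T (z + h ^+ 2 *: w)
    <= ('D_u ('D_u T) z + e / 4) * h ^+ 2.
  apply: (second_difference_line (U := U)); [exact: ltW|exact: sT| |].
    by move=> s sh; have [] := Hr _ (Hb s _ sh h2n).
  move=> s sh; have [_ A _] := Hr _ (Hb s _ sh h2n).
  exact (dist_le_upper A).
have dT (s : R) : `|s| <= `|h ^+ 2| ->
    is_derive s 1 (fun r => T (z + r *: w)) ('D_w T (z + s *: w)).
  move=> sh; apply: is_derive_line.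
  have := Hb 0 s _ (le_trans sh h2n); rewrite normr0 scale0r addr0 => /(_ (ltW h0)) /Hr [Us _ _].
  exact: (smooth_derivable sT Us).
have [s sh E] := mvt_from0 dT.
have A : `|'D_w T z - 'D_w T (z + s *: w)| <= e / 4.
  have := Hb 0 s _ (le_trans sh h2n); rewrite normr0 scale0r addr0.
  by move=> /(_ (ltW h0)) /Hr [_ _].
rewrite scale0r addr0 in E.
have h20 : 0 <= h ^+ 2 by rewrite exprn_ge0 // ltW.
exact (parabolic_aux h20 (ltW e0) P1 E (dist_le_upper A)).
Qed.

End SecondDifference.

(** * Evolution of the Ricci tensor at the center of normal coordinates *)

Section Evolution.
Variables (R : realType) (V : normedModType R) (m : nat).
Variables (eps : 'I_m -> V) (tau : V) (U : set V) (G : V -> 'M[R]_m) (z : V).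
Implicit Types a b c d e f : 'I_m.
Hypothesis mG : metric_on U G.
Hypothesis Uz : U z.
Hypothesis G1 : G z = 1%:M.
Hypothesis Gam0 : forall a, Gam eps G a z = 0.
Local Notation S := (Ric eps G).
(** The flow equation is used at the center only, plain and with two spatial derivatives. Both forms
    follow from its validity on a single time slice, which matters at time 0, after which no flow is
    given. *)
Hypothesis flow0 : dmx tau G z = (-2) *: S z.
Hypothesis flow2 : forall a b,
  dmx (eps a) (dmx (eps b) (dmx tau G)) z = (-2) *: dmx (eps a) (dmx (eps b) S) z.

Let oU : open U. Proof. by have [] := mG. Qed.
Let sG : msmooth U G. Proof. by have [] := mG. Qed.
Let sGam a : msmooth U (Gam eps G a). Proof. exact: Gam_msmooth. Qed.
Let sRc a b : msmooth U (Rc eps G a b). Proof. exact: Rc_msmooth. Qed.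
Let sS : msmooth U S. Proof. exact: Ric_msmooth mG. Qed.

Lemma dmx_metric_center a : dmx (eps a) G z = 0.
Proof. by rewrite (metric_connectionE eps mG) // Gam0 mul0mx trmx0 mulmx0 addr0. Qed.

Lemma dmx2_metric_center k e : dmx (eps k) (dmx (eps e) G) z =
  dmx (eps k) (Gam eps G e) z + (dmx (eps k) (Gam eps G e) z)^T.
Proof.
have sT : msmooth U (fun y => (Gam eps G e y)^T) by exact: msmoothT.
transitivity (dmx (eps k) (fun y => Gam eps G e y *m G y + G y *m (Gam eps G e y)^T) z).
  by apply: (dmx_ext _ oU _ Uz) => y Uy; exact: (metric_connectionE eps mG).
rewrite (dmxD _ (msmoothM oU (sGam e) sG) (msmoothM oU sG sT) Uz).
rewrite (dmxM _ (sGam e) sG Uz) (dmxM _ sG sT Uz) dmxT !dmx_metric_center Gam0 G1.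
by rewrite mulmx1 mul1mx mulmx0 mul0mx addr0 add0r.
Qed.

Lemma Rc_center a b : Rc eps G a b z =
  dmx (eps a) (Gam eps G b) z - dmx (eps b) (Gam eps G a) z.
Proof. by rewrite RcE !Gam0 !mulmx0 subr0 addr0. Qed.

Lemma dmx_contract v (F : V -> 'M[R]_m) (H : 'I_m -> V -> 'M[R]_m) b d y :
  (forall y, U y -> F y b d = \sum_c H c y d c) -> (forall c, msmooth U (H c)) -> U y ->
  dmx v F y b d = \sum_c dmx v (H c) y d c.
Proof.
move=> FH sH Uy; rewrite dmxE.
have -> : 'D_v (fun x => F x b d) y = 'D_v (fun x => \sum_c H c x d c) y.
  by apply: near_eq_derive; apply: filterS (near_open oU Uy) => x /FH.
have := is_derive_sumR (index_enum 'I_m) (fun c => dmx_is_derive v d c (sH c) Uy).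
by case.
Qed.

Lemma dmx_RicE v y b d : U y -> dmx v S y b d = \sum_c dmx v (Rc eps G c b) y d c.
Proof.
move=> Uy; have H := @dmx_contract v S (fun c => Rc eps G c b) b d y; apply: H => // x _.
by rewrite mxE.
Qed.

Lemma dmx2_RicE v w b d :
  dmx v (dmx w S) z b d = \sum_c dmx v (dmx w (Rc eps G c b)) z d c.
Proof.
have H := @dmx_contract v (dmx w S) (fun c => dmx w (Rc eps G c b)) b d z; apply: H => // [y Uy|c].
  exact: dmx_RicE.
exact: msmooth_dmx.
Qed.

Section ContractedBianchi.
Variable k : 'I_m.
Let Q e a b := dmx (eps k) (dmx (eps e) (Rc eps G a b)) z.
Let r a b := Rc eps G a b z.
Let g e := dmx (eps k) (Gam eps G e) z.

Let gC e a f : g e a f = g a e f.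
Proof.
rewrite /g !dmxE; apply: near_eq_derive.
by apply: filterS (near_open oU Uz) => y Uy; exact: (torsion_free eps mG).
Qed.

Let rC a b : r b a = - r a b. Proof. exact: Rc_antiC. Qed.

Let QC e a b : Q e b a = - Q e a b.
Proof.
have sd : msmooth U (dmx (eps e) (Rc eps G a b)) by exact: msmooth_dmx.
rewrite /Q -(dmxN _ sd Uz); apply: (dmx_ext _ oU _ Uz) => y Uy.
rewrite -(dmxN _ (sRc a b) Uy); apply: (dmx_ext _ oU _ Uy) => x _.
exact: Rc_antiC.
Qed.

Let r_anti a b : (r a b)^T = - r a b.
Proof. by have := Rc_low_anti eps mG a b Uz; rewrite G1 mulmx1. Qed.

Let Q_anti e a b : (Q e a b + r a b *m (g e + (g e)^T))^T =
  - (Q e a b + r a b *m (g e + (g e)^T)).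
Proof.
pose F y := Rc eps G a b y *m G y.
have sF : msmooth U F by exact: msmoothM.
have dF y : U y -> dmx (eps e) F y = dmx (eps e) (Rc eps G a b) y *m G y
    + Rc eps G a b y *m dmx (eps e) G y.
  by move=> Uy; rewrite (dmxM _ (sRc a b) sG Uy).
have sd : msmooth U (dmx (eps e) (Rc eps G a b)) by exact: msmooth_dmx.
have sdG : msmooth U (dmx (eps e) G) by exact: msmooth_dmx.
have E : dmx (eps k) (dmx (eps e) F) z = Q e a b + r a b *m (g e + (g e)^T).
  rewrite (dmx_ext _ oU dF Uz).
  rewrite (dmxD _ (msmoothM oU sd sG) (msmoothM oU (sRc a b) sdG) Uz).
  rewrite (dmxM _ sd sG Uz) (dmxM _ (sRc a b) sdG Uz) !dmx_metric_center dmx2_metric_center G1.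
  by rewrite mulmx1 !mulmx0 addr0 add0r.
rewrite -E -dmxT -(dmxN _ (msmooth_dmx _ sF) Uz); apply: (dmx_ext _ oU _ Uz) => y Uy.
rewrite -dmxT -(dmxN _ sF Uy); apply: (dmx_ext _ oU _ Uy) => x Ux.
exact: (Rc_low_anti eps mG).
Qed.

Let Q_bianchi e a b : (Q e a b + r a b *m g e - g e *m r a b)
  + (Q a b e + r b e *m g a - g a *m r b e) + (Q b e a + r e a *m g b - g b *m r e a) = 0.
Proof.
pose D h f l y := dmx (eps h) (Rc eps G f l) y + Rc eps G f l y *m Gam eps G h y
  - Gam eps G h y *m Rc eps G f l y.
have sd h f l : msmooth U (dmx (eps h) (Rc eps G f l)) by exact: msmooth_dmx.
have s1 h f l : msmooth U (fun y => Rc eps G f l y *m Gam eps G h y) by exact: msmoothM.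
have s2 h f l : msmooth U (fun y => Gam eps G h y *m Rc eps G f l y) by exact: msmoothM.
have s3 h f l : msmooth U (fun y => dmx (eps h) (Rc eps G f l) y + Rc eps G f l y *m Gam eps G h y).
  exact: msmoothD.
have sD h f l : msmooth U (D h f l) by exact: msmoothB.
have dD h f l : dmx (eps k) (D h f l) z = Q h f l + r f l *m g h - g h *m r f l.
  rewrite (dmxB _ oU (s3 h f l) (s2 h f l) Uz) (dmxD _ (sd h f l) (s1 h f l) Uz).
  rewrite (dmxM _ (sRc f l) (sGam h) Uz) (dmxM _ (sGam h) (sRc f l) Uz) Gam0.
  by rewrite mulmx0 mul0mx add0r addr0.
rewrite -!dD -(dmxD _ (sD e a b) (sD a b e) Uz).
rewrite -(dmxD _ (msmoothD oU (sD e a b) (sD a b e)) (sD b e a) Uz).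
rewrite -[RHS](dmx_cst (eps k) (0 : 'M[R]_m) z); apply: (dmx_ext _ oU _ Uz) => y Uy.
exact: (second_bianchi eps mG).
Qed.

Let corr e a b : 'M[R]_m := \sum_f (g e a f *: r f b + g e b f *: r a f).
(** The second covariant derivative nabla_k nabla_e of the curvature at the center, where [Gam]
    vanishes but its derivatives [g] do not: the commutator with [g] corrects the endomorphism,
    [corr] the two form indices. Unlike [Q], it has the antisymmetries and the Bianchi identity
    needed for a contraction. *)
Let T e a b : 'M[R]_m := Q e a b + r a b *m g e - g e *m r a b - corr e a b.

Let T_antiC e a b : T e b a = - T e a b.
Proof.
have -> : T e b a = Q e b a + r b a *m g e - g e *m r b a - corr e b a by [].
have -> : corr e b a = - corr e a b.
  rewrite /corr -sumrN; apply: eq_bigr => f _.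
  by rewrite (rC f a) (rC b f) !scalerN opprD !opprK addrC.
by rewrite QC rC mulNmx mulmxN /T; mx_abel.
Qed.

Let T_anti e a b : (T e a b)^T = - T e a b.
Proof.
have Hc : (corr e a b)^T = - corr e a b.
  rewrite /corr linear_sum -sumrN; apply: eq_bigr => f _ /=.
  by rewrite trmxD !trmxZ !r_anti !scalerN opprD.
have := Q_anti e a b; rewrite /T mulmxDr !(trmxD, trmxN) !trmx_mul trmxK Hc !r_anti.
rewrite !(mulmxN, mulNmx) => H.
apply/matrixP => i j; move/matrixP: H => /(_ i j); rewrite !(addmxE, oppmxE); lra.
Qed.

Let T_bianchi e a b : T e a b + T a b e + T b e a = 0.
Proof.
have H := Q_bianchi e a b.
have Hc : corr e a b + corr a b e + corr b e a = 0.
  rewrite /corr -!big_split big1 // => f _ /=.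
  rewrite (gC a e) (gC b a) (gC b e) (rC b f) (rC a f) (rC e f); mx_abel.
transitivity ((Q e a b + r a b *m g e - g e *m r a b)
  + (Q a b e + r b e *m g a - g a *m r b e) + (Q b e a + r e a *m g b - g b *m r e a)
  - (corr e a b + corr a b e + corr b e a)); first by rewrite /T; mx_abel.
by rewrite H Hc subr0.
Qed.

Let u e b d := \sum_c T e c b d c.

Let T_contract e : \sum_b u e b b = 2 * \sum_a u a e a.
Proof.
have H : \sum_a \sum_b (T e a b b a + T a b e b a + T b e a b a) = 0.
  rewrite big1 // => a _; rewrite big1 // => b _.
  by have /matrixP/(_ b a) := T_bianchi e a b; rewrite !addmxE zeromxE.
have E2 : \sum_a \sum_b T a b e b a = - \sum_a u a e a.
  rewrite -sumrN; apply: eq_bigr => a _; rewrite -sumrN; apply: eq_bigr => b _.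
  by rewrite -oppmxE -T_anti trmxE.
have E3 : \sum_a \sum_b T b e a b a = - \sum_a u a e a.
  rewrite exchange_big -sumrN; apply: eq_bigr => b _ /=; rewrite -sumrN; apply: eq_bigr => a _.
  by rewrite T_antiC oppmxE.
have E1 : \sum_a \sum_b T e a b b a = \sum_b u e b b by rewrite exchange_big.
have : \sum_b u e b b - \sum_a u a e a - \sum_a u a e a = 0.
  rewrite -[RHS]H; under [RHS]eq_bigr do rewrite !big_split.
  by rewrite !big_split /= E1 E2 E3.
lra.
Qed.

Let uE e b d : u e b d = dmx (eps k) (dmx (eps e) S) z b d
  - \sum_f g e d f * S z b f - \sum_f g e b f * S z f d.
Proof.
have SE x y : S z x y = \sum_c r c x y c by rewrite mxE.
have -> : u e b d = \sum_c Q e c b d c + \sum_c \sum_f r c b d f * g e f c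
   - \sum_c \sum_f g e d f * r c b f c
   - \sum_c \sum_f (g e c f * r f b d c + g e b f * r c f d c).
  rewrite -!sumrN -!big_split; apply: eq_bigr => c _ /=.
  rewrite /T !(addmxE, oppmxE) /corr summxE; congr (_ - _).
    by rewrite !mxE.
  by apply: eq_bigr => f _; rewrite addmxE !scalemxE.
rewrite dmx2_RicE.
have -> : \sum_c \sum_f (g e c f * r f b d c + g e b f * r c f d c) =
   \sum_c \sum_f r c b d f * g e f c + \sum_f g e b f * S z f d.
  under eq_bigr do rewrite big_split.
  rewrite big_split /=; congr (_ + _).
    by rewrite exchange_big; apply: eq_bigr => c _; apply: eq_bigr => f _; rewrite mulrC.
  by rewrite exchange_big; apply: eq_bigr => f _; rewrite SE mulr_sumr.
have -> : \sum_c \sum_f g e d f * r c b f c = \sum_f g e d f * S z b f.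
  by rewrite exchange_big; apply: eq_bigr => f _; rewrite SE mulr_sumr.
rewrite /Q; ring.
Qed.

(** This is nabla_k of the contracted second Bianchi identity dR = 2 div Ric, written in partial
    derivatives; the last sum is what remains of the Christoffel corrections. *)
Lemma contracted_bianchi_center e : (forall b d, S z b d = S z d b) ->
  \sum_b dmx (eps k) (dmx (eps e) S) z b b =
  2 * \sum_a dmx (eps k) (dmx (eps a) S) z e a
  - 2 * \sum_a \sum_f dmx (eps k) (Gam eps G a) z a f * S z e f.
Proof.
move=> symS; have := T_contract e.
under eq_bigr do rewrite uE.
under [in RHS]eq_bigr do rewrite uE.
rewrite !big_split /= !sumrN.
have -> : \sum_a \sum_f g a a f * S z e f = \sum_a \sum_f dmx (eps k) (Gam eps G a) z a f * S z e f by [].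
have -> : \sum_a \sum_f g a e f * S z f a = \sum_b \sum_f g e b f * S z f b.
  by apply: eq_bigr => a _; apply: eq_bigr => f _; rewrite gC.
have -> : \sum_b \sum_f g e b f * S z b f = \sum_b \sum_f g e b f * S z f b.
  by apply: eq_bigr => a _; apply: eq_bigr => f _; rewrite symS.
lra.
Qed.

End ContractedBianchi.

Lemma dmx_low_comb v (X : 'I_m -> V -> 'M[R]_m) b y : (forall c, msmooth U (X c)) -> U y ->
  dmx v (fun y => \matrix_(d, e) (2^-1 * (X b y d e + X d y b e - X e y b d))) y =
  \matrix_(d, e) (2^-1 * (dmx v (X b) y d e + dmx v (X d) y b e - dmx v (X e) y b d)).
Proof.
move=> sX Uy; apply: dmx_eq => d e; rewrite mxE.
have Dc c i j := dmx_is_derive v i j (sX c) Uy.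
rewrite (_ : (fun x => _) = (fun x => 2^-1 * (X b x d e + X d x b e - X e x b d))); last first.
  by apply/funext => x; rewrite mxE.
have D1 := is_deriveB (is_deriveDR (Dc b d e) (Dc d b e)) (Dc e b d).
have D2 : is_derive y v (fun _ : V => 2^-1 : R) 0 by exact: is_derive_cst.
by have := is_deriveMR D2 D1; rewrite mul0r addr0.
Qed.

(** The variation of [Gam] is extracted from [Gam_low], whose right-hand side is linear in the
    metric, so the inverse metric is never differentiated. *)
Lemma evolution_Ric b d : dmx tau S z b d =
  \sum_a (dmx (eps a) (dmx (eps a) S) z b d - dmx (eps a) (dmx (eps d) S) z b a
   + dmx (eps b) (dmx (eps d) S) z a a - dmx (eps b) (dmx (eps a) S) z a d)
  + 2 * \sum_a (Rc eps G a b z *m S z) d a.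
Proof.
have W a c : dmx (eps a) (dmx tau (Gam eps G c)) z =
   dmx (eps a) (dmx tau (christoffel_low eps G c)) z + 2 *: (dmx (eps a) (Gam eps G c) z *m S z).
  have sdt : msmooth U (dmx tau (Gam eps G c)) by exact: msmooth_dmx.
  have sdG : msmooth U (dmx tau G) by exact: msmooth_dmx.
  have -> : dmx (eps a) (dmx tau (christoffel_low eps G c)) z =
    dmx (eps a) (fun y => dmx tau (Gam eps G c) y *m G y + Gam eps G c y *m dmx tau G y) z.
    apply: (dmx_ext _ oU _ Uz) => y Uy; rewrite -(dmxM _ (sGam c) sG Uy).
    by apply: (dmx_ext _ oU _ Uy) => x Ux; rewrite (Gam_low eps mG).
  rewrite (dmxD _ (msmoothM oU sdt sG) (msmoothM oU (sGam c) sdG) Uz).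
  rewrite (dmxM _ sdt sG Uz) (dmxM _ (sGam c) sdG Uz) dmx_metric_center Gam0 G1 flow0.
  by rewrite mulmx1 mulmx0 mul0mx -scalemxAr; mx_abel.
have L a c i j : dmx (eps a) (dmx tau (christoffel_low eps G c)) z i j =
   - (dmx (eps a) (dmx (eps c) S) z i j + dmx (eps a) (dmx (eps i) S) z c j
      - dmx (eps a) (dmx (eps j) S) z c i).
  have s1 h : msmooth U (dmx (eps h) G) by exact: msmooth_dmx.
  have s2 h : msmooth U (dmx (eps h) (dmx tau G)) by apply: msmooth_dmx; exact: msmooth_dmx.
  pose X h := dmx (eps h) (dmx tau G).
  have -> : dmx (eps a) (dmx tau (christoffel_low eps G c)) z =
    dmx (eps a) (fun y => \matrix_(d, e) (2^-1 * (X c y d e + X d y c e - X e y c d))) z.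
    apply: (dmx_ext _ oU _ Uz) => y Uy.
    rewrite (dmx_low_comb tau c s1 Uy); apply/matrixP => f h; rewrite !mxE /X.
    by rewrite !(dmxC tau _ oU sG Uy).
  by rewrite (dmx_low_comb _ _ s2 Uz) mxE !flow2 !scalemxE; field.
have DRc h : dmx tau (Rc eps G h b) z =
  dmx (eps h) (dmx tau (Gam eps G b)) z - dmx (eps b) (dmx tau (Gam eps G h)) z.
  have s1 f c : msmooth U (dmx (eps f) (Gam eps G c)) by exact: msmooth_dmx.
  have s2 f c : msmooth U (fun y => Gam eps G f y *m Gam eps G c y) by exact: msmoothM.
  have s3 : msmooth U (fun y => dmx (eps h) (Gam eps G b) y - dmx (eps b) (Gam eps G h) y).
    exact: msmoothB.
  rewrite RcE (dmxB _ oU (msmoothD oU s3 (s2 b h)) (s2 h b) Uz).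
  rewrite (dmxD _ s3 (s2 b h) Uz) (dmxB _ oU (s1 h b) (s1 b h) Uz).
  rewrite (dmxM _ (sGam b) (sGam h) Uz) (dmxM _ (sGam h) (sGam b) Uz) !Gam0.
  rewrite !mulmx0 !mul0mx !addr0 subr0.
  by rewrite (dmxC tau _ oU (sGam b) Uz) (dmxC tau _ oU (sGam h) Uz).
rewrite dmx_RicE // mulr_sumr -!big_split; apply: eq_bigr => a _ /=.
rewrite DRc !W Rc_center !(addmxE, oppmxE) !L mulmxBl !(addmxE, oppmxE, scalemxE).
rewrite (dmxC (eps b) (eps a) oU sS Uz); ring.
Qed.

Variable r : 'I_m -> R.
Hypothesis Sr : forall b d, S z b d = r b *+ (b == d).

(** Hamilton's equation Ric_t = Lap Ric + 2 Rm(Ric) - 2 Ric^2 on an eigenvector. The first two sums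
    together form the covariant Laplacian, since the second derivatives of G_bb are twice
    derivatives of [Gam]. *)
Lemma evolution_diag b : dmx tau S z b b =
  \sum_a dmx (eps a) (dmx (eps a) S) z b b - r b * \sum_a dmx (eps a) (dmx (eps a) G) z b b
  - 2 * r b ^+ 2 + 2 * \sum_a r a * Rc eps G a b z b a.
Proof.
have symS x y : S z x y = S z y x.
  by rewrite !Sr eq_sym; case: eqP => [->|].
have SR (F : 'M[R]_m) x y : (F *m S z) x y = F x y * r y.
  rewrite mxE (bigD1 y) //= Sr eqxx mulr1n big1 ?addr0 // => j jy.
  by rewrite Sr (negPf jy) mulr0n mulr0.
have B := contracted_bianchi_center b b symS.
have B2 : \sum_a \sum_f dmx (eps b) (Gam eps G a) z a f * S z b f =
   r b * \sum_a dmx (eps b) (Gam eps G a) z a b.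
  rewrite mulr_sumr; apply: eq_bigr => a _; rewrite (bigD1 b) //= Sr eqxx mulr1n big1 ?addr0 1?mulrC //.
  by move=> j jb; rewrite Sr eq_sym (negPf jb) mulr0n mulr0.
rewrite B2 in B.
have K : r b = \sum_a (dmx (eps a) (Gam eps G b) z b a - dmx (eps b) (Gam eps G a) z b a).
  transitivity (S z b b); first by rewrite Sr eqxx.
  by rewrite mxE; apply: eq_bigr => a _; rewrite Rc_center addmxE oppmxE.
have anti a : Rc eps G a b z a b = - Rc eps G a b z b a.
  have := Rc_low_anti eps mG a b Uz; rewrite G1 mulmx1 => /matrixP/(_ b a).
  by rewrite trmxE oppmxE.
have K2 : r b = - \sum_a (dmx (eps a) (Gam eps G b) z a b - dmx (eps b) (Gam eps G a) z a b).
  rewrite K -sumrN; apply: eq_bigr => a _.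
  by have := anti a; rewrite Rc_center !(addmxE, oppmxE) => ->; ring.
have GG : \sum_a dmx (eps a) (dmx (eps a) G) z b b = 2 * \sum_a dmx (eps a) (Gam eps G b) z a b.
  rewrite mulr_sumr; apply: eq_bigr => a _; rewrite dmx2_metric_center addmxE trmxE.
  have -> : dmx (eps a) (Gam eps G a) z b b = dmx (eps a) (Gam eps G b) z a b.
    rewrite !dmxE; apply: near_eq_derive.
    by apply: filterS (near_open oU Uz) => y Uy; exact: (torsion_free eps mG).
  by ring.
rewrite evolution_Ric GG.
have -> : \sum_a (Rc eps G a b z *m S z) b a = \sum_a r a * Rc eps G a b z b a.
  by apply: eq_bigr => a _; rewrite SR mulrC.
have symS2 e f x y : dmx (eps e) (dmx (eps f) S) z x y = dmx (eps e) (dmx (eps f) S) z y x.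
  have H i j : dmx (eps e) (dmx (eps f) S) z i j =
      (-2)^-1 * dmx (eps e) (dmx (eps f) (dmx tau G)) z i j.
    by rewrite flow2 scalemxE mulKf // oppr_eq0 pnatr_eq0.
  rewrite !H; congr (_ * _); rewrite !dmxE; apply: near_eq_derive.
  apply: filterS (near_open oU Uz) => w Uw.
  rewrite !dmxE; apply: near_eq_derive.
  apply: filterS (near_open oU Uw) => w' Uw'.
  exact: (dmx_metric_symE mG).
have -> : \sum_a (dmx (eps a) (dmx (eps a) S) z b b - dmx (eps a) (dmx (eps b) S) z b a
   + dmx (eps b) (dmx (eps b) S) z a a - dmx (eps b) (dmx (eps a) S) z a b) =
  \sum_a dmx (eps a) (dmx (eps a) S) z b b + \sum_a dmx (eps b) (dmx (eps b) S) z a a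
  - 2 * \sum_a dmx (eps b) (dmx (eps a) S) z b a.
  rewrite mulr_sumr -sumrN -!big_split; apply: eq_bigr => a _ /=.
  rewrite (dmxC (eps a) (eps b) oU sS Uz) (symS2 b a a b); ring.
rewrite B; move: K2; rewrite sumrB; nra.
Qed.

End Evolution.

(** * Trace of the Ricci tensor over a coordinate plane *)

Definition plane_trace (R : realType) m (g s : 'M[R]_m) (i j : 'I_m) : R :=
  (s i i * g j j + s j j * g i i - 2 * (s i j * g i j)) / (g i i * g j j - g i j * g i j).

Lemma deriveZ_dir (R : realType) (V : normedModType R) (fb : fbasis V) (U : set V) (f : V -> R)
    x (c : R) v : open U -> smooth U f -> U x -> 'D_(c *: v) f x = c * 'D_v f x.
Proof.
move=> oU sf Ux; rewrite !(derive_dirE fb _ oU sf Ux) mulr_sumr; apply: eq_bigr => i _.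
have Z : fcoord fb i (0 : V) = 0 by rewrite -(subrr (0 : V)) fcoordB subrr.
by rewrite -[c *: v]addr0 fcoordP Z addr0 mulrA.
Qed.

(** Value and first two derivatives along one direction. As a relation, it lets [jet2_add] and
    [jet2_mul] compute the jet of an expression by unification. *)
Definition jet2 (R : realType) (V : normedModType R) (U : set V) (z u : V) (f : V -> R)
    (f0 f1 f2 : R) : Prop :=
  [/\ smooth U f, f z = f0, 'D_u f z = f1 & 'D_u ('D_u f) z = f2].

Section Jets.
Variables (R : realType) (V : normedModType R) (U : set V) (z u : V).
Hypothesis oU : open U.
Hypothesis Uz : U z.
Local Notation jet := (jet2 U z u).

Lemma jet2_ext f g f0 f1 f2 : (forall y, U y -> f y = g y) -> jet f f0 f1 f2 -> jet g f0 f1 f2.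
Proof.
move=> fg [sf <- <- <-].
have near_fg y : U y -> \forall x \near y, f x = g x.
  by move=> Uy; apply: filterS (near_open oU Uy) => x /fg.
have E y : U y -> 'D_u f y = 'D_u g y by move=> Uy; exact: near_eq_derive (near_fg y Uy).
split; [exact: smooth_ext oU fg sf|by rewrite fg|by rewrite E|].
by apply/esym/near_eq_derive; apply: filterS (near_open oU Uz) => x /E.
Qed.

Lemma jet2_cst c : jet (fun _ => c) c 0 0.
Proof.
have E y : 'D_u (fun _ : V => c) y = 0 by exact: derive_cst.
split=> //; first exact: smooth_cst.
have -> : 'D_u (fun _ : V => c) = fun _ => 0 by apply/funext.
exact: derive_cst.
Qed.

Lemma jet2_add f g f0 f1 f2 g0 g1 g2 : jet f f0 f1 f2 -> jet g g0 g1 g2 ->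
  jet (fun y => f y + g y) (f0 + g0) (f1 + g1) (f2 + g2).
Proof.
move=> [sf <- <- <-] [sg <- <- <-].
have E y : U y -> 'D_u (fun y => f y + g y) y = 'D_u f y + 'D_u g y.
  by move=> Uy; have [_ ->] := is_deriveDR (smooth_is_derive u sf Uy) (smooth_is_derive u sg Uy).
split; [exact: smoothD|by []|exact: E|].
transitivity ('D_u (fun y => 'D_u f y + 'D_u g y) z).
  by apply: near_eq_derive; apply: filterS (near_open oU Uz) => x /E.
by have [_ ->] := is_deriveDR (smooth_is_derive u (smooth_derive u sf) Uz)
  (smooth_is_derive u (smooth_derive u sg) Uz).
Qed.

Lemma jet2_mul f g f0 f1 f2 g0 g1 g2 : jet f f0 f1 f2 -> jet g g0 g1 g2 ->
  jet (fun y => f y * g y) (f0 * g0) (f0 * g1 + f1 * g0) (f0 * g2 + 2 * (f1 * g1) + f2 * g0).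
Proof.
move=> [sf <- <- <-] [sg <- <- <-].
have E y : U y -> 'D_u (fun y => f y * g y) y = f y * 'D_u g y + 'D_u f y * g y.
  by move=> Uy; have [_ ->] := is_deriveMR (smooth_is_derive u sf Uy) (smooth_is_derive u sg Uy).
split; [exact: smoothM|by []|exact: E|].
transitivity ('D_u (fun y => f y * 'D_u g y + 'D_u f y * g y) z).
  by apply: near_eq_derive; apply: filterS (near_open oU Uz) => x /E.
have D1 := is_deriveMR (smooth_is_derive u sf Uz) (smooth_is_derive u (smooth_derive u sg) Uz).
have D2 := is_deriveMR (smooth_is_derive u (smooth_derive u sf) Uz) (smooth_is_derive u sg Uz).
have [_ ->] := is_deriveDR D1 D2.
by move: ('D_u f z) ('D_u g z) ('D_u _ z) ('D_u _ z) => a b c d; ring.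
Qed.

Lemma jet2_entry p q (F : V -> 'M[R]_(p, q)) i j : msmooth U F ->
  jet (fun y => F y i j) (F z i j) (dmx u F z i j) (dmx u (dmx u F) z i j).
Proof. by move=> sF; split=> //; rewrite ?dmxE // dmx_entry. Qed.

Lemma jet2_unique f f0 f1 f2 g0 g1 g2 : jet f f0 f1 f2 -> jet f g0 g1 g2 ->
  [/\ f0 = g0, f1 = g1 & f2 = g2].
Proof. by move=> [_ <- <- <-] [_ <- <- <-]. Qed.

Lemma jet2_self f : smooth U f -> jet f (f z) ('D_u f z) ('D_u ('D_u f) z).
Proof. by []. Qed.

End Jets.

Lemma step_aux (R : realType) (m : nat) (A dt K X h2 e kappa : R) : 0 < m%:R :> R ->
  kappa = (2 * m%:R)^-1 -> A - dt = - 2 * K ->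
  2 * X *+ m + h2 * (A + 2 * (- kappa * dt) *+ m + e / m%:R *+ m) <=
  2 * m%:R * X - h2 * (2 * K - e).
Proof.
rewrite -(mulr_natr (2 * X)) -(mulr_natr (2 * _)) -(mulr_natr (e / _)); move: (m%:R) => n n0 -> E; have -> : A = dt - 2 * K by lra.
by apply: le_of_eq; field; rewrite gt_eqF.
Qed.

Section PlaneTrace.
Variables (R : realType) (V : normedModType R) (m : nat).
Variables (eps : 'I_m -> V) (tau : V) (U : set V) (G : V -> 'M[R]_m) (z : V).
Hypothesis mG : metric_on U G.
Hypothesis Uz : U z.
Hypothesis G1 : G z = 1%:M.
Hypothesis Gam0 : forall a, Gam eps G a z = 0.
Local Notation S := (Ric eps G).
Hypothesis flow0 : dmx tau G z = (-2) *: S z.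
Hypothesis flow2 : forall a b,
  dmx (eps a) (dmx (eps b) (dmx tau G)) z = (-2) *: dmx (eps a) (dmx (eps b) S) z.
Variable r : 'I_m -> R.
Hypothesis Sr : forall b d, S z b d = r b *+ (b == d).
Variables i j : 'I_m.
Hypothesis ij : i != j.
Hypothesis detU : forall y, U y -> G y i i * G y j j - G y i j * G y i j != 0.

Let oU : open U. Proof. by have [] := mG. Qed.
Let sG : msmooth U G. Proof. by have [] := mG. Qed.
Let sS : msmooth U S. Proof. exact: Ric_msmooth mG. Qed.

(** The division by the Gram determinant makes the trace depend on the plane alone, so fixed
    coordinate vectors can be used at all times; an orthonormal frame would have to be evolved along
    with the metric. *)
Let T y := plane_trace (G y) (S y) i j.

Lemma plane_trace_smooth : smooth U T.
Proof.
apply: smoothM => //.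
  apply: smoothB => //; first by apply: smoothD => //; exact: smoothM.
  by apply: smoothM => //; [exact: smooth_cst|exact: smoothM].
by apply: smoothV => //; apply: smoothB => //; exact: smoothM.
Qed.

Let ijF : (i == j) = false. Proof. exact: negPf. Qed.

Lemma plane_trace_center : T z = r i + r j.
Proof.
by rewrite /T /plane_trace G1 !Sr !mxE !eqxx ijF !(mulr0n, mulr1n); field.
Qed.

Let N y := S y i i * G y j j + S y j j * G y i i + (-2) * (S y i j * G y i j).
Let D y := G y i i * G y j j + (-1) * (G y i j * G y i j).

Let NE y : U y -> T y * D y = N y.
Proof.
move=> Uy; have := detU Uy; rewrite /T /plane_trace /D /N => d.
by rewrite mulN1r divfK // mulNr.
Qed.

(* Product rule for T D = N. *)
Let jet_quotient u : exists t1 t2 : R, jet2 U z u T (r i + r j) t1 t2 /\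
  let g k l := dmx u G z k l in let g' k l := dmx u (dmx u G) z k l in
  let s k l := dmx u S z k l in let s' k l := dmx u (dmx u S) z k l in
  (r i + r j) * (g i i + g j j) + t1 = r i * g j j + s i i + (r j * g i i + s j j) /\
  (r i + r j) * (g' i i + 2 * (g i i * g j j) + g' j j - 2 * (g i j * g i j))
    + 2 * (t1 * (g i i + g j j)) + t2 =
  r i * g' j j + 2 * (s i i * g j j) + s' i i + (r j * g' i i + 2 * (s j j * g i i) + s' j j)
      - 4 * (s i j * g i j).
Proof.
pose sE k l := jet2_entry z u k l sS; pose gE k l := jet2_entry z u k l sG.
have J1 := jet2_mul oU Uz (sE i i) (gE j j).
have J2 := jet2_mul oU Uz (sE j j) (gE i i).
have J3 := jet2_mul oU Uz (jet2_cst z u oU (-2)) (jet2_mul oU Uz (sE i j) (gE i j)).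
have JN : jet2 U z u N _ _ _ := jet2_add oU Uz (jet2_add oU Uz J1 J2) J3.
have J4 := jet2_mul oU Uz (gE i i) (gE j j).
have J5 := jet2_mul oU Uz (jet2_cst z u oU (-1)) (jet2_mul oU Uz (gE i j) (gE i j)).
have JD : jet2 U z u D _ _ _ := jet2_add oU Uz J4 J5.
have JT := jet2_self z u plane_trace_smooth.
rewrite plane_trace_center in JT.
have JTD := jet2_ext oU Uz NE (jet2_mul oU Uz JT JD).
have [E0 E1 E2] := jet2_unique JTD JN.
exists ('D_u T z), ('D_u ('D_u T) z); split=> //=.
move: E1 E2; rewrite !G1 !Sr !mxE !eqxx ijF !mulr0n !mulr1n.
move: ('D_u T z) ('D_u ('D_u T) z) => t1 t2.
move: (dmx u G z i i) (dmx u G z j j) (dmx u G z i j) => g1 g2 g3.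
move: (dmx u S z i i) (dmx u S z j j) (dmx u S z i j) => s1 s2 s3.
move: (dmx u (dmx u G) z i i) (dmx u (dmx u G) z j j) (dmx u (dmx u G) z i j) => k1 k2 k3.
move: (dmx u (dmx u S) z i i) (dmx u (dmx u S) z j j) (dmx u (dmx u S) z i j) => l1 l2 l3.
by move=> E1 E2; split; lra.
Qed.

(** The metric terms of the quotient match those of [evolution_diag]: second derivatives of [G]
    complete the Laplacian, and the time derivative -2 Ric of [G] absorbs the terms -2 r_b^2. Only
    the reaction survives. *)
Lemma plane_trace_heat : \sum_a 'D_(eps a) ('D_(eps a) T) z - 'D_tau T z =
  - 2 * \sum_a r a * (Rc eps G a i z i a + Rc eps G a j z j a).
Proof.
have dd a : 'D_(eps a) ('D_(eps a) T) z =
  dmx (eps a) (dmx (eps a) S) z i i - r i * dmx (eps a) (dmx (eps a) G) z i i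
  + (dmx (eps a) (dmx (eps a) S) z j j - r j * dmx (eps a) (dmx (eps a) G) z j j).
  have [t1 [t2 [[_ _ _ ->] /= [_]]]] := jet_quotient (eps a).
  by rewrite !(dmx_metric_center mG) // !mxE; lra.
have dt : 'D_tau T z = dmx tau S z i i + 2 * r i ^+ 2 + (dmx tau S z j j + 2 * r j ^+ 2).
  have [t1 [t2 [[_ _ -> _] /= [+ _]]]] := jet_quotient tau.
  by rewrite flow0 !scalemxE !Sr !eqxx !mulr1n; lra.
rewrite (eq_bigr _ (fun a _ => dd a)) !big_split /= !sumrN -!mulr_sumr dt.
rewrite !(evolution_diag mG Uz G1 Gam0 flow0 flow2 Sr).
have -> : \sum_a r a * (Rc eps G a i z i a + Rc eps G a j z j a) =
  \sum_a r a * Rc eps G a i z i a + \sum_a r a * Rc eps G a j z j a.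
  by rewrite -big_split; apply: eq_bigr => a _; rewrite mulrDr.
ring.
Qed.

(** A parabolic mean value inequality: the spatial second differences contribute h^2 Lap T, and the
    2 m time steps of size kappa h^2 contribute -h^2 T_t exactly when 2 m kappa = 1. *)
Lemma plane_trace_step (fb : fbasis V) (kappa e : R) : kappa = (2 * m%:R)^-1 -> 0 < e ->
  exists2 h0 : R, 0 < h0 & forall h : R, 0 < h -> h < h0 ->
    \sum_a (T (z - (kappa * h ^+ 2) *: tau + h *: eps a) + T (z - (kappa * h ^+ 2) *: tau - h *: eps a))
    <= 2 * m%:R * (r i + r j)
       - h ^+ 2 * (2 * \sum_a r a * (Rc eps G a i z i a + Rc eps G a j z j a) - e).
Proof.
move=> kE e0.
have m0 : 0 < m%:R :> R.
  by rewrite ltr0n; case: m i => [[]|].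
have em : 0 < e / m%:R by rewrite divr_gt0.
have dZ := deriveZ_dir fb (- kappa) tau oU plane_trace_smooth Uz.
have [d2 [dt [H' E]]] : exists (d2 : 'I_m -> R) (dt : R),
    (forall a, exists s : R, 0 < s /\ forall h : R, 0 < h -> h < s ->
      T (z + h ^+ 2 *: (- kappa *: tau) + h *: eps a) + T (z + h ^+ 2 *: (- kappa *: tau) - h *: eps a)
       - 2 * T z <= h ^+ 2 * (d2 a + 2 * (- kappa * dt) + e / m%:R)) /\
    \sum_a d2 a - dt = - 2 * \sum_a r a * (Rc eps G a i z i a + Rc eps G a j z j a).
  exists (fun a => 'D_(eps a) ('D_(eps a) T) z), ('D_tau T z).
  split; last exact: plane_trace_heat.
  move=> a; have [s s0 Hs] := parabolic_second_difference (eps a) (- kappa *: tau) oU plane_trace_smooth Uz em.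
  by exists s; split=> // h h1 h2; have := Hs h h1 h2; rewrite dZ.
have [h0 Hh0] := choice H'.
exists (\big[Num.min/1]_a h0 a).
  by apply: lt_bigmin => // a _; have [] := Hh0 a.
move=> h hp hh.
have hha a : h < h0 a by apply: lt_le_trans hh _; exact: bigmin_le_cond.
have wE : h ^+ 2 *: (- kappa *: tau) = - ((kappa * h ^+ 2) *: tau).
  by rewrite scalerA mulrN mulrC scaleNr.
have L : \sum_a (T (z - (kappa * h ^+ 2) *: tau + h *: eps a) + T (z - (kappa * h ^+ 2) *: tau - h *: eps a)) <=
  \sum_a (2 * T z + h ^+ 2 * (d2 a + 2 * (- kappa * dt) + e / m%:R)).
  apply: ler_sum => a _; have [_ /(_ h hp (hha a))] := Hh0 a.
  by rewrite wE lerBlDl.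
apply: le_trans L _; rewrite plane_trace_center.
rewrite big_split /= sumr_const card_ord -mulr_sumr !big_split /= !sumr_const card_ord.
exact (step_aux _ _ _ m0 kE E).
Qed.

End PlaneTrace.

(** * Space-time and its slices *)

Lemma mx_norm_le (R : realType) m n (A : 'M[R]_(m.+1, n.+1)) e : 0 <= e ->
  (forall i j, `|A i j| <= e) -> `|A| <= e.
Proof.
by move=> e0 H; rewrite /Num.Def.normr/= mx_normrE (bigmax_le _ e0).
Qed.

Section SpaceTime.
Variables (R : realType) (n : nat).
Local Notation X := 'rV[R]_n.+1.
Local Notation ST := ('rV[R]_n.+1 * R)%type.

Definition sdir (a : 'I_n.+1) : ST := (delta_mx 0 a, 0).
Definition tdir : ST := (0, 1).
Definition xdir (a : 'I_n.+1) : X := delta_mx 0 a.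
Definition ST_fbasis : fbasis ST := prod_fbasis (rV_fbasis R n) (R_fbasis R).

Lemma derive_slice (f : ST -> R) (x v : X) (t : R) :
  'D_v (fun y => f (y, t)) x = 'D_(v, 0) f (x, t).
Proof.
have E : (fun h : R => h^-1 *: (((fun y => f (y, t)) \o shift x) (h *: v) - f (x, t))) =
    (fun h : R => h^-1 *: ((f \o shift (x, t)) (h *: (v, 0)) - f (x, t))).
  apply/funext => h /=; congr (_ *: (f _ - _)); apply/pair_equal_spec; split => //=.
  by rewrite scaler0 add0r.
by rewrite /derive E.
Qed.

Lemma dmx_slice p q (F : ST -> 'M[R]_(p, q)) (x v : X) (t : R) :
  dmx v (fun y => F (y, t)) x = dmx (v, 0) F (x, t).
Proof.
apply/matrixP => i j; rewrite !dmxE.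
exact: (derive_slice (fun z => F z i j)).
Qed.

Lemma Gam_slice (G : ST -> 'M[R]_n.+1) a x t :
  Gam xdir (fun y => G (y, t)) a x = Gam sdir G a (x, t).
Proof.
by rewrite !GamE; congr (_ *m _); apply/matrixP => b d; rewrite !mxE !dmx_slice.
Qed.

Lemma Rc_slice (G : ST -> 'M[R]_n.+1) a b x t :
  Rc xdir (fun y => G (y, t)) a b x = Rc sdir G a b (x, t).
Proof.
rewrite !RcE -!dmx_slice !Gam_slice.
have E c : Gam xdir (fun y => G (y, t)) c = (fun y => Gam sdir G c (y, t)).
  by apply/funext => y; exact: Gam_slice.
by rewrite !E.
Qed.

Lemma Ric_slice (G : ST -> 'M[R]_n.+1) x t :
  Ric xdir (fun y => G (y, t)) x = Ric sdir G (x, t).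
Proof.
by apply/matrixP => b d; rewrite !mxE; apply: eq_bigr => a _; rewrite Rc_slice.
Qed.

Lemma open_slice (U : set ST) t : open U -> open [set y | U (y, t)].
Proof.
move=> oU; rewrite openE => y Uy.
have /nbhs_ballP[e /= e0 He] := near_open oU Uy.
apply/nbhs_ballP; exists e => //= w yw; apply: He; split => //=.
exact: ballxx.
Qed.

Lemma smooth_slice (U : set ST) t (f : ST -> R) : open U -> smooth U f ->
  smooth [set y | U (y, t)] (fun y => f (y, t)).
Proof.
move=> oU sf; apply: (smooth_comp (fb := ST_fbasis) (U' := U)) => //; first exact: open_slice.
move=> i; rewrite /= ; case: fintype.split => j /=.
  exact: (smooth_fcoord (fb := rV_fbasis R n) j (open_slice oU)).
exact: smooth_cst (open_slice oU).
Qed.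

Lemma msmooth_slice p q (U : set ST) t (F : ST -> 'M[R]_(p, q)) : open U -> msmooth U F ->
  msmooth [set y | U (y, t)] (fun y => F (y, t)).
Proof. by move=> oU sF i j; exact: (smooth_slice t oU (sF i j)). Qed.

Lemma dmx_slice_ext p q (U : set ST) (F F' : ST -> 'M[R]_(p, q)) x (v : X) t : open U ->
  (forall y, U (y, t) -> F (y, t) = F' (y, t)) -> U (x, t) ->
  dmx (v, 0) F (x, t) = dmx (v, 0) F' (x, t).
Proof.
move=> oU FF Ux; rewrite -!dmx_slice; by apply: (dmx_ext _ (open_slice oU) _ Ux) => y; exact: FF.
Qed.

Lemma msmooth_fst (U : set ST) : open U -> msmooth U (fun z : ST => z.1).
Proof.
move=> oU i a; rewrite ord1.
have := smooth_fcoord (fb := ST_fbasis) (lshift 1 a) oU.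
by rewrite /= (unsplitK (inl a)).
Qed.

Lemma smooth_snd (U : set ST) : open U -> smooth U (fun z : ST => z.2).
Proof.
move=> oU; have := smooth_fcoord (fb := ST_fbasis) (rshift n.+1 ord0) oU.
by rewrite /= (unsplitK (inr ord0)).
Qed.

Lemma dmx_fst (v z : ST) : dmx v (fun z : ST => z.1) z = v.1.
Proof.
apply: dmx_eq => i a; apply: (@is_derive_lin _ _ (fun z : ST => z.1 i a)).
by move=> c u w; rewrite /= !mxE.
Qed.

(* The second order approximation of the geodesic exponential at [x]. *)
Definition moved (Gm : 'I_n.+1 -> 'M[R]_n.+1) (x w : X) : X :=
  x + w - 2^-1 *: \sum_c w 0 c *: (w *m Gm c).

End SpaceTime.

(** * Normal coordinates in space-time *)

Section NormalCoordinates.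
Variables (R : realType) (n : nat).
Local Notation X := 'rV[R]_n.+1.
Local Notation ST := ('rV[R]_n.+1 * R)%type.
Local Notation sdir := (@sdir R n).
Local Notation tdir := (@tdir R n).
Local Notation xdir := (@xdir R n).
Variables (U' : set ST) (H : ST -> 'M[R]_n.+1) (x0 : X) (t0 : R) (E : 'M[R]_n.+1).
Hypothesis mH : metric_on U' H.
Hypothesis Ux0 : U' (x0, t0).
Hypothesis flowH : forall x, U' (x, t0) -> dmx tdir H (x, t0) = (-2) *: Ric sdir H (x, t0).
Hypothesis orthoE : E *m H (x0, t0) *m E^T = 1%:M.

Let Gm c := Gam sdir H c (x0, t0).
(** Normal coordinates of second order at (x0, t0), which is enough for [Gam] to vanish at the
    center; the rows of [E] become the coordinate vectors there, and time is left alone. *)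
Definition ncoord (z : ST) : ST := (moved Gm x0 (z.1 *m E), z.2).
(** The Jacobian of the spatial part. The factor 1/2 of [moved] disappears because the quadratic
    term is symmetric ([Gm_sym]). *)
Definition ncoord_jac (z : ST) : 'M[R]_n.+1 := E *m (1%:M - \sum_c (z.1 *m E) 0 c *: Gm c).
Let phi := ncoord.
Let Jn := ncoord_jac.

Let oU' : open U'. Proof. by have [] := mH. Qed.

Let Gm_sym (u v : X) : \sum_c u 0 c *: (v *m Gm c) = \sum_c v 0 c *: (u *m Gm c).
Proof. exact: (Gam_swap sdir mH _ _ Ux0). Qed.

Let oT : open (setT : set ST). Proof. exact: openT. Qed.

Let zE_smooth : msmooth setT (fun z : ST => z.1 *m E).
Proof. by apply: msmoothM; [exact: openT|exact: msmooth_fst openT|exact: msmooth_cst openT]. Qed.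

Let phi1_smooth : msmooth setT (fun z => (phi z).1).
Proof.
apply: msmoothB => //.
  by apply: msmoothD => //; exact: msmooth_cst.
apply: msmoothZ => //; first exact: smooth_cst.
apply: msmooth_sum => // c; apply: msmoothZ => //.
by apply: msmoothM => //; exact: msmooth_cst.
Qed.

Let Jn_smooth : msmooth setT Jn.
Proof.
apply: msmoothM => //; first exact: msmooth_cst.
apply: msmoothB => //; first exact: msmooth_cst.
apply: msmooth_sum => // c; apply: msmoothZ => //; exact: msmooth_cst.
Qed.

Let dzE (v z : ST) : dmx v (fun z : ST => z.1 *m E) z = v.1 *m E.
Proof.
rewrite (dmxM v (msmooth_fst oT) (msmooth_cst E oT) (I : setT z)).
by rewrite dmx_fst dmx_cst mulmx0 addr0.
Qed.

Let dphi1 (v z : ST) : dmx v (fun z => (phi z).1) z =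
  v.1 *m E - \sum_c (z.1 *m E) 0 c *: (v.1 *m E *m Gm c).
Proof.
have Tz : (setT : set ST) z by [].
have s0 : msmooth setT (fun _ : ST => x0) by exact: msmooth_cst.
have s1 c : msmooth setT (fun z : ST => z.1 *m E *m Gm c).
  by apply: msmoothM => //; exact: msmooth_cst.
have s2 c : smooth setT (fun z : ST => (z.1 *m E) 0 c) by exact: (zE_smooth 0 c).
have s3 c : msmooth setT (fun z : ST => (z.1 *m E) 0 c *: (z.1 *m E *m Gm c)).
  exact: msmoothZ.
have s4 : msmooth setT (fun z : ST => \sum_c (z.1 *m E) 0 c *: (z.1 *m E *m Gm c)).
  exact: msmooth_sum.
have s5 : smooth setT (fun _ : ST => 2^-1 : R) by exact: smooth_cst.
rewrite (dmxB _ oT (msmoothD oT s0 zE_smooth) (msmoothZ oT s5 s4) Tz).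
rewrite (dmxD _ s0 zE_smooth Tz) dmx_cst add0r dzE; congr (_ - _).
rewrite (dmxZ _ s5 s4 Tz) (_ : 'D_v _ z = 0) ?scale0r ?add0r; last exact: derive_cst.
rewrite (dmx_sum _ _ s3 Tz).
have D c : dmx v (fun z : ST => (z.1 *m E) 0 c *: (z.1 *m E *m Gm c)) z =
    (v.1 *m E) 0 c *: (z.1 *m E *m Gm c) + (z.1 *m E) 0 c *: (v.1 *m E *m Gm c).
  rewrite (dmxZ _ (s2 c) (s1 c) Tz) -dmxE dzE; congr (_ + _ *: _).
  by rewrite (dmxM _ zE_smooth (msmooth_cst (Gm c) oT) Tz) dzE dmx_cst mulmx0 addr0.
have -> : \sum_c dmx v (fun z : ST => (z.1 *m E) 0 c *: (z.1 *m E *m Gm c)) z =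
    \sum_c ((v.1 *m E) 0 c *: (z.1 *m E *m Gm c) + (z.1 *m E) 0 c *: (v.1 *m E *m Gm c)).
  by apply: eq_bigr => c _; exact: D.
rewrite big_split /= Gm_sym; apply/matrixP => a b; by rewrite !(scalemxE, addmxE); field.
Qed.

Let dphi_s a z b : dmx (sdir a) (fun z => (phi z).1) z 0 b = Jn z a b.
Proof.
rewrite dphi1 /= -rowE /Jn /ncoord_jac.
rewrite -[RHS]/((fun A : 'M[R]_n.+1 => A a b) _) mulmxBr mulmx1 mulmx_sumr.
rewrite !(addmxE, oppmxE) mxE; congr (_ - _).
rewrite !summxE; apply: eq_bigr => c _.
by rewrite -scalemxAr !scalemxE -row_mul [row _ _ _ _]mxE.
Qed.

Let dphi_t z : dmx tdir (fun z => (phi z).1) z = 0.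
Proof. by rewrite dphi1 /= mul0mx sub0r big1 ?oppr0 // => c _; rewrite mul0mx scaler0. Qed.

Let phi_coord_smooth (W : set ST) i : open W -> smooth W (fun z => fcoord (ST_fbasis R n) i (phi z)).
Proof.
move=> oW; rewrite /=; case: fintype.split => j /=.
  exact: (smooth_sub (subsetT W) (phi1_smooth 0 j)).
exact: smooth_snd.
Qed.

Let phi_chain_dir v (d : X) (e : R) (F : ST -> 'M[R]_n.+1) z :
  dmx v (fun z => (phi z).1) z = d -> v.2 = e ->
  msmooth U' F -> U' (phi z) ->
  dmx v (fun z => F (phi z)) z = \sum_b d 0 b *: dmx (sdir b) F (phi z) + e *: dmx tdir F (phi z).
Proof.
move=> dE eE sF Uz.
have Tz : (setT : set ST) z by [].
have D i : is_derive z v (fun y => fcoord (ST_fbasis R n) i (phi y))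
    (match fintype.split i with inl j => d 0 j | inr j => e end).
  rewrite /=; case: fintype.split => j /=.
    by rewrite -dE; exact: (dmx_is_derive v 0 j phi1_smooth Tz).
  by rewrite -eE; apply: (@is_derive_lin _ _ (fun z : ST => z.2)).
have c : {for z, continuous phi}.
  apply: (continuous_fcoord (fb := ST_fbasis R n)) => i.
  exact: smooth_continuous (phi_coord_smooth i oT) Tz.
rewrite (dmx_comp oU' sF Uz D c) big_split_ord /= big_ord1; congr (_ + _).
  by apply: eq_bigr => b _; rewrite (unsplitK (inl b)).
by rewrite (unsplitK (inr ord0)).
Qed.

Let W : set ST := [set z | U' (phi z) /\ \det (Jn z) != 0].

Let oW : open W.
Proof.
rewrite openE => z [Uz dz].
have c : {for z, continuous phi}.
  apply: (continuous_fcoord (fb := ST_fbasis R n)) => i.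
  exact: smooth_continuous (phi_coord_smooth i oT) (I : setT z).
have N1 := c _ (near_open oU' Uz).
have cd := smooth_continuous (smooth_det oT Jn_smooth) (I : setT z).
have N2 : nbhs z (fun y => \det (Jn y) != 0) by exact: cvgr_neq0 cd dz.
have N1' : nbhs z (fun y => U' (phi y)) := N1.
have : nbhs z W by apply: filterS2 N1' N2 => y.
by [].
Qed.

Let G := pullback_metric phi Jn H.

Let phi_smoothF (F : ST -> 'M[R]_n.+1) : msmooth U' F -> msmooth W (fun z => F (phi z)).
Proof.
move=> sF; apply: (msmooth_comp (fb := ST_fbasis R n) oW oU' sF).
  by move=> z [].
by move=> i; exact: (phi_coord_smooth i oW).
Qed.

Let phi_chain (F : ST -> 'M[R]_n.+1) a z : msmooth U' F -> W z ->
  dmx (sdir a) (fun z => F (phi z)) z = \sum_b Jn z a b *: dmx (sdir b) F (phi z).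
Proof.
move=> sF [Uz _]; rewrite (phi_chain_dir (erefl _) (erefl _) sF Uz) scale0r addr0.
by apply: eq_bigr => b _; rewrite dphi_s.
Qed.

Let phi_chain_t (F : ST -> 'M[R]_n.+1) z : msmooth U' F -> W z ->
  dmx tdir (fun z => F (phi z)) z = dmx tdir F (phi z).
Proof.
move=> sF [Uz _]; rewrite (phi_chain_dir (erefl _) (erefl _) sF Uz) scale1r dphi_t.
by rewrite big1 ?add0r // => b _; rewrite mxE scale0r.
Qed.

Let sJ : msmooth W Jn. Proof. exact: msmooth_sub (subsetT W) Jn_smooth. Qed.
Let uJ z : W z -> Jn z \in unitmx. Proof. by move=> [_]; rewrite unitmxE unitfE. Qed.

Let dJ v z : dmx v Jn z = - (E *m \sum_c (v.1 *m E) 0 c *: Gm c).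
Proof.
have Tz : (setT : set ST) z by [].
have s1 c : msmooth setT (fun _ : ST => Gm c) by exact: msmooth_cst.
have s2 c : smooth setT (fun z : ST => (z.1 *m E) 0 c) by exact: (zE_smooth 0 c).
have s3 c : msmooth setT (fun z : ST => (z.1 *m E) 0 c *: Gm c) by exact: msmoothZ.
have s4 : msmooth setT (fun z : ST => \sum_c (z.1 *m E) 0 c *: Gm c) by exact: msmooth_sum.
have s5 : msmooth setT (fun _ : ST => 1%:M : 'M[R]_n.+1) by exact: msmooth_cst.
have s6 : msmooth setT (fun _ : ST => E) by exact: msmooth_cst.
rewrite (dmxM _ s6 (msmoothB oT s5 s4) Tz) dmx_cst mul0mx add0r.
rewrite (dmxB _ oT s5 s4 Tz) dmx_cst sub0r mulmxN (dmx_sum _ _ s3 Tz).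
congr (- (_ *m _)); apply: eq_bigr => c _.
by rewrite (dmxZ _ (s2 c) (s1 c) Tz) -dmxE dzE dmx_cst scaler0 addr0.
Qed.

Let cJ a b c z : W z -> dmx (sdir a) Jn z b c = dmx (sdir b) Jn z a c.
Proof.
have K e f : dmx (sdir e) Jn z f c = - (\sum_d (row e E) 0 d *: (row f E *m Gm d)) 0 c.
  rewrite dJ /= -rowE oppmxE; congr (- _).
  rewrite mulmx_sumr !summxE; apply: eq_bigr => d _.
  by rewrite -scalemxAr !scalemxE -row_mul [row f _ _ _]mxE.
by move=> _; rewrite !K Gm_sym.
Qed.

Let z0 : ST := (0, t0).

Let phi0 : phi z0 = (x0, t0).
Proof.
rewrite /phi /ncoord /moved /= mul0mx big1 ?scaler0 ?subr0 ?addr0 //.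
by move=> c _; rewrite mul0mx scaler0.
Qed.

Let Jn0 : Jn z0 = E.
Proof.
rewrite /Jn /ncoord_jac /= mul0mx big1 ?subr0 ?mulmx1 // => c _.
by rewrite mxE scale0r.
Qed.

Let E_unit : E \in unitmx. Proof. exact: frame_unitmx orthoE. Qed.

Let Wz0 : W z0.
Proof. by split; rewrite ?phi0 // Jn0 -unitfE -unitmxE. Qed.

Let mG : metric_on W G.
Proof.
apply: (pullback_metric_on oW _ phi_smoothF sJ uJ mH).
by move=> z [].
Qed.

Let G1 : G z0 = 1%:M.
Proof. by rewrite /G /pullback_metric phi0 Jn0. Qed.

Let WU z : W z -> U' (phi z). Proof. by case. Qed.

Let Gam0 a : Gam sdir G a z0 = 0.
Proof.
have := Gam_law oW WU phi_smoothF phi_chain sJ uJ cJ mH a Wz0.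
have -> : dmx (sdir a) Jn z0 + Jn z0 *m pulled_Gam sdir phi Jn H a z0 = 0.
  rewrite dJ Jn0 /pulled_Gam phi0 Jn0 /= -rowE.
  rewrite addrC -mulmxBr (_ : _ - _ = 0) ?mulmx0 // -sumrB big1 // => c _.
  by rewrite [row _ _ _ _]mxE subrr.
rewrite Jn0 => /(congr1 (mulmx^~ (invmx E))).
by rewrite mulmxK // mul0mx.
Qed.

Let RicG z : W z -> Ric sdir G z = Jn z *m Ric sdir H (phi z) *m (Jn z)^T.
Proof. exact: (Ric_law oW WU phi_smoothF phi_chain sJ uJ cJ mH). Qed.

Let dtG z : W z -> dmx tdir G z = Jn z *m dmx tdir H (phi z) *m (Jn z)^T.
Proof.
move=> Wz; have [_ sH _ _] := mH; have sHp := phi_smoothF sH.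
rewrite (dmxM _ (msmoothM oW sJ sHp) (msmoothT oW sJ) Wz) (dmxM _ sJ sHp Wz) dmxT.
have -> : dmx tdir Jn z = 0.
  rewrite dJ /= big1 ?mulmx0 ?oppr0 // => c _; by rewrite mul0mx mxE scale0r.
by rewrite phi_chain_t // mul0mx trmx0 mulmx0 add0r addr0.
Qed.

Let flow_slice y : W (y, t0) -> dmx tdir G (y, t0) = (-2) *: Ric sdir G (y, t0).
Proof.
move=> Wy; rewrite dtG // RicG //; have [Uy _] := Wy.
by rewrite /phi /ncoord flowH // -scalemxAr -scalemxAl.
Qed.

Let flow0 : dmx tdir G z0 = (-2) *: Ric sdir G z0. Proof. exact: flow_slice. Qed.

(** [H] is known to satisfy the flow equation on the slice at t0 only, but spatial derivatives see
    nothing else ([dmx_slice_ext]). *)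
Let flow2 a b : dmx (sdir a) (dmx (sdir b) (dmx tdir G)) z0 =
  (-2) *: dmx (sdir a) (dmx (sdir b) (Ric sdir G)) z0.
Proof.
have sR := Ric_msmooth sdir mG.
have s2 : smooth W (fun _ : ST => -2 : R) by exact: smooth_cst oW.
have Z (F : ST -> 'M[R]_n.+1) v y : msmooth W F -> W y ->
    dmx v (fun z => (-2) *: F z) y = (-2) *: dmx v F y.
  by move=> sF Wy; rewrite (dmxZ _ s2 sF Wy) (_ : 'D_v _ y = 0) ?scale0r ?add0r //; exact: derive_cst.
rewrite -(Z _ _ _ (msmooth_dmx _ sR) Wz0); apply: (dmx_slice_ext _ oW _ Wz0) => y Wy.
rewrite -(Z _ _ _ sR Wy); exact: (dmx_slice_ext _ oW flow_slice Wy).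
Qed.

Variable r : 'I_n.+1 -> R.
Hypothesis ricE : forall b d, (E *m Ric sdir H (x0, t0) *m E^T) b d = r b *+ (b == d).

Let Sr b d : Ric sdir G z0 b d = r b *+ (b == d).
Proof. by rewrite RicG // phi0 Jn0 ricE. Qed.

(** For an orthonormal frame, the sectional curvature of the plane of the frame vectors [a] and
    [b]. *)
Definition frame_curv (a b : 'I_n.+1) : R :=
  \sum_c \sum_d (E a c * E b d) * (E *m (Rc sdir H c d (x0, t0) *m H (x0, t0)) *m E^T) b a.

Let RcG a b : Rc sdir G a b z0 b a = frame_curv a b.
Proof.
have := Rc_low_law oW WU phi_smoothF phi_chain sJ uJ cJ mH a b Wz0.
rewrite -/G G1 mulmx1 => ->; rewrite phi0 Jn0 -!mulmxA mulmx_suml mulmx_sumr summxE.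
apply: eq_bigr => c _; rewrite mulmx_suml mulmx_sumr summxE; apply: eq_bigr => d _.
by rewrite -scalemxAl -scalemxAr scalemxE !mulmxA.
Qed.

(** [plane_trace_step] in normal coordinates, together with what a comparison with Ricci eigenvalues
    at the displaced points requires: they stay in [U], and the coordinate plane does not degenerate
    there. *)
Lemma heat_step (i j : 'I_n.+1) (kappa e : R) : i != j ->
  kappa = (2 * n.+1%:R)^-1 -> 0 < e ->
  let T z := plane_trace (Jn z *m H (phi z) *m (Jn z)^T) (Jn z *m Ric sdir H (phi z) *m (Jn z)^T) i j in
  exists2 h0 : R, 0 < h0 & forall h : R, 0 < h -> h < h0 ->
    (forall a (s : bool), let z := ((-1) ^+ s * h *: xdir a, t0 - kappa * h ^+ 2) : ST in
      let g := Jn z *m H (phi z) *m (Jn z)^T in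
      U' (phi z) /\ g i i * g j j - g i j * g i j != 0) /\
    \sum_a (T (h *: xdir a, t0 - kappa * h ^+ 2) + T (- h *: xdir a, t0 - kappa * h ^+ 2))
    <= 2 * n.+1%:R * (r i + r j)
       - h ^+ 2 * (2 * \sum_a r a * (frame_curv a i + frame_curv a j) - e).
Proof.
move=> ij kE e0 T.
have sG : msmooth W G by have [] := mG.
pose D z := G z i i * G z j j - G z i j * G z i j.
have sD : smooth W D by apply: smoothB => //; exact: smoothM.
pose W' : set ST := [set z | W z /\ D z != 0].
have oW' : open W'.
  rewrite openE => z [Wz Dz].
  have N : nbhs z (fun y => D y != 0) by exact: cvgr_neq0 (smooth_continuous sD Wz) Dz.
  exact: filterS2 (near_open oW Wz) N.
have W'W : W' `<=` W by move=> z [].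
have mG' : metric_on W' G.
  have [_ _ sy un] := mG; split=> // [|z /W'W|z /W'W]; [exact: msmooth_sub sG|exact: sy|exact: un].
have Wz0' : W' z0.
  by split=> //; rewrite /D G1 !mxE !eqxx (negPf ij) mulr0 subr0 mulr1 oner_neq0.
have detW z : W' z -> G z i i * G z j j - G z i j * G z i j != 0 by case.
have [h1 h10 Hh1] := plane_trace_step mG' Wz0' G1 Gam0 flow0 flow2 Sr ij detW (ST_fbasis R n) kE e0.
have k0 : 0 < kappa by rewrite kE invr_gt0 mulr_gt0 // ltr0n.
have /nbhs_ballP[d /= d0 Hd] := near_open oW' Wz0'.
exists (Num.min h1 (Num.min 1 (Num.min (d / 2) (d / (2 * kappa))))).
  by rewrite !lt_min h10 ltr01 !divr_gt0 // mulr_gt0.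
move=> h hp; rewrite !lt_min => /and4P[hh1 h1' hd hk].
have zE a (s : bool) : ((-1) ^+ s * h *: xdir a, t0 - kappa * h ^+ 2) =
   z0 - (kappa * h ^+ 2) *: tdir + (-1) ^+ s * h *: sdir a :> ST.
  by apply/pair_equal_spec; split; rewrite /= ?scaler0 ?subr0 ?add0r ?addr0 // [_ *: 1]mulr1.
have WW a (s : bool) : W' ((-1) ^+ s * h *: xdir a, t0 - kappa * h ^+ 2).
  apply: Hd; rewrite -ball_normE /= prod_normE /= sub0r normrN gt_max.
  have -> : t0 - (t0 - kappa * h ^+ 2) = kappa * h ^+ 2 by ring.
  apply/andP; split.
    rewrite normrZ normrM normrX normrN1 expr1n mul1r gtr0_norm //.
    apply: le_lt_trans (_ : h < d); last by rewrite ltr_pdivlMr // in hd; lra.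
    rewrite ger_pMr //; apply: mx_norm_le => // k l.
    by rewrite mxE; case: (_ && _); rewrite /= ?normr1 ?normr0.
  rewrite ger0_norm; last by rewrite mulr_ge0 ?exprn_ge0 // ltW.
  rewrite ltr_pdivlMr in hk; last by rewrite mulr_gt0.
  by rewrite expr2; nra.
split.
  by move=> a s /=; have [[? _] ?] := WW a s; split.
have TE z : W z -> T z = plane_trace (G z) (Ric sdir G z) i j.
  by move=> Wz; rewrite RicG.
apply: le_trans (le_trans _ (Hh1 h hp hh1)) _.
  apply: le_of_eq; apply: eq_bigr => a _.
  have [W0 _] := WW a false; have [W1 _] := WW a true.
  have := zE a false; have := zE a true.
  rewrite /= expr0 expr1 mul1r mulN1r !scaleNr => E1 E0.
  rewrite -E0 -E1.
  move: W0 W1; rewrite /= expr0 expr1 mul1r mulN1r scaleNr => W0 W1.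
  by rewrite !TE.
have -> // : \sum_a r a * (Rc sdir G a i z0 i a + Rc sdir G a j z0 j a) =
  \sum_a r a * (frame_curv a i + frame_curv a j).
by apply: eq_bigr => a _; rewrite !RcG.
Qed.

End NormalCoordinates.

(** * Bilinear forms, compactness and the spectral theorem *)

Section Bilinear.
Variables (R : realType) (m : nat).
Implicit Types (K P : 'M[R]_m) (u v w : 'rV[R]_m).

Definition bil K u v : R := (u *m K *m v^T) 0 0.

Lemma bilDl K u v w : bil K (u + v) w = bil K u w + bil K v w.
Proof. by rewrite /bil !mulmxDl addmxE. Qed.
Lemma bilZl K c u v : bil K (c *: u) v = c * bil K u v.
Proof. by rewrite /bil -!scalemxAl scalemxE. Qed.
Lemma bilDr K u v w : bil K u (v + w) = bil K u v + bil K u w.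
Proof. by rewrite /bil trmxD mulmxDr addmxE. Qed.
Lemma bilZr K c u v : bil K u (c *: v) = c * bil K u v.
Proof. by rewrite /bil trmxZ -scalemxAr scalemxE. Qed.
Lemma bilNl K u v : bil K (- u) v = - bil K u v.
Proof. by rewrite -scaleN1r bilZl mulN1r. Qed.
Lemma bilNr K u v : bil K u (- v) = - bil K u v.
Proof. by rewrite -scaleN1r bilZr mulN1r. Qed.
Lemma bilC K u v : K^T = K -> bil K u v = bil K v u.
Proof.
move=> symK; rewrite /bil -[LHS]/((fun A : 'M[R]_1 => A 0 0) _) -[in LHS](trmxK (u *m K *m v^T)) trmxE.
by rewrite !trmx_mul trmxK symK mulmxA.
Qed.
Lemma bil_delta K i j : bil K (delta_mx 0 i) (delta_mx 0 j) = K i j.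
Proof. by rewrite /bil -rowE trmx_delta -colE !mxE. Qed.
Lemma frame_bil P K i j : (P *m K *m P^T) i j = bil K (row i P) (row j P).
Proof.
by rewrite -bil_delta /bil !rowE trmx_mul !mulmxA.
Qed.

Lemma bil_mul P K u v : bil K (u *m P) (v *m P) = bil (P *m K *m P^T) u v.
Proof. by rewrite /bil trmx_mul !mulmxA. Qed.

Lemma bilE K u v : bil K u v = \sum_i \sum_j u 0 i * K i j * v 0 j.
Proof.
rewrite /bil mxE exchange_big /=; apply: eq_bigr => j _.
by rewrite mxE mulr_suml trmxE; apply: eq_bigr.
Qed.

End Bilinear.

Lemma ultra_fmap (T U : Type) (f : T -> U) (F : set_system T) :
  UltraFilter F -> UltraFilter (fmap f F).
Proof.
move=> FU; split; first exact: fmap_proper_filter.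
move=> G GF sub; apply/seteqP; split => A //=; last exact: sub.
move=> GA; have [//|FA] := in_ultra_setVsetC (f @^-1` A) FU.
have /(filterI GA) : G (~` A) by apply: sub.
by rewrite setICr => /filter_not_empty.
Qed.

(** Along an ultrafilter every bounded entry converges, so the limit is assembled entry by entry;
    the later compactness arguments follow the same pattern. *)
Lemma mx_bounded_closed_compact (R : realType) p q (A : set 'M[R]_(p.+1, q.+1)) (M : R) :
  (forall x, A x -> forall i j, `|x i j| <= M) -> closed A -> compact A.
Proof.
move=> Abd Acl; rewrite compact_ultra => F FU FA.
have H (ij : 'I_p.+1 * 'I_q.+1) : exists l : R,
    (fun x : 'M[R]_(p.+1, q.+1) => x ij.1 ij.2) @ F --> l.
  have FAB : F (fun x : 'M[R]_(p.+1, q.+1) => `[- M, M]%classic (x ij.1 ij.2)).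
    apply: filterS FA => x /Abd /(_ ij.1 ij.2) /=.
    by rewrite in_itv /= ler_norml.
  have := @segment_compact R (- M) M; rewrite compact_ultra => /(_ _ (ultra_fmap (fun x : 'M[R]_(p.+1, q.+1) => x ij.1 ij.2) FU) FAB).
  by move=> [l [_ Fl]]; exists l.
have [l lP] := choice H.
pose L : 'M[R]_(p.+1, q.+1) := \matrix_(i, j) l (i, j).
have FL : F --> L.
  apply/cvgrPdist_le => e e0.
  have : F (fun x : 'M[R]_(p.+1, q.+1) => forall ij : 'I_p.+1 * 'I_q.+1, `|l ij - x ij.1 ij.2| <= e).
    by apply: filter_forall => ij; move/cvgrPdist_le: (lP ij); exact.
  apply: filterS => x Hx; apply: mx_norm_le; first exact: ltW.
  by move=> i j; have := Hx (i, j); rewrite !mxE.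
exists L; split=> //.
exact: (closed_cvg (u_ := id) A Acl FA L FL).
Qed.

Section ContinuousSums.
Variables (R : realType) (T : topologicalType).

Lemma sumf_continuous (I : Type) (r : seq I) (F : I -> T -> R) :
  (forall i, continuous (F i)) -> continuous (fun v => \sum_(i <- r) F i v).
Proof. by move=> cF v; apply: cvg_big => [|i _]; [exact: add_continuous|exact: cF]. Qed.

Lemma mulf_continuous (f g : T -> R) : continuous f -> continuous g ->
  continuous (fun v => f v * g v).
Proof. by move=> cf cg v; apply: cvgM; [exact: cf|exact: cg]. Qed.

Lemma sub_cst_continuous (f : T -> R) (a : R) : continuous f -> continuous (fun v => f v - a).
Proof. by move=> cf v; apply: cvgB; [exact: cf|exact: cvg_cst]. Qed.

End ContinuousSums.

Section Spectral.
Variables (R : realType) (m : nat).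
Local Notation N := m.+1.
Implicit Types (P S K : 'M[R]_N).

Let O_set : set 'M[R]_N := [set P | P *m P^T = 1%:M].

Lemma orthogonal_compact : compact O_set.
Proof.
apply: (@mx_bounded_closed_compact R m m O_set 1).
  move=> P PO a b.
  have : (P *m P^T) a a = 1 by rewrite PO mxE eqxx.
  rewrite mxE (bigD1 b) //= trmxE => E.
  have : P a b * P a b <= 1.
    rewrite -E lerDl; apply: sumr_ge0 => c _; rewrite trmxE -expr2; exact: sqr_ge0.
  by rewrite -expr2 -real_normK ?num_real // expr_le1.
pose h P (a b : 'I_N) := (\sum_c P a c * P b c) - (a == b)%:R.
pose g P := \sum_(a < N) \sum_(b < N) h P a b * h P a b.
have gE : O_set = g @^-1` [set x | x = 0].
  apply/seteqP; split => P /=.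
    move=> vo; rewrite /g big1 // => a _; rewrite big1 // => b _.
    have := congr1 (fun A : 'M[R]_N => A a b) vo; rewrite !mxE => E.
    rewrite /h (_ : \sum_c _ = (a == b)%:R) ?subrr ?mul0r // -E.
    by apply: eq_bigr => c _; rewrite trmxE.
  move=> g0; apply/matrixP => a b; rewrite !mxE.
  have H1 : \sum_(b < N) h P a b * h P a b = 0.
    apply/eqP; move/eqP: g0; rewrite /g psumr_eq0; last first.
      by move=> c _; apply: sumr_ge0 => d _; rewrite -expr2 sqr_ge0.
    by move/allP => /(_ a); rewrite mem_index_enum => /(_ isT).
  move/eqP: H1; rewrite psumr_eq0; last by move=> d _; rewrite -expr2 sqr_ge0.
  move/allP => /(_ b); rewrite mem_index_enum => /(_ isT) /=.
  rewrite mulf_eq0 orbb subr_eq0 => /eqP <-.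
  by apply: eq_bigr => c _; rewrite trmxE.
rewrite gE; apply: preimage_closed; last exact: closed_eq.
have C a b : continuous (fun P => h P a b).
  apply: sub_cst_continuous.
  by apply: sumf_continuous => c; apply: mulf_continuous; exact: coord_continuous.
have C2 : continuous g.
  by apply: sumf_continuous => a; apply: sumf_continuous => b; exact: mulf_continuous.
by move=> P _; exact: C2.
Qed.

Section Rotation.
Variables (i j : 'I_N) (c s : R).
Hypothesis ij : i != j.
Hypothesis cs : c ^+ 2 + s ^+ 2 = 1.

Definition rot_row (a : 'I_N) : 'rV[R]_N :=
  if a == i then c *: delta_mx 0 i + s *: delta_mx 0 j
  else if a == j then (- s) *: delta_mx 0 i + c *: delta_mx 0 j else delta_mx 0 a.

Definition rotation : 'M[R]_N := \matrix_a rot_row a.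

Lemma rotation_bil K a b : (rotation *m K *m rotation^T) a b = bil K (rot_row a) (rot_row b).
Proof. by rewrite frame_bil !rowK. Qed.

Let ji : (j == i) = false. Proof. by rewrite eq_sym; exact: negPf. Qed.

Let bilr := (bilDl, bilDr, bilZl, bilZr, bil_delta).

Lemma rotation_orthogonal : rotation *m rotation^T = 1%:M.
Proof.
have -> : rotation *m rotation^T = rotation *m 1%:M *m rotation^T by rewrite mulmx1.
apply/matrixP => a b; rewrite rotation_bil /rot_row !mxE.
have ijF := negPf ij.
case: (eqVneq a i) => [ai|ai]; case: (eqVneq b i) => [bi|bi];
  case: (eqVneq a j) => [aj|aj]; case: (eqVneq b j) => [bj|bj];
  try (exfalso; move/eqP: ij; apply; congruence);
  rewrite ?bilr ?mxE ?ai ?bi ?aj ?bj ?eqxx ?ijF ?ji ?(eq_sym i a) ?(eq_sym i b) ?(eq_sym j a) ?(eq_sym j b)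
    ?(negPf ai) ?(negPf bi) ?(negPf aj) ?(negPf bj) /= ?mulr1n ?mulr0n ?(mulr0, mulr1, addr0, add0r); try by [move: cs; rewrite !expr2; lra|ring].
Qed.

Lemma rotation_diag K : K^T = K ->
  [/\ (rotation *m K *m rotation^T) i i = c ^+ 2 * K i i + 2 * c * s * K i j + s ^+ 2 * K j j,
      (rotation *m K *m rotation^T) j j = s ^+ 2 * K i i - 2 * c * s * K i j + c ^+ 2 * K j j &
      forall a, a != i -> a != j -> (rotation *m K *m rotation^T) a a = K a a].
Proof.
move=> symK; have sK : K j i = K i j by rewrite -[in LHS]symK trmxE.
split=> [||a ai aj]; rewrite rotation_bil /rot_row ?eqxx ?ji ?(negPf ai) ?(negPf aj) ?bilr //.
  by rewrite sK; ring.
by rewrite sK; ring.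
Qed.

End Rotation.

(** [P] minimizes, over the orthogonal group, the trace with strictly decreasing weights. Rotations
    in a coordinate plane cannot lower it further; as the weights are distinct, this forces the
    off-diagonal entries to vanish and the diagonal to be sorted. *)
Lemma spectral_orthogonal S : S^T = S -> exists P (r : 'I_N -> R),
  [/\ P *m P^T = 1%:M, forall a b, (P *m S *m P^T) a b = r a *+ (a == b) &
      forall a b : 'I_N, (a <= b)%N -> r a <= r b].
Proof.
move=> symS.
pose w (a : 'I_N) : R := (N - a)%:R.
pose f (P : 'M[R]_N) := \sum_a w a * (P *m S *m P^T) a a.
have cf : continuous f.
  apply: sumf_continuous => a; apply: mulf_continuous; first exact: cst_continuous.
  have -> : (fun P : 'M[R]_N => (P *m S *m P^T) a a) =
     fun P => \sum_b (\sum_c P a c * S c b) * P a b.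
    by apply/funext => P; rewrite mxE; apply: eq_bigr => b _; rewrite mxE trmxE.
  apply: sumf_continuous => b; apply: mulf_continuous; last exact: coord_continuous.
  apply: sumf_continuous => d; apply: mulf_continuous; first exact: coord_continuous.
  exact: cst_continuous.
have O0 : O_set !=set0 by exists 1%:M; rewrite /O_set /= mul1mx trmx1.
have [P + vmin] := compact_EVT_min O0 orthogonal_compact (continuous_subspaceT cf).
rewrite inE /O_set /= => vo.
set B := P *m S *m P^T.
have symB : B^T = B by rewrite /B !trmx_mul trmxK symS mulmxA.
have key i j c s : i != j -> c ^+ 2 + s ^+ 2 = 1 ->
    0 <= (w i - w j) * (2 * c * s * B i j + s ^+ 2 * (B j j - B i i)).
  move=> ij cs; pose Q := rotation i j c s.
  have QO : (Q *m P) *m (Q *m P)^T = 1%:M.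
    by rewrite trmx_mul mulmxA -(mulmxA Q P) vo mulmx1 rotation_orthogonal.
  have := vmin (Q *m P); rewrite inE /O_set /= => /(_ QO).
  rewrite /f -/B.
  have -> : (Q *m P) *m S *m (Q *m P)^T = Q *m B *m Q^T.
    by rewrite trmx_mul /B !mulmxA.
  have [E1 E2 E3] := rotation_diag c s ij symB.
  rewrite (bigD1 i) //= (bigD1 j) 1?eq_sym //= [in leRHS](bigD1 i) //= [in leRHS](bigD1 j) 1?eq_sym //=.
  rewrite -/Q E1 E2.
  have -> : \sum_(k | (k != i) && (k != j)) w k * (Q *m B *m Q^T) k k =
      \sum_(k | (k != i) && (k != j)) w k * B k k.
    by apply: eq_bigr => k /andP[ki kj]; rewrite E3.
  rewrite -subr_ge0; have -> : c ^+ 2 = 1 - s ^+ 2 by lra.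
  by move/le_trans; apply; apply: le_of_eq; ring.
have wlt (i j : 'I_N) : (i < j)%N -> 0 < w i - w j.
  by move=> lij; rewrite subr_gt0 /w ltr_nat; have := ltn_ord i; have := ltn_ord j; lia.
have sorted (i j : 'I_N) : (i < j)%N -> B i i <= B j j.
  move=> lij; have ij : i != j by rewrite -val_eqE /= neq_ltn lij.
  (* A quarter turn exchanges the two diagonal entries. *)
  have := key i j 0 1 ij; rewrite expr0n expr1n add0r => /(_ erefl).
  by rewrite pmulr_rge0 ?wlt // mulr0 !mul0r add0r mul1r subr_ge0.
have off (i j : 'I_N) : (i < j)%N -> B i j = 0.
  move=> lij; have ij : i != j by rewrite -val_eqE /= neq_ltn lij.
  have d0 := sorted i j lij.
  have K c s : c ^+ 2 + s ^+ 2 = 1 -> 0 <= 2 * c * s * B i j + s ^+ 2 * (B j j - B i i).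
    by move=> cs; have := key i j c s ij cs; rewrite pmulr_rge0 ?wlt.
  set d := B j j - B i i in K; have d0' : 0 <= d by rewrite subr_ge0.
  apply/eqP; apply/negPn/negP => Bn.
  have b0 : 0 < `|B i j| by rewrite normr_gt0.
  set b := `|B i j| in b0.
  (* The tangent of half the rotation angle, which makes cosine and sine rational. Since u <= 1/2
     and u d <= b/2, the first order gain from a nonzero entry beats the quadratic loss. *)
  pose u := b / (2 * (b + d)).
  have bd : 0 < b + d by rewrite ltr_wpDr.
  have u0 : 0 < u by rewrite divr_gt0 // mulr_gt0.
  have u1 : u * (2 * (b + d)) = b by rewrite /u divfK // gt_eqF // mulr_gt0.
  have q0 : 0 < 1 + u ^+ 2 by rewrite ltr_pwDl // sqr_ge0.
  have cs1 : ((1 - u ^+ 2) / (1 + u ^+ 2)) ^+ 2 + (2 * u / (1 + u ^+ 2)) ^+ 2 = 1.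
    by field; rewrite gt_eqF.
  have cs2 : ((1 - u ^+ 2) / (1 + u ^+ 2)) ^+ 2 + (- (2 * u / (1 + u ^+ 2))) ^+ 2 = 1.
    by field; rewrite gt_eqF.
  have H : 0 <= - (2 * ((1 - u ^+ 2) / (1 + u ^+ 2)) * (2 * u / (1 + u ^+ 2))) * b
      + (2 * u / (1 + u ^+ 2)) ^+ 2 * d.
    have [Bp|Bm] := lerP 0 (B i j).
      by have := K _ _ cs2; rewrite /b ger0_norm // sqrrN mulrN.
    by have := K _ _ cs1; rewrite /b ltr0_norm // mulrNN.
  have H2 : 0 <= - (1 - u ^+ 2) * b + u * d.
    have : 0 <= (4 * u / (1 + u ^+ 2) ^+ 2) * (- (1 - u ^+ 2) * b + u * d).
      apply: le_trans H _; apply: le_of_eq; field; by rewrite gt_eqF.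
    have q4 : 0 < 4 * u / (1 + u ^+ 2) ^+ 2 by apply: divr_gt0; [exact: mulr_gt0|exact: exprn_gt0].
    by rewrite (pmulr_rge0 _ q4).
  have : u * d <= b / 2 by nra.
  nra.
exists P, (fun a => B a a); split=> // [a b|a b].
  case: (ltngtP a b) => [ab|ba|/val_inj ->]; last by rewrite eqxx mulr1n.
    by rewrite (off a b ab) -val_eqE /= (ltn_eqF ab) mulr0n.
  rewrite -/B (_ : B a b = B b a); last by rewrite -[in LHS]symB trmxE.
  by rewrite (off b a ba) -val_eqE /= (gtn_eqF ba) mulr0n.
rewrite leq_eqVlt => /orP[/eqP/val_inj -> //|]; exact: sorted.
Qed.

Definition posdef K : Prop := forall u : 'rV[R]_N, u != 0 -> 0 < bil K u u.

(** An eigenbasis of [K], rescaled to be [K]-orthonormal, reduces to [spectral_orthogonal]. *)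
Lemma spectral_sorted K S : K^T = K -> posdef K -> S^T = S -> exists E (r : 'I_N -> R),
  [/\ E *m K *m E^T = 1%:M, forall a b, (E *m S *m E^T) a b = r a *+ (a == b) &
      forall a b : 'I_N, (a <= b)%N -> r a <= r b].
Proof.
move=> symK pK symS.
have [P [k [PO PK _]]] := spectral_orthogonal symK.
have kpos a : 0 < k a.
  have : (P *m K *m P^T) a a = k a by rewrite PK eqxx.
  rewrite frame_bil => <-; apply: pK; apply/eqP => r0.
  have : (P *m 1%:M *m P^T) a a = 1 by rewrite mulmx1 PO mxE eqxx.
  by rewrite frame_bil r0 /bil !mul0mx mxE => /eqP; rewrite eq_sym oner_eq0.
pose D : 'M[R]_N := diag_mx (\row_a (Num.sqrt (k a))^-1).
pose F := D *m P.
have FF : F *m K *m F^T = 1%:M.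
  rewrite /F trmx_mul !mulmxA -(mulmxA D) -(mulmxA D).
  have -> : P *m K *m P^T = diag_mx (\row_a k a).
    by apply/matrixP => a b; rewrite PK !mxE.
  rewrite tr_diag_mx !mulmx_diag -diag_const_mx; congr diag_mx; apply/rowP => a; rewrite !mxE.
  rewrite mulrAC -invfM -expr2 sqr_sqrtr ?mulVf ?gt_eqF //; exact: ltW.
clearbody F; have symS' : (F *m S *m F^T)^T = F *m S *m F^T by rewrite !trmx_mul trmxK symS !mulmxA.
have [Q [r [QO QS rs]]] := spectral_orthogonal symS'.
exists (Q *m F), r; split=> // [|a b].
  by rewrite trmx_mul !mulmxA -(mulmxA Q) -(mulmxA Q) FF mulmx1.
by rewrite -QS trmx_mul !mulmxA.
Qed.

End Spectral.

Section KyFan.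
Variables (R : realType) (m : nat).
Local Notation N := m.+2.

(** In the eigenbasis the right-hand side is a combination of the eigenvalues with weights x_k^2 +
    y_k^2, which sum to 2 and are at most 1 by Bessel's inequality. *)
Lemma ky_fan (K S E : 'M[R]_N) (r : 'I_N -> R) (u v : 'rV[R]_N) :
  E *m K *m E^T = 1%:M -> (forall a b, (E *m S *m E^T) a b = r a *+ (a == b)) ->
  (forall a b : 'I_N, (a <= b)%N -> r a <= r b) ->
  bil K u u = 1 -> bil K v v = 1 -> bil K u v = 0 ->
  r ord0 + r (lift ord0 ord0) <= bil S u u + bil S v v.
Proof.
move=> EO ES rs.
have Eu := frame_unitmx EO.
rewrite -[u](mulmxKV Eu) -[v](mulmxKV Eu).
move: (u *m invmx E) (v *m invmx E) => x y {u v}.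
rewrite !bil_mul EO.
have b1 (p q : 'rV[R]_N) : bil 1%:M p q = \sum_k p 0 k * q 0 k.
  by rewrite /bil mulmx1 mxE; apply: eq_bigr => k _; rewrite trmxE.
have bS (p : 'rV[R]_N) : bil (E *m S *m E^T) p p = \sum_k r k * p 0 k ^+ 2.
  rewrite bilE; apply: eq_bigr => a _; rewrite (bigD1 a) //= ES eqxx mulr1n big1 ?addr0.
    by rewrite expr2; ring.
  by move=> b ba; rewrite ES eq_sym (negPf ba) mulr0n mulr0 mul0r.
move=> x1 y1 xy; rewrite !bS -big_split /=.
pose p k := x 0 k ^+ 2 + y 0 k ^+ 2.
have p0 k : 0 <= p k by rewrite addr_ge0 ?sqr_ge0.
have psum : \sum_k p k = 2.
  by rewrite big_split /= -(eq_bigr _ (fun k _ => expr2 (x 0 k))) -(eq_bigr _ (fun k _ => expr2 (y 0 k))) -!b1 x1 y1.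
have p1 k : p k <= 1.
  (* The part of the k-th basis vector orthogonal to [x] and [y]; its squared norm is 1 - p k. *)
  pose d : 'rV[R]_N := delta_mx 0 k - x 0 k *: x - y 0 k *: y.
  have : 0 <= bil 1%:M d d by rewrite b1 sumr_ge0 // => l _; rewrite -expr2 sqr_ge0.
  have bd (q : 'rV[R]_N) : bil 1%:M (delta_mx 0 k) q = q 0 k.
    rewrite b1 (bigD1 k) //= mxE !eqxx mul1r big1 ?addr0 // => l lk.
    by rewrite mxE (negPf lk) mul0r.
  have bC (q q' : 'rV[R]_N) : bil 1%:M q q' = bil 1%:M q' q by apply: bilC; exact: trmx1.
  rewrite /d !(bilDl, bilDr, bilNl, bilNr, bilZl, bilZr) !bd !(bC _ (delta_mx 0 k)) !bd.
  rewrite (bC y x) x1 y1 xy mxE !eqxx /p !expr2 /=; lra.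
pose i1 : 'I_N := lift ord0 ord0.
have -> : \sum_k (r k * x 0 k ^+ 2 + r k * y 0 k ^+ 2) = \sum_k (r k - r i1) * p k + r i1 * 2.
  by rewrite -psum mulr_sumr -big_split; apply: eq_bigr => k _ /=; rewrite /p; ring.
rewrite (bigD1 ord0) //=.
have : 0 <= \sum_(k | k != ord0) (r k - r i1) * p k.
  apply: sumr_ge0 => k k0; apply: mulr_ge0 => //; rewrite subr_ge0; apply: rs.
  by rewrite /= /bump /= lt0n.
have r01 : r ord0 <= r i1 by apply: rs.
have := p1 ord0; have := p0 ord0; rewrite -/i1; nra.
Qed.

End KyFan.

(** * Eigenvalues, and the algebra of curvature in dimension 4 *)

Section Eigenvalues.
Variables (R : realType) (m : nat).
Implicit Types (S P E : 'M[R]_m).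

Lemma char_poly_conj S P : P *m P^T = 1%:M -> char_poly (P *m S *m P^T) = char_poly S.
Proof.
move=> PO; have PO' : P^T *m P = 1%:M by exact: mulmx1C.
rewrite /char_poly /char_poly_mx.
have -> : 'X%:M - map_mx polyC (P *m S *m P^T) =
    map_mx polyC P *m ('X%:M - map_mx polyC S) *m map_mx polyC P^T.
  rewrite mulmxBr mulmxBl !map_mxM; congr (_ - _).
  by rewrite scalar_mxC -mulmxA -map_mxM PO map_mx1 mulmx1.
rewrite !det_mulmx mulrAC -det_mulmx -map_mxM PO map_mx1 det1 mul1r //.
Qed.

Lemma trace_conj S P : P *m P^T = 1%:M -> \tr (P *m S *m P^T) = \tr S.
Proof. by move=> PO; rewrite mxtrace_mulC mulmxA (mulmx1C PO) mul1mx. Qed.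

Lemma frobenius S : S^T = S -> \sum_i \sum_j S i j ^+ 2 = \tr (S *m S).
Proof.
move=> symS; apply: eq_bigr => i _; rewrite mxE; apply: eq_bigr => j _.
by rewrite -[in S j i]symS trmxE expr2.
Qed.

Lemma frobenius_diag S P (r : 'I_m -> R) : S^T = S -> P *m P^T = 1%:M ->
  (forall a b, (P *m S *m P^T) a b = r a *+ (a == b)) ->
  \sum_i \sum_j S i j ^+ 2 = \sum_i r i ^+ 2.
Proof.
move=> symS PO SE; rewrite frobenius // -(trace_conj _ PO).
have -> : P *m (S *m S) *m P^T = (P *m S *m P^T) *m (P *m S *m P^T).
  by rewrite !mulmxA -(mulmxA _ P^T P) (mulmx1C PO) mulmx1.
apply: eq_bigr => i _; rewrite mxE (bigD1 i) //= !SE eqxx !mulr1n big1 ?addr0 ?expr2 //.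
by move=> j ji; rewrite SE eq_sym (negPf ji) mulr0n mul0r.
Qed.

(** [eigenvalues] sorts a chosen list of roots; by unique factorization two such lists are
    permutations of each other, so the choice does not matter. *)
Lemma eigenvalues_diag S P (r : 'I_m -> R) : P *m P^T = 1%:M ->
  (forall a b, (P *m S *m P^T) a b = r a *+ (a == b)) ->
  (forall a b : 'I_m, (a <= b)%N -> r a <= r b) ->
  eigenvalues S = [seq r a | a <- enum 'I_m].
Proof.
move=> PO SE rs.
have cS : char_poly S = \prod_(a <- [seq r a | a <- enum 'I_m]) ('X - a%:P).
  rewrite -(char_poly_conj S PO) char_poly_trig; last first.
    by apply/is_trig_mxP => i j ij; rewrite SE -val_eqE /= (ltn_eqF ij).
  by rewrite big_map big_enum /=; apply: eq_bigr => i _; rewrite SE eqxx.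
have := xgetPex [::] (ex_intro (fun s : seq R => char_poly S = \prod_(a <- s) ('X - a%:P)) _ cS).
rewrite /eigenvalues; set s := xget _ _ => /= cs.
have /perm_sort_leP -> : perm_eq s [seq r a | a <- enum 'I_m].
  by apply: prod_XsubC_eq; rewrite -cs.
apply: sort_le_id; rewrite sorted_map.
have : sorted (relpre val leq) (enum 'I_m).
  by rewrite -sorted_map val_enum_ord iota_sorted.
by apply: sub_sorted => a b; exact: rs.
Qed.

End Eigenvalues.

Lemma sum_two_smallest_diag (R : realType) m (S P : 'M[R]_m.+2) (r : 'I_m.+2 -> R) :
  P *m P^T = 1%:M ->
  (forall a b, (P *m S *m P^T) a b = r a *+ (a == b)) ->
  (forall a b : 'I_m.+2, (a <= b)%N -> r a <= r b) ->
  sum_two_smallest S = r ord0 + r (lift ord0 ord0).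
Proof.
move=> PO SE rs; rewrite /sum_two_smallest (eigenvalues_diag PO SE rs).
rewrite !enum_ordSl /=; congr (r _ + r _); exact/val_inj.
Qed.

Lemma sum_two_smallest_le (R : realType) m (S : 'M[R]_m.+2) i j : S^T = S -> i != j ->
  sum_two_smallest S <= S i i + S j j.
Proof.
move=> symS ij; have [P [r [PO SE rs]]] := spectral_orthogonal symS.
rewrite (sum_two_smallest_diag PO SE rs) -!bil_delta.
apply: (@ky_fan _ _ 1%:M S P r) => //; first by rewrite mulmx1.
- by rewrite bil_delta mxE eqxx.
- by rewrite bil_delta mxE eqxx.
- by rewrite bil_delta mxE (negPf ij).
Qed.

Section FrameTensor.
Variables (R : realType) (m : nat) (T : 'I_m -> 'I_m -> 'I_m -> 'I_m -> R).
Variable E : 'M[R]_m.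

Definition frame_tensor i j k l := \sum_a \sum_b \sum_c \sum_d
  E i a * E j b * E k c * E l d * T a b c d.

Hypothesis anti12 : forall a b c d, T b a c d = - T a b c d.
Hypothesis anti34 : forall a b c d, T a b d c = - T a b c d.
Hypothesis cyclic : forall a b c d, T a b c d + T b c a d + T c a b d = 0.

(** The classical combination of the four cyclic identities that keep one index fixed in turn, with
    the antisymmetries. *)
Lemma tensor_pair a b c d : T c d a b = T a b c d.
Proof.
have := cyclic a b c d; have := cyclic b c d a; have := cyclic c d a b; have := cyclic d a b c.
have := (anti12 a b c d, anti12 b c a d, anti12 c a b d, anti12 c d a b, anti12 d b c a, anti12 d a b c, anti12 a c d b).
have := (anti34 a b c d, anti34 b c a d, anti34 c a b d, anti34 c d a b, anti34 d b c a, anti34 d a b c, anti34 a c d b,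
 anti34 b d a c, anti34 d b a c, anti34 c a d b, anti34 a d b c, anti34 b c d a).
have := (anti12 b c d a, anti12 a d b c, anti12 a d c b, anti12 b d c a, anti12 b d a c, anti12 c a d b).
by move=> [[[[[? ?] ?] ?] ?] ?] [[[[[[[[[[[? ?] ?] ?] ?] ?] ?] ?] ?] ?] ?] ?] [[[[[[? ?] ?] ?] ?] ?] ?]; lra.
Qed.

Lemma frame_tensor_anti12 i j k l : frame_tensor j i k l = - frame_tensor i j k l.
Proof.
rewrite /frame_tensor exchange_big -sumrN; apply: eq_bigr => a _ /=.
rewrite -sumrN; apply: eq_bigr => b _; rewrite -sumrN; apply: eq_bigr => c _.
by rewrite -sumrN; apply: eq_bigr => d _; rewrite anti12; ring.
Qed.

Lemma frame_tensor_anti34 i j k l : frame_tensor i j l k = - frame_tensor i j k l.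
Proof.
rewrite /frame_tensor -sumrN; apply: eq_bigr => a _ /=.
rewrite -sumrN; apply: eq_bigr => b _; rewrite exchange_big -sumrN; apply: eq_bigr => c _ /=.
by rewrite -sumrN; apply: eq_bigr => d _; rewrite anti34; ring.
Qed.

Lemma frame_tensor_pair i j k l : frame_tensor k l i j = frame_tensor i j k l.
Proof.
rewrite /frame_tensor.
under eq_bigr do rewrite exchange_big.
rewrite exchange_big.
under eq_bigr do under eq_bigr do rewrite exchange_big.
under eq_bigr do rewrite exchange_big.
apply: eq_bigr => a _; apply: eq_bigr => b _ /=.
apply: eq_bigr => c _ /=.
apply: eq_bigr => d _; rewrite (tensor_pair a b c d); ring.
Qed.

Lemma frame_tensor_cyclic i j k l :
  frame_tensor i j k l + frame_tensor j k i l + frame_tensor k i j l = 0.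
Proof.
have C1 : frame_tensor j k i l = \sum_a \sum_b \sum_c \sum_d
    E i a * E j b * E k c * E l d * T b c a d.
  rewrite /frame_tensor; under eq_bigr do rewrite exchange_big; rewrite exchange_big /=.
  apply: eq_bigr => a _; apply: eq_bigr => b _; apply: eq_bigr => c _; apply: eq_bigr => d _; ring.
have C2 : frame_tensor k i j l = \sum_a \sum_b \sum_c \sum_d
    E i a * E j b * E k c * E l d * T c a b d.
  rewrite /frame_tensor exchange_big /=; under eq_bigr do rewrite exchange_big /=.
  apply: eq_bigr => a _; apply: eq_bigr => b _; apply: eq_bigr => c _; apply: eq_bigr => d _; ring.
rewrite C1 C2 /frame_tensor -!big_split big1 // => a _; rewrite -!big_split big1 // => b _.
rewrite -!big_split big1 // => c _; rewrite -!big_split big1 // => d _ /=.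
by rewrite -!mulrDr cyclic mulr0.
Qed.

Lemma frame_tensor_trace j l : \sum_a frame_tensor a j a l =
  \sum_b \sum_d E j b * (\sum_a \sum_c (E^T *m E) a c * T a b c d) * E l d.
Proof.
symmetry; transitivity (\sum_b \sum_d \sum_a0 \sum_a \sum_c
  E a0 a * E j b * E a0 c * E l d * T a b c d).
  apply: eq_bigr => b _; apply: eq_bigr => d _.
  rewrite mulr_sumr mulr_suml exchange_big /=; apply: eq_bigr => a _.
  rewrite mulr_sumr mulr_suml exchange_big /=; apply: eq_bigr => c _.
  rewrite mxE mulr_suml mulr_sumr mulr_suml; apply: eq_bigr => a0 _.
  by rewrite trmxE; ring.
under eq_bigr do rewrite exchange_big; rewrite exchange_big; apply: eq_bigr => a0 _ /=.
under eq_bigr do rewrite exchange_big; rewrite exchange_big; apply: eq_bigr => a _ /=.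
apply: eq_bigr => b _; rewrite exchange_big; by apply: eq_bigr.
Qed.

End FrameTensor.

Lemma cyclic_sign (R : realType) (p q r : R) : p + q + r = 0 -> - p - q - r = 0.
Proof. lra. Qed.

Section Curvature4.
Variables (R : realType) (U : set 'rV[R]_4) (G : 'rV[R]_4 -> 'M[R]_4) (x : 'rV[R]_4).
Hypothesis mG : metric_on U G.
Hypothesis Ux : U x.
Variable E : 'M[R]_4.
Hypothesis orthoE : orthonormal_frame G x E.

Let T a b c d := riem G a b c d x.
Let Rf := riem_frame G x E.

Let anti12 a b c d : T b a c d = - T a b c d.
Proof. by rewrite /T !(riemE mG) // Rc_antiC mulNmx oppmxE. Qed.
Let anti34 a b c d : T a b d c = - T a b c d.
Proof.
rewrite /T !(riemE mG) // -oppmxE -(Rc_low_anti _ mG) // trmxE //.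
Qed.
Let cyclic a b c d : T a b c d + T b c a d + T c a b d = 0.
Proof.
have cyc i j k l : T i j l k + T j k l i + T k i l j = 0.
  rewrite /T !(riemE mG) //.
  have := first_bianchi (@xdir R 3) mG i j k Ux.
  move/(congr1 (fun v => (v *m G x) 0 l)).
  by rewrite !mulmxDl mul0mx !addmxE zeromxE -!row_mul ![row _ _ _ _]mxE.
have := cyc a b c d; rewrite !(anti34 _ _ d).
exact: cyclic_sign.
Qed.

Lemma riem_frame_symmetries :
  [/\ forall i j k l, Rf j i k l = - Rf i j k l, forall i j k l, Rf i j l k = - Rf i j k l,
      forall i j k l, Rf k l i j = Rf i j k l &
      forall i j k l, Rf i j k l + Rf j k i l + Rf k i j l = 0].
Proof.
split=> i j k l.
- exact (frame_tensor_anti12 E anti12 i j k l).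
- exact (frame_tensor_anti34 E anti34 i j k l).
- exact (frame_tensor_pair E anti12 anti34 cyclic i j k l).
- exact (frame_tensor_cyclic E cyclic i j k l).
Qed.

Let invG : invmx (G x) = E^T *m E.
Proof.
have [_ _ _ uG] := mG; have uGx := uG x Ux.
have := mulmx1C orthoE; rewrite mulmxA => /(canRL (mulmxK uGx)).
by rewrite mul1mx.
Qed.

Lemma ricci_frameE b d : ricci_frame G x E b d = \sum_a Rf a b a d.
Proof.
rewrite /Rf -[RHS]/(\sum_a frame_tensor T E a b a d) frame_tensor_trace /ricci_frame frame_bil bilE.
apply: eq_bigr => b0 _; apply: eq_bigr => d0 _; by rewrite !mxE invG.
Qed.

Lemma scal_frame : scal G x = \tr (ricci_frame G x E).
Proof.
have symI : (invmx (G x))^T = invmx (G x) by rewrite invG trmx_mul trmxK.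
rewrite /ricci_frame mxtrace_mulC mulmxA -invG /scal /mxtrace.
rewrite exchange_big; apply: eq_bigr => b _; rewrite mxE; apply: eq_bigr => d _.
by rewrite -[in LHS]symI trmxE.
Qed.

Lemma ricci_frame_sym : (ricci_frame G x E)^T = ricci_frame G x E.
Proof.
have [_ _ pair _] := riem_frame_symmetries.
by apply/matrixP => b d; rewrite trmxE !ricci_frameE; apply: eq_bigr => a _; exact: pair.
Qed.

Lemma curv_op_sym : (curv_op G x E)^T = curv_op G x E.
Proof.
have [_ _ pair _] := riem_frame_symmetries.
by apply/matrixP => k l; rewrite !mxE; exact: pair.
Qed.

End Curvature4.

Section DualBlocks.
Variables (R : realType) (P : 'M[R]_(3 + 3)).
Hypothesis symP : P^T = P.

Let sq2 : (Num.sqrt 2)^-1 * (Num.sqrt 2)^-1 = 2^-1 :> R.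
Proof. by rewrite -invfM -expr2 sqr_sqrtr. Qed.

Let blk (e : R) (B : 'M[R]_(3, 3 + 3)) : B = (Num.sqrt 2)^-1 *: row_mx 1%:M (e *: 1%:M) ->
  B *m P *m B^T = 2^-1 *: (ulsubmx P + e *: ursubmx P + e *: dlsubmx P + e ^+ 2 *: drsubmx P).
Proof.
move=> ->; rewrite -[in LHS](submxK P) trmxZ -scalemxAr -!scalemxAl scalerA sq2; congr (_ *: _).
rewrite tr_row_mx trmxZ trmx1 mul_row_block mul_row_col !mul1mx mulmx1 -!scalemxAl !mul1mx.
by rewrite -scalemxAr mulmx1 scalerDr scalerA expr2 !addrA (addrAC (ulsubmx P)).
Qed.

Lemma sd_block : sd_basis R *m P *m (sd_basis R)^T =
  2^-1 *: (ulsubmx P + ursubmx P + dlsubmx P + drsubmx P).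
Proof. by rewrite (@blk 1) ?expr1n ?scale1r. Qed.

Lemma asd_block : asd_basis R *m P *m (asd_basis R)^T =
  2^-1 *: (ulsubmx P - ursubmx P - dlsubmx P + drsubmx P).
Proof. by rewrite (@blk (-1)) ?sqrrN ?expr1n ?scaleN1r ?scale1r. Qed.

Lemma sd_block_sym : (sd_basis R *m P *m (sd_basis R)^T)^T = sd_basis R *m P *m (sd_basis R)^T.
Proof. by rewrite !trmx_mul trmxK symP mulmxA. Qed.

Lemma asd_block_sym : (asd_basis R *m P *m (asd_basis R)^T)^T = asd_basis R *m P *m (asd_basis R)^T.
Proof. by rewrite !trmx_mul trmxK symP mulmxA. Qed.

End DualBlocks.

Section Flip.
Variables (R : realType) (E : 'M[R]_4).

(** Negating the first vector reverses the orientation of a frame. The curvature conditions speak of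
    positively oriented frames; sectional curvatures and the curvature norm do not see the sign. *)
Definition flip_sign (i : 'I_4) : R := (-1) ^+ (i == 0).
Definition flip : 'M[R]_4 := diag_mx (\row_i flip_sign i) *m E.

Lemma flipE i j : flip i j = flip_sign i * E i j.
Proof. by rewrite /flip mul_diag_mx !mxE. Qed.

Lemma flip_sign_sq i : flip_sign i * flip_sign i = 1.
Proof. by rewrite -expr2 sqrr_sign. Qed.

Lemma det_flip : \det flip = - \det E.
Proof.
rewrite det_mulmx det_diag big_ord_recl big1 ?mulr1; last by move=> i _; rewrite mxE.
by rewrite mxE /flip_sign eqxx expr1 mulN1r.
Qed.

Lemma orthonormal_flip G x : orthonormal_frame G x E -> orthonormal_frame G x flip.
Proof.
rewrite /orthonormal_frame /flip trmx_mul => EO.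
rewrite !mulmxA -(mulmxA _ E) -(mulmxA _ (E *m _)) EO mulmx1 tr_diag_mx mulmx_diag -diag_const_mx.
by congr diag_mx; apply/rowP => i; rewrite !mxE flip_sign_sq.
Qed.

Lemma riem_frame_flip G x i j k l : riem_frame G x flip i j k l =
  flip_sign i * flip_sign j * flip_sign k * flip_sign l * riem_frame G x E i j k l.
Proof.
rewrite /riem_frame mulr_sumr; apply: eq_bigr => a _; rewrite mulr_sumr.
apply: eq_bigr => b _; rewrite mulr_sumr; apply: eq_bigr => c _; rewrite mulr_sumr.
apply: eq_bigr => d _; rewrite !flipE; move: (riem _ _ _ _ _ _) => T; ring.
Qed.

Lemma sectional_flip G x i j : riem_frame G x flip i j i j = riem_frame G x E i j i j.
Proof.
rewrite riem_frame_flip /flip_sign.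
by case: (i == 0); case: (j == 0); rewrite ?expr0 ?expr1; ring.
Qed.

Lemma curv_norm_flip G x : curv_norm G x flip = curv_norm G x E.
Proof.
congr Num.sqrt; apply: eq_bigr => k _; apply: eq_bigr => l _.
rewrite !mxE riem_frame_flip exprMn.
set s := (X in X * _); suff -> : s = 1 by rewrite mul1r.
by rewrite /s !exprMn !sqrr_sign !mulr1.
Qed.

End Flip.

Section SmallSums.
Variables (R : realType).
Lemma sum3 (F : 'I_3 -> R) : \sum_i F i = F 0 + F 1 + F 2.
Proof. by rewrite !big_ord_recl big_ord0 addr0 addrA; congr (F _ + F _ + F _); apply/val_inj. Qed.
Lemma sum4 (F : 'I_4 -> R) : \sum_i F i = F 0 + F 1 + F 2 + F 3.
Proof. by rewrite !big_ord_recl big_ord0 addr0 !addrA; congr (F _ + F _ + F _ + F _); apply/val_inj. Qed.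

(** Put lambda = r0 + r1. Then 2 Q = lambda (lambda - (a + b)) + 2 (a^2 + b^2 + K23 (a + b)). The
    third curvature sum is a + b >= 0, and the first two add up to lambda + 2 K23 >= 0; so for
    lambda <= 0 everything beyond lambda^2 is nonnegative. Here isotropic curvature enters the
    maximum principle. *)
Lemma isotropic_reaction (K01 K02 K03 K12 K13 K23 : R) :
  let r0 := K01 + K02 + K03 in let r1 := K01 + K12 + K13 in
  let r2 := K02 + K12 + K23 in let r3 := K03 + K13 + K23 in
  let Q := r0 * K01 + r1 * K01 + r2 * (K02 + K12) + r3 * (K03 + K13) in
  r0 + r1 <= 0 ->
  0 <= (K01 + K23) + (K02 + K13) -> 0 <= (K01 + K23) + (K03 + K12) ->
  0 <= (K02 + K13) + (K03 + K12) ->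
  (r0 + r1) ^+ 2 <= 2 * Q /\
  (0 < (K01 + K23) + (K02 + K13) -> 0 < (K01 + K23) + (K03 + K12) ->
   0 < (K02 + K13) + (K03 + K12) -> 0 < 2 * Q).
Proof.
move=> r0 r1 r2 r3 Q lam D1 D2 D3.
pose a := K02 + K12; pose b := K03 + K13.
have QE : 2 * Q = (r0 + r1) * (r0 + r1 - (a + b)) + 2 * (a ^+ 2 + b ^+ 2 + K23 * (a + b)).
  by rewrite /Q /r0 /r1 /r2 /r3 /a /b; ring.
have k0 : 0 <= (r0 + r1) + 2 * K23 by rewrite /r0 /r1; lra.
have P0 : 0 <= a + b by rewrite /a /b; lra.
have A3 : 0 <= (r0 + r1) ^+ 2 by rewrite sqr_ge0.
split; first by rewrite QE; nra.
move=> E1 E2 E3.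
have P1 : 0 < a + b by rewrite /a /b; lra.
have k1 : 0 < K23 by rewrite /r0 /r1 in k0 lam; lra.
have : 0 < K23 * (a + b) by rewrite mulr_gt0.
by rewrite QE expr2 in A3 *; nra.
Qed.

(** The traces are tA = tC = s / 4, so the bounds add up to 3/8 + 1/2 - 1/8 = 3/4 of s^2. *)
Lemma curv_norm_aux (N NA NC NR tA tC s : R) : NA <= 3 * tA ^+ 2 -> 0 <= tA ->
  NC <= 3 * tC ^+ 2 -> NR <= s ^+ 2 -> tA = tC -> tA + tC = 2^-1 * s ->
  N = NA + NC + 2^-1 * NR - 8^-1 * s ^+ 2 -> N <= s ^+ 2 /\ 0 <= s.
Proof.
move=> HA A0 HC HR tE E ->; subst tC; have sE : s = 4 * tA by lra.
have := sqr_ge0 tA; subst s.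
by rewrite !expr2 in HA HC HR *; split; nra.
Qed.

End SmallSums.

Section Frobenius.
Variable R : realType.

(** Equality holds for the eigenvalues -1, 1, 1. *)
Lemma frobenius_le3 (S : 'M[R]_3) : S^T = S -> 0 <= sum_two_smallest S ->
  \sum_i \sum_j S i j ^+ 2 <= 3 * (\tr S) ^+ 2 /\ 0 <= \tr S.
Proof.
move=> symS; have [P [r [PO SE rs]]] := spectral_orthogonal symS.
rewrite (sum_two_smallest_diag PO SE rs) (frobenius_diag symS PO SE) -(trace_conj S PO).
have -> : \tr (P *m S *m P^T) = \sum_i r i by apply: eq_bigr => i _; rewrite SE eqxx.
have o1 : lift ord0 ord0 = 1 :> 'I_3 by exact/val_inj.
rewrite !sum3 o1.
have : r 0 <= r 1 by exact: rs.
have : r 1 <= r 2 by exact: rs.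
move: (r 0) (r 1) (r 2) => a b c {SE rs o1} bc ab ab0; clear -bc ab ab0.
have t1 : 0 <= (b - a) * (a + b) by rewrite mulr_ge0 // subr_ge0.
have t2 : 0 <= (c - b) * (c + b) by rewrite mulr_ge0; lra.
have t3 : 0 <= (a + b) * c by rewrite mulr_ge0; lra.
have t4 := sqr_ge0 (a + b).
by split; rewrite ?expr2 in t4 *; nra.
Qed.

(** Equality holds for the eigenvalues -1, 1, 1, 1. *)
Lemma frobenius_le4 (S : 'M[R]_4) : S^T = S -> 0 <= sum_two_smallest S ->
  \sum_i \sum_j S i j ^+ 2 <= (\tr S) ^+ 2 /\ 0 <= \tr S.
Proof.
move=> symS; have [P [r [PO SE rs]]] := spectral_orthogonal symS.
rewrite (sum_two_smallest_diag PO SE rs) (frobenius_diag symS PO SE) -(trace_conj S PO).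
have -> : \tr (P *m S *m P^T) = \sum_i r i by apply: eq_bigr => i _; rewrite SE eqxx.
have o1 : lift ord0 ord0 = 1 :> 'I_4 by exact/val_inj.
rewrite !sum4 o1.
have : r 0 <= r 1 by exact: rs.
have : r 1 <= r 2 by exact: rs.
have : r 2 <= r 3 by exact: rs.
move: (r 0) (r 1) (r 2) (r 3) => a b c d {SE rs o1} cd bc ab ab0; clear -cd bc ab ab0.
have t1 : 0 <= (a + b) * (c + d) by rewrite mulr_ge0; lra.
have t2 : 0 <= (a + b) * b by rewrite mulr_ge0; lra.
have t3 : 0 <= (c - b) * b by rewrite mulr_ge0; lra.
have t4 : 0 <= c * (d - c) by rewrite mulr_ge0; lra.
have t5 : 0 <= (c - b) * c by rewrite mulr_ge0; lra.
by split; rewrite ?expr2; nra.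
Qed.

End Frobenius.

Section Pointwise4.
Variables (R : realType) (U : set 'rV[R]_4) (G : 'rV[R]_4 -> 'M[R]_4) (x : 'rV[R]_4).
Hypothesis mG : metric_on U G.
Hypothesis Ux : U x.
Variable E : 'M[R]_4.
Hypothesis orthoE : orthonormal_frame G x E.
Let K i j := riem_frame G x E i j i j.
Let i1 : 'I_3 := lift ord0 ord0.
Let i2 : 'I_3 := lift ord0 (lift ord0 ord0).

Let Pop := curv_op G x E.
Let D (i : 'I_3) := Pop (lshift 3 i) (lshift 3 i) + Pop (rshift 3 i) (rshift 3 i).

Lemma dual_diag i : curv_A G x E i i + curv_C G x E i i = D i.
Proof.
rewrite /curv_A /curv_C sd_block asd_block !(scalemxE, addmxE, oppmxE) /D.
rewrite -/Pop /ulsubmx /drsubmx !mxE; lra.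
Qed.

(** [D] is the diagonal of A + C in the basis given by the frame, with entries such as K01 + K23;
    two diagonal entries of a symmetric matrix add up to at least its two smallest eigenvalues. *)
Lemma isotropic_sums : let s := sum_two_smallest (curv_A G x E) + sum_two_smallest (curv_C G x E) in
  [/\ s <= (K 0 1 + K 2 3) + (K 0 2 + K 1 3), s <= (K 0 1 + K 2 3) + (K 0 3 + K 1 2) &
      s <= (K 0 2 + K 1 3) + (K 0 3 + K 1 2)].
Proof.
have symP := curv_op_sym mG Ux E.
have key i j : i != j -> sum_two_smallest (curv_A G x E) + sum_two_smallest (curv_C G x E) <= D i + D j.
  move=> ij; rewrite -!dual_diag [leRHS]addrACA; apply: lerD; apply: sum_two_smallest_le => //.
    exact: sd_block_sym.
  exact: asd_block_sym.
have [a12 a34 _ _] := riem_frame_symmetries mG Ux E.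
have D0 : D 0 = K 0 1 + K 2 3 by rewrite /D !mxE.
have D1 : D i1 = K 0 2 + K 1 3 by rewrite /D !mxE /bivector /= (a12 1 3) (a34 _ _ 1 3) opprK.
have D2 : D i2 = K 0 3 + K 1 2 by rewrite /D !mxE.
by rewrite -D0 -D1 -D2; split; apply: key.
Qed.

(** |Rm|^2 = |A|^2 + |C|^2 + 2 |B|^2, where 2 |B|^2 is half the squared norm of the traceless Ricci
    tensor. *)
Lemma curv_op_norm : \sum_k \sum_l Pop k l ^+ 2 =
  \sum_i \sum_j curv_A G x E i j ^+ 2 + \sum_i \sum_j curv_C G x E i j ^+ 2
  + 2^-1 * \sum_i \sum_j ricci_frame G x E i j ^+ 2 - 8^-1 * scal G x ^+ 2.
Proof.
have [a12 a34 pair cyc] := riem_frame_symmetries mG Ux E.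
rewrite (scal_frame mG Ux orthoE) /mxtrace.
rewrite big_split_ord /=; under eq_bigr do rewrite big_split_ord /=.
under [X in _ + X = _]eq_bigr do rewrite big_split_ord /=.
set f := riem_frame G x E in a12 a34 pair cyc.
have f0 i k l : f i i k l = 0 by have := a12 i i k l; lra.
have f0' i k l : f k l i i = 0 by rewrite pair f0.
have fC : f 0 3 1 2 = f 0 2 1 3 - f 0 1 2 3.
  by have := cyc 0 1 2 3; rewrite -(pair 1 2 0 3) (a12 0 2 1 3); lra.
have RE b d : ricci_frame G x E b d = f 0 b 0 d + f 1 b 1 d + f 2 b 2 d + f 3 b 3 d.
  by rewrite (ricci_frameE mG Ux orthoE) sum4.
have AE i j : curv_A G x E i j = 2^-1 * (Pop (lshift 3 i) (lshift 3 j) + Pop (lshift 3 i) (rshift 3 j)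
    + Pop (rshift 3 i) (lshift 3 j) + Pop (rshift 3 i) (rshift 3 j)).
  by rewrite /curv_A sd_block !(scalemxE, addmxE) !mxE.
have CE i j : curv_C G x E i j = 2^-1 * (Pop (lshift 3 i) (lshift 3 j) - Pop (lshift 3 i) (rshift 3 j)
    - Pop (rshift 3 i) (lshift 3 j) + Pop (rshift 3 i) (rshift 3 j)).
  by rewrite /curv_C asd_block !(scalemxE, addmxE, oppmxE) !mxE.
have PE k l : Pop k l = f (bivector k).1 (bivector k).2 (bivector l).1 (bivector l).2 by rewrite mxE.
rewrite !sum3 !sum4 !AE !CE !RE !PE /bivector /=.
move: f f0 f0' fC a12 a34 pair {AE CE RE PE cyc} => f f0 f0' fC a12 a34 pair.
rewrite !(a12 0 1, a12 0 2, a12 0 3, a12 1 2, a12 1 3, a12 2 3, a34 _ _ 0 1, a34 _ _ 0 2, a34 _ _ 0 3,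
  a34 _ _ 1 2, a34 _ _ 1 3, a34 _ _ 2 3, f0, f0').
rewrite !(pair 0 1 0 2, pair 0 1 0 3, pair 0 1 2 3, pair 0 1 1 3, pair 0 1 1 2,
  pair 0 2 0 3, pair 0 2 2 3, pair 0 2 1 3, pair 0 2 1 2, pair 0 3 2 3, pair 0 3 1 3, pair 0 3 1 2,
  pair 1 2 1 3, pair 1 2 2 3, pair 1 3 2 3).
rewrite fC; by field.
Qed.


Lemma dual_trace : \tr (curv_A G x E) = \tr (curv_C G x E) /\
  \tr (curv_A G x E) + \tr (curv_C G x E) = 2^-1 * scal G x.
Proof.
have [a12 a34 pair cyc] := riem_frame_symmetries mG Ux E.
have AE i : curv_A G x E i i = 2^-1 * D i + Pop (lshift 3 i) (rshift 3 i).
  rewrite /curv_A sd_block !(scalemxE, addmxE) /D !mxE.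
  rewrite (pair (bivector (lshift 3 i)).1 (bivector (lshift 3 i)).2); lra.
have CE i : curv_C G x E i i = 2^-1 * D i - Pop (lshift 3 i) (rshift 3 i).
  rewrite /curv_C asd_block !(scalemxE, addmxE, oppmxE) /D !mxE.
  rewrite (pair (bivector (lshift 3 i)).1 (bivector (lshift 3 i)).2); lra.
have B0 : Pop (lshift 3 0) (rshift 3 0) + Pop (lshift 3 1) (rshift 3 1) + Pop (lshift 3 2) (rshift 3 2) = 0.
  rewrite !mxE /bivector /=.
  have := cyc 0 1 2 3; rewrite -(pair 1 2 0 3) (a12 0 2 1 3) (a34 0 2 1 3).
  set p := riem_frame _ _ _ 0 1 2 3; set q := riem_frame _ _ _ 0 2 1 3; set r := riem_frame _ _ _ 0 3 1 2; lra.
rewrite /mxtrace !sum3 !AE !CE; split; first by lra.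
rewrite (scal_frame mG Ux orthoE) /mxtrace sum4 !(ricci_frameE mG Ux orthoE) !sum4 /D !mxE /bivector /=.
have f0 i k l : riem_frame G x E i i k l = 0 by have := a12 i i k l; lra.
rewrite !f0 !(a12 0 1, a12 0 2, a12 0 3, a12 1 2, a12 1 3, a12 2 3, a34 _ _ 0 1, a34 _ _ 0 2, a34 _ _ 0 3,
  a34 _ _ 1 2, a34 _ _ 1 3, a34 _ _ 2 3).
by move: (riem_frame G x E) => f; field.
Qed.

Lemma curv_norm_le_scal : 0 <= sum_two_smallest (curv_A G x E) ->
  0 <= sum_two_smallest (curv_C G x E) -> 0 <= sum_two_smallest (ricci_frame G x E) ->
  curv_norm G x E <= scal G x.
Proof.
have symP := curv_op_sym mG Ux E.
have symA : (curv_A G x E)^T = curv_A G x E by exact: sd_block_sym.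
have symC : (curv_C G x E)^T = curv_C G x E by exact: asd_block_sym.
have symR := ricci_frame_sym mG Ux orthoE.
move=> A0 C0 R0.
have [At Ap] := frobenius_le3 symA A0; have [Ct Cp] := frobenius_le3 symC C0.
have [Rt Rp] := frobenius_le4 symR R0.
have [tAC tR] := dual_trace.
rewrite -(scal_frame mG Ux orthoE) in Rt.
have [N0 S0] := curv_norm_aux At Ap Ct Rt tAC tR curv_op_norm.
by rewrite /curv_norm -[leRHS](ger0_norm S0) -sqrtr_sqr; apply: ler_wsqrtr.
Qed.

End Pointwise4.

(** * Smooth maps between coordinate spaces, and charts *)

Section SmoothEntries.
Variables (R : realType) (V : normedModType R).

Lemma Ck_open_entry p q k (U : set V) (F : V -> 'M[R]_(p.+1, q.+1)) a b : open U ->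
  Ck_open k U F -> Ck_open k U (fun x => F x a b).
Proof.
move=> oU; elim: k F => [|k IH] F [cF H]; split=> //.
- move=> x Ux; exact: (@cvg_comp _ _ _ F (fun M : 'M[R]_(p.+1, q.+1) => M a b) _ _ _
    (cF x Ux) (@coord_continuous _ _ _ a b (F x))).
- move=> x Ux; exact: (@cvg_comp _ _ _ F (fun M : 'M[R]_(p.+1, q.+1) => M a b) _ _ _
    (cF x Ux) (@coord_continuous _ _ _ a b (F x))).
move=> v; have [dF CF] := H v; split.
  by move=> x Ux; exact: ((derivable_mxP _ _ _).1 (dF x Ux) a b).
apply: (Ck_open_ext (f := fun x => 'D_v F x a b)) => //; last exact: IH.
by move=> x Ux; rewrite derive_mx ?mxE //; exact: dF.
Qed.

Lemma Ck_open_local k (A : set V) (f : V -> R) :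
  (forall x, A x -> exists2 U, U x & open U /\ Ck_open k U f) -> Ck_open k A f.
Proof.
elim: k f => [|k IH] f H.
  by split=> // x /H[U Ux [_ [cf _]]]; exact: cf.
split=> [x /H[U Ux [_ [cf _]]]|v]; first exact: cf.
split=> [x /H[U Ux [_ [_ D]]]|]; first exact: (D v).1.
by apply: IH => x /H[U Ux [oU [_ D]]]; exists U => //; split=> //; exact: (D v).2.
Qed.

Lemma smooth_on_msmooth p q (A : set V) (F : V -> 'M[R]_(p.+1, q.+1)) : open A ->
  smooth_on A F -> msmooth A F.
Proof.
move=> oA sF a b k; apply: Ck_open_local => x Ax.
have [U [h [oU Ux Ch hF]]] := sF x Ax; exists (A `&` U) => //.
have oAU : open (A `&` U) by exact: openI.
split=> //; apply: (Ck_open_ext (f := fun x => h x a b)) => //.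
  by move=> y [Ay Uy]; rewrite hF.
by apply: (Ck_open_sub (U := U)); [move=> y []|exact: Ck_open_entry].
Qed.

End SmoothEntries.

Section RowCalculus.
Variables (R : realType) (n : nat).
Local Notation X := 'rV[R]_n.+1.

Lemma is_derive_rV (V : normedModType R) (f : V -> X) x v (d : X) :
  (forall j, is_derive x v (fun y => f y 0 j) (d 0 j)) -> is_derive x v f d.
Proof.
move=> H; have df : derivable f x v.
  by apply/derivable_mxP => i j; rewrite ord1; have [] := H j.
split=> //; rewrite derive_mx //; apply/rowP => j; rewrite mxE.
by have [_ ->] := H j.
Qed.

Lemma is_derive_coord (V : normedModType R) (f : V -> X) x v (d : X) j :
  is_derive x v f d -> is_derive x v (fun y => f y 0 j) (d 0 j).
Proof.
move=> [df <-]; split; first exact: ((derivable_mxP _ _ _).1 df 0 j).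
by rewrite derive_mx // mxE.
Qed.

Lemma derivable_curve_continuous (f : R -> X) s : derivable f s 1 -> {for s, continuous f}.
Proof. by move=> /derivable1_diffP; exact: differentiable_continuous. Qed.

(** [jacobian] is read off the differential of [f]; the linear approximation of [C1_increment] is
    that differential by uniqueness. *)
Lemma jacobianE (U : set X) (f : X -> X) x a b : open U -> msmooth U f -> U x ->
  jacobian f x a b = dmx (xdir R a) f x 0 b.
Proof.
move=> oU sf Ux.
pose J : 'M[R]_n.+1 := \matrix_(a, b) dmx (xdir R a) f x 0 b.
have JE (w : X) c : (w *m J) 0 c = \sum_i w 0 i * 'D_(xdir R i) (fun y => f y 0 c) x.
  by rewrite mxE; apply: eq_bigr => i _; rewrite mxE dmxE.
have cJ : continuous (fun w : X => w *m J).
  move=> w; apply: (@continuous_fcoord R _ _ (rV_fbasis R n)) => c /=.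
  have -> : (fun y : X => (y *m J) 0 c) = (fun y => \sum_i y 0 i * J i c).
    by apply/funext => y; rewrite mxE.
  have H (i : 'I_n.+1) : continuous (fun y : X => y 0 i * J i c).
    by apply: mulf_continuous; [exact: coord_continuous|exact: cst_continuous].
  have K := @sumf_continuous R X _ (index_enum 'I_n.+1) _ H; exact: (K w).
have D : 'd f x = (mulmxr J : {linear X -> X}) :> (X -> X).
  apply: diff_unique; first exact: cJ.
  apply/eqaddoP => e e0.
  have e1 : 0 < e / n.+1%:R by rewrite divr_gt0 // ltr0n.
  pose P (c : 'I_n.+1) (w : X) := `|f (w + x) 0 c - f x 0 c - \sum_i fcoord (rV_fbasis R n) i (w + x - x) *
      'D_(fvec (rV_fbasis R n) i) (fun y => f y 0 c) x| <=
      e / n.+1%:R * \sum_i `|fcoord (rV_fbasis R n) i (w + x - x)|.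
  have near_c : \forall w \near (0 : X), forall c, P c w.
    suff HP c : \forall w \near (0 : X), P c w by exact: (filter_forall _ HP).
    have := C1_increment (rV_fbasis R n) oU (sf 0 c) Ux e1.
    by rewrite (near_shift 0 x) /=; apply: filterS => z; rewrite subr0.
  near=> w.
  have N i : `|w 0 i| <= `|w| by exact: coord_le_norm.
  have Hw : forall c, P c w by near: w.
  apply: mx_norm_le; first by rewrite mulr_ge0 // ltW.
  move=> k c; rewrite ord1 !fctE /= !(addmxE, oppmxE) JE opprD addrA; have Hc := Hw c.
  rewrite /P addrK /= in Hc; apply: (le_trans Hc).
  rewrite -mulrA; apply: ler_wpM2l; first exact: ltW.
  rewrite mulrC ler_pdivrMr ?ltr0n // -[leRHS]/(`|w| * _).
  apply: le_trans (ler_sum _ (fun i _ => N i)) _.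
  by rewrite sumr_const card_ord mulr_natr.
by rewrite /jacobian -[lin1_mx _ a b]/(lin1_mx ('d f x) a b) mxE D /= -rowE !mxE.
Unshelve. all: by end_near. Qed.

Lemma curve_chain (U : set X) (f : X -> X) (c : R -> X) s d : open U -> msmooth U f -> U (c s) ->
  is_derive s 1 c d -> is_derive s 1 (fun r => f (c r)) (d *m jacobian f (c s)).
Proof.
move=> oU sf Uc dc; apply: is_derive_rV => j.
have cc : {for s, continuous c} by apply: derivable_curve_continuous; have [] := dc.
have := chain_rule (fb := rV_fbasis R n) oU (sf 0 j) Uc cc (fun i => is_derive_coord i dc).
suff -> : (d *m jacobian f (c s)) 0 j = \sum_i
    d 0 i * 'D_(fvec (rV_fbasis R n) i) (fun x => f x 0 j) (c s) by [].
by rewrite mxE; apply: eq_bigr => i _; rewrite (jacobianE _ _ oU sf Uc) dmxE.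
Qed.

End RowCalculus.

Section ManifoldBasics.
Variables (R : realType) (n : nat) (M : manifold R n).
Implicit Types (i j : chart M).

Lemma phi_cont i p : dom i p -> {for p, continuous (phi i)}.
Proof.
move=> ip; have := phi_continuous (i := i); rewrite (continuous_open_subspace _ (dom_open i)).
by apply; rewrite inE.
Qed.

Lemma img_isopen i : open (img i).
Proof. exact: img_open. Qed.

Lemma psi_cont i x : img i x -> {for x, continuous (psi i)}.
Proof.
move=> ix; have := psi_continuous (i := i); rewrite (continuous_open_subspace _ (@img_isopen i)).
by apply; rewrite inE.
Qed.

Lemma psi_dom i x : img i x -> dom i (psi i x).
Proof. by move=> [p ip <-]; rewrite phiK. Qed.

Lemma psiK i x : img i x -> phi i (psi i x) = x.
Proof. by move=> [p ip <-]; rewrite phiK. Qed.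

Lemma phi_img i p : dom i p -> img i (phi i p).
Proof. by move=> ip; exists p. Qed.

Lemma overlapP i j x : overlap i j x <-> img i x /\ dom j (psi i x).
Proof.
split=> [[p [ip jp] <-]|[[p ip <-]]]; first by rewrite phiK //; split=> //; exists p.
by rewrite phiK // => jp; exists p.
Qed.

Lemma overlap_open i j : open (overlap i j).
Proof.
rewrite openE => x /overlapP[ix jx].
have N1 := near_open (@img_isopen i) ix.
have N2 : nbhs x (fun y => dom j (psi i y)).
  exact: (psi_cont ix (near_open (dom_open j) jx)).
by apply: filterS2 N1 N2 => y iy jy; apply/overlapP.
Qed.

Lemma transition_msmooth i j : msmooth (overlap i j) (transition i j).
Proof. apply: smooth_on_msmooth; [exact: overlap_open|exact: transition_smooth]. Qed.

Lemma psi_transition i j x : overlap i j x -> psi j (transition i j x) = psi i x.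
Proof. by move=> /overlapP[ix jx]; rewrite /transition /= phiK. Qed.

Lemma transition_overlap i j x : overlap i j x -> overlap j i (transition i j x).
Proof.
move=> o; have /overlapP[ix jx] := o; apply/overlapP; rewrite psi_transition //.
by split; [exact: phi_img|exact: psi_dom].
Qed.

Lemma overlap_phi i j p : dom i p -> dom j p -> overlap i j (phi i p).
Proof. by move=> ip jp; exists p. Qed.

Lemma transition_phi i j p : dom i p -> transition i j (phi i p) = phi j p.
Proof. by move=> ip; rewrite /transition /= phiK. Qed.

End ManifoldBasics.

Arguments img_isopen {R n M} i.
Arguments overlap_open {R n M} i j.
Arguments transition_msmooth {R n M} i j _ _.

(** * Curves, their speed and reparametrization *)

Section NormOfForm.
Variables (R : realType) (m : nat).
Implicit Types (G : 'M[R]_m) (v : 'rV[R]_m).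

Definition gn G v : R := Num.sqrt (bil G v v).

Lemma gn_ge0 G v : 0 <= gn G v. Proof. exact: sqrtr_ge0. Qed.

Lemma gnZ G a v : gn G (a *: v) = `|a| * gn G v.
Proof. by rewrite /gn bilZl bilZr mulrA -expr2 sqrtrM ?sqr_ge0 // sqrtr_sqr. Qed.

End NormOfForm.

Lemma near_eq_derive1 (R : realType) (W : normedModType R) (f g : R -> W) (s : R) :
  (\forall r \near s, f r = g r) -> derive1 f s = derive1 g s.
Proof.
by move=> fg; rewrite !derive1E; apply: near_eq_derive.
Qed.

Lemma continuous_germ (T U : topologicalType) (f g : T -> U) s :
  (\forall r \near s, f r = g r) -> {for s, continuous f} -> {for s, continuous g}.
Proof.
move=> fg; rewrite /prop_for /continuous_at -(nbhs_singleton fg); apply: cvg_trans.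
by apply: near_eq_cvg; apply: filterS fg.
Qed.

Lemma derivable_germ (R : realType) (W : normedModType R) (f g : R -> W) (s : R) :
  (\forall r \near s, f r = g r) -> derivable f s 1 -> derivable g s 1.
Proof. by move=> fg; apply: near_eq_derivable. Qed.

Lemma is_derive_germ (R : realType) (W : normedModType R) (f g : R -> W) (s : R) v :
  (\forall r \near s, f r = g r) -> is_derive s 1 f v -> is_derive s 1 g v.
Proof.
move=> fg [df <-]; split; first exact: derivable_germ fg df.
by symmetry; apply: near_eq_derive.
Qed.

Lemma is_derive_compR (R : realType) (f g : R -> R) (s a b : R) :
  is_derive (g s) 1 f a -> is_derive s 1 g b -> is_derive s 1 (f \o g) (b * a).
Proof.
move=> [df fE] [dg gE]; split.
  by apply/derivable1_diffP/differentiable_comp; exact/derivable1_diffP.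
have E1 : derive1 f (g s) = a by rewrite derive1E; exact: fE.
have E2 : derive1 g s = b by rewrite derive1E; exact: gE.
by rewrite -derive1E (derive1_comp dg df) E1 E2 mulrC.
Qed.

Section Curves.
Variables (R : realType) (n : nat) (M : manifold R n).
Implicit Types (i j : chart M) (c : R -> M) (g : tensor2 M).
Local Notation X := 'rV[R]_n.+1.

Definition vel i c s : X := derive1 (phi i \o c) s.

Lemma curve_near_dom c i s : {for s, continuous c} -> dom i (c s) -> \forall r \near s, dom i (c r).
Proof. by move=> cc ic; exact: (cc _ (near_open (dom_open i) ic)). Qed.

Lemma vel_is_derive c i s : C1_curve c -> dom i (c s) -> is_derive s 1 (phi i \o c) (vel i c s).
Proof.
move=> [_ H] ic; have [dn _] := H s i ic; rewrite /vel derive1E; split=> //.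
exact: nbhs_singleton dn.
Qed.

Lemma vel_germ c c' i s : (\forall r \near s, c r = c' r) -> vel i c s = vel i c' s.
Proof. by move=> cc; apply: near_eq_derive1; apply: filterS cc => r /= ->. Qed.

Lemma is_derive_transition c i j s v : {for s, continuous c} -> dom i (c s) -> dom j (c s) ->
  is_derive s 1 (phi i \o c) v ->
  is_derive s 1 (phi j \o c) (v *m jacobian (transition i j) (phi i (c s))).
Proof.
move=> cc ic jc dv.
have H := curve_chain (overlap_open i j) (transition_msmooth i j) (overlap_phi ic jc) dv.
have E : \forall r \near s, transition i j (phi i (c r)) = phi j (c r).
  by apply: filterS (curve_near_dom cc ic) => r ir; rewrite transition_phi.
exact: is_derive_germ E H.
Qed.

Lemma vel_change c i j s : C1_curve c -> dom i (c s) -> dom j (c s) ->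
  vel j c s = vel i c s *m jacobian (transition i j) (phi i (c s)).
Proof.
move=> C1 ic jc; have [cc _] := C1.
have [_ <-] := is_derive_transition (cc s) ic jc (vel_is_derive C1 ic).
by rewrite /vel derive1E.
Qed.

Lemma speed_chart g c i s : riemannian g -> C1_curve c -> dom i (c s) ->
  speed g c s = gn (g i (phi i (c s))) (vel i c s).
Proof.
move=> [_ _ _ law] C1 ic; rewrite /speed; set j := chart_at (c s).
have jc : dom j (c s) by exact: dom_chart_at.
rewrite -[derive1 _ s]/(vel j c s) /gn (vel_change C1 jc ic) bil_mul.
by rewrite (law j i _ (overlap_phi jc ic)) transition_phi.
Qed.

Lemma speed_germ g c c' s : (\forall r \near s, c r = c' r) -> speed g c s = speed g c' s.
Proof.
move=> E; rewrite /speed (nbhs_singleton E); set i := chart_at _.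
by rewrite -![derive1 _ s]/(vel i _ s) (vel_germ i E).
Qed.

Lemma C1_germ c : (forall s : R, exists2 c', C1_curve c' & \forall r \near s, c r = c' r) -> C1_curve c.
Proof.
move=> H; split=> [s|s i ic].
  have [c' [cc _] E] := H s; have := cc s; rewrite /continuous_at (nbhs_singleton E).
  by apply: cvg_trans; apply: near_eq_cvg; apply: filterS E => r ->.
have [c' [cc D] E] := H s; have ic' : dom i (c' s) by rewrite -(nbhs_singleton E).
have [dn dc] := D s i ic'.
have E2 := near_join E.
have Ed : \forall r \near s, derive1 (phi i \o c) r = derive1 (phi i \o c') r.
  by apply: filterS E2 => r Er; apply: near_eq_derive1; apply: filterS Er => u /= ->.
split.
  apply: filterS2 E2 dn => r Er; apply: derivable_germ.
  by apply: filterS Er => u /= ->.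
by apply: continuous_germ dc; apply: filterS Ed => r ->.
Qed.

(** One chart around each time is enough: velocities in another chart are the image under the
    Jacobian of a transition, which varies continuously along the curve. *)
Lemma C1_from_chart c : continuous c ->
  (forall s, exists i, [/\ dom i (c s), \forall r \near s, derivable (phi i \o c) r 1 &
     {for s, continuous (vel i c)}]) -> C1_curve c.
Proof.
move=> cc H; split=> // s j jc; have [i [ic dn dc]] := H s.
have near_dom := curve_near_dom (cc s).
have N : \forall r \near s, is_derive (r : R) 1 (phi j \o c) (vel i c r *m jacobian (transition i j) (phi i (c r))).
  apply: filterS3 (near_dom _ ic) (near_dom _ jc) dn => r ir jr dr.
  have dv : is_derive r 1 (phi i \o c) (vel i c r) by split; [exact: dr|rewrite /vel derive1E].
  exact: (is_derive_transition (cc r) ir jr dv).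
split; first by apply: filterS N => r [].
apply: (@continuous_fcoord R _ _ (rV_fbasis R n)) => b /=.
have E : \forall r \near s, derive1 (phi j \o c) r 0 b =
    \sum_a vel i c r 0 a * dmx (xdir R a) (transition i j) (phi i (c r)) 0 b.
  apply: filterS3 N (near_dom _ ic) (near_dom _ jc) => r [_ Er] ir jr.
  rewrite derive1E Er mxE; apply: eq_bigr => a _.
  by rewrite (jacobianE _ _ (overlap_open i j) (transition_msmooth i j) (overlap_phi ir jr)).
have C : {for s, continuous (fun r => \sum_a vel i c r 0 a *
    dmx (xdir R a) (transition i j) (phi i (c r)) 0 b)}.
  rewrite /continuous_at; apply: cvg_big => [|a _]; first exact: add_continuous.
  apply: cvgM.
    exact: (@cvg_comp _ _ _ (vel i c) (fun v : X => v 0 a) _ _ _ dc (@coord_continuous _ _ _ 0 a _)).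
  have sm := msmooth_dmx (xdir R a) (transition_msmooth i j) 0 b.
  have c1 := smooth_continuous sm (overlap_phi ic jc).
  have c2 : {for s, continuous (fun r => phi i (c r))}.
    exact: (@cvg_comp _ _ _ c (phi i) _ _ _ (cc s) (phi_cont ic)).
  exact: (@cvg_comp _ _ _ (fun r => phi i (c r)) _ _ _ _ c2 c1).
by apply: continuous_germ C; apply: filterS E => r ->.
Qed.

Lemma speed_continuous g c : riemannian g -> C1_curve c -> continuous (speed g c).
Proof.
move=> rg C1 s; have [cc D] := C1; have [sg _ _ _] := rg.
set i := chart_at (c s); have ic : dom i (c s) by exact: dom_chart_at.
have E : \forall r \near s, Num.sqrt (\sum_a \sum_b vel i c r 0 a * g i (phi i (c r)) a b * vel i c r 0 b)
    = speed g c r.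
  apply: filterS (curve_near_dom (cc s) ic) => r ir.
  by rewrite (speed_chart rg C1 ir) /gn bilE.
apply: continuous_germ E _.
have C : {for s, continuous (fun r => \sum_a \sum_b vel i c r 0 a * g i (phi i (c r)) a b * vel i c r 0 b)}.
  have sm := smooth_on_msmooth (@img_isopen _ _ _ i) (sg i).
  have dc : {for s, continuous (vel i c)} by have [_] := D s i ic.
  have cv a : {for s, continuous (fun r => vel i c r 0 a)}.
    exact: (@cvg_comp _ _ _ (vel i c) (fun v : X => v 0 a) _ _ _ dc (@coord_continuous _ _ _ 0 a _)).
  have c2 : {for s, continuous (fun r => phi i (c r))}.
    exact: (@cvg_comp _ _ _ c (phi i) _ _ _ (cc s) (phi_cont ic)).
  rewrite /prop_for /continuous_at; apply: cvg_big => [|a _]; first exact: add_continuous.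
  apply: cvg_big => [|b _]; first exact: add_continuous.
  apply: cvgM (cv b); apply: cvgM (cv a) _.
  have c1 := smooth_continuous (sm a b) (phi_img ic).
  exact: (@cvg_comp _ _ _ (fun r => phi i (c r)) _ _ _ _ c2 c1).
exact: (@cvg_comp _ _ _ _ (@Num.sqrt R) _ _ _ C (@sqrt_continuous _ _)).
Qed.

Lemma is_derive_curve_comp (c : R -> X) (f : R -> R) s v e :
  is_derive (f s) 1 c v -> is_derive s 1 f e -> is_derive s 1 (c \o f) (e *: v).
Proof.
move=> dc df; apply: is_derive_rV => j; rewrite mxE.
exact: (is_derive_compR (is_derive_coord j dc) df).
Qed.

Section Composition.
Variables (f f' : R -> R).
Hypothesis df : forall s : R, is_derive s 1 f (f' s).
Hypothesis cf' : continuous f'.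

Let cf : continuous f.
Proof. by move=> s; apply: derivable_continuous1; have [] := df s. Qed.

Lemma vel_comp c i s : C1_curve c -> dom i (c (f s)) -> vel i (c \o f) s = f' s *: vel i c (f s).
Proof.
move=> C1 ic; have [_ <-] := is_derive_curve_comp (vel_is_derive C1 ic) (df s).
by rewrite /vel derive1E.
Qed.

Lemma C1_comp c : C1_curve c -> C1_curve (c \o f).
Proof.
move=> C1; have [cc D] := C1; have ccf : continuous (c \o f) by move=> s; exact: (@cvg_comp _ _ _ f c _ _ _ (@cf s) (cc (f s))).
split=> // s i ic.
have near_dom := curve_near_dom (ccf s) ic.
split.
  by apply: filterS near_dom => r ir; have [] := is_derive_curve_comp (vel_is_derive C1 ir) (df r).
have E : \forall r \near s, f' r *: vel i c (f r) = derive1 (phi i \o (c \o f)) r.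
  by apply: filterS near_dom => r ir; rewrite -vel_comp.
apply: continuous_germ E _.
have [_ dc] := D (f s) i ic.
apply: cvgZ; first exact: cf'.
exact: (@cvg_comp _ _ _ f (vel i c) _ _ _ (@cf s) dc).
Qed.

Lemma speed_comp g c s : riemannian g -> C1_curve c ->
  speed g (c \o f) s = `|f' s| * speed g c (f s).
Proof.
move=> rg C1; set i := chart_at (c (f s)).
have ic : dom i (c (f s)) by exact: dom_chart_at.
by rewrite (speed_chart rg (C1_comp C1) ic) (speed_chart rg C1 ic) vel_comp // gnZ.
Qed.

End Composition.

Lemma C1_cst (p : M) : C1_curve (fun _ : R => p).
Proof.
split=> [s|s i ip]; first exact: cvg_cst.
have E r : derive1 (phi i \o (fun _ : R => p)) r = 0.
  by rewrite derive1E; exact: (derive_cst (phi i p)).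
split; first by apply: filterE => r; exact: (derivable_cst (phi i p)).
by rewrite (_ : derive1 _ = cst 0); [exact: cvg_cst|apply/funext].
Qed.

Lemma speed_cst g (p : M) s : speed g (fun _ => p) s = 0.
Proof.
rewrite /speed derive1E (_ : 'D_1 _ s = 0); last exact: (derive_cst (phi _ p)).
by rewrite mul0mx mul0mx mxE sqrtr0.
Qed.

End Curves.

(** * A step function of class C^1, and primitives *)

Section SmoothStep.
Variable R : realType.
Implicit Types (s h : R).

Lemma is_derive_quadratic (f : R -> R) (s d C : R) :
  (forall h, `|f (h + s) - f s - h * d| <= C * h ^+ 2) -> is_derive s 1 f d.
Proof.
move=> H; have L : h^-1 *: ((f \o shift s) (h *: 1) - f s) @[h --> 0^'] --> d.
  apply/cvgrPdist_le => e e0; near=> h.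
  have h0 : h != 0 by near: h; exact: nbhs_dnbhs_neq.
  rewrite /= -[h *: 1]/(h * 1) mulr1 -[_ *: _]/(h^-1 * _).
  have -> : d - h^-1 * (f (h + s) - f s) = - (h^-1 * (f (h + s) - f s - h * d)) by field.
  rewrite normrN normrM normfV ler_pdivrMl ?normr_gt0 //.
  apply: le_trans (H h) _; rewrite -(real_normK (num_real h)) expr2 mulrA [leRHS]mulrC.
  apply: ler_wpM2r => //.
  apply: le_trans (_ : (1 + `|C|) * `|h| <= e).
    by apply: ler_wpM2r => //; apply: le_trans (ler_norm C) _; rewrite lerDr.
  rewrite mulrC -ler_pdivlMr //; near: h.
  by apply: dnbhs0_le; rewrite divr_gt0.
split; first by apply/cvg_ex; exists d.
exact: (cvg_lim (@norm_hausdorff _ _) L).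
Unshelve. all: by end_near. Qed.

Lemma is_derive_linear (f : R -> R) (s d : R) : (forall h, f (h + s) - f s - h * d = 0) -> is_derive s 1 f d.
Proof. by move=> H; apply: (@is_derive_quadratic f s d 0) => h; rewrite H mul0r normr0. Qed.

Lemma is_derive_affine (a b s : R) : is_derive s 1 (fun r => a + b * r) b.
Proof. by apply: is_derive_linear => h; ring. Qed.

Lemma is_derive_scale (b s : R) : is_derive s 1 (fun r => b * r) b.
Proof. by apply: is_derive_linear => h; ring. Qed.

Lemma is_derive_sqr_pos s : is_derive s 1 (fun r => Num.max 0 r ^+ 2) (2 * Num.max 0 s).
Proof.
apply: (@is_derive_quadratic _ _ _ 1) => h; rewrite mul1r ler_norml !expr2.
by have [?|?] := lerP 0 s; have [?|?] := lerP 0 (h + s); apply/andP; split; nra.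
Qed.

(* A C^1 function, constant for s <= 1/3 and for s >= 2/3. *)
Definition step s : R := let q r := Num.max 0 r ^+ 2 in
  2 * q (3 * s - 1) - 4 * q (3 * s - 3 / 2) + 2 * q (3 * s - 2).
Definition step' s : R := 12 * (Num.max 0 (3 * s - 1) - 2 * Num.max 0 (3 * s - 3 / 2)
  + Num.max 0 (3 * s - 2)).

Lemma is_derive_step s : is_derive s 1 step (step' s).
Proof.
have D (b : R) : is_derive s 1 (fun r => Num.max 0 (3 * r - b) ^+ 2) (3 * (2 * Num.max 0 (3 * s - b))).
  apply: (@is_derive_compR _ (fun r => Num.max 0 r ^+ 2) (fun r => 3 * r - b)).
    exact: is_derive_sqr_pos.
  by apply: is_derive_linear => h; ring.
have Z (k b : R) : is_derive s 1 (fun r => k * Num.max 0 (3 * r - b) ^+ 2)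
    ((3 * (2 * Num.max 0 (3 * s - b))) * k).
  exact: (is_derive_compR (is_derive_scale k _) (D b)).
suff -> : step' s = (3 * (2 * Num.max 0 (3 * s - 1))) * 2 + (3 * (2 * Num.max 0 (3 * s - 3 / 2))) * (- 4)
    + (3 * (2 * Num.max 0 (3 * s - 2))) * 2.
  have -> : step = (fun r => 2 * Num.max 0 (3 * r - 1) ^+ 2 + - 4 * Num.max 0 (3 * r - 3 / 2) ^+ 2
      + 2 * Num.max 0 (3 * r - 2) ^+ 2) by apply/funext => r; rewrite /step; ring.
  exact: (is_deriveDR (is_deriveDR (Z 2 1) (Z (- 4) (3 / 2))) (Z 2 2)).
by rewrite /step'; ring.
Qed.

Lemma step_le s : s <= 1 / 3 -> step s = 0.
Proof.
move=> s3; rewrite /step !max_l ?expr0n; lra.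
Qed.

Lemma step_ge s : 2 / 3 <= s -> step s = 1.
Proof. by move=> s3; rewrite /step !max_r; [field|lra|lra|lra]. Qed.

Lemma step'_ge0 s : 0 <= step' s.
Proof.
rewrite /step'; have [?|?] := lerP 0 (3 * s - 1); have [?|?] := lerP 0 (3 * s - 3 / 2);
  have [?|?] := lerP 0 (3 * s - 2); lra.
Qed.

Lemma step_itv s : 0 <= step s <= 1.
Proof.
rewrite /step; have [?|?] := lerP 0 (3 * s - 1); have [?|?] := lerP 0 (3 * s - 3 / 2);
  have [?|?] := lerP 0 (3 * s - 2); rewrite !expr2; apply/andP; split; nra.
Qed.

Lemma step'_continuous : continuous step'.
Proof.
have C (b : R) : continuous (fun s => Num.max 0 (3 * s - b)).
  move=> s; apply/cvgrPdist_le => e e0; near=> r.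
  apply: (@le_trans _ _ (`|3 * s - 3 * r|)).
    rewrite ler_norml; have := ler_norm (3 * s - 3 * r); have := ler_norm (- (3 * s - 3 * r)); rewrite normrN.
    by have [?|?] := lerP 0 (3 * s - b); have [?|?] := lerP 0 (3 * r - b) => *; apply/andP; split; lra.
  rewrite -mulrBr normrM ger0_norm // mulrC -ler_pdivlMr //.
  by near: r; apply: cvgr_dist_le; rewrite ?divr_gt0.
move=> s; apply: cvgM; first exact: cvg_cst.
by apply: cvgD; [apply: cvgB; [exact: C|apply: cvgM; [exact: cvg_cst|exact: C]]|exact: C].
Unshelve. all: by end_near. Qed.

End SmoothStep.

Section Primitives.
Variable R : realType.
Implicit Types f Phi : R -> R.

Lemma near_lt (s b : R) : s < b -> \forall r \near s, r < b.
Proof. by move=> sb; exact: (@cvgr_lt _ _ _ _ id s cvg_id b sb). Qed.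

Lemma near_gt (s b : R) : b < s -> \forall r \near s, b < r.
Proof. by move=> sb; exact: (@cvgr_gt _ _ _ _ id s cvg_id b sb). Qed.

Lemma mvt (f df : R -> R) (a b : R) : a <= b ->
  (forall x : R, a <= x <= b -> is_derive x 1 f (df x)) ->
  exists2 x, a <= x <= b & f b - f a = df x * (b - a).
Proof.
move=> ab D; have [|| x xab E] := @MVT_segment _ f df a b ab.
- by move=> x; rewrite in_itv /= => /andP[ax xb]; apply: D; rewrite !ltW.
- by apply: derivable_within_continuous => x; rewrite in_itv /= => /D[].
- by exists x.
Qed.

Lemma primitive_above f (a : R) : continuous f -> exists Phi, forall s : R, a < s ->
  is_derive s 1 Phi (f s).
Proof.
move=> cf; exists (fun y => Rintegral (@lebesgue_measure R) `[a, y] f) => s s1.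
have s2 : s < s + 1 by rewrite ltrDl.
have I : (@lebesgue_measure R).-integrable `[a, s + 1] (EFin \o f).
  apply: continuous_compact_integrable; first exact: segment_compact.
  exact: continuous_subspaceT.
have [d e] := continuous_FTC1_closed s2 I s1 (cf s).
by split; [exact: d|rewrite -derive1E].
Qed.

(** An integral from a base point is a primitive only to the right of that point; to the left of 0,
    where [f] vanishes, it is continued by a constant. *)
Lemma primitive_flat f : continuous f -> (forall s, s <= 0 -> f s = 0) ->
  exists Phi, forall s : R, is_derive s 1 Phi (f s).
Proof.
move=> cf f0; have [Phi dPhi] := primitive_above (-1) cf.
exists (fun s => if s < 0 then Phi 0 else Phi s) => s.
have cst_Phi (r : R) : - 1 < r -> r < 0 -> Phi r = Phi 0.
  move=> r1 r0; have [|x /andP[_ x0] E] := @mvt Phi f r 0 (ltW r0).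
    by move=> x /andP[rx _]; apply: dPhi; exact: lt_le_trans rx.
  by move: E; rewrite f0 // mul0r => /eqP; rewrite subr_eq0 => /eqP ->.
have [s0|s0] := ltrP s 0.
  have D0 : is_derive s 1 (fun _ : R => Phi 0) 0.
    by apply: is_derive_linear => h; ring.
  rewrite f0 ?ltW //; apply: is_derive_germ D0.
  by apply: filterS (near_lt s0) => r /= ->.
have s1 : -1 < s by lra.
apply: is_derive_germ (dPhi s s1).
have : \forall r \near s, -1 < r by apply: near_gt; lra.
apply: filterS => r r1 /=; by case: ifPn => // r0; exact: cst_Phi.
Qed.

Lemma integral_primitive f Phi : continuous f ->
  (forall s : R, 0 <= s <= 1 -> is_derive s 1 Phi (f s)) ->
  (\int[@lebesgue_measure R]_(s in `[0%R, 1%R]) (f s)%:E)%E = (Phi 1 - Phi 0)%:E.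
Proof.
move=> cf dP.
have cP (s : R) : 0 <= s <= 1 -> {for s, continuous Phi}.
  by move=> s01; apply: derivable_continuous1; have [] := dP s s01.
rewrite (@continuous_FTC2 _ f Phi) ?ltr01 // ?EFinB //.
- exact: continuous_subspaceT.
- split.
  + by move=> s /[!in_itv]/= /andP[? ?]; have [] := dP s; rewrite ?ltW.
  + by apply: cvg_at_right_filter; apply: cP; rewrite lexx ler01.
  + by apply: cvg_at_left_filter; apply: cP; rewrite lexx ler01.
- by move=> s /[!in_itv]/= /andP[? ?]; rewrite derive1E; have [|_ ->] := dP s; rewrite ?ltW.
Qed.

End Primitives.

(** * Paths, length and distance *)

Section Paths.
Variables (R : realType) (n : nat) (M : manifold R n) (g : tensor2 M).
Hypothesis rg : riemannian g.
Implicit Types (c : R -> M) (p q r : M) (a b : R).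

(* The margins, where the curve is constant, make concatenation C^1. *)
Definition is_path c : Prop :=
  [/\ C1_curve c, forall s, s <= 1 / 3 -> c s = c 0 & forall s, 2 / 3 <= s -> c s = c 1].

(** With length as the increment of a primitive of the speed, reparametrization, comparison of
    lengths and subdivision become calculus in one variable. *)
Definition arclength c (Phi : R -> R) : Prop := forall s : R, is_derive s 1 Phi (speed g c s).

(** The relation [riem_dist] < a (see [riem_dist_ltP]), without infima and extended reals. *)
Definition dlt p q a : Prop := exists c Phi,
  [/\ is_path c, arclength c Phi, c 0 = p, c 1 = q & Phi 1 - Phi 0 < a].

Lemma arclength_le c Phi s u : arclength c Phi -> s <= u -> Phi s <= Phi u.
Proof.
move=> dP su; have [x _ E] := mvt su (fun x _ => dP x).
by rewrite -subr_ge0 E mulr_ge0 ?subr_ge0 ?sqrtr_ge0.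
Qed.

Lemma path_speed0 c s : is_path c -> s <= 1 / 3 \/ 2 / 3 <= s -> speed g c s = 0.
Proof.
move=> [C1 c0 c1] Hs.
have Z (s' : R) p : (\forall r \near s', c r = p) -> speed g c s' = 0.
  by move=> E; rewrite (speed_germ g (c' := fun _ => p) E) speed_cst.
have cs := @speed_continuous _ _ _ g c rg C1 s.
apply/eqP; rewrite eq_le sqrtr_ge0 andbT; apply/ler_addgt0Pr => e e0; rewrite add0r.
move/cvgrPdist_le: cs => /(_ e e0) /nbhs_ballP[d /= d0 Hd].
have key (x : R) : `|s - x| < d -> speed g c x = 0 -> speed g c s <= e.
  by move=> sx x0; have := Hd x sx; rewrite x0 subr0 => /(le_trans (ler_norm _)).
case: Hs => Hs.
  apply: (key (s - d / 2)); first by rewrite opprB addrCA subrr addr0 gtr0_norm //; lra.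
  have s3 : s - d / 2 < 1 / 3 by lra.
  by apply: (Z _ (c 0)); apply: filterS (near_lt s3) => x x3; rewrite c0 // ltW.
apply: (key (s + d / 2)); first by rewrite opprD addrA subrr sub0r normrN gtr0_norm //; lra.
have s3 : 2 / 3 < s + d / 2 by lra.
by apply: (Z _ (c 1)); apply: filterS (near_gt s3) => x x3; rewrite c1 // ltW.
Qed.

Lemma path_arclength c : is_path c -> exists Phi, arclength c Phi.
Proof.
move=> pc; have [C1 _ _] := pc; apply: primitive_flat; first exact: speed_continuous.
by move=> s s0; apply: path_speed0 => //; left; lra.
Qed.

(* Covers sub-paths and curves without margins. *)
Lemma reparametrize c F a b : C1_curve c -> a <= b ->
  (forall s : R, a <= s <= b -> is_derive s 1 F (speed g c s)) ->
  exists c' Phi, [/\ is_path c', arclength c' Phi, c' 0 = c a, c' 1 = c b & Phi 1 - Phi 0 = F b - F a].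
Proof.
move=> C1 ab dF; pose f s := a + (b - a) * step s.
pose f' s := (b - a) * step' s.
have df (s : R) : is_derive s 1 f (f' s).
  have H (x : R) := is_derive_affine a (b - a) x.
  by rewrite /f' mulrC; exact: (is_derive_compR (H _) (is_derive_step s)).
have cf' : continuous f' by move=> s; apply: cvgM; [exact: cvg_cst|exact: step'_continuous].
have fab s : a <= f s <= b.
  by have /andP[s0 s1] := step_itv s; rewrite /f; apply/andP; split; nra.
have f0 s : s <= 1 / 3 -> f s = a by move=> s3; rewrite /f step_le // mulr0 addr0.
have f1 s : 2 / 3 <= s -> f s = b by move=> s3; rewrite /f step_ge //; ring.
have z4 : (2 / 3 : R) <= 1 by lra.
exists (c \o f), (F \o f); split=> /=.
- split; first exact: (C1_comp df cf').
  + by move=> s s3 /=; rewrite !f0.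
  + by move=> s s3 /=; rewrite !f1.
- move=> s; rewrite (speed_comp df cf' _ rg C1) ger0_norm; last first.
    by apply: mulr_ge0; [rewrite subr_ge0|exact: step'_ge0].
  exact: (is_derive_compR (dF _ (fab s)) (df s)).
- by rewrite f0.
- by rewrite f1.
- by rewrite (f1 1) // (f0 0).
Qed.

Lemma dlt_mono p q a b : a <= b -> dlt p q a -> dlt p q b.
Proof.
by move=> ab [c [Phi [? ? ? ? L]]]; exists c, Phi; split=> //; exact: lt_le_trans ab.
Qed.

Lemma dlt_gt0 p q a : dlt p q a -> 0 < a.
Proof.
move=> [c [Phi [pc dP _ _]]]; apply: le_lt_trans.
by rewrite subr_ge0; apply: arclength_le dP _.
Qed.

Lemma dlt_refl p a : 0 < a -> dlt p p a.
Proof.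
move=> a0; exists (fun _ => p), (fun _ => 0); split=> //; last by rewrite subrr.
  by split=> //; exact: C1_cst.
by move=> s; rewrite speed_cst; exact: is_derive_cst.
Qed.

Lemma dlt_sym p q a : dlt p q a -> dlt q p a.
Proof.
move=> [c [Phi [pc dP c0 c1 L]]]; have [C1 e0 e1] := pc.
have H (x : R) : is_derive x 1 (fun r : R => 1 - r) (- 1).
  by apply: is_derive_linear => h; ring.
have cH : continuous (fun _ : R => - 1 : R) by move=> ?; exact: cvg_cst.
exists (c \o (fun s => 1 - s)), (fun s => - 1 * Phi (1 - s)); split=> /=.
- split; first exact: (C1_comp H cH).
  + by move=> s s3 /=; rewrite subr0 e1 //; lra.
  + by move=> s s3 /=; rewrite subrr e0 //; lra.
- move=> s; rewrite (speed_comp H cH _ rg C1) normrN1.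
  have H1 (x : R) := is_derive_scale (- 1) x.
  have := is_derive_compR (H1 _) (@is_derive_compR _ Phi (fun s => 1 - s) s _ _ (dP (1 - s)) (H s)).
  by rewrite (_ : - 1 * _ * - 1 = 1 * speed g c (1 - s)) //; ring.
- by rewrite subr0.
- by rewrite subrr.
- by rewrite subrr subr0; lra.
Qed.

Lemma dlt_trans p q r a b : dlt p q a -> dlt q r b -> dlt p r (a + b).
Proof.
move=> [c1 [P1 [pc1 dP1 c10 c11 L1]]] [c2 [P2 [pc2 dP2 c20 c21 L2]]].
have [C1 e10 e11] := pc1; have [C2 e20 e21] := pc2.
(* The moving parts [1/3, 2/3] of [c1] and [c2] are traversed during [1/3, 7/18] and [11/18, 2/3];
   otherwise the curve rests, which leaves room for the gluing at 1/2. *)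
pose f1 (s : R) := 6 * s - 5 / 3; pose f2 (s : R) := 6 * s - 10 / 3.
have H (k x : R) : is_derive x 1 (fun s : R => 6 * s - k) 6.
  by apply: is_derive_linear => h; ring.
have cH : continuous (fun _ : R => 6 : R) by move=> ?; exact: cvg_cst.
pose c s := if s < 1 / 2 then c1 (f1 s) else c2 (f2 s).
have mid (s : R) : 4 / 9 < s -> s < 5 / 9 -> c s = q.
  move=> s1 s2; rewrite /c /f1 /f2; case: ifP => sh; first by rewrite e11 ?c11 //; lra.
  by rewrite e20 ?c20 //; lra.
have G (s : R) : [\/ s < 1 / 2 /\ (\forall r \near s, c r = (c1 \o f1) r),
    s = 1 / 2 /\ (\forall r \near s, c r = q) | 1 / 2 < s /\ (\forall r \near s, c r = (c2 \o f2) r)].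
  have [s2|s2|s2] := ltrgtP s (1 / 2).
  - by constructor 1; split=> //; apply: filterS (near_lt s2) => x r2; rewrite /c r2.
  - by constructor 3; split=> //; apply: filterS (near_gt s2) => x r2; rewrite /c ltNge ltW.
  - constructor 2; split=> //.
    have h1 : \forall r \near s, 4 / 9 < r by apply: near_gt; lra.
    have h2 : \forall r \near s, r < 5 / 9 by apply: near_lt; lra.
    by apply: filterS2 h1 h2 => x; exact: mid.
have Cc : C1_curve c.
  apply: C1_germ => s; have [[_ E]|[_ E]|[_ E]] := G s.
  - by exists (c1 \o f1) => //; exact: (C1_comp (H _) cH).
  - by exists (fun _ => q) => //; exact: C1_cst.
  - by exists (c2 \o f2) => //; exact: (C1_comp (H _) cH).
(* At every time at most one of the two speeds is nonzero, so a plain sum of primitives measures the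
   length. *)
have S (s : R) : speed g c s = 6 * speed g c1 (f1 s) + 6 * speed g c2 (f2 s).
  have [[h E]|[h E]|[h E]] := G s; rewrite (speed_germ g E).
  - rewrite (speed_comp (H _) cH _ rg C1) ger0_norm // (path_speed0 (s := f2 s) pc2) ?mulr0 ?addr0 //.
    by left; rewrite /f2; lra.
  - rewrite speed_cst !path_speed0 ?mulr0 ?addr0 //; rewrite /f1 /f2 h; first by left; lra.
    by right; lra.
  - rewrite (speed_comp (H _) cH _ rg C2) ger0_norm // (path_speed0 (s := f1 s) pc1) ?mulr0 ?add0r //.
    by right; rewrite /f1; lra.
have D (s : R) : is_derive s 1 (fun s => P1 (f1 s) + P2 (f2 s)) (speed g c s).
  rewrite S; exact: (is_deriveDR (is_derive_compR (dP1 _) (H _ s)) (is_derive_compR (dP2 _) (H _ s))).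
have Z (P : R -> R) (c' : R -> M) (u v : R) : is_path c' -> arclength c' P -> u <= v ->
    v <= 1 / 3 \/ 2 / 3 <= u -> P u = P v.
  move=> pc' dP uv Huv; have [x /andP[ux xv] E] := mvt uv (fun x _ => dP x).
  have s0 : speed g c' x = 0 by apply: path_speed0 => //; case: Huv => ?; [left|right]; lra.
  rewrite s0 mul0r in E.
  by apply/eqP; rewrite eq_sym -subr_eq0 E.
exists c, (fun s => P1 (f1 s) + P2 (f2 s)); split=> //.
- have c0 s : s <= 1 / 3 -> c s = p.
    move=> s3; rewrite /c /f1 ifT; last by lra.
    by rewrite e10 ?c10 //; lra.
  have c1' s : 2 / 3 <= s -> c s = r.
    move=> s3; rewrite /c /f2 ifF; last by apply/negbTE; rewrite -leNgt; lra.
    by rewrite e21 ?c21 //; lra.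
  by split=> // s s3; [rewrite !c0 //|rewrite !c1' //]; lra.
- by rewrite /c /f1 ifT; [rewrite e10 ?c10 //; lra|lra].
- by rewrite /c /f2 ifF; [rewrite e21 ?c21 //; lra|apply/negbTE; rewrite -leNgt; lra].
- have E1 := Z P1 c1 1 (f1 1) pc1 dP1; have E2 := Z P1 c1 (f1 0) 0 pc1 dP1.
  have E3 := Z P2 c2 1 (f2 1) pc2 dP2; have E4 := Z P2 c2 (f2 0) 0 pc2 dP2.
  rewrite -E1 ?E2 -?E3 ?E4; rewrite /f1 /f2 /=; (try lra); by [left; lra|right; lra].
Qed.

Lemma riem_dist_ltP p q a : (riem_dist g p q < a%:E)%E <-> dlt p q a.
Proof.
split=> [/ereal_inf_lt[_ [c [C1 <- <- ->]] La]|].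
  have cs := @speed_continuous _ _ _ g c rg C1.
  have [F dF] := primitive_above (-1) cs.
  have dF' (s : R) : 0 <= s <= 1 -> is_derive s 1 F (speed g c s).
    by move=> /andP[s0 _]; apply: dF; lra.
  rewrite /curve_length (integral_primitive cs dF') lte_fin in La.
  have [c' [Phi [pc' dPhi e0 e1 PE]]] := reparametrize C1 ler01 dF'.
  by exists c', Phi; split=> //; rewrite PE.
move=> [c [Phi [pc dP c0 c1 L]]]; have [C1 _ _] := pc.
apply: le_lt_trans (_ : ((Phi 1 - Phi 0)%:E < _)%E); last by rewrite lte_fin.
apply: ereal_inf_lbound; exists c; split=> //.
have cs := @speed_continuous _ _ _ g c rg C1.
by rewrite /curve_length (integral_primitive cs (fun s _ => dP s)).
Qed.

Lemma dlt_complete : riem_complete g -> forall u : nat -> M,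
  (forall e, 0 < e -> exists N, forall k l, (N <= k)%N -> (N <= l)%N -> dlt (u k) (u l) e) ->
  exists p, forall e, 0 < e -> exists N, forall k, (N <= k)%N -> dlt (u k) p e.
Proof.
move=> cg u Hu; have [|p Hp] := cg u.
  move=> e /Hu[N HN]; exists N => k l kN lN; apply/riem_dist_ltP; exact: HN.
exists p => e /Hp[N HN]; exists N => k kN; apply/riem_dist_ltP; exact: HN.
Qed.

End Paths.

(** * Comparison of the metric with the norm, and distance inside a chart *)

Section Forms.
Variables (R : realType) (n : nat).
Local Notation X := 'rV[R]_n.+1.
Implicit Types (K : 'M[R]_n.+1) (v w : X).

Lemma bil_ge0 K v : posdef K -> 0 <= bil K v v.
Proof.
move=> pK; have [->|v0] := eqVneq v 0; last exact: ltW (pK v v0).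
by rewrite /bil !mul0mx mxE.
Qed.

Lemma gn_sqr K v : posdef K -> gn K v ^+ 2 = bil K v v.
Proof. by move=> pK; rewrite sqr_sqrtr // bil_ge0. Qed.

Lemma row_norm_le v (e : R) : 0 <= e -> (forall j, `|v 0 j| <= e) -> `|v| <= e.
Proof. by move=> e0 H; apply: mx_norm_le => // i j; rewrite ord1. Qed.

Lemma norm_mulmx_le v K (C : R) : (forall i j, `|K i j| <= C) -> `|v *m K| <= n.+1%:R * C * `|v|.
Proof.
move=> KC; have C0 : 0 <= C by apply: le_trans (KC 0 0).
apply: row_norm_le; first by rewrite !mulr_ge0.
move=> j; rewrite mxE; apply: le_trans (ler_norm_sum _ _ _) _.
apply: le_trans (_ : \sum_(i < n.+1) C * `|v| <= _); last first.
  by rewrite sum_cst mulrA.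
apply: ler_sum => i _; rewrite normrM mulrC ler_pM //; exact: coord_le_norm.
Qed.

Lemma bil_norm_le K v w (C : R) : (forall i j, `|K i j| <= C) ->
  `|bil K v w| <= n.+1%:R ^+ 2 * C * (`|v| * `|w|).
Proof.
move=> KC.
rewrite bilE; apply: le_trans (ler_norm_sum _ _ _) _.
apply: le_trans (_ : \sum_(i < n.+1) \sum_(j < n.+1) C * (`|v| * `|w|) <= _); last first.
  by rewrite !sumr_const !card_ord -mulrnA -[leLHS]mulr_natl natrM expr2 !mulrA.
apply: ler_sum => i _; apply: le_trans (ler_norm_sum _ _ _) _; apply: ler_sum => j _.
rewrite !normrM mulrAC mulrC; apply: ler_pM => //; last by apply: ler_pM => //; exact: coord_le_norm.
Qed.

Lemma posdef_lower K : K^T = K -> posdef K ->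
  exists2 l : R, 0 < l & forall v, l * `|v| ^+ 2 <= bil K v v.
Proof.
move=> symK pK; have [E [r [EO _ _]]] := spectral_sorted symK pK (trmx1 R n.+1).
have Eu := frame_unitmx EO.
pose C := 1 + `|E|.
have C0 : 0 < C by rewrite ltr_pwDl.
have EC i j : `|E i j| <= C.
  by apply: le_trans (coord_le_norm _ i j) _; rewrite lerDr.
have N0 : 0 < n.+1%:R * C by rewrite mulr_gt0 // ltr0n.
exists ((n.+1%:R * C) ^- 2); first by rewrite invr_gt0 exprn_gt0.
move=> v; rewrite mulrC ler_pdivrMr ?exprn_gt0 // -[v in leRHS](mulmxKV Eu) -[v in leLHS](mulmxKV Eu).
set w := v *m invmx E; rewrite bil_mul EO.
have W : `|w| ^+ 2 <= bil 1%:M w w.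
  have S : bil 1%:M w w = \sum_j w 0 j ^+ 2.
    by rewrite /bil mulmx1 mxE; apply: eq_bigr => j _; rewrite trmxE expr2.
  have S0 : 0 <= bil 1%:M w w by rewrite S sumr_ge0 // => j _; exact: sqr_ge0.
  rewrite -[leRHS](sqr_sqrtr S0) ler_pXn2r ?nnegrE ?sqrtr_ge0 //.
  apply: row_norm_le; first exact: sqrtr_ge0.
  move=> j; rewrite -sqrtr_sqr; apply: ler_wsqrtr; rewrite S (bigD1 j) //= lerDl.
  by apply: sumr_ge0 => k _; exact: sqr_ge0.
have := norm_mulmx_le w EC => H.
apply: le_trans (_ : (n.+1%:R * C * `|w|) ^+ 2 <= _).
  by rewrite ler_pXn2r ?nnegrE ?mulr_ge0 // ltW.
by rewrite exprMn mulrC; apply: ler_wpM2r; rewrite ?sqr_ge0.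
Qed.

Section Near.
Variables (T : topologicalType) (F : T -> 'M[R]_n.+1) (z0 : T).
Hypothesis cF : forall i j, {for z0, continuous (fun z => F z i j)}.

Lemma near_bil (e : R) : 0 < e -> \forall z \near z0, forall v w,
  `|bil (F z) v w - bil (F z0) v w| <= e * (`|v| * `|w|).
Proof.
move=> e0; pose C := e / n.+1%:R ^+ 2.
have C0 : 0 < C by rewrite divr_gt0.
pose P (ij : 'I_n.+1 * 'I_n.+1) z := `|F z ij.1 ij.2 - F z0 ij.1 ij.2| <= C.
have H ij : \forall z \near z0, P ij z.
  by have /cvgrPdist_le/(_ _ C0) := @cF ij.1 ij.2; apply: filterS => z; rewrite distrC.
apply: filterS (filter_forall _ H) => z Hz v w.
have -> : bil (F z) v w - bil (F z0) v w = bil (F z - F z0) v w.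
  by rewrite /bil mulmxBr mulmxBl addmxE oppmxE.
have CE : n.+1%:R ^+ 2 * C = e by rewrite /C mulrC divfK ?gt_eqF.
have := @bil_norm_le (F z - F z0) v w C; rewrite CE; apply.
by move=> i j; rewrite addmxE oppmxE; exact: (Hz (i, j)).
Qed.

Hypotheses (symF : (F z0)^T = F z0) (pF : posdef (F z0)).

Lemma near_bil_compare (e : R) : 0 < e -> \forall z \near z0, forall v,
  `|bil (F z) v v - bil (F z0) v v| <= e * bil (F z0) v v.
Proof.
move=> e0; have [l l0 Hl] := posdef_lower symF pF.
apply: filterS (near_bil (mulr_gt0 e0 l0)) => z Hz v.
apply: le_trans (Hz v v) _; rewrite -expr2 -mulrA; apply: ler_wpM2l => //; exact: ltW.
Qed.

Lemma near_gn_bounds : exists2 L : R, 0 < L & \forall z \near z0, forall v,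
  `|v| <= L * gn (F z) v /\ gn (F z) v <= L * `|v|.
Proof.
have [l l0 Hl] := posdef_lower symF pF.
pose C := 1 + `|F z0|.
have C0 : 0 < C by rewrite ltr_pwDl.
have FC i j : `|F z0 i j| <= C.
  by apply: le_trans (coord_le_norm _ i j) _; rewrite lerDr.
have B v := bil_norm_le v v FC.
set D := n.+1%:R ^+ 2 * C in B.
have D0 : 0 < D by rewrite mulr_gt0 // exprn_gt0 // ltr0n.
have h2 : 0 < 1 / 2 :> R by rewrite divr_gt0.
exists (Num.sqrt (2 / l) + Num.sqrt (2 * D)).
  by rewrite ltr_pwDl ?sqrtr_ge0 // sqrtr_gt0 divr_gt0.
apply: filterS (near_bil_compare h2) => z Hz v.
have := Hz v; have := Hl v; have := le_trans (ler_norm _) (B v); rewrite -expr2 ler_norml.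
move=> H1 H2 /andP[H3 H4].
have sv : `|v| = Num.sqrt (`|v| ^+ 2) by rewrite sqrtr_sqr normr_id.
have g0 := gn_ge0 (F z) v.
split.
  apply: le_trans (_ : Num.sqrt (2 / l) * gn (F z) v <= _); last first.
    by apply: ler_wpM2r => //; rewrite lerDl sqrtr_ge0.
  rewrite /gn -sqrtrM; last by rewrite divr_ge0 // ltW.
  rewrite sv; apply: ler_wsqrtr; rewrite mulrAC ler_pdivlMr //; lra.
apply: le_trans (_ : Num.sqrt (2 * D) * `|v| <= _); last first.
  by apply: ler_wpM2r => //; rewrite lerDr sqrtr_ge0.
rewrite /gn [X in _ * X]sv -sqrtrM; last by rewrite mulr_ge0 // ltW.
by apply: ler_wsqrtr; lra.
Qed.

End Near.
End Forms.

(** Continuous induction through the supremum of the initial segments on which [Q] holds; it keeps a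
    short path inside a chart. *)
Lemma real_induction (R : realType) (Q : R -> Prop) : Q 0 ->
  (forall s : R, 0 <= s < 1 -> (forall u, 0 <= u <= s -> Q u) ->
     exists2 d : R, 0 < d & forall u, s <= u < s + d -> Q u) ->
  (forall s : R, 0 < s <= 1 -> (forall u, 0 <= u < s -> Q u) -> Q s) ->
  forall s : R, 0 <= s <= 1 -> Q s.
Proof.
move=> Q0 ext lim.
pose S := [set s : R | 0 <= s <= 1 /\ forall u, 0 <= u <= s -> Q u].
have S0 : S 0.
  split; first by rewrite lexx ler01.
  by move=> u u0; have -> : u = 0 by apply/eqP; rewrite eq_le andbC.
have SU : has_sup S by split; [exists 0|exists 1 => s [/andP[]]].
have sS := sup_upper_bound SU.
set m := sup S in sS.
have m0 : 0 <= m by apply: sS.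
have m1 : m <= 1 by apply: ge_sup; [exists 0|move=> s [/andP[]]].
have below u : 0 <= u < m -> Q u.
  move=> /andP[u0 um]; have e0 : 0 < m - u by rewrite subr_gt0.
  have [s [s01 Hs] us] := sup_adherent e0 SU.
  rewrite -/m opprB addrCA subrr addr0 in us; apply: Hs; rewrite u0 ltW //.
have Qm : Q m.
  have [->//|mn] := eqVneq m 0; apply: lim => //.
  by rewrite m1 andbT lt_neqAle eq_sym mn.
have Sm : S m.
  split; first by rewrite m0.
  move=> u /andP[u0]; rewrite le_eqVlt => /orP[/eqP -> //|um]; apply: below; exact/andP.
have [m1'|] := ltrP m 1; last first.
  move=> m1' s /andP[s0 s1]; apply: (Sm.2); rewrite s0; exact: le_trans m1'.
have [|d d0 Hd] := ext m _ (Sm.2); first exact/andP.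
pose u := Num.min 1 (m + d / 2).
have mu : m < u by rewrite /u lt_min m1' ltrDl divr_gt0.
suff /sS : S u by rewrite leNgt mu.
split; first by rewrite /u le_min ler01 ge_min lexx andbT addr_ge0 // divr_ge0 // ltW.
move=> v /andP[v0 vu]; have [vm|mv] := lerP v m; first by apply: (Sm.2); exact/andP.
apply: Hd; rewrite ltW //=; apply: le_lt_trans vu _.
by rewrite /u gt_min ltrD2l; apply/orP; right; lra.
Qed.

Section ChartBounds.
Variables (R : realType) (n : nat) (M : manifold R n) (g : tensor2 M).
Hypothesis rg : riemannian g.
Variables (i : chart M) (x0 : 'rV[R]_n.+1) (r L : R).
Local Notation X := 'rV[R]_n.+1.
Hypothesis L0 : 0 < L.
Hypothesis ball_img : forall x, `|x - x0| < r -> img i x.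
Hypothesis bounds : forall x v, `|x - x0| < r ->
  `|v| <= L * gn (g i x) v /\ gn (g i x) v <= L * `|v|.

Lemma chart_upper x y a : `|x - x0| < r -> `|y - x0| < r -> L * `|y - x| < a ->
  dlt g (psi i x) (psi i y) a.
Proof.
move=> xr yr La; pose k s := x + step s *: (y - x).
have kr s : `|k s - x0| < r.
  have /andP[s0 s1] := step_itv s.
  have -> : k s - x0 = (1 - step s) *: (x - x0) + step s *: (y - x0).
    by rewrite /k; apply/matrixP => a' b; rewrite !(addmxE, oppmxE, scalemxE, addmxE, oppmxE); ring.
  apply: le_lt_trans (ler_normD _ _) _; rewrite !normrZ !ger0_norm ?subr_ge0 //.
  have [s2|s2] := lerP (step s) (1 / 2); nra.
have ki s : img i (k s) by apply: ball_img.
have dk (s : R) : is_derive s 1 k (step' s *: (y - x)).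
  apply: is_derive_rV => j; rewrite mxE.
  have -> : (fun s => k s 0 j) = (fun s => x 0 j + (y - x) 0 j * step s).
    by apply/funext => u; rewrite /k addmxE scalemxE mulrC.
  exact: (is_derive_compR (is_derive_affine _ _ _) (is_derive_step s)).
have ck : continuous k by move=> s; apply: derivable_curve_continuous; have [] := dk s.
pose c s := psi i (k s).
have cc : continuous c.
  move=> s; exact: (@cvg_comp _ _ _ k (psi i) _ _ _ (ck s) (psi_cont (ki s))).
have ci s : dom i (c s) by apply: psi_dom.
have phic : phi i \o c = k by apply/funext => s; rewrite /= psiK.
have velc s : vel i c s = step' s *: (y - x).
  by rewrite /vel phic derive1E; have [_ ->] := dk s.
have C1 : C1_curve c.
  apply: C1_from_chart => // s; exists i; split=> //.
    by apply: filterE => u; rewrite phic; have [] := dk u.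
  rewrite (_ : vel i c = fun s => step' s *: (y - x)); last exact/funext.
  by apply: cvgZr_tmp; exact: step'_continuous.
have z3 : (0 : R) <= 1 / 3 by lra. have z4 : (2 / 3 : R) <= 1 by lra.
have pc : is_path c.
  split=> // s s3; rewrite /c /k; first by rewrite !step_le.
  by rewrite !step_ge.
have [Phi dP] := path_arclength rg pc.
exists c, Phi; split=> //.
- by rewrite /c /k step_le // scale0r addr0.
- by rewrite /c /k step_ge // scale1r addrC subrK.
apply: le_lt_trans La.
have N := is_derive_scale (- (L * `|y - x|)).
have D (s : R) := is_deriveDR (dP s) (is_derive_compR (N (step s)) (is_derive_step s)).
have [u _] := mvt ler01 (fun s _ => D s).
rewrite /= (step_ge z4) (step_le z3) mulr1 mulr0 addr0 subr0 mulr1 => E.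
have : speed g c u + step' u * - (L * `|y - x|) <= 0.
  rewrite (speed_chart rg C1 (ci u)) velc gnZ ger0_norm ?step'_ge0 // psiK //.
  have [_ B] := bounds (y - x) (kr u).
  by have := ler_wpM2l (step'_ge0 u) B; rewrite mulrN subr_le0.
by rewrite -E; lra.
Qed.

Lemma path_near c Phi (s : R) : is_path c -> arclength g c Phi -> 0 <= s ->
  (forall u, 0 <= u <= s -> dom i (c u) /\ `|phi i (c u) - x0| < r) ->
  `|phi i (c s) - phi i (c 0)| <= L * (Phi s - Phi 0).
Proof.
move=> [C1 _ _] dP s0 H.
have P0 : 0 <= L * (Phi s - Phi 0).
  by apply: mulr_ge0; [exact: ltW|rewrite subr_ge0; exact: arclength_le dP _].
apply: row_norm_le => // j; rewrite addmxE oppmxE.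
have key (e : R) : `|e| = 1 -> e * (phi i (c s) 0 j - phi i (c 0) 0 j) <= L * (Phi s - Phi 0).
  move=> e1.
  have N := @is_derive_scale R.
  have D (u : R) : 0 <= u <= s -> is_derive u 1 (fun u => e * phi i (c u) 0 j + - L * Phi u)
      (vel i c u 0 j * e + speed g c u * - L).
    move=> /H[iu _]; have dv := is_derive_coord j (vel_is_derive C1 iu).
    exact: (is_deriveDR (is_derive_compR (N e _) dv) (is_derive_compR (N (- L) _) (dP u))).
  have [u us E] := mvt s0 D; have [iu ru] := H u us.
  have : vel i c u 0 j * e + speed g c u * - L <= 0.
    rewrite mulrN subr_le0 mulrC (speed_chart rg C1 iu).
    have [B _] := bounds (vel i c u) ru; rewrite [leRHS]mulrC; apply: le_trans B.
    by apply: le_trans (ler_norm _) _; rewrite normrM e1 mul1r; exact: coord_le_norm.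
  have : 0 <= s - 0 by rewrite subr0.
  by move=> h1 h2; have := mulr_le0_ge0 h2 h1; rewrite -E; lra.
have := key 1 (normr1 _); have := key (-1) (normrN1 _); rewrite mul1r mulN1r ler_norml => k1 k2.
by apply/andP; split; lra.
Qed.

(** While the path is in the ball, its coordinates move by at most [rho] and are confined to a
    smaller compact ball. At a limiting time they accumulate at a point of that ball, which [psi i]
    maps to [c s] because the manifold is Hausdorff; so the path does not leave the chart. *)
Lemma path_stays c Phi : is_path c -> arclength g c Phi -> dom i (c 0) ->
  `|phi i (c 0) - x0| + L * (Phi 1 - Phi 0) < r ->
  forall s, dom i (c s) /\ `|phi i (c s) - x0| < r.
Proof.
move=> pc dP i0 Hr; have [C1 c0 c1] := pc; have [cc _] := C1.
pose Q s := dom i (c s) /\ `|phi i (c s) - x0| < r.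
set rho := L * (Phi 1 - Phi 0) in Hr.
have rho0 : 0 <= rho by apply: mulr_ge0; [exact: ltW|rewrite subr_ge0; exact: arclength_le dP _].
have near (s : R) : 0 <= s <= 1 -> (forall u, 0 <= u <= s -> Q u) -> `|phi i (c s) - phi i (c 0)| <= rho.
  move=> /andP[s0 s1] H; apply: le_trans (path_near pc dP s0 H) _.
  by apply: ler_wpM2l; [exact: ltW|rewrite lerD2r; exact: arclength_le dP s1].
have inside y : `|y - phi i (c 0)| <= rho -> `|y - x0| < r.
  move=> yr; rewrite -(subrK (phi i (c 0)) y) -addrA; apply: le_lt_trans (ler_normD _ _) _; lra.
suff H (s : R) : 0 <= s <= 1 -> Q s.
  move=> s; have [s0|s0] := ltrP s 0.
    by rewrite (c0 s) ?(_ : c 0 = c 0) //; [apply: H; rewrite lexx ler01|lra].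
  have [s1|s1] := lerP s 1; first by apply: H; rewrite s0.
  by rewrite (c1 s); [apply: H; rewrite lexx ler01|lra].
apply: real_induction s.
- by split=> //; lra.
- move=> s /andP[s0 s1] H; have [|ic rs] := H s; first by rewrite s0 lexx.
  have N1 := curve_near_dom (cc s) ic.
  have c2 : {for s, continuous (fun u => phi i (c u))}.
    exact: (@cvg_comp _ _ _ c (phi i) _ _ _ (cc s) (phi_cont ic)).
  have N2 : \forall u \near s, `|phi i (c u) - x0| < r.
    have c3 : (fun u => `|phi i (c u) - x0|) @ s --> `|phi i (c s) - x0|.
      by apply: cvg_norm; apply: cvgB c2 _; exact: cvg_cst.
    exact: (@cvgr_lt _ _ _ _ _ _ c3 r rs).
  have /nbhs_ballP[d /= d0 Hd] : nbhs s Q by apply: filterS2 N1 N2.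
  exists d => // u /andP[su ud]; apply: Hd; rewrite /ball /= ltr_norml; apply/andP; split; lra.
- move=> s /andP[s0 s1] H.
  suff [y [iy yr ys]] : exists y, [/\ img i y, `|y - phi i (c 0)| <= rho & psi i y = c s].
    by rewrite /Q -ys psiK //; split; [exact: psi_dom|exact: inside].
  (* An ultrafilter of times tending to [s] from below, along which the coordinates converge in
     [K]. *)
  have [F [FU sF]] := ultraFilterLemma (at_left_proper_filter s).
  have Fs : F [set u | 0 <= u < s].
    apply: sF; have h0 := near_gt s0.
    rewrite /at_left /within /=; apply: filterS h0 => u u0 us.
    by rewrite us ltW.
  pose K : set X := [set y | `|y - phi i (c 0)| <= rho].
  have cK : compact K.
    apply: (@mx_bounded_closed_compact R 0 n K (rho + `|phi i (c 0)|)).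
      move=> y Ky a b; apply: le_trans (coord_le_norm y a b) _.
      by rewrite -(subrK (phi i (c 0)) y); apply: le_trans (ler_normD _ _) _; rewrite lerD2r.
    have -> : K = closed_ball_ Num.norm (phi i (c 0)) rho.
      by apply/seteqP; split => y; rewrite /K /closed_ball_ /= distrC.
    exact: closed_closed_ball_.
  have FK : F [set u | K (phi i (c u))].
    apply: filterS Fs => u /andP[u0 us]; apply: near; first by apply/andP; split; lra.
    by move=> v /andP[v0 vu]; apply: H; rewrite v0 (le_lt_trans vu).
  move: cK; rewrite compact_ultra => /(_ _ (ultra_fmap (fun u => phi i (c u)) FU) FK) [y [Ky Fy]].
  have iy : img i y by apply: ball_img; exact: inside.
  exists y; split=> //.
  have F1 : (fun u => psi i (phi i (c u))) @ F --> psi i y.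
    exact: (@cvg_comp _ _ _ (fun u => phi i (c u)) (psi i) _ _ _ Fy (psi_cont iy)).
  have F2 : c @ F --> c s.
    apply: cvg_trans (cc s); apply: cvg_app; apply: cvg_trans sF _.
    exact: cvg_within.
  have F3 : (fun u => psi i (phi i (c u))) @ F --> c s.
    apply: cvg_trans F2; apply: near_eq_cvg; apply: filterS Fs => u us.
    by have [iu _] := H u us; rewrite phiK.
  exact: (cvg_unique (@point_hausdorff _ _ M) F1 F3).
Qed.

Lemma chart_lower p q a : dlt g p q a -> dom i p -> `|phi i p - x0| + L * a <= r ->
  dom i q /\ `|phi i q - phi i p| < L * a.
Proof.
move=> [c [Phi [pc dP <- <- La]]] ip Hr.
have La' : L * (Phi 1 - Phi 0) < L * a by rewrite ltr_pM2l.
have H := path_stays pc dP ip (_ : _ < r).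
have H1 : forall s, dom i (c s) /\ `|phi i (c s) - x0| < r by apply: H; lra.
split; first by have [] := H1 1.
by apply: le_lt_trans (path_near pc dP ler01 (fun u _ => H1 u)) La'.
Qed.

End ChartBounds.

(** * The metric space of a Riemannian manifold, and the Hopf-Rinow theorem *)

Section MetricSpace.
Variables (R : realType) (n : nat) (M : manifold R n) (g : tensor2 M).
Hypothesis rg : riemannian g.
Implicit Types (p q z : M) (a b e : R).
Local Notation X := 'rV[R]_n.+1.

Definition good_ball i (x0 : X) (r L : R) := [/\ 0 < r, 0 < L,
  forall x, `|x - x0| < r -> img (M := M) i x &
  forall x v, `|x - x0| < r -> `|v| <= L * gn (g i x) v /\ gn (g i x) v <= L * `|v|].

Lemma riemannian_posdef i x : img i x -> posdef (g i x).
Proof. by have [_ _ pos _] := rg; move=> ix u; exact: pos. Qed.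

Lemma riemannian_cont i x : img i x -> forall j k : 'I_n.+1, {for x, continuous (fun y => g i y j k)}.
Proof.
have [sg _ _ _] := rg; move=> ix j k.
exact: (smooth_continuous (smooth_on_msmooth (@img_isopen _ _ _ i) (sg i) j k) ix).
Qed.

Lemma good_ball_exists i x0 : img i x0 -> exists r L, good_ball i x0 r L.
Proof.
move=> ix; have [_ sg _ _] := rg.
have [L L0 HL] := near_gn_bounds (riemannian_cont ix) (sg i x0 ix) (riemannian_posdef ix).
have N := near_open (@img_isopen _ _ _ i) ix.
have [r r0 key] : exists2 r, 0 < r & forall x, `|x - x0| < r -> img i x /\ forall v,
  `|v| <= L * gn (g i x) v /\ gn (g i x) v <= L * `|v| by apply: near_dist; apply: filterS2 N HL.
exists r, L; split=> [//|//|x /key[]//|x v /key[_ H]]; exact: H.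
Qed.

Lemma near_dlt p e : 0 < e -> \forall q \near p, dlt g p q e.
Proof.
move=> e0; set i := chart_at p; have ip : dom i p by exact: dom_chart_at.
have [r [L [r0 L0 bi bd]]] := good_ball_exists (phi_img ip).
have d0 : 0 < Num.min r (e / L) by rewrite lt_min r0 divr_gt0.
have /cvgrPdist_lt /(_ _ d0) := phi_cont ip.
have N := near_open (dom_open i) ip.
apply: filterS2 N => q iq; rewrite distrC lt_min => /andP[q1 q2].
have -> : dlt g p q e = dlt g (psi i (phi i p)) (psi i (phi i q)) e by rewrite !phiK.
apply: (chart_upper rg bi bd) => //.
  by rewrite subrr normr0.
by rewrite mulrC -ltr_pdivlMr.
Qed.

Lemma dlt_nbhs p (U : set M) : nbhs p U -> exists2 e, 0 < e & forall q, dlt g p q e -> U q.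
Proof.
move=> Up; set i := chart_at p; have ip : dom i p by exact: dom_chart_at.
have [r [L [r0 L0 bi bd]]] := good_ball_exists (phi_img ip).
have := psi_cont (phi_img ip); rewrite /prop_for /continuous_at phiK // => /(_ _ Up).
move=> /nbhs_ballP[d /= d0 Hd].
exists (Num.min r d / L); first by rewrite divr_gt0 // lt_min r0.
move=> q pq; have [|iq] := chart_lower rg L0 bi bd pq ip.
  by rewrite subrr normr0 add0r mulrC divfK ?gt_eqF // ge_min lexx.
rewrite [L * _]mulrC divfK ?gt_eqF // lt_min => /andP[_ qd].
by rewrite -(phiK iq); apply: Hd; rewrite -ball_normE /= distrC.
Qed.

(** Distance at most [a]. Since no minimizing curve is at hand, an arbitrarily small excess is
    allowed. *)
Definition dle p q a := forall e, 0 < e -> dlt g p q (a + e).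

Lemma dlt_dle p q a : dlt g p q a -> dle p q a.
Proof. by move=> pq e e0; apply: dlt_mono pq; rewrite lerDl ltW. Qed.

Lemma dle_dlt p q a b : dle p q a -> a < b -> dlt g p q b.
Proof. by move=> H ab; have := H (b - a); rewrite subr_gt0 addrC subrK; exact. Qed.

Lemma dle_ge0 p q a : dle p q a -> 0 <= a.
Proof. by move=> H; apply/ler_addgt0Pr => e /H /dlt_gt0 /ltW. Qed.

Lemma dle_mono p q a b : a <= b -> dle p q a -> dle p q b.
Proof. by move=> ab H e e0; apply: dlt_mono (H e e0); rewrite lerD2r. Qed.

Lemma dle0 p q : dle p q 0 -> p = q.
Proof.
move=> H; apply: (point_hausdorff (m := M)) => A B /dlt_nbhs[e e0 eA] /nbhs_singleton Bq.
by exists q; split=> //; apply: eA; have := H e e0; rewrite add0r.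
Qed.

(** Relative compactness: the limit may lie outside [A]. *)
Definition ultra_precompact (A : set M) := forall F : set_system M, UltraFilter F -> F A ->
  exists l : M, F --> l.

Lemma precompact_sub (A B : set M) : A `<=` B -> ultra_precompact B -> ultra_precompact A.
Proof. by move=> AB HB F FU FA; apply: HB; exact: filterS FA. Qed.

Lemma precompact_small p : exists2 e, 0 < e & ultra_precompact [set q | dlt g p q e].
Proof.
set i := chart_at p; have ip : dom i p by exact: dom_chart_at.
have [r [L [r0 L0 bi bd]]] := good_ball_exists (phi_img ip).
exists (r / 2 / L); first by rewrite !divr_gt0.
move=> F FU FA.
pose K : set X := [set y | `|y - phi i p| <= r / 2].
have cK : compact K.
  apply: (@mx_bounded_closed_compact R 0 n K (r / 2 + `|phi i p|)).
    move=> y Ky a b; apply: le_trans (coord_le_norm y a b) _.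
    by rewrite -(subrK (phi i p) y); apply: le_trans (ler_normD _ _) _; rewrite lerD2r.
  have -> : K = closed_ball_ Num.norm (phi i p) (r / 2).
    by apply/seteqP; split => y; rewrite /K /closed_ball_ /= distrC.
  exact: closed_closed_ball_.
have FK : F [set q | dom i q /\ K (phi i q)].
  apply: filterS FA => q pq; have [|iq] := chart_lower rg L0 bi bd pq ip.
    by rewrite subrr normr0 add0r mulrC divfK ?gt_eqF //; lra.
  by rewrite [L * _]mulrC divfK ?gt_eqF // => /ltW; split.
have FK' : F [set q | K (phi i q)] by apply: filterS FK => q [].
move: cK; rewrite compact_ultra => /(_ _ (ultra_fmap (phi i) FU) FK') [y [Ky Fy]].
have iy : img i y by apply: bi; apply: le_lt_trans Ky _; lra.
exists (psi i y).
have F1 : (fun q => psi i (phi i q)) @ F --> psi i y.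
  exact: (@cvg_comp _ _ _ (phi i) (psi i) _ _ _ Fy (psi_cont iy)).
move=> A nA; have FA' : F [set q | A (psi i (phi i q))] := F1 A nA.
by apply: filterS2 FA' FK => q /= + [iq _]; rewrite phiK.
Qed.

Lemma dlt_split p q b c : 0 < b -> 0 < c -> dlt g p q (b + c) ->
  exists z, dlt g p z b /\ dlt g z q c.
Proof.
move=> b0 c0 [k [Phi [pk dP <- <- La]]]; have [C1 _ _] := pk.
have bc : 0 < b + c by rewrite addr_gt0.
set l := Phi 1 - Phi 0 in La.
have l0 : 0 <= l by rewrite subr_ge0; exact: arclength_le dP _.
have [s /[!in_itv]/= /andP[s0 s1] Es] : exists2 s, s \in `[0, 1] & Phi s = Phi 0 + l * (b / (b + c)).
  have b1 : b / (b + c) <= 1 by rewrite ler_pdivrMr // mul1r lerDl ltW.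
  have b2 : 0 <= b / (b + c) by rewrite divr_ge0 // ltW.
  apply: IVT => //.
    by apply: derivable_within_continuous => x _; have [] := dP x.
  rewrite min_l ?max_r; [|by rewrite -subr_ge0 -/l..].
  rewrite lerDl mulr_ge0 //=; apply: le_trans (_ : Phi 0 + l * 1 <= _); last by rewrite /l; lra.
  by rewrite lerD2l; apply: ler_wpM2l.
have lb : l * (b / (b + c)) < b by rewrite mulrA ltr_pdivrMr // mulrC ltr_pM2l.
have lc : l * (c / (b + c)) < c by rewrite mulrA ltr_pdivrMr // mulrC ltr_pM2l.
have lbc : l * (b / (b + c)) + l * (c / (b + c)) = l.
  by rewrite -mulrDr -mulrDl divff ?mulr1 // gt_eqF.
exists (k s); split.
  have [k' [P' [? ? ? ? E]]] := reparametrize rg C1 s0 (fun x _ => dP x).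
  by exists k', P'; split=> //; rewrite E Es; lra.
have [k' [P' [? ? ? ? E]]] := reparametrize rg C1 s1 (fun x _ => dP x).
by exists k', P'; split=> //; rewrite E; have -> : Phi 1 - Phi s = l * (c / (b + c)) by rewrite Es -[in RHS]/l; move: lbc; rewrite {3}/l; lra.
Qed.

Section Complete.
Hypothesis complete_g : riem_complete g.

(** Every point of the ball is within rho / 4 of some point of the concentric ball of radius 3 rho /
    4. If the latter were precompact, the nearby points would converge to some [l], and the ball of
    radius 3 rho / 4 around [l] would carry the ultrafilter. *)
Let not_precompact_step x rho : 0 < rho -> ~ ultra_precompact [set q | dlt g x q rho] ->
  exists y, dlt g x y rho /\ ~ ultra_precompact [set q | dlt g y q (rho * (3 / 4))].
Proof.
move=> r0 NG; apply: contrapT => H.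
have G y : dlt g x y rho -> ultra_precompact [set q | dlt g y q (rho * (3 / 4))].
  by move=> xy; apply: contrapT => Gy; apply: H; exists y.
apply: NG => F FU FA.
have H1 w : exists z, dlt g x w rho -> dlt g x z (rho * (3 / 4)) /\ dlt g z w (rho * (1 / 4)).
  have [xw|xw] := pselect (dlt g x w rho); last by exists w.
  have [|||z [h1 h2]] := @dlt_split x w (rho * (3 / 4)) (rho * (1 / 4)).
  - by rewrite mulr_gt0.
  - by rewrite mulr_gt0.
  - by rewrite -mulrDr (_ : 3 / 4 + 1 / 4 = 1) ?mulr1 //; field.
  by exists z.
have [z Hz] := choice H1.
have Fz : F [set w | dlt g x (z w) (rho * (3 / 4))] by apply: filterS FA => w /Hz[].
have [l Fl] := G x (dlt_refl g x r0) _ (ultra_fmap z FU) Fz.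
have r8 : 0 < rho * (1 / 8) by rewrite mulr_gt0.
have Nl : F [set w | dlt g l (z w) (rho * (1 / 8))] := Fl _ (near_dlt l r8).
have xl : dlt g x l rho.
  have [w [h1 h2]] := filter_ex (filterI Fz Nl).
  apply: (dlt_mono _ (dlt_trans rg h1 (dlt_sym rg h2))); lra.
apply: (G l xl F FU); apply: filterS2 FA Nl => w /Hz[_ h1] h2.
by apply: (dlt_mono _ (dlt_trans rg h2 h1)); lra.
Qed.

(** No geodesics are needed: a ball that fails to be precompact contains the center of a failing
    ball 3/4 as large. The centers form a Cauchy sequence, and small balls around its limit are
    precompact, a contradiction. *)
Lemma hopf_rinow p a : ultra_precompact [set q | dlt g p q a].
Proof.
have [a0|a0] := ltrP 0 a; last first.
  move=> F FU FA.
  by have [q /dlt_gt0] := filter_ex FA; rewrite ltNge a0.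
apply: contrapT => NG.
pose rho k := a * (3 / 4) ^+ k.
have rho0 k : 0 < rho k by rewrite mulr_gt0 // exprn_gt0.
have st (kx : nat * M) : exists y, ~ ultra_precompact [set q | dlt g kx.2 q (rho kx.1)] ->
    dlt g kx.2 y (rho kx.1) /\ ~ ultra_precompact [set q | dlt g y q (rho kx.1.+1)].
  have [G|G] := pselect (ultra_precompact [set q | dlt g kx.2 q (rho kx.1)]); first by exists p.
  have [y Hy] := not_precompact_step (rho0 kx.1) G; exists y => _.
  by have -> : rho kx.1.+1 = rho kx.1 * (3 / 4) by rewrite /rho exprS; ring.
have [f Hf] := choice st.
pose u := fix u k := if k is k'.+1 then f (k', u k') else p.
have NGu k : ~ ultra_precompact [set q | dlt g (u k) q (rho k)].
  elim: k => [|k IH]; first by rewrite /rho expr0 mulr1.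
  by have [] := Hf (k, u k) IH.
have du k : dlt g (u k) (u k.+1) (rho k) by have [] := Hf (k, u k) (NGu k).
(* 4 is the sum of the geometric series of ratio 3/4. *)
have dkl k l : dlt g (u k) (u (k + l)%N) (4 * rho k).
  elim: l k => [|l IH] k; first by rewrite addn0; apply: dlt_refl; rewrite mulr_gt0.
  have := dlt_trans rg (du k) (IH k.+1); rewrite addSnnS; apply: dlt_mono.
  by rewrite /rho exprSr; have := rho0 k; rewrite /rho; lra.
have rho_small e : 0 < e -> exists N, forall k, (N <= k)%N -> rho k < e.
  move=> e0; have : (fun k => a * (3 / 4) ^+ k) @ \oo --> a * 0.
    by apply: cvgMr; apply: cvg_expr; rewrite ger0_norm; lra.
  rewrite mulr0 => /cvgrPdist_lt /(_ e e0) [N _ HN]; exists N => k /HN /=.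
  by rewrite sub0r normrN; apply: le_lt_trans; exact: ler_norm.
have [|q Hq] := dlt_complete rg complete_g (u := u).
  move=> e e0; have e8 : 0 < e / 8 by rewrite divr_gt0.
  have [N HN] := rho_small _ e8; exists N => k l kN lN.
  have key k' l' : (N <= k')%N -> (k' <= l')%N -> dlt g (u k') (u l') e.
    move=> k'N kl; have := dkl k' (l' - k')%N; rewrite subnKC //; apply: dlt_mono.
    by have := HN k' k'N; lra.
  by have [kl|/ltnW lk] := leqP k l; [exact: key|exact/(dlt_sym rg)/key].
have [e e0 Ge] := precompact_small q.
have e2 : 0 < e / 2 by rewrite divr_gt0.
have [N1 H1] := rho_small _ e2; have [N2 H2] := Hq _ e2.
apply: (NGu (maxn N1 N2)); apply: precompact_sub Ge => w kw /=.
have := dlt_trans rg (dlt_sym rg (H2 _ (leq_maxr N1 N2))) kw; apply: dlt_mono.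
by have := H1 _ (leq_maxl N1 N2); lra.
Qed.

Lemma ultra_dle (F : set_system M) l p a : ProperFilter F -> F --> l ->
  (forall e, 0 < e -> F [set q | dlt g p q (a + e)]) -> dle p l a.
Proof.
move=> FF Fl H e e0; have e2 : 0 < e / 2 by rewrite divr_gt0.
have [q [h1 h2]] := filter_ex (filterI (H _ e2) (Fl _ (near_dlt l e2))).
by apply: (dlt_mono _ (dlt_trans rg h1 (dlt_sym rg h2))); lra.
Qed.

Lemma closed_ball_compact p a : compact [set q | dle p q a].
Proof.
rewrite compact_ultra => F FU FA; have FF : ProperFilter F by exact: ultra_proper.
have [|l Fl] := @hopf_rinow p (a + 1) F FU.
  by apply: filterS FA => q /(_ 1 ltr01).
exists l; split=> //; apply: (ultra_dle FF Fl) => e e0.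
by apply: filterS FA => q; exact.
Qed.

(** For every excess [e] there is a point at almost the required distances; these points stay in a
    precompact ball, and their limit as [e] tends to 0 satisfies both bounds exactly. *)
Lemma dle_split p q b c : 0 <= b -> 0 <= c -> dle p q (b + c) ->
  exists z, dle p z b /\ dle z q c.
Proof.
move=> b0 c0 H.
have H1 e : exists z, 0 < e -> dlt g p z (b + e) /\ dlt g z q (c + e).
  have [e0|e0] := ltrP 0 e; last by exists p.
  have [|||z Hz] := @dlt_split p q (b + e) (c + e); [lra|lra| |by exists z].
  by rewrite addrACA; apply: H; lra.
have [z Hz] := choice H1.
have [G [GU sG]] := ultraFilterLemma (at_right_proper_filter (0 : R)).
have Ge e : 0 < e -> G [set x | 0 < x < e].
  move=> e0; apply: sG; rewrite /at_right /within /=.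
  by apply: filterS (near_lt e0) => x xe x0; rewrite x0.
have G1 : G [set x | dlt g p (z x) (b + 1)].
  by apply: filterS (Ge 1 ltr01) => x /andP[x0 x1] /=; apply: (dlt_mono _ (Hz x x0).1); lra.
have [l Gl] := @hopf_rinow p (b + 1) _ (ultra_fmap z GU) G1.
have zG : ProperFilter (z @ G) by exact: fmap_proper_filter.
exists l; split.
  apply: (ultra_dle zG Gl) => e e0; suff : G [set x | dlt g p (z x) (b + e)] by [].
  apply: filterS (Ge e e0) => x /andP[x0 x1] /=.
  by apply: (dlt_mono _ (Hz x x0).1); lra.
suff H2 : dle q l c by move=> e /H2 /(dlt_sym rg).
apply: (ultra_dle zG Gl) => e e0; suff : G [set x | dlt g q (z x) (c + e)] by [].
apply: filterS (Ge e e0) => x /andP[x0 x1] /=.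
by apply: (dlt_mono _ (dlt_sym rg (Hz x x0).2)); lra.
Qed.

End Complete.
End MetricSpace.

(** * The flow near a point of space-time *)

Section Germs.
Variables (R : realType) (V : normedModType R) (m : nat) (eps : 'I_m -> V).
Variables (U : set V) (G G' : V -> 'M[R]_m).
Hypotheses (oU : open U) (GG : forall x, U x -> G x = G' x).

Lemma Gam_ext a x : U x -> Gam eps G a x = Gam eps G' a x.
Proof.
move=> Ux; rewrite !GamE GG //; congr (_ *m _); apply/matrixP => b d.
by rewrite !mxE !(dmx_ext _ oU GG Ux).
Qed.

Lemma Rc_ext a b x : U x -> Rc eps G a b x = Rc eps G' a b x.
Proof.
move=> Ux; rewrite !RcE !Gam_ext //.
by rewrite (dmx_ext _ oU (Gam_ext b) Ux) (dmx_ext _ oU (Gam_ext a) Ux).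
Qed.

Lemma Ric_ext x : U x -> Ric eps G x = Ric eps G' x.
Proof.
by move=> Ux; apply/matrixP => b d; rewrite !mxE; apply: eq_bigr => a _; rewrite Rc_ext.
Qed.

End Germs.

Section Flow.
Variables (R : realType) (n : nat) (M : manifold R n) (g : R -> tensor2 M).
Hypothesis ancient : complete_ancient_ricci_flow g.
Local Notation ST := ('rV[R]_n.+1 * R)%type.
Local Notation sdir := (@sdir R n).
Local Notation tdir := (@tdir R n).
Local Notation xdir := (@xdir R n).

Lemma flow_riemannian t : t <= 0 -> riemannian (g t).
Proof. by have [H _ _] := ancient; move=> /H[]. Qed.

Lemma flow_complete t : t <= 0 -> riem_complete (g t).
Proof. by have [H _ _] := ancient; move=> /H[]. Qed.

Lemma riemannian_metric_on (g' : tensor2 M) i : riemannian g' -> metric_on (img i) (g' i).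
Proof.
move=> rg; have [sg symg pos _] := rg; have oi := @img_isopen _ _ M i.
split=> // [|x ix|x ix]; [exact: smooth_on_msmooth|exact: symg|].
rewrite unitmxE unitfE; apply/det0P => -[v v0 vG].
by have := pos i x ix v v0; rewrite vG mul0mx mxE ltxx.
Qed.

(** At time 0 the metrics are given on one side only. [H] lives on an open set of space-time, where
    the calculus applies, but is tied to [g] and to the flow equation only at nonpositive times. *)
Definition flow_ext i (U : set ST) (H : ST -> 'M[R]_n.+1) :=
  [/\ metric_on U H, forall z, U z -> img i z.1,
      forall z, U z -> z.2 <= 0 -> H z = g z.2 i z.1 &
      forall z, U z -> z.2 <= 0 -> dmx tdir H z = (-2) *: Ric sdir H z].

Let past_filter (t : R) := within [set s : R | s <= 0] t^'.

Let past_proper t : t <= 0 -> ProperFilter (past_filter t).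
Proof.
move=> t0; have FF : Filter (past_filter t) by exact: within_filter.
apply: Build_ProperFilter; rewrite /past_filter /within /dnbhs /= => /nbhs_ballP[e /= e0 He].
apply: (He (t - e / 2)).
- rewrite -ball_normE /= opprB addrCA subrr addr0 gtr0_norm; lra.
- by apply/eqP => E; lra.
- by rewrite /=; lra.
Qed.

Lemma flow_Ric t i x : t <= 0 -> img i x -> ricci (g t i) x = Ric xdir (g t i) x.
Proof. by move=> t0 ix; apply: (ricciE (riemannian_metric_on i (flow_riemannian t0))). Qed.

Lemma flow_slice_eq i (U : set ST) (H : ST -> 'M[R]_n.+1) t : open U -> t <= 0 ->
  (forall z, U z -> z.2 <= 0 -> H z = g z.2 i z.1) ->
  forall x, U (x, t) -> Gam xdir (g t i) ^~ x = Gam sdir H ^~ (x, t) /\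
    Ric xdir (g t i) x = Ric sdir H (x, t).
Proof.
move=> oU t0 HE x Ux; have oS := open_slice (t := t) oU.
have E y : [set y | U (y, t)] y -> g t i y = H (y, t) by move=> Uy; rewrite HE.
split; last by rewrite (Ric_ext xdir oS E Ux) Ric_slice.
by apply/funext => a; rewrite (Gam_ext xdir oS E a Ux) Gam_slice.
Qed.

Lemma flow_extension i x0 t0 : img i x0 -> t0 <= 0 ->
  exists U H, flow_ext i U H /\ U (x0, t0).
Proof.
move=> ix t00; have [_ sg dg] := ancient.
have [U [h [oU Uz Ch hE]]] := sg i (x0, t0) (conj ix t00).
have sh : msmooth U h by move=> a b k; exact: (Ck_open_entry _ _ oU (Ch k)).
(* A smooth extension of a symmetric family need not be symmetric at positive times. *)
pose H z := 2^-1 *: (h z + (h z)^T).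
have sH : msmooth U H.
  apply: msmoothZ => //; first exact: smooth_cst.
  by apply: msmoothD => //; exact: msmoothT.
pose W : set ST := [set z | [/\ U z, img i z.1 & \det (H z) != 0]].
have HE z : W z -> z.2 <= 0 -> H z = g z.2 i z.1.
  move=> [Uw iw _] z0; have E : h z = g z.2 i z.1 by apply: hE.
  have [_ sy _ _] := flow_riemannian z0.
  rewrite /H E sy //; apply/matrixP => a b; rewrite scalemxE addmxE; lra.
have oW : open W.
  rewrite openE => z [Uw iw dw].
  have N1 := near_open oU Uw.
  have N2 : nbhs z (fun z => img i z.1).
    have c1 : (fun z : ST => z.1) @ z --> z.1 by exact: cvg_fst.
    exact: (c1 _ (near_open (@img_isopen _ _ M i) iw)).
  have N3 : nbhs z (fun z => \det (H z) != 0).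
    exact: cvgr_neq0 (smooth_continuous (smooth_det oU sH) Uw) dw.
  by apply: filterS3 N1 N2 N3.
have WU : W `<=` U by move=> z [].
have mH : metric_on W H.
  split=> // [|z [_ _]|z [_ _ dz]]; first exact: msmooth_sub sH.
    by move=> _; rewrite /H trmxZ trmxD trmxK addrC.
  by rewrite unitmxE unitfE.
exists W, H; split; last first.
  split=> //=; have gu := (riemannian_metric_on i (flow_riemannian t00)).
  have [_ sy _ _] := flow_riemannian t00; have [_ _ _ ug] := gu.
  have E : h (x0, t0) = g t0 i x0 by apply: hE.
  have -> : H (x0, t0) = g t0 i x0.
    rewrite /H E sy //; apply/matrixP => a b; rewrite scalemxE addmxE; lra.
  by rewrite -unitfE -unitmxE; exact: ug.
split=> // [z []//|[x t] Wz /= tn].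
have [_ ix' _] := Wz; have [_ RicE] := flow_slice_eq oW tn HE Wz.
have PF := past_proper tn.
rewrite -RicE -flow_Ric //; have dgz := dg t tn i x ix'.
apply/matrixP => a b.
have L1 : (fun s : R => (s - t)^-1 * (g s i x a b - g t i x a b)) @ past_filter t --> ((-2) *: ricci (g t i) x) a b.
  have := @cvg_comp _ _ _ _ (fun A : 'M[R]_n.+1 => A a b) _ _ _ dgz (@coord_continuous _ _ _ a b _).
  apply: cvg_trans; apply: near_eq_cvg; apply: filterE => s /=.
  by rewrite scalemxE addmxE oppmxE.
(* The two-sided time derivative of [H] is also the limit over nonpositive times, where [H] is the
   flow; limits are unique. *)
have L2 : (fun s : R => (s - t)^-1 * (g s i x a b - g t i x a b)) @ past_filter t --> dmx tdir H (x, t) a b.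
  have [dH <-] := dmx_is_derive tdir a b (msmooth_sub WU sH) Wz.
  have c1 : (fun s : R => s - t) @ past_filter t --> (0 : R)^'.
    move=> A; rewrite /dnbhs /= => /nbhs_ballP[e /= e0 He].
    rewrite /past_filter /within /dnbhs /=; apply/nbhs_ballP; exists e => //= s st snt s0.
    by apply: He; rewrite ?subr_eq0 // -ball_normE /= sub0r opprB.
  have := @cvg_comp _ _ _ (fun s : R => s - t) (fun k : R => k^-1 *: (((fun z => H z a b) \o shift (x, t)) (k *: tdir) - H (x, t) a b)) _ _ _ c1 dH.
  apply: cvg_trans; apply: near_eq_cvg.
  have NW : \forall s \near t, W (x, s).
    have /nbhs_ballP[e /= e0 He] := near_open oW Wz.
    by apply/nbhs_ballP; exists e => // s ts; apply: He; split => //; exact: ballxx.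
  rewrite /past_filter /within /dnbhs /=; apply: filterS NW => s Ws snt s0 /=.
  have -> : (s - t) *: tdir + (x, t) = (x, s) :> ST.
    by apply/pair_equal_spec; split; rewrite /= ?scaler0 ?add0r // [_ *: 1]mulr1 subrK.
  by rewrite !HE.
exact: (cvg_unique (@norm_hausdorff _ _) L2 L1).
Qed.

End Flow.

(** * Second variation: the metric seen by a displaced path *)

Section SpaceTimeMaps.
Variables (R : realType) (n : nat) (V : normedModType R).
Local Notation X := 'rV[R]_n.+1.
Local Notation ST := ('rV[R]_n.+1 * R)%type.
Variables (O : set V) (U : set ST) (f1 : V -> X) (f2 : V -> R).
Hypotheses (oO : open O) (oU : open U) (s1 : msmooth O f1) (s2 : smooth O f2).

Let fcoord_smooth i : smooth O (fun z => fcoord (ST_fbasis R n) i (f1 z, f2 z)).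
Proof. by rewrite /=; case: fintype.split => j /=; [exact: (s1 0 j)|exact: s2]. Qed.

Lemma ST_continuous z : O z -> {for z, continuous (fun z => (f1 z, f2 z) : ST)}.
Proof.
move=> Oz; apply: (continuous_fcoord (fb := ST_fbasis R n)) => i.
exact: smooth_continuous (fcoord_smooth i) Oz.
Qed.

Lemma ST_comp_smooth p q (F : ST -> 'M[R]_(p, q)) : msmooth U F ->
  (forall z, O z -> U (f1 z, f2 z)) -> msmooth O (fun z => F (f1 z, f2 z)).
Proof.
by move=> sF OU; apply: (msmooth_comp (fb := ST_fbasis R n) oO oU sF OU); exact: fcoord_smooth.
Qed.

Lemma ST_chain p q (F : ST -> 'M[R]_(p, q)) z v : msmooth U F -> O z -> U (f1 z, f2 z) ->
  dmx v (fun z => F (f1 z, f2 z)) z =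
  \sum_b dmx v f1 z 0 b *: dmx (@sdir R n b) F (f1 z, f2 z) + 'D_v f2 z *: dmx (@tdir R n) F (f1 z, f2 z).
Proof.
move=> sF Oz Uz.
have D i : is_derive z v (fun y => fcoord (ST_fbasis R n) i (f1 y, f2 y))
    (match fintype.split i with inl j => dmx v f1 z 0 j | inr j => 'D_v f2 z end).
  rewrite /=; case: fintype.split => j /=.
    exact: (dmx_is_derive v 0 j s1 Oz).
  exact: (smooth_is_derive v s2 Oz).
rewrite (dmx_comp oU sF Uz D (ST_continuous Oz)) big_split_ord /= big_ord1; congr (_ + _).
  by apply: eq_bigr => b _; rewrite (unsplitK (inl b)).
by rewrite (unsplitK (inr ord0)).
Qed.

End SpaceTimeMaps.

Section MovedMetric.
Variables (R : realType) (n : nat).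
Local Notation X := 'rV[R]_n.+1.
Local Notation ST := ('rV[R]_n.+1 * R)%type.
Local Notation sdir := (@sdir R n).
Local Notation V := (('rV[R]_n.+1 * R) * 'rV[R]_n.+1)%type.
Definition V_fbasis : fbasis V := prod_fbasis (ST_fbasis R n) (rV_fbasis R n).
Variables (U : set ST) (H : ST -> 'M[R]_n.+1) (q : X) (t0 : R).
Hypothesis mH : metric_on U H.
Hypothesis Uq : U (q, t0).

Definition wdir (Y : X) : V := (0, Y).
Definition ldir (a : 'I_n.+1) : V := (sdir a, 0).

Let oU : open U. Proof. by have [] := mH. Qed.

Lemma msmooth_V1 (W : set V) : open W -> msmooth W (fun z : V => z.1.1).
Proof.
move=> oW i a; rewrite ord1.
have := smooth_fcoord (fb := V_fbasis) (lshift n.+1 (lshift 1 a)) oW.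
by rewrite /= (unsplitK (inl _)) /= (unsplitK (inl _)).
Qed.

Lemma smooth_V2 (W : set V) : open W -> smooth W (fun z : V => z.1.2).
Proof.
move=> oW; have := smooth_fcoord (fb := V_fbasis) (lshift n.+1 (rshift n.+1 ord0)) oW.
by rewrite /= (unsplitK (inl _)) /= (unsplitK (inr _)).
Qed.

Lemma msmooth_V3 (W : set V) : open W -> msmooth W (fun z : V => z.2).
Proof.
move=> oW i a; rewrite ord1.
have := smooth_fcoord (fb := V_fbasis) (rshift (n.+1 + 1) a) oW.
by rewrite /= (unsplitK (inr _)).
Qed.

Lemma dmx_V1 (v z : V) : dmx v (fun z : V => z.1.1) z = v.1.1.
Proof.
apply: dmx_eq => i a; apply: (@is_derive_lin _ _ (fun z : V => z.1.1 i a)).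
by move=> c u w; rewrite /= !mxE.
Qed.

Lemma derive_V2 (v z : V) : 'D_v (fun z : V => z.1.2) z = v.1.2.
Proof.
by have [] : is_derive z v (fun z : V => z.1.2) v.1.2
  by apply: (@is_derive_lin _ _ (fun z : V => z.1.2)).
Qed.

Lemma dmx_V3 (v z : V) : dmx v (fun z : V => z.2) z = v.2.
Proof.
apply: dmx_eq => i a; apply: (@is_derive_lin _ _ (fun z : V => z.2 i a)).
by move=> c u w; rewrite /= !mxE.
Qed.

Let Gq c := Gam sdir H c (q, t0).
Let Gx c (z : V) := Gam sdir H c (z.1.1, t0).

(* The field with value w at q whose covariant derivative vanishes at q. *)
Definition field_mx (x : X) : 'M[R]_n.+1 := 1%:M - \sum_a (x - q) 0 a *: Gam sdir H a (q, t0).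
Let B (z : V) := field_mx z.1.1.
Let S (f g : V -> X) (z : V) : X := \sum_c (f z *m B z) 0 c *: (g z *m B z *m Gx c z).
(** The point [z.1.1] is displaced by the second order exponential, at time t0, of the field that
    has value [z.2] at [q] and is parallel there. The time [z.1.2] does not influence the
    displacement; it selects the metric in [shifted_metric]. *)
Definition shifted (z : V) : X :=
  moved (fun c => Gam sdir H c (z.1.1, t0)) z.1.1 (z.2 *m field_mx z.1.1).

Let w3 (z : V) : X := z.2.
Let Psi := shifted.

Let O1 : set V := [set z | U (z.1.1, t0)].

Let oT : open (setT : set V). Proof. exact: openT. Qed.

Let oO1 : open O1.
Proof.
rewrite openE => z Uz.
have c := ST_continuous (msmooth_V1 oT) (smooth_cst t0 oT) (I : setT z).
exact: (c _ (near_open oU Uz)).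
Qed.

Let sGx c : msmooth O1 (Gx c).
Proof.
exact: (ST_comp_smooth oO1 oU (msmooth_V1 oO1) (smooth_cst t0 oO1) (Gam_msmooth sdir mH c)).
Qed.

Let dGx v c z : O1 z -> dmx v (Gx c) z = \sum_b v.1.1 0 b *: dmx (sdir b) (Gam sdir H c) (z.1.1, t0).
Proof.
move=> Oz; rewrite (ST_chain oU (msmooth_V1 oO1) (smooth_cst t0 oO1) v (Gam_msmooth sdir mH c) Oz Oz).
rewrite (_ : 'D_v _ z = 0); last exact: derive_cst.
by rewrite scale0r addr0 dmx_V1.
Qed.

Let sB : msmooth setT B.
Proof.
apply: msmoothB => //; first exact: msmooth_cst.
apply: msmooth_sum => // a; apply: msmoothZ => //; last exact: msmooth_cst.
by apply: msmoothB; [|exact: msmooth_V1|exact: msmooth_cst].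
Qed.

Let dB v z : dmx v B z = - \sum_a v.1.1 0 a *: Gq a.
Proof.
have Tz : (setT : set V) z by [].
have s0 : msmooth setT (fun z : V => z.1.1 - q) by apply: msmoothB; [|exact: msmooth_V1|exact: msmooth_cst].
have s1 a : smooth setT (fun z : V => (z.1.1 - q) 0 a) by exact: (s0 0 a).
have s2 a : msmooth setT (fun z : V => (z.1.1 - q) 0 a *: Gq a) by apply: msmoothZ => //; exact: msmooth_cst.
have s3 : msmooth setT (fun _ : V => 1%:M : 'M[R]_n.+1) by exact: msmooth_cst.
rewrite (dmxB _ oT s3 (msmooth_sum _ oT s2) Tz) dmx_cst sub0r (dmx_sum _ _ s2 Tz).
congr (- _); apply: eq_bigr => a _.
rewrite (dmxZ _ (s1 a) (msmooth_cst (Gq a) oT) Tz) dmx_cst scaler0 addr0 -dmxE.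
rewrite (dmxB _ oT (msmooth_V1 oT) (msmooth_cst q oT) Tz) dmx_V1 dmx_cst.
by rewrite subr0.
Qed.

Let sB1 : msmooth O1 B. Proof. exact: msmooth_sub (subsetT O1) sB. Qed.

Let sfB (f : V -> X) : msmooth O1 f -> msmooth O1 (fun z => f z *m B z).
Proof. by move=> sf; apply: msmoothM. Qed.

Let sS f g : msmooth O1 f -> msmooth O1 g -> msmooth O1 (S f g).
Proof.
move=> sf sg; apply: msmooth_sum => // c; apply: msmoothZ => //; first exact: (sfB sf 0 c).
by apply: msmoothM => //; exact: sfB.
Qed.

Let dS v f g z : msmooth O1 f -> msmooth O1 g -> O1 z ->
  dmx v (S f g) z = \sum_c ((dmx v f z *m B z + f z *m dmx v B z) 0 c *: (g z *m B z *m Gx c z)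
   + (f z *m B z) 0 c *: ((dmx v g z *m B z + g z *m dmx v B z) *m Gx c z
       + g z *m B z *m dmx v (Gx c) z)).
Proof.
move=> sf sg Oz; rewrite (dmx_sum _ _ _ Oz); last first.
  move=> c; apply: msmoothZ => //; first exact: (sfB sf 0 c).
  by apply: msmoothM => //; exact: sfB.
apply: eq_bigr => c _.
rewrite (dmxZ _ (sfB sf 0 c) (msmoothM oO1 (sfB sg) (sGx c)) Oz) -dmxE.
by rewrite (dmxM _ sf sB1 Oz) (dmxM _ (sfB sg) (sGx c) Oz) (dmxM _ sg sB1 Oz).
Qed.

Let sw : msmooth O1 w3. Proof. exact: msmooth_V3. Qed.
Let sY (Y : X) : msmooth O1 (fun _ : V => Y). Proof. exact: msmooth_cst. Qed.

Let sPsi : msmooth O1 Psi.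
Proof.
apply: msmoothB => //; first by apply: msmoothD => //; [exact: msmooth_V1|exact: sfB].
by apply: msmoothZ => //; [exact: smooth_cst|exact: sS].
Qed.

Lemma shifted_smooth : msmooth [set z : V | U (z.1.1, t0)] shifted.
Proof. exact: sPsi. Qed.

Let dPsi v z : O1 z -> dmx v Psi z =
  v.1.1 + (v.2 *m B z + z.2 *m dmx v B z) - 2^-1 *: dmx v (S w3 w3) z.
Proof.
move=> Oz; have s1 := msmooth_V1 oO1; have s2 := sfB sw; have s3 := sS sw sw.
have s5 : smooth O1 (fun _ : V => 2^-1 : R) by exact: smooth_cst.
rewrite (dmxB _ oO1 (msmoothD oO1 s1 s2) (msmoothZ oO1 s5 s3) Oz) (dmxD _ s1 s2 Oz) dmx_V1.
rewrite (dmxM _ sw sB1 Oz) dmx_V3 (dmxZ _ s5 s3 Oz) (_ : 'D_v _ z = 0); last exact: derive_cst.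
by rewrite scale0r add0r.
Qed.

Section WDirection.
Variable Y : X.
Let u := wdir Y.
Let cY : V -> X := fun _ => Y.

Let uB z : dmx u B z = 0.
Proof. by rewrite dB big1 ?oppr0 // => a _; rewrite mxE scale0r. Qed.

Let uGx c z : O1 z -> dmx u (Gx c) z = 0.
Proof. by move=> Oz; rewrite dGx // big1 // => a _; rewrite mxE scale0r. Qed.

Let uSww z : O1 z -> dmx u (S w3 w3) z = S cY w3 z + S w3 cY z.
Proof.
move=> Oz; rewrite dS // dmx_V3 uB /S -big_split; apply: eq_bigr => c _ /=.
by rewrite uGx // !mulmx0 !addr0.
Qed.

Let uSYw z : O1 z -> dmx u (S cY w3) z = S cY cY z.
Proof.
move=> Oz; rewrite (dS _ (sY Y) sw Oz) dmx_V3 uB /S; apply: eq_bigr => c _ /=.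
by rewrite uGx // dmx_cst mul0mx !mulmx0 !addr0 mxE scale0r add0r.
Qed.

Let uSwY z : O1 z -> dmx u (S w3 cY) z = S cY cY z.
Proof.
move=> Oz; rewrite (dS _ sw (sY Y) Oz) dmx_V3 uB /S; apply: eq_bigr => c _ /=.
by rewrite uGx // dmx_cst !mul0mx !mulmx0 !addr0 mul0mx scaler0 addr0.
Qed.

Let uPsi z : O1 z -> dmx u Psi z = Y *m B z - 2^-1 *: (S cY w3 z + S w3 cY z).
Proof. by move=> Oz; rewrite dPsi // uSww // uB mulmx0 addr0 add0r. Qed.

Let uuPsi z : O1 z -> dmx u (dmx u Psi) z = - S cY cY z.
Proof.
move=> Oz; rewrite (dmx_ext _ oO1 uPsi Oz).
have s1 := sfB (sY Y); have s2 := sS (sY Y) sw; have s3 := sS sw (sY Y).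
have s5 : smooth O1 (fun _ : V => 2^-1 : R) by exact: smooth_cst.
rewrite (dmxB _ oO1 s1 (msmoothZ oO1 s5 (msmoothD oO1 s2 s3)) Oz) (dmxM _ (sY Y) sB1 Oz).
rewrite (dmxZ _ s5 (msmoothD oO1 s2 s3) Oz) (_ : 'D_u _ z = 0); last exact: derive_cst.
rewrite (dmxD _ s2 s3 Oz) uSYw // uSwY // dmx_cst uB mul0mx mulmx0 !add0r scale0r add0r.
by apply/matrixP => a b; rewrite !(oppmxE, scalemxE, addmxE); field.
Qed.

Let zs : V := ((q, t0), 0).
Let Ozs : O1 zs. Proof. exact: Uq. Qed.
Let Bzs : B zs = 1%:M.
Proof.
rewrite /B /field_mx big1 ?subr0 // => a _.
by rewrite [zs.1.1 - q]subrr mxE scale0r.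
Qed.
Let w0B a z : z.2 = 0 -> (0 : X) *m B z + z.2 *m dmx (ldir a) B z = 0.
Proof. by move=> ->; rewrite !mul0mx addr0. Qed.

Let lB a z : dmx (ldir a) B z = - Gq a.
Proof.
rewrite dB (bigD1 a) //= mxE !eqxx scale1r big1 ?addr0 // => b ba.
by rewrite mxE (negPf ba) scale0r.
Qed.

Let lSYw a z : O1 z -> z.2 = 0 -> dmx (ldir a) (S cY w3) z = 0.
Proof.
move=> Oz z0; rewrite (dS _ (sY Y) sw Oz) big1 // => c _.
by rewrite dmx_V3 /= w0B // /w3 z0 !mul0mx !addr0 !scaler0 addr0.
Qed.

Let lSwY a z : O1 z -> z.2 = 0 -> dmx (ldir a) (S w3 cY) z = 0.
Proof.
move=> Oz z0; rewrite (dS _ sw (sY Y) Oz) big1 // => c _.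
by rewrite dmx_V3 /= w0B // /w3 z0 !mul0mx mxE !scale0r addr0.
Qed.

Let luPsi a : dmx (ldir a) (dmx u Psi) zs = - (Y *m Gq a).
Proof.
rewrite (dmx_ext _ oO1 uPsi Ozs).
have s1 := sfB (sY Y); have s2 := sS (sY Y) sw; have s3 := sS sw (sY Y).
have s5 : smooth O1 (fun _ : V => 2^-1 : R) by exact: smooth_cst.
rewrite (dmxB _ oO1 s1 (msmoothZ oO1 s5 (msmoothD oO1 s2 s3)) Ozs) (dmxM _ (sY Y) sB1 Ozs).
rewrite (dmxZ _ s5 (msmoothD oO1 s2 s3) Ozs) (_ : 'D_(ldir a) _ zs = 0); last exact: derive_cst.
rewrite (dmxD _ s2 s3 Ozs) lSYw // lSwY // dmx_cst lB mul0mx add0r addr0 scale0r scaler0 addr0 subr0.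
by rewrite mulmxN.
Qed.

Let D1 a c := dmx (sdir a) (Gam sdir H c) (q, t0).

Let lGx a c : dmx (ldir a) (Gx c) zs = D1 a c.
Proof.
rewrite dGx // (bigD1 a) //= mxE !eqxx scale1r big1 ?addr0 // => b ba.
by rewrite mxE (negPf ba) scale0r.
Qed.

Let luuPsi a : dmx (ldir a) (dmx u (dmx u Psi)) zs =
  \sum_c ((Y *m Gq a) 0 c *: (Y *m Gq c) + Y 0 c *: (Y *m Gq a *m Gq c - Y *m D1 a c)).
Proof.
rewrite (dmx_ext _ oO1 uuPsi Ozs) (dmxN _ (sS (sY Y) (sY Y)) Ozs).
rewrite (dS _ (sY Y) (sY Y) Ozs) -sumrN; apply: eq_bigr => c _.
rewrite dmx_cst lB Bzs lGx !mul0mx !add0r !mulmx1 mulmxN.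
rewrite /Gx /= -/(Gq c) mulNmx.
by apply/matrixP => k l; rewrite !(oppmxE, scalemxE, addmxE); ring.
Qed.

Definition shifted_jac (z : V) : 'M[R]_n.+1 := \matrix_(a, b) dmx (ldir a) Psi z 0 b.
Let J := shifted_jac.

Let sJ : msmooth O1 J.
Proof.
move=> a b; apply: (smooth_ext (f := fun z => dmx (ldir a) Psi z 0 b)) => //; last exact: msmooth_dmx.
by move=> z _; rewrite mxE.
Qed.

Let J0 z : O1 z -> z.2 = 0 -> J z = 1%:M.
Proof.
move=> Oz z0; apply/matrixP => a b; rewrite !mxE dPsi //=.
rewrite w0B // addr0 (_ : dmx _ (S w3 w3) z = 0) ?scaler0 ?subr0.
  by rewrite mxE /= eq_sym.
rewrite dS // big1 // => c _.
by rewrite dmx_V3 /= w0B // /w3 z0 !mul0mx mxE !scale0r addr0.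
Qed.

Let duJ z a b : O1 z -> dmx u J z a b = dmx (ldir a) (dmx u Psi) z 0 b.
Proof.
move=> Oz; rewrite dmxE.
have -> : 'D_u (fun y => J y a b) z = dmx u (dmx (ldir a) Psi) z 0 b.
  by rewrite dmxE; apply: near_eq_derive; apply: filterE => y; rewrite mxE.
by rewrite (dmxC _ _ oO1 sPsi Oz).
Qed.

Let duuJ a b : dmx u (dmx u J) zs a b = dmx (ldir a) (dmx u (dmx u Psi)) zs 0 b.
Proof.
rewrite dmxE.
have E : \forall y \near zs, dmx u J y a b = dmx (ldir a) (dmx u Psi) y 0 b.
  by apply: filterS (near_open oO1 Ozs) => y; exact: duJ.
transitivity (dmx u (dmx (ldir a) (dmx u Psi)) zs 0 b).
  by rewrite dmxE; exact: near_eq_derive.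
by rewrite (dmxC _ _ oO1 (msmooth_dmx u sPsi) Ozs).
Qed.

(** The pullback, by the displacement, of the metric at time [z.1.2]: on the velocity of a path it
    is the squared speed of the displaced path ([push_shifted]). *)
Definition shifted_metric (z : V) : 'M[R]_n.+1 :=
  shifted_jac z *m H (shifted z, z.1.2) *m (shifted_jac z)^T.
Let A := shifted_metric.
Definition shifted_dom : set V := [set z | U (z.1.1, t0) /\ U (shifted z, z.1.2)].
Let O := shifted_dom.

Lemma shifted0 z : z.2 = 0 -> shifted z = z.1.1.
Proof.
move=> z0; rewrite /shifted z0 mul0mx /moved big1 ?scaler0 ?subr0 ?addr0 // => c _.
by rewrite mul0mx scaler0.
Qed.

Lemma shifted_dom_open : open O.
Proof.
rewrite openE => z [Oz Uz].
have c := ST_continuous sPsi (smooth_V2 oO1) Oz.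
have N1 := c _ (near_open oU Uz).
by apply: filterS2 (near_open oO1 Oz) N1 => y.
Qed.

Let OO1 : O `<=` O1. Proof. by move=> z []. Qed.

Lemma shifted_dom0 : O zs.
Proof. by split => //; rewrite shifted0. Qed.

Let sHQ (F : ST -> 'M[R]_n.+1) : msmooth U F -> msmooth O (fun z => F (Psi z, z.1.2)).
Proof.
move=> sF; apply: (ST_comp_smooth shifted_dom_open oU _ (smooth_V2 shifted_dom_open) sF).
  exact: msmooth_sub sPsi.
by move=> z [].
Qed.

Let uHQ (F : ST -> 'M[R]_n.+1) z : msmooth U F -> O z ->
  dmx u (fun z => F (Psi z, z.1.2)) z = \sum_b dmx u Psi z 0 b *: dmx (sdir b) F (Psi z, z.1.2).
Proof.
move=> sF [Oz Uz]; rewrite (ST_chain oU sPsi (smooth_V2 oO1) u sF Oz Uz).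
by rewrite derive_V2 /= scale0r addr0.
Qed.

Let sJO : msmooth O J. Proof. exact: msmooth_sub sJ. Qed.

Lemma shifted_metric_smooth : msmooth O A.
Proof.
have [_ sH _ _] := mH; have oO := shifted_dom_open.
by apply: msmoothM => //; [apply: msmoothM => //; exact: sHQ|exact: msmoothT].
Qed.

Lemma shifted_metric0 z : O z -> z.2 = 0 -> A z = H z.1.
Proof.
move=> [Oz _] z0; rewrite /A /shifted_metric -/J J0 // trmx1 mul1mx mulmx1 shifted0 //.
by case: z z0 Oz => -[].
Qed.

(** The covariant derivative, in the direction of [Y], of the differential of the displacement. It
    vanishes at [zs] because the field is parallel at [q]; therefore only its first derivative
    enters the second derivative of the metric. *)
Let K z := dmx u J z + J z *m \sum_b dmx u Psi z 0 b *: Gam sdir H b (Psi z, z.1.2).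

Let uA z : O z -> dmx u A z = K z *m H (Psi z, z.1.2) *m (J z)^T
  + (K z *m H (Psi z, z.1.2) *m (J z)^T)^T.
Proof.
move=> Oz; have [_ sH symH _] := mH; have oO := shifted_dom_open; have [_ Uz] := Oz.
rewrite (dmxM _ (msmoothM oO sJO (sHQ sH)) (msmoothT oO sJO) Oz) (dmxM _ sJO (sHQ sH) Oz) dmxT.
rewrite uHQ //.
have -> : \sum_b dmx u Psi z 0 b *: dmx (sdir b) H (Psi z, z.1.2) =
    (\sum_b dmx u Psi z 0 b *: Gam sdir H b (Psi z, z.1.2)) *m H (Psi z, z.1.2)
    + H (Psi z, z.1.2) *m (\sum_b dmx u Psi z 0 b *: Gam sdir H b (Psi z, z.1.2))^T.
  rewrite mulmx_suml linear_sum mulmx_sumr -big_split; apply: eq_bigr => b _ /=.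
  by rewrite (metric_connectionE sdir mH b Uz) scalerDr scalemxAl trmxZ scalemxAr.
rewrite /K; set Q := \sum_b _; set dJ := dmx u J z.
move: dJ Q => dJ Q; have sy := symH _ Uz; move: sy; set h := H _ => sy.
by mx_expand; rewrite sy; mx_abel.
Qed.

Let sK : msmooth O K.
Proof.
have oO := shifted_dom_open.
apply: msmoothD => //; first exact: msmooth_dmx.
apply: msmoothM => //; apply: msmooth_sum => // b; apply: msmoothZ => //.
  exact: (msmooth_sub OO1 (msmooth_dmx u sPsi) 0 b).
exact: sHQ (Gam_msmooth sdir mH b).
Qed.

Let tors (v w : X) : \sum_c v 0 c *: (w *m Gq c) = \sum_c w 0 c *: (v *m Gq c).
Proof. exact: (Gam_swap sdir mH _ _ Uq). Qed.

Let row_sumZ (f : 'I_n.+1 -> R) (F : 'I_n.+1 -> 'M[R]_n.+1) e :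
  row e (\sum_b f b *: F b) = \sum_b f b *: row e (F b).
Proof. by apply/rowP => d; rewrite mxE !summxE; apply: eq_bigr => b _; rewrite !mxE. Qed.

Let rowGq (f : X) e : row e (\sum_b f 0 b *: Gq b) = f *m Gq e.
Proof.
rewrite row_sumZ; under eq_bigr do rewrite rowE.
rewrite tors (bigD1 e) //= mxE !eqxx scale1r big1 ?addr0 // => c ca.
by rewrite mxE (negPf ca) scale0r.
Qed.

Let GY := \sum_b Y 0 b *: Gq b.

Let uPsi0 : dmx u Psi zs = Y.
Proof.
have S1 : S cY w3 zs = 0 by rewrite /S big1 // => c _; rewrite /w3 mul0mx mul0mx scaler0.
have S2 : S w3 cY zs = 0 by rewrite /S big1 // => c _; rewrite /w3 mul0mx mxE scale0r.
by rewrite (uPsi Ozs) Bzs mulmx1 S1 S2 addr0 scaler0 subr0.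
Qed.

Let QGq b : Gam sdir H b (Psi zs, zs.1.2) = Gq b.
Proof. by rewrite /Psi shifted0. Qed.

Let duJ0 : dmx u J zs = - GY.
Proof.
apply/matrixP => a b; rewrite duJ // luPsi !oppmxE; congr (- _).
rewrite -rowGq.
by rewrite [row _ _ _ _]mxE.
Qed.

Let K0 : K zs = 0.
Proof.
rewrite /K duJ0 J0 // mul1mx uPsi0.
under eq_bigr do rewrite QGq.
by rewrite -/GY addNr.
Qed.

Lemma shifted_metric_first : dmx u A zs = 0.
Proof.
by rewrite uA; [rewrite K0 !mul0mx trmx0 addr0|exact: shifted_dom0].
Qed.

(** Row [e] is R(Y, d_e) Y, the curvature term of the Jacobi equation. *)
Definition jacobi_mx : 'M[R]_n.+1 :=
  \matrix_(e, d) (\sum_a Y 0 a *: (Y *m Rc sdir H a e (q, t0))) 0 d.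

Let dtors d e (v : X) : \sum_b v 0 b *: row e (D1 d b) = v *m D1 d e.
Proof.
apply/rowP => c; rewrite summxE mxE; apply: eq_bigr => b _; rewrite mxE mxE; congr (_ * _).
rewrite /D1 !dmxE; apply: near_eq_derive.
by apply: filterS (near_open oU Uq) => z Uz; exact: (torsion_free sdir mH).
Qed.

Let uK0 : dmx u K zs = jacobi_mx.
Proof.
have oO := shifted_dom_open; have Oz := shifted_dom0.
have sP := msmooth_sub OO1 (msmooth_dmx u sPsi).
have sG b := sHQ (Gam_msmooth sdir mH b).
have s1 b : msmooth O (fun z => dmx u Psi z 0 b *: Gam sdir H b (Psi z, z.1.2)).
  by apply: msmoothZ => //; exact: (sP 0 b).
have s2 : msmooth O (fun z => \sum_b dmx u Psi z 0 b *: Gam sdir H b (Psi z, z.1.2)) by exact: msmooth_sum.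
rewrite (dmxD _ (msmooth_dmx u sJO) (msmoothM oO sJO s2) Oz) (dmxM _ sJO s2 Oz) (dmx_sum _ _ s1 Oz).
have E b : dmx u (fun z => dmx u Psi z 0 b *: Gam sdir H b (Psi z, z.1.2)) zs =
    (- \sum_c Y 0 c *: (Y *m Gq c)) 0 b *: Gq b + Y 0 b *: \sum_d Y 0 d *: D1 d b.
  rewrite (dmxZ _ (sP 0 b) (sG b) Oz) -dmxE uuPsi // uHQ //; last exact: Gam_msmooth.
  rewrite uPsi0 QGq; congr (_ 0 b *: _ + _ *: _).
    have -> : S cY cY zs = \sum_c Y 0 c *: (Y *m Gq c) by apply: eq_bigr => c _; rewrite Bzs !mulmx1.
    by [].
  by apply: eq_bigr => d _; rewrite /Psi shifted0.
rewrite [X in J zs *m X](eq_bigr _ (fun b _ => E b)).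
rewrite duJ0 J0 // mul1mx uPsi0.
have -> : \sum_b Y 0 b *: Gam sdir H b (Psi zs, zs.1.2) = GY by apply: eq_bigr => b _; rewrite QGq.
apply/row_matrixP => e.
have -> : row e jacobi_mx = \sum_a Y 0 a *: (Y *m Rc sdir H a e (q, t0)).
  by apply/rowP => d; rewrite !mxE.
have R1 : row e (dmx u (dmx u J) zs) =
    \sum_c ((Y *m Gq e) 0 c *: (Y *m Gq c) + Y 0 c *: (Y *m Gq e *m Gq c - Y *m D1 e c)).
  by apply/rowP => d; rewrite [LHS]mxE duuJ luuPsi.
rewrite !rowDE R1 big_split /= tors.
have -> : row e (- GY *m GY) = - \sum_c Y 0 c *: (Y *m Gq e *m Gq c).
  have rG : row e GY = Y *m Gq e by exact: rowGq.
  rewrite row_mul rowNE rG mulNmx /GY mulmx_sumr; congr (- _).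
  by apply: eq_bigr => c _; rewrite -scalemxAr.
have -> : row e (\sum_b ((- \sum_c Y 0 c *: (Y *m Gq c)) 0 b *: Gq b + Y 0 b *: \sum_d Y 0 d *: D1 d b))
    = - \sum_c Y 0 c *: (Y *m Gq c *m Gq e) + \sum_d Y 0 d *: (Y *m D1 d e).
  rewrite big_split rowDE /=; congr (_ + _).
    rewrite rowGq.
    rewrite mulNmx mulmx_suml; congr (- _); apply: eq_bigr => c _; by rewrite -scalemxAl.
  rewrite row_sumZ (eq_bigr (fun b => \sum_d Y 0 b *: (Y 0 d *: row e (D1 d b)))); last first.
    by move=> b _; rewrite row_sumZ scaler_sumr.
  rewrite exchange_big; apply: eq_bigr => d _ /=; rewrite -dtors scaler_sumr; apply: eq_bigr => b _.
  by rewrite !scalerA mulrC.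
have -> : \sum_a Y 0 a *: (Y *m Rc sdir H a e (q, t0)) =
    \sum_a (Y 0 a *: (Y *m D1 a e) - Y 0 a *: (Y *m D1 e a) + Y 0 a *: (Y *m Gq e *m Gq a)
      - Y 0 a *: (Y *m Gq a *m Gq e)).
  apply: eq_bigr => a _; rewrite RcE -/(D1 a e) -/(D1 e a) -/(Gq a) -/(Gq e).
  by rewrite mulmxBr mulmxDr mulmxBr !mulmxA !(scalerBr, scalerDr).
rewrite !big_split /= !sumrN.
have -> : \sum_c Y 0 c *: (Y *m Gq e *m Gq c - Y *m D1 e c) =
    \sum_c Y 0 c *: (Y *m Gq e *m Gq c) - \sum_c Y 0 c *: (Y *m D1 e c).
  by rewrite -sumrN -big_split; apply: eq_bigr => c _; rewrite scalerBr.
by apply/matrixP => k l; rewrite !(oppmxE, addmxE); ring.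
Qed.

(** The second variation formula for a field parallel at [q]: on a vector v it gives 2 <R(Y, v) Y,
    v>, which is minus twice the sectional curvature when Y and v are orthonormal. *)
Lemma shifted_metric_second : dmx u (dmx u A) zs = jacobi_mx *m H (q, t0) + (jacobi_mx *m H (q, t0))^T.
Proof.
have oO := shifted_dom_open; have Oz := shifted_dom0; have [_ sH _ _] := mH.
rewrite (dmx_ext _ oO uA Oz).
have s1 := msmoothM oO sK (sHQ sH); have s2 := msmoothM oO s1 (msmoothT oO sJO).
have -> : dmx u (fun x => K x *m H (Psi x, x.1.2) *m (J x)^T + (K x *m H (Psi x, x.1.2) *m (J x)^T)^T) zs
   = dmx u (fun x => K x *m H (Psi x, x.1.2) *m (J x)^T) zs + (dmx u (fun x => K x *m H (Psi x, x.1.2) *m (J x)^T) zs)^T.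
  by rewrite (dmxD _ s2 (msmoothT oO s2) Oz) dmxT.
have -> : dmx u (fun x => K x *m H (Psi x, x.1.2) *m (J x)^T) zs = jacobi_mx *m H (q, t0).
  rewrite (dmxM _ s1 (msmoothT oO sJO) Oz) (dmxM _ sK (sHQ sH) Oz) K0 uK0 J0 // !mul0mx.
  by rewrite trmx1 mulmx1 !addr0 /Psi shifted0.
by [].
Qed.

End WDirection.

End MovedMetric.

(** * Local estimate: curvature against the displacement in time *)

Lemma second_difference_line_ge (R : realType) (V : normedModType R) (U : set V) (T : V -> R)
    (p u : V) (h M : R) :
  0 <= h -> smooth U T -> (forall s : R, `|s| <= h -> U (p + s *: u)) ->
  (forall s : R, `|s| <= h -> M <= 'D_u ('D_u T) (p + s *: u)) ->
  M * h ^+ 2 <= T (p + h *: u) + T (p - h *: u) - 2 * T p.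
Proof.
move=> h0 sT HU HM.
have neg (f : R -> R) (s d : R) : is_derive s 1 f d -> is_derive s 1 (fun s => - f s) (- d).
  by move=> [df <-]; split; [exact: derivableN|exact: deriveN].
have := @second_difference_le _ (fun s => - T (p + s *: u)) (fun s => - 'D_u T (p + s *: u))
  (fun s => - 'D_u ('D_u T) (p + s *: u)) h (- M) h0.
rewrite scale0r addr0 scaleNr => HS.
suff : - T (p + h *: u) - T (p - h *: u) - 2 * - T p <= - M * h ^+ 2 by rewrite mulNr; lra.
apply: HS => s sh.
- apply: neg; apply: is_derive_line; exact: smooth_derivable sT (HU s sh).
- apply: neg; apply: is_derive_line.
  exact: (smooth_derivable (smooth_derive _ sT) (HU s sh)).
- by rewrite lerN2; exact: HM.
Qed.

Lemma aux_sum (R : realType) (m e h2 a b c d s : R) : 0 <= e * h2 ->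
  - (m * (e * h2)) <= a - 2 * m * b - h2 * d -> a - 2 * m * b - h2 * d <= m * (e * h2) ->
  - (h2 * e) <= h2 * d + h2 * (2 * s) -> h2 * d + h2 * (2 * s) <= h2 * e ->
  - (e * h2) <= 2 * m * (b - c) - h2 * (2 * s) -> 2 * m * (b - c) - h2 * (2 * s) <= e * h2 ->
  - ((m + 3) * e * h2) <= a - 2 * m * c /\ a - 2 * m * c <= (m + 3) * e * h2.
Proof. by move=> *; split; lra. Qed.

Section LocalEstimate.
Variables (R : realType) (n : nat).
Local Notation X := 'rV[R]_n.+1.
Local Notation ST := ('rV[R]_n.+1 * R)%type.
Local Notation V := (('rV[R]_n.+1 * R) * 'rV[R]_n.+1)%type.
Local Notation sdir := (@sdir R n).
Local Notation tdir := (@tdir R n).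
Local Notation xdir := (@xdir R n).
Local Notation wdir := (@wdir R n).
Local Notation m := (n.+1%:R : R).
Variables (U : set ST) (H : ST -> 'M[R]_n.+1) (q : X) (t0 : R).
Hypothesis mH : metric_on U H.
Hypothesis Uq : U (q, t0).
Hypothesis flowq : dmx tdir H (q, t0) = (-2) *: Ric sdir H (q, t0).

Let zs : V := ((q, t0), 0).
Let A := shifted_metric H q t0.
Let O := shifted_dom U H q t0.
Let oO : open O. Proof. exact: shifted_dom_open mH. Qed.
Let Ozs : O zs. Proof. exact: shifted_dom0. Qed.
Let sA : msmooth O A. Proof. exact: (shifted_metric_smooth _ _ mH). Qed.

Lemma nbhs_V (P : V -> Prop) : nbhs zs P -> exists2 r : R, 0 < r & forall x tau w,
  `|x - q| < r -> `|tau - t0| < r -> `|w| < r -> P ((x, tau), w).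
Proof.
move=> /nbhs_ballP[r /= r0 Hr]; exists r => // x tau w xr tr wr; apply: Hr.
split; last by rewrite -ball_normE /= sub0r normrN.
by split; rewrite -ball_normE /= distrC.
Qed.

Let D2 a b (z : V) := dmx (wdir (xdir a)) (dmx (wdir (xdir b)) A) z.

Let wdirE (Y : X) p p' (F : V -> 'M[R]_(p, p')) z : msmooth O F -> O z ->
  dmx (wdir Y) F z = \sum_a Y 0 a *: dmx (wdir (xdir a)) F z.
Proof.
move=> sF Oz; rewrite (dmx_dirE (V_fbasis R n) _ oO sF Oz) big_split_ord /= big1 ?add0r.
  by apply: eq_bigr => a _; rewrite !(unsplitK (inr a)).
move=> j _; rewrite !(unsplitK (inl j)) /=; case: fintype.split => k /=.
  by rewrite mxE scale0r.
by rewrite scale0r.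
Qed.

Let wdir2E (Y : X) z : O z ->
  dmx (wdir Y) (dmx (wdir Y) A) z = \sum_a \sum_b (Y 0 a * Y 0 b) *: D2 a b z.
Proof.
move=> Oz; rewrite (wdirE _ (msmooth_dmx _ sA) Oz); apply: eq_bigr => a _.
have E y : O y -> dmx (wdir Y) A y = \sum_b Y 0 b *: dmx (wdir (xdir b)) A y by exact: wdirE.
rewrite (dmx_ext _ oO E Oz).
have sY b : smooth O (fun _ : V => Y 0 b) by exact: smooth_cst.
have s1 b : msmooth O (fun y => Y 0 b *: dmx (wdir (xdir b)) A y).
  by apply: msmoothZ => //; exact: msmooth_dmx.
rewrite (dmx_sum _ _ s1 Oz) scaler_sumr; apply: eq_bigr => b _.
rewrite (dmxZ _ (sY b) (msmooth_dmx _ sA) Oz) (_ : 'D_ _ _ z = 0); last exact: derive_cst.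
by rewrite scale0r add0r scalerA.
Qed.

Section Estimate.
Variables (C eta : R).
Hypotheses (C0 : 0 < C) (eta0 : 0 < eta).

Let near_facts (e1 : R) : 0 < e1 -> exists2 r : R, 0 < r & forall x tau w,
  `|x - q| < r -> `|tau - t0| < r -> `|w| < r ->
  [/\ O ((x, tau), w),
    forall a b i j, `|D2 a b ((x, tau), w) i j - D2 a b zs i j| <= e1,
    forall a i j, `|dmx (wdir (xdir a)) A ((x, tau), w) i j| <= e1,
    U (x, tau) &
    forall i j, `|dmx tdir H (x, tau) i j - dmx tdir H (q, t0) i j| <= e1].
Proof.
move=> e10.
have N1 : \forall z \near zs, O z by exact: open_nbhs_nbhs.
pose P2 (k : 'I_n.+1 * 'I_n.+1 * ('I_n.+1 * 'I_n.+1)) z :=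
  `|D2 k.1.1 k.1.2 z k.2.1 k.2.2 - D2 k.1.1 k.1.2 zs k.2.1 k.2.2| <= e1.
have H2 k : \forall z \near zs, P2 k z.
  have sm := msmooth_dmx (wdir (xdir k.1.1)) (msmooth_dmx (wdir (xdir k.1.2)) sA).
  have /cvgrPdist_le /(_ _ e10) := smooth_continuous (sm k.2.1 k.2.2) Ozs.
  by apply: filterS => z; rewrite distrC.
pose P3 (k : 'I_n.+1 * ('I_n.+1 * 'I_n.+1)) z := `|dmx (wdir (xdir k.1)) A z k.2.1 k.2.2| <= e1.
have H3 k : \forall z \near zs, P3 k z.
  have sm := msmooth_dmx (wdir (xdir k.1)) sA.
  have /cvgrPdist_le /(_ _ e10) := smooth_continuous (sm k.2.1 k.2.2) Ozs.
  apply: filterS => z; rewrite /A (shifted_metric_first mH Uq (xdir k.1)) zeromxE sub0r normrN.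
  exact.
have [_ sH _ _] := mH.
pose P4 (k : 'I_n.+1 * 'I_n.+1) (z : ST) := `|dmx tdir H z k.1 k.2 - dmx tdir H (q, t0) k.1 k.2| <= e1.
have H4 k : \forall z \near (q, t0), P4 k z.
  have sm := msmooth_dmx tdir sH.
  have /cvgrPdist_le /(_ _ e10) := smooth_continuous (sm k.1 k.2) Uq.
  by apply: filterS => z; rewrite distrC.
have oU : open U by have [] := mH.
have /nbhs_ballP[r1 /= r10 Hr1] : nbhs (q, t0) (fun z => U z /\ forall k, P4 k z).
  exact: (filterI (near_open oU Uq) (filter_forall _ H4)).
have [r2 r20 Hr2] := nbhs_V (filterI N1 (filterI (filter_forall _ H2) (filter_forall _ H3))).
exists (Num.min r1 r2); first by rewrite lt_min r10.
move=> x tau w; rewrite !lt_min => /andP[x1 x2] /andP[t1 t2] /andP[w1 w2].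
have [h1 [h2 h3]] := Hr2 x tau w x2 t2 w2.
have [h4 h5] : U (x, tau) /\ forall k, P4 k (x, tau).
  by apply: Hr1; split; rewrite -ball_normE /= distrC.
split=> // [a b i j|a i j|i j]; [exact: (h2 (a, b, (i, j)))|exact: (h3 (a, (i, j)))|exact: (h5 (i, j))].
Qed.

Lemma local_second (e1 : R) : 0 < e1 -> exists2 r : R, 0 < r &
  forall x tau (Y : X) h, `|x - q| < r -> `|tau - t0| < r -> 0 < h -> h * C < r -> `|Y| <= C ->
  [/\ O ((x, tau), h *: Y) /\ O ((x, tau), - h *: Y),
   forall i j, `|A ((x, tau), h *: Y) i j + A ((x, tau), - h *: Y) i j - 2 * H (x, tau) i j
     - h ^+ 2 * dmx (wdir Y) (dmx (wdir Y) A) zs i j| <= e1 * h ^+ 2,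
   forall i j, `|A ((x, tau), h *: Y) i j - H (x, tau) i j| <= e1 * h,
   forall i j, `|A ((x, tau), - h *: Y) i j - H (x, tau) i j| <= e1 * h &
   U (x, tau) /\ forall i j, `|dmx tdir H (x, tau) i j - dmx tdir H (q, t0) i j| <= e1].
Proof.
move=> e10; pose e2 := Num.min e1 (e1 / (m ^+ 2 * C ^+ 2 + m * C)).
have d0 : 0 < m ^+ 2 * C ^+ 2 + m * C by rewrite addr_gt0 // mulr_gt0 // exprn_gt0.
have e20 : 0 < e2 by rewrite /e2 lt_min e10 divr_gt0.
have e2d : e2 * (m ^+ 2 * C ^+ 2 + m * C) <= e1.
  by rewrite -ler_pdivlMr // /e2 ge_min lexx orbT.
have e21 : e2 <= e1 by rewrite /e2 ge_min lexx.
have [r r0 Hr] := near_facts e20; exists r => // x tau Y h xr tr h0 hC YC.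
have seg (s : R) : `|s| <= h -> `|s *: Y| < r.
  move=> sh; rewrite normrZ; apply: le_lt_trans hC; exact: ler_pM.
have pE (s : R) : ((x, tau), 0) + s *: wdir Y = ((x, tau), s *: Y) :> V.
  apply/pair_equal_spec; split; rewrite /= ?add0r //.
  by apply/pair_equal_spec; split; rewrite /= ?scaler0 ?addr0.
have facts s sh := Hr x tau (s *: Y) xr tr (seg s sh).
have Os (s : R) : `|s| <= h -> O (((x, tau), 0) + s *: wdir Y).
  by move=> sh; rewrite pE; have [] := facts s sh.
have hh : `|h| <= h by rewrite gtr0_norm.
have hN : `|- h| <= h by rewrite normrN gtr0_norm.
have h00 : `|0 : R| <= h by rewrite normr0 ltW.
have A00 : A ((x, tau), 0) = H (x, tau).
  by rewrite /A (shifted_metric0 mH) //; have [] := facts 0 h00; rewrite scale0r.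
have YY a b : `|Y 0 a * Y 0 b| <= C ^+ 2.
  by rewrite normrM expr2; apply: ler_pM => //; apply: le_trans (coord_le_norm _ _ _) YC.
have second i j (s : R) : `|s| <= h ->
    `|dmx (wdir Y) (dmx (wdir Y) A) ((x, tau), s *: Y) i j - dmx (wdir Y) (dmx (wdir Y) A) zs i j| <= e1.
  move=> sh; have [Oz h2 _ _ _] := facts s sh.
  rewrite (wdir2E Y Oz) (wdir2E Y Ozs) !summxE -sumrB.
  apply: le_trans (ler_norm_sum _ _ _) _.
  apply: le_trans (_ : \sum_(a < n.+1) \sum_(b < n.+1) C ^+ 2 * e2 <= _).
    apply: ler_sum => a _; rewrite !summxE -sumrB; apply: le_trans (ler_norm_sum _ _ _) _.
    apply: ler_sum => b _; rewrite !scalemxE -mulrBr normrM; apply: ler_pM => //; exact: h2.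
  rewrite !sumr_const !card_ord -mulrnA -[leLHS]mulr_natl natrM.
  apply: le_trans e2d; rewrite -expr2 mulrA mulrC; apply: ler_wpM2l; first exact: ltW.
  by rewrite lerDl mulr_ge0 // ltW.
have first_ i j (s : R) : `|s| <= h -> `|dmx (wdir Y) A ((x, tau), s *: Y) i j| <= e1.
  move=> sh; have [Oz _ h3 _ _] := facts s sh.
  rewrite (wdirE Y sA Oz) !summxE; apply: le_trans (ler_norm_sum _ _ _) _.
  apply: le_trans (_ : \sum_(a < n.+1) C * e2 <= _).
    apply: ler_sum => a _; rewrite !scalemxE normrM; apply: ler_pM => //.
    exact: le_trans (coord_le_norm _ _ _) YC.
  rewrite sum_cst mulrA mulrC; apply: le_trans e2d.
  by apply: ler_wpM2l; [exact: ltW|rewrite lerDr mulr_ge0 ?exprn_ge0 // ltW].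
have incr i j (c : R) : `|c| <= h -> `|A ((x, tau), c *: Y) i j - H (x, tau) i j| <= e1 * h.
  move=> ch; rewrite -A00.
  have := @segment_increment R V (fun z => A z i j) ((x, tau), 0) (wdir Y) c 0 e1.
  rewrite pE mulr0 subr0 => HS; apply: le_trans (HS _) _.
    move=> s sc; split; first exact: (smooth_derivable (sA i j) (Os s (le_trans sc ch))).
    by rewrite subr0 pE -dmxE; exact: first_ (le_trans sc ch).
  by apply: ler_wpM2l => //; exact: ltW.
split.
- by rewrite -!pE; split; exact: Os.
- move=> i j; rewrite ler_norml; apply/andP; split.
    have := @second_difference_line_ge R V O (fun z => A z i j) ((x, tau), 0) (wdir Y) h
      (dmx (wdir Y) (dmx (wdir Y) A) zs i j - e1) (ltW h0) (sA i j) Os.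
    rewrite -scaleNr !pE A00 => HS.
    suff /HS : forall s : R, `|s| <= h -> dmx (wdir Y) (dmx (wdir Y) A) zs i j - e1
        <= 'D_(wdir Y) ('D_(wdir Y) (fun z => A z i j)) (((x, tau), 0) + s *: wdir Y) by lra.
    move=> s sh; rewrite pE; have := second i j s sh; rewrite ler_norml => /andP[+ _].
    rewrite [X in _ <= X - _]dmxE dmx_entry; lra.
  have := @second_difference_line R V O (fun z => A z i j) ((x, tau), 0) (wdir Y) h
      (dmx (wdir Y) (dmx (wdir Y) A) zs i j + e1) (ltW h0) (sA i j) Os.
  rewrite -scaleNr !pE A00 => HS.
  suff /HS : forall s : R, `|s| <= h -> 'D_(wdir Y) ('D_(wdir Y) (fun z => A z i j)) (((x, tau), 0) + s *: wdir Y)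
      <= dmx (wdir Y) (dmx (wdir Y) A) zs i j + e1 by lra.
  move=> s sh; rewrite pE; have := second i j s sh; rewrite ler_norml => /andP[_].
  rewrite [X in X - _ <= _]dmxE dmx_entry; lra.
- by move=> i j; apply: incr.
- by move=> i j; apply: incr.
- have [_ _ _ Ux h5] := facts 0 h00; split=> // i j; exact: le_trans (h5 i j) e21.
Qed.

Let RG a e := Rc sdir H a e (q, t0) *m H (q, t0).
Let Q (P : 'M[R]_n.+1) e f := \sum_a \sum_b P a b * RG a e b f.

Let jacobi_sum (E : 'M[R]_n.+1) e f :
  \sum_j (jacobi_mx H q t0 (row j E) *m H (q, t0)) e f = Q (E^T *m E) e f.
Proof.
have J1 (Y : X) : (jacobi_mx H q t0 Y *m H (q, t0)) e f = \sum_a \sum_b Y 0 a * Y 0 b * RG a e b f.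
  rewrite mxE; under eq_bigr do rewrite mxE summxE mulr_suml.
  rewrite exchange_big; apply: eq_bigr => a _ /=.
  transitivity (\sum_d Y 0 a * ((Y *m Rc sdir H a e (q, t0)) 0 d * H (q, t0) d f)).
    by apply: eq_bigr => d _; rewrite scalemxE mulrA.
  rewrite -mulr_sumr.
  have -> : \sum_d (Y *m Rc sdir H a e (q, t0)) 0 d * H (q, t0) d f = (Y *m RG a e) 0 f by rewrite /RG mulmxA mxE.
  by rewrite mxE mulr_sumr; apply: eq_bigr => b _; rewrite mulrA.
under eq_bigr do rewrite J1.
rewrite exchange_big; apply: eq_bigr => a _; rewrite exchange_big; apply: eq_bigr => b _ /=.
rewrite [(E^T *m E) a b]mxE mulr_suml; apply: eq_bigr => j _; by rewrite !mxE.
Qed.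

(** A sum of Jacobi terms over a frame [E] is a contraction with E^T E ([jacobi_sum]). For an
    orthonormal frame this is the inverse metric, and the contraction is minus the Ricci tensor. *)
Let Q_inv e f : Q (invmx (H (q, t0))) e f = - Ric sdir H (q, t0) e f.
Proof.
have [_ _ symH uH] := mH.
have symI : (invmx (H (q, t0)))^T = invmx (H (q, t0)) by rewrite trmx_inv symH.
rewrite /Q mxE -sumrN; apply: eq_bigr => a _.
transitivity (- (RG a e *m invmx (H (q, t0))) f a); last by rewrite /RG mulmxK //; exact: uH.
rewrite mxE -sumrN; apply: eq_bigr => b _.
have -> : RG a e b f = - RG a e f b.
  by rewrite -oppmxE -(Rc_low_anti sdir mH a e Uq) trmxE.
by rewrite -[in LHS]symI trmxE; ring.
Qed.

(** It decides how far from orthonormal a frame may be while its Jacobi terms still add up to minus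
    Ricci within a given tolerance. *)
Definition curv_size (z : ST) : R :=
  1 + \sum_a \sum_e \sum_b \sum_f `|(Rc sdir H a e z *m H z) b f|.

Let Q_near (P P' : 'M[R]_n.+1) r e f : 0 <= r -> (forall a b, `|P a b - P' a b| <= r) ->
  `|Q P e f - Q P' e f| <= r * curv_size (q, t0).
Proof.
move=> r0 PP; rewrite /Q -sumrB; apply: le_trans (ler_norm_sum _ _ _) _.
apply: le_trans (_ : r * \sum_a \sum_b `|RG a e b f| <= _).
  rewrite mulr_sumr; apply: ler_sum => a _; rewrite -sumrB; apply: le_trans (ler_norm_sum _ _ _) _.
  rewrite mulr_sumr; apply: ler_sum => b _; rewrite -mulrBl normrM; exact: ler_wpM2r.
apply: ler_wpM2l => //; rewrite ler_wpDl //; apply: ler_sum => a _.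
rewrite [leRHS](bigD1 e) //= ler_wpDr //; first by do 3 (apply: sumr_ge0 => ? _).
apply: ler_sum => b _; rewrite [leRHS](bigD1 f) //= ler_wpDr //; exact: sumr_ge0.
Qed.

Let Ric_sym e f : Ric sdir H (q, t0) e f = Ric sdir H (q, t0) f e.
Proof.
have := dmx_metric_symE mH tdir e f Uq; rewrite flowq !scalemxE; lra.
Qed.

(** On a vector v the displacements change the sum of the squared norms by -2 h^2 Ric(v, v) up to a
    small error. The 2 m earlier metrics contribute 2 h^2 Ric(v, v), because 2 m kappa = 1. A frame
    orthonormal up to [tol] suffices. *)
Lemma local_estimate (kappa tol : R) : kappa = (2 * m)^-1 -> 0 <= tol ->
  tol * curv_size (q, t0) * (2 * (m ^+ 2 * (m + 3))) <= eta ->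
  exists2 r : R, 0 < r & forall x h (E : 'M[R]_n.+1), `|x - q| < r -> 0 < h -> h < r ->
  (forall j, `|row j E| <= C) ->
  (forall a b, `|(E^T *m E) a b - invmx (H (q, t0)) a b| <= tol) ->
  let w j (s : bool) : V := ((x, t0 - kappa * h ^+ 2), ((-1) ^+ s * h) *: row j E) in
  [/\ forall j s, O (w j s),
      forall j s v, `|bil (A (w j s)) v v - bil (H (x, t0)) v v| <= eta * h * `|v| ^+ 2 &
      forall v, `|\sum_j (bil (A (w j false)) v v + bil (A (w j true)) v v)
         - 2 * m * bil (H (x, t0)) v v| <= eta * h ^+ 2 * `|v| ^+ 2].
Proof.
move=> kE tol0 Htol; have m0 : 0 < m by rewrite ltr0n.
have m1 : 1 <= m by rewrite ler1n.
have k0 : 0 < kappa by rewrite kE invr_gt0 mulr_gt0.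
have km : 2 * m * kappa = 1 by rewrite kE divff // gt_eqF // mulr_gt0.
(* The factor m ^ 2 is lost between the entries of a matrix and its quadratic form; m + 3 leaves
   room for the m second differences, the trace of the curvature and the time step. *)
pose e1 := eta / (m ^+ 2 * (m + 3)).
have e10 : 0 < e1 by rewrite divr_gt0 // mulr_gt0 ?exprn_gt0 //; lra.
have e1E : m ^+ 2 * ((m + 3) * e1) = eta.
  rewrite /e1 mulrA mulrC divfK // gt_eqF // mulr_gt0 ?exprn_gt0 //; lra.
have [r1 r10 Hr1] := local_second e10.
pose RM := 1 + `|Ric sdir H (q, t0)|.
have RM0 : 0 < RM by rewrite ltr_pwDl.
have RicM i j : `|Ric sdir H (q, t0) i j| <= RM.
  by apply: le_trans (coord_le_norm _ i j) _; rewrite lerDr.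
pose r := Num.min (Num.min 1 r1) (Num.min (r1 / C) (e1 / (2 * RM + e1))).
have d1 : 0 < 2 * RM + e1 by rewrite addr_gt0 // mulr_gt0.
exists r; first by rewrite !lt_min ltr01 r10 !divr_gt0.
move=> x h E xr h0 hr EC Er w.
move: xr hr; rewrite /r !lt_min => /andP[/andP[_ xr] _].
move=> /andP[/andP[h1 hr1] /andP[hC hR]].
rewrite ltr_pdivlMr // in hC; rewrite ltr_pdivlMr // in hR.
have h20 : 0 < h ^+ 2 by rewrite exprn_gt0.
pose tau := t0 - kappa * h ^+ 2.
have tr s : `|s| <= kappa * h ^+ 2 -> `|(t0 + s) - t0| < r1.
  by move=> sk; rewrite addrAC subrr add0r; apply: le_lt_trans sk _; nra.
have kh0 : 0 <= kappa * h ^+ 2 by rewrite mulr_ge0 // ltW.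
have tauE : tau = t0 + - (kappa * h ^+ 2) by [].
have tr0 : `|tau - t0| < r1 by rewrite tauE; apply: tr; rewrite normrN ger0_norm.
have facts j := Hr1 x tau (row j E) h xr tr0 h0 hC (EC j).
have wF j : w j false = ((x, tau), h *: row j E) by rewrite /w expr0 mul1r.
have wT j : w j true = ((x, tau), - h *: row j E) by rewrite /w expr1 mulN1r.
have time i j : `|H (x, tau) i j - H (x, t0) i j - 2 * (kappa * h ^+ 2) * Ric sdir H (q, t0) i j| <= e1 * (kappa * h ^+ 2).
  have := @segment_increment R _ (fun z => H z i j) (x, t0) tdir (- (kappa * h ^+ 2)) (dmx tdir H (q, t0) i j) e1.
  have pE (s : R) : (x, t0) + s *: tdir = (x, t0 + s) :> ST.
    by apply/pair_equal_spec; split; rewrite /= ?scaler0 ?addr0 // [_ *: 1]mulr1.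
  rewrite pE normrN ger0_norm // -tauE flowq scalemxE => HS.
  have -> : 2 * (kappa * h ^+ 2) * Ric sdir H (q, t0) i j =
     - (kappa * h ^+ 2) * (-2 * Ric sdir H (q, t0) i j) by ring.
  apply: HS => s sk; have C00 : `|0 : X| <= C by rewrite normr0 ltW.
  have [_ _ _ _ [Us Hs]] := Hr1 x (t0 + s) 0 h xr (tr s sk) h0 hC C00.
  have [_ sH _ _] := mH; rewrite pE; split; first exact: (smooth_derivable (sH i j) Us).
  by have := Hs i j; rewrite flowq scalemxE dmxE.
split.
- move=> j [] ; [rewrite wT|rewrite wF]; by have [[]] := facts j.
- move=> j s v.
  have entry i k : `|(A (w j s) - H (x, t0)) i k| <= 2 * e1 * h.
    have B : `|A (w j s) i k - H (x, tau) i k| <= e1 * h.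
      by case: s; [rewrite wT|rewrite wF]; have [_ _ Bp Bm _] := facts j; [exact: Bm|exact: Bp].
    have T := time i k; have RR := RicM i k.
    rewrite addmxE oppmxE; move: B T RR; rewrite !ler_norml => /andP[B1 B2] /andP[T1 T2] /andP[R1 R2].
    have K1 : kappa * h ^+ 2 * (2 * RM + e1) <= e1 * h.
      rewrite expr2; have : h * (h * (2 * RM + e1)) <= h * e1 by apply: ler_wpM2l; rewrite ltW.
      have : 0 <= h * (h * (2 * RM + e1)) by rewrite !mulr_ge0 // ltW.
      by nra.
    have X1 : kappa * h ^+ 2 * Ric sdir H (q, t0) i k <= kappa * h ^+ 2 * RM by exact: ler_wpM2l.
    have X2 : kappa * h ^+ 2 * (- RM) <= kappa * h ^+ 2 * Ric sdir H (q, t0) i k by exact: ler_wpM2l.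
    apply/andP; split; clear - B1 B2 T1 T2 K1 X1 X2 mH Uq C eta; lra.
  have -> : bil (A (w j s)) v v - bil (H (x, t0)) v v = bil (A (w j s) - H (x, t0)) v v.
    by rewrite /bil mulmxBr mulmxBl addmxE oppmxE.
  apply: le_trans (bil_norm_le _ _ entry) _; rewrite -expr2; apply: ler_wpM2r; first exact: sqr_ge0.
  rewrite -e1E mulrA; apply: ler_wpM2r; first exact: ltW.
  by apply: ler_wpM2l; [exact: sqr_ge0|apply: ler_wpM2r; [exact: ltW|lra]].
- move=> v.
  pose N := \sum_j (A (w j false) + A (w j true)) - (2 * m) *: H (x, t0).
  have entry i k : `|N i k| <= (m + 3) * e1 * h ^+ 2.
    have NE : N i k = \sum_j (A (w j false) i k + A (w j true) i k) - 2 * m * H (x, t0) i k.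
      by rewrite /N addmxE oppmxE scalemxE summxE; congr (_ - _); apply: eq_bigr => j _; rewrite addmxE.
    pose D j := dmx (wdir (row j E)) (dmx (wdir (row j E)) A) zs i k.
    have DS : \sum_j D j = Q (E^T *m E) i k + Q (E^T *m E) k i.
      rewrite -!jacobi_sum -big_split; apply: eq_bigr => j _ /=.
      by rewrite /D (shifted_metric_second mH Uq) addmxE trmxE.
    have DR : `|\sum_j D j + 2 * Ric sdir H (q, t0) i k| <= e1.
      have rK : tol * curv_size (q, t0) <= e1 / 2.
        rewrite /e1 -mulrA -invfM ler_pdivlMr; last by rewrite !mulr_gt0 ?exprn_gt0 //; lra.
        by rewrite [_ * 2]mulrC.
      have := Q_near i k tol0 Er; have := Q_near k i tol0 Er.
      rewrite DS !Q_inv (Ric_sym k i) !ler_norml => /andP[A1 A2] /andP[B1 B2].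
      by apply/andP; split; lra.
    have SD : `|\sum_j (A (w j false) i k + A (w j true) i k - 2 * H (x, tau) i k - h ^+ 2 * D j)| <= m * (e1 * h ^+ 2).
      apply: le_trans (ler_norm_sum _ _ _) _.
      apply: le_trans (_ : \sum_(j < n.+1) e1 * h ^+ 2 <= _); last by rewrite sum_cst.
      by apply: ler_sum => j _; rewrite wF wT; have [_ HH _ _ _] := facts j; exact: HH.
    have SE : \sum_j (A (w j false) i k + A (w j true) i k - 2 * H (x, tau) i k - h ^+ 2 * D j) =
       \sum_j (A (w j false) i k + A (w j true) i k) - 2 * m * H (x, tau) i k - h ^+ 2 * \sum_j D j.
      by rewrite sumrB sumrB -!mulr_sumr sum_cst mulrA.
    rewrite SE in SD; rewrite NE.
    have E2 : h ^+ 2 * `|\sum_j D j + 2 * Ric sdir H (q, t0) i k| <= h ^+ 2 * e1 by apply: ler_wpM2l; [exact: ltW|].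
    rewrite -{1}(ger0_norm (ltW h20)) -normrM in E2.
    have T2 : `|2 * m * (H (x, tau) i k - H (x, t0) i k - 2 * (kappa * h ^+ 2) * Ric sdir H (q, t0) i k)| <= e1 * h ^+ 2.
      rewrite normrM (@ger0_norm _ (2 * m)) ?mulr_ge0 // ?(ltW m0) //.
      apply: le_trans (_ : 2 * m * (e1 * (kappa * h ^+ 2)) <= _).
        by apply: ler_wpM2l => //; rewrite mulr_ge0 // (ltW m0).
      rewrite (_ : 2 * m * (e1 * (kappa * h ^+ 2)) = 2 * m * kappa * (e1 * h ^+ 2)); last by ring.
      by rewrite km mul1r.
    have T3 : 2 * m * (H (x, tau) i k - H (x, t0) i k - 2 * (kappa * h ^+ 2) * Ric sdir H (q, t0) i k) =
       2 * m * (H (x, tau) i k - H (x, t0) i k) - h ^+ 2 * (2 * Ric sdir H (q, t0) i k).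
      rewrite mulrBr; congr (_ - _).
      transitivity (2 * m * kappa * (h ^+ 2 * (2 * Ric sdir H (q, t0) i k))); first by ring.
      by rewrite km mul1r.
    rewrite T3 in T2; move: SD E2 T2; rewrite mulrDr !ler_norml.
    have e1h : 0 <= e1 * h ^+ 2 by rewrite mulr_ge0 // ltW.
    move=> /andP[S1 S2] /andP[U1 U2] /andP[V1 V2]; apply/andP.
    move: e1h S1 S2 U1 U2 V1 V2; exact: aux_sum.
  have -> : \sum_j (bil (A (w j false)) v v + bil (A (w j true)) v v) - 2 * m * bil (H (x, t0)) v v = bil N v v.
    rewrite /N /bil mulmxBr mulmxBl addmxE oppmxE -scalemxAr -scalemxAl scalemxE; congr (_ - _).
    rewrite mulmx_sumr mulmx_suml summxE; apply: eq_bigr => j _.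
    by rewrite mulmxDr mulmxDl addmxE.
  apply: le_trans (bil_norm_le _ _ entry) _; rewrite -expr2; apply: ler_wpM2r; first exact: sqr_ge0.
  by rewrite -e1E !mulrA.
Qed.

End Estimate.
End LocalEstimate.

(** * Displaced paths and their speeds *)

Section Push.
Variables (R : realType) (n : nat) (M : manifold R n).
Local Notation X := 'rV[R]_n.+1.

Lemma jacobian_curve_continuous (U : set X) (f : X -> X) (x v : R -> X) s : open U -> msmooth U f ->
  (\forall r \near s, U (x r)) -> {for s, continuous x} -> {for s, continuous v} ->
  {for s, continuous (fun r => v r *m jacobian f (x r))}.
Proof.
move=> oU sf nU cx cv; have Us : U (x s) by exact: nbhs_singleton nU.
apply: (@continuous_fcoord R _ _ (rV_fbasis R n)) => b /=.
have C : {for s, continuous (fun r => \sum_a v r 0 a * dmx (xdir R a) f (x r) 0 b)}.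
  rewrite /continuous_at; apply: cvg_big => [|a _]; first exact: add_continuous.
  apply: cvgM.
    exact: (@cvg_comp _ _ _ v (fun v : X => v 0 a) _ _ _ cv (@coord_continuous _ _ _ 0 a _)).
  have c1 := smooth_continuous (msmooth_dmx (xdir R a) sf 0 b) Us.
  exact: (@cvg_comp _ _ _ x _ _ _ _ cx c1).
apply: continuous_germ C; apply: filterS nU => r Ur.
by rewrite mxE; apply: eq_bigr => a _; rewrite (jacobianE _ _ oU sf Ur).
Qed.

Lemma push_path (g : tensor2 M) i (U : set X) (f : X -> X) (c : R -> M) :
  riemannian g -> open U -> msmooth U f -> is_path c ->
  (forall s, [/\ dom i (c s), U (phi i (c s)) & img i (f (phi i (c s)))]) ->
  let c' := psi i \o f \o phi i \o c in
  is_path c' /\ forall s, speed g c' s =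
    gn (jacobian f (phi i (c s)) *m g i (f (phi i (c s))) *m (jacobian f (phi i (c s)))^T) (vel i c s).
Proof.
move=> rg oU sf [C1 c0 c1] H c'.
have E : phi i \o c' = f \o (phi i \o c).
  by apply/funext => s; rewrite /c' /= psiK //; have [] := H s.
have dc s := vel_is_derive C1 (let: And3 h _ _ := H s in h).
have cx s : {for s, continuous (phi i \o c)}.
  have [ic _ _] := H s; have [cc _] := C1.
  exact: (@cvg_comp _ _ _ c (phi i) _ _ _ (cc s) (phi_cont ic)).
have cf s : {for s, continuous (f \o (phi i \o c))}.
  have [_ Us _] := H s.
  exact: (@cvg_comp _ _ _ _ f _ _ _ (cx s) (msmooth_continuous sf Us)).
have cc' : continuous c'.
  move=> s; have [_ _ is_] := H s.
  exact: (@cvg_comp _ _ _ _ (psi i) _ _ _ (cf s) (psi_cont is_)).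
have dc' (s : R) : is_derive s 1 (phi i \o c') (vel i c s *m jacobian f (phi i (c s))).
  by rewrite E; have [_ Us _] := H s; exact: (curve_chain oU sf Us (dc s)).
have velE : vel i c' = fun s => vel i c s *m jacobian f (phi i (c s)).
  by apply/funext => s; rewrite /vel derive1E; have [_ ->] := dc' s.
have C1' : C1_curve c'.
  apply: (C1_from_chart cc') => s; exists i; have [ic Us is_] := H s; split.
  - exact: psi_dom.
  - by apply: (@filterE _ (nbhs s)) => r; have [] := dc' r.
  - rewrite velE; apply: (jacobian_curve_continuous oU sf) => //.
    + by apply: (@filterE _ (nbhs s)) => r; have [] := H r.
    + by have [_ /(_ s i ic)[]] := C1.
split.
  split=> // s s3; first by rewrite /c' /= c0.
  by rewrite /c' /= c1.
move=> s; have [ic Us is_] := H s.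
rewrite (speed_chart rg C1' (psi_dom is_)) velE /gn bil_mul /c' /= psiK //.
Qed.

End Push.

Section PushShifted.
Variables (R : realType) (n : nat) (M : manifold R n) (g : R -> tensor2 M).
Hypothesis ancient : complete_ancient_ricci_flow g.
Local Notation X := 'rV[R]_n.+1.
Local Notation ST := ('rV[R]_n.+1 * R)%type.
Local Notation V := (('rV[R]_n.+1 * R) * 'rV[R]_n.+1)%type.

Lemma derive_slice3 (F : V -> R) (x v w : X) (tau : R) :
  'D_v (fun y => F ((y, tau), w)) x = 'D_((v, 0), 0) F ((x, tau), w).
Proof.
rewrite (derive_slice (fun z : ST => F (z, w))).
have E : (fun h : R => h^-1 *: (((fun y => F (y, w)) \o shift (x, tau)) (h *: (v, 0)) - F ((x, tau), w))) =
    (fun h : R => h^-1 *: ((F \o shift ((x, tau), w)) (h *: ((v, 0), 0)) - F ((x, tau), w))).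
  apply/funext => h /=; congr (_ *: (F _ - _)); apply/pair_equal_spec; split => //=.
  by rewrite scaler0 add0r.
by rewrite /derive E.
Qed.

Variables (i : chart M) (U : set ST) (H : ST -> 'M[R]_n.+1) (q : X) (t0 : R).
Hypothesis extH : flow_ext g i U H.

Let mH : metric_on U H. Proof. by have [] := extH. Qed.

Lemma push_shifted (c : R -> M) tau (w : X) : tau <= 0 -> is_path c ->
  (forall s, dom i (c s) /\ shifted_dom U H q t0 ((phi i (c s), tau), w)) ->
  let c' s := psi i (shifted H q t0 ((phi i (c s), tau), w)) in
  is_path c' /\ forall s, speed (g tau) c' s =
    gn (shifted_metric H q t0 ((phi i (c s), tau), w)) (vel i c s).
Proof.
move=> tau0 pc Hc c'.
have oO := @shifted_dom_open _ _ U H q t0 mH.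
pose W := [set x : X | shifted_dom U H q t0 ((x, tau), w)].
pose f x := shifted H q t0 ((x, tau), w).
have oW : open W.
  rewrite openE => x Wx; have /nbhs_ballP[e /= e0 He] := near_open oO Wx.
  apply/nbhs_ballP; exists e => //= y xy; apply: He; split; last exact: ballxx.
  by split => //=; exact: ballxx.
have sf : msmooth W f.
  move=> a b.
  have S := @shifted_smooth _ _ U H q t0 mH a b.
  have fs k : smooth W (fun x : X => fcoord (V_fbasis R n) k ((x, tau), w)).
    rewrite /=; case: fintype.split => j /=; last exact: smooth_cst.
    case: fintype.split => j' /=; last exact: smooth_cst.
    exact: (smooth_fcoord (fb := rV_fbasis R n) j' oW).
  have S' : smooth (shifted_dom U H q t0) (fun z => shifted H q t0 z a b).
    by apply: smooth_sub S => z [].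
  exact: (smooth_comp (fb := V_fbasis R n) oW oO S' (fun x (Wx : W x) => Wx) fs).
have jE x : W x -> jacobian f x = shifted_jac H q t0 ((x, tau), w).
  move=> Wx; apply/matrixP => a b; rewrite (jacobianE _ _ oW sf Wx) [RHS]mxE /f !dmxE /ldir.
  exact: (derive_slice3 (fun z => shifted H q t0 z 0 b)).
have [_ sub Hg _] := extH.
have inW s : [/\ dom i (c s), W (phi i (c s)) & img i (f (phi i (c s)))].
  by have [ic Ws] := Hc s; split=> //; case: (Ws) => _ /sub.
have [pc' sp] := push_path (flow_riemannian ancient tau0) oW sf pc inW.
split; first exact pc'.
move=> s; have [_ Ws _] := inW s; move: (sp s); rewrite (jE _ Ws) => E.
have Hx : H (f (phi i (c s)), tau) = g tau i (f (phi i (c s))) := Hg _ (proj2 Ws) tau0.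
have Q (J G G' : 'M[R]_n.+1) v : G = G' -> gn (J *m G *m J^T) v = gn (J *m G' *m J^T) v by move=> ->.
exact (eq_trans E (Q _ _ _ _ (esym Hx))).
Qed.

End PushShifted.

(** * Transport of frames over short distances *)

Section FieldDrift.
Variables (R : realType) (n : nat).
Local Notation X := 'rV[R]_n.+1.
Local Notation ST := ('rV[R]_n.+1 * R)%type.
Local Notation m := (n.+1%:R : R).
Variables (U : set ST) (H : ST -> 'M[R]_n.+1) (q : X) (t0 : R).
Hypothesis mH : metric_on U H.
Hypothesis Uq : U (q, t0).

Let Ut := [set x : X | U (x, t0)].
Let oUt : open Ut. Proof. by have [oU _ _ _] := mH; exact: open_slice. Qed.

(** The Gram matrix of the fields given by the rows of [field_mx]. It is stationary at [q], where
    the fields are parallel, so transport over a short distance near [q] spoils orthonormality only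
    by a small multiple of that distance. *)
Definition field_gram (x : X) : 'M[R]_n.+1 :=
  field_mx H q t0 x *m H (x, t0) *m (field_mx H q t0 x)^T.

Lemma field_mx_smooth (W : set X) : open W -> msmooth W (field_mx H q t0).
Proof.
move=> oW; apply: msmoothB => //; first exact: msmooth_cst.
apply: msmooth_sum => // a; apply: msmoothZ => //; last exact: msmooth_cst.
have -> : (fun x : X => (x - q) 0 a) = fun x => x 0 a - q 0 a by apply/funext => x; rewrite !mxE.
apply: smoothB => //; [exact: (smooth_fcoord (fb := rV_fbasis R n) a oW)|exact: smooth_cst].
Qed.

Lemma field_mx_q : field_mx H q t0 q = 1%:M.
Proof. by rewrite /field_mx big1 ?subr0 // => a _; rewrite subrr zeromxE scale0r. Qed.

Let dfield a : dmx (xdir R a) (field_mx H q t0) q = - Gam (@sdir R n) H a (q, t0).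
Proof.
apply: dmx_eq => b c.
pose G d := Gam (@sdir R n) H d (q, t0) b c.
have E : (fun x => field_mx H q t0 x b c) = fun x => (1%:M : 'M[R]_n.+1) b c - \sum_d (x 0 d - q 0 d) * G d.
  apply/funext => x; rewrite /field_mx addmxE oppmxE summxE; congr (_ - _).
  by apply: eq_bigr => d _; rewrite scalemxE addmxE oppmxE.
rewrite E oppmxE -[- _]add0r; apply: is_deriveB.
have -> : Gam (@sdir R n) H a (q, t0) b c = \sum_d (delta_mx 0 a : X) 0 d * G d.
  rewrite (bigD1 a) //= mxE !eqxx mul1r big1 ?addr0 // => d da.
  by rewrite mxE eqxx /= (negbTE da) mul0r.
apply: is_derive_sumR => d.
have H1 : is_derive q (xdir R a) (fun x : X => x 0 d - q 0 d) ((delta_mx 0 a : X) 0 d).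
  rewrite -[X in is_derive _ _ _ X]subr0; apply: is_deriveB.
  exact: (is_derive_coord _ (is_derive_id q (xdir R a))).
have := is_deriveMR H1 (is_derive_cst (G d) q (xdir R a)).
by rewrite mulr0 add0r.
Qed.

Let gram_smooth : msmooth Ut field_gram.
Proof.
have [oU sH _ _] := mH; have sF := field_mx_smooth oUt.
by apply: msmoothM => //; [apply: msmoothM => //; exact: msmooth_slice|exact: msmoothT].
Qed.

Lemma field_gram_flat a : dmx (xdir R a) field_gram q = 0.
Proof.
have [oU sH _ _] := mH; have sF := field_mx_smooth oUt.
have sHt := msmooth_slice t0 oU sH.
rewrite (dmxM _ (msmoothM oUt sF sHt) (msmoothT oUt sF) Uq) (dmxM _ sF sHt Uq) dmxT.
rewrite dfield field_mx_q trmx1 !mulmx1 mul1mx.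
rewrite (dmx_slice H q (xdir R a) t0) -[(xdir R a, 0)]/(sdir R a) (metric_connection _ mH _ Uq).
rewrite trmxN mulmxN !mulNmx mul1mx trmx_mul; have [_ _ symH _] := mH; rewrite symH //.
apply/matrixP => b c; rewrite !addmxE !oppmxE zeromxE; ring.
Qed.

Lemma field_gram_drift eps : 0 < eps -> exists2 r, 0 < r & forall x y,
  `|x - q| < r -> `|y - q| < r -> forall b c, `|field_gram y b c - field_gram x b c| <= eps * `|y - x|.
Proof.
move=> eps0; pose P (k : 'I_n.+1 * ('I_n.+1 * 'I_n.+1)) x :=
  `|dmx (xdir R k.1) field_gram x k.2.1 k.2.2| <= eps / m.
have m0 : 0 < m by rewrite ltr0n.
have HP k : \forall x \near q, P k x.
  have /cvgrPdist_le /(_ _ (divr_gt0 eps0 m0)) := smooth_continuous (msmooth_dmx (xdir R k.1) gram_smooth k.2.1 k.2.2) Uq.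
  by apply: filterS => x; rewrite field_gram_flat zeromxE sub0r normrN.
have [r r0 Hr] : exists2 r, 0 < r & forall x, `|x - q| < r -> Ut x /\ forall k, P k x.
  exact: near_dist (filterI (near_open oUt Uq) (filter_forall _ HP)).
exists r => // x y xr yr b c.
have seg (s : R) : 0 <= s <= 1 -> `|x + s *: (y - x) - q| < r.
  move=> /andP[s0 s1].
  have -> : x + s *: (y - x) - q = (1 - s) *: (x - q) + s *: (y - q).
    by apply/rowP => k; rewrite !mxE; ring.
  apply: le_lt_trans (ler_normD _ _) _; rewrite !normrZ !ger0_norm ?subr_ge0 //.
  case: (ltrP s 1) => s2.
    have h1 : (1 - s) * `|x - q| < (1 - s) * r by rewrite ltr_pM2l ?subr_gt0.
    have h2 : s * `|y - q| <= s * r by rewrite ler_wpM2l // ltW.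
    lra.
  have -> : s = 1 by apply/eqP; rewrite eq_le s1.
  by rewrite subrr mul0r add0r mul1r.
have in_ (s : R) : 0 <= s <= 1 -> Ut (x + s *: (y - x)) /\ forall k, P k (x + s *: (y - x)).
  by move=> s01; apply: Hr; exact: seg.
have [Ux _] : Ut x /\ forall k, P k x by exact: Hr.
pose F z := field_gram z b c.
have D (s : R) : 0 <= s <= 1 -> is_derive s 1 (fun s => F (x + s *: (y - x))) ('D_(y - x) F (x + s *: (y - x))).
  move=> /in_[Us _]; apply: is_derive_line; exact: (smooth_derivable (gram_smooth b c) Us).
have [s s01] := mvt ler01 D.
rewrite scale1r scale0r addr0 subr0 mulr1 [x + _]addrC subrK /F => ->.
have [Us Ps] := in_ s s01.
rewrite (derive_dirE (rV_fbasis R n) _ oUt (gram_smooth b c) Us).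
apply: le_trans (ler_norm_sum _ _ _) _.
apply: le_trans (_ : \sum_(k < n.+1) `|y - x| * (eps / m) <= _).
  apply: ler_sum => k _; rewrite normrM; apply: ler_pM => //; first exact: coord_le_norm.
  by have := Ps (k, (b, c)); rewrite /P /= dmxE.
rewrite sum_cst mulrCA [_ * (eps / m)]mulrC divfK ?gt_eqF //.
by rewrite mulrC.
Qed.

End FieldDrift.

Section InverseNearOne.
Variables (R : realType) (n : nat).

Lemma invmx_near1 (e : R) : 0 < e -> exists2 r : R, 0 < r & forall P : 'M[R]_n.+1,
  (forall a b, `|P a b - (a == b)%:R| <= r) -> P \in unitmx /\
  forall a b, `|invmx P a b - (a == b)%:R| <= e.
Proof.
move=> e0; pose U := [set P : 'M[R]_n.+1 | P \in unitmx].
have sid (W : set 'M[R]_n.+1) : open W -> msmooth W (fun P => P).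
  move=> oW a b; apply: smooth_lin => //; first exact: coord_continuous.
  by move=> c u w; rewrite !mxE.
have oU : open U.
  have -> : U = (fun P : 'M[R]_n.+1 => \det P) @^-1` (~` [set 0]).
    by apply/seteqP; split=> P; rewrite /U /= unitmxE unitfE => /eqP.
  apply: open_comp => [P _|]; last by rewrite openC; exact: closed_eq.
  exact: (smooth_continuous (smooth_det openT (sid _ openT)) I).
have sI := msmooth_inv oU (sid _ oU) (fun P h => h).
have U1 : U 1%:M by exact: unitmx1.
pose Q (k : 'I_n.+1 * 'I_n.+1) (P : 'M[R]_n.+1) := `|invmx P k.1 k.2 - (k.1 == k.2)%:R| <= e.
have HQ k : \forall P \near (1%:M : 'M[R]_n.+1), Q k P.
  have /cvgrPdist_le /(_ _ e0) := smooth_continuous (sI k.1 k.2) U1.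
  by apply: filterS => P; rewrite invmx1 mxE distrC.
have [r r0 Hr] : exists2 r, 0 < r & forall P : 'M[R]_n.+1, `|P - 1%:M| < r -> U P /\ forall k, Q k P.
  exact: near_dist (filterI (near_open oU U1) (filter_forall _ HQ)).
exists (r / 2); first by rewrite divr_gt0.
move=> P HP; have [UP QP] : U P /\ forall k, Q k P.
  apply: Hr; apply: le_lt_trans (_ : r / 2 < r); last by lra.
  apply: mx_norm_le => [|a b]; first by rewrite divr_ge0 // ltW.
  by rewrite addmxE oppmxE [X in _ - X]mxE.
by split=> // a b; exact: QP (a, b).
Qed.

End InverseNearOne.

(** * Growth of the distance between two framed points *)

Section Speeds.
Variable R : realType.

(** From squared speeds to speeds: 2 g0 sqrt(a) <= g0^2 + a, by concavity of the square root. Thus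
    first order deviations of the single terms cost nothing in the sum. *)
Lemma speeds_sum N (a : 'I_N -> bool -> R) (g0 b1 b2 : R) : 0 <= g0 -> 0 <= b1 <= 1 -> 0 <= b2 ->
  (forall k s, `|a k s - g0 ^+ 2| <= b1 * g0 ^+ 2) ->
  `|\sum_k (a k false + a k true) - 2 * N%:R * g0 ^+ 2| <= b2 * g0 ^+ 2 ->
  (forall k s, Num.sqrt (a k s) <= (1 + b1) * g0) /\
  \sum_k (Num.sqrt (a k false) + Num.sqrt (a k true)) <= (2 * N%:R + b2) * g0.
Proof.
move=> g00 /andP[b10 b11] b20 Ha Hs.
have single k s : Num.sqrt (a k s) <= (1 + b1) * g0.
  have := Ha k s; rewrite ler_norml => /andP[_ Hk].
  have g1 : 0 <= (1 + b1) * g0 by rewrite mulr_ge0 // addr_ge0.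
  rewrite -(ger0_norm g1) -sqrtr_sqr ler_wsqrtr // exprMn.
  have : 0 <= g0 ^+ 2 by exact: sqr_ge0.
  nra.
split=> //; have [z|gN0] := eqVneq g0 0.
  rewrite z mulr0 big1 // => k _; apply/eqP; rewrite eq_le addr_ge0 ?sqrtr_ge0 // andbT.
  by have := single k false; have := single k true; rewrite z mulr0; lra.
have gpos : 0 < g0 by rewrite lt_def gN0.
have amgm k s : 2 * g0 * Num.sqrt (a k s) <= g0 ^+ 2 + a k s.
  have := Ha k s; rewrite ler_norml => /andP[Hk _].
  have a0 : 0 <= a k s by nra.
  rewrite -[X in _ + X]sqr_sqrtr //; have := sqr_ge0 (g0 - Num.sqrt (a k s)).
  by rewrite sqrrB; lra.
have S : 2 * g0 * \sum_k (Num.sqrt (a k false) + Num.sqrt (a k true)) <=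
    \sum_k (a k false + a k true) + 2 * N%:R * g0 ^+ 2.
  rewrite mulr_sumr; apply: le_trans (_ : \sum_k ((a k false + a k true) + 2 * g0 ^+ 2) <= _).
    by apply: ler_sum => k _; have := amgm k false; have := amgm k true; lra.
  by rewrite big_split /= sum_cst mulrCA mulrA.
move: Hs; rewrite ler_norml => /andP[_ Hs].
have b2g : 0 <= b2 * g0 ^+ 2 by rewrite mulr_ge0 // sqr_ge0.
suff : 2 * g0 * \sum_k (Num.sqrt (a k false) + Num.sqrt (a k true)) <= 2 * g0 * ((2 * N%:R + b2) * g0).
  by rewrite ler_pM2l // mulr_gt0.
rewrite (_ : 2 * g0 * ((2 * N%:R + b2) * g0) = 4 * N%:R * g0 ^+ 2 + 2 * (b2 * g0 ^+ 2)); last by ring.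
lra.
Qed.

Lemma increment_le (f f' : R -> R) (g g' : R -> R) :
  (forall s : R, is_derive s 1 f (f' s)) -> (forall s : R, is_derive s 1 g (g' s)) ->
  (forall s, f' s <= g' s) -> f 1 - f 0 <= g 1 - g 0.
Proof.
move=> df dg fg; have D (s : R) : 0 <= s <= 1 -> is_derive s 1 (g - f) (g' s - f' s).
  by move=> _; exact: is_deriveB.
have [s _] := mvt ler01 D; rewrite subr0 mulr1.
rewrite -[(g - f) 1]/(g 1 - f 1) -[(g - f) 0]/(g 0 - f 0) => E.
have := fg s; lra.
Qed.

Lemma sum_addr2 N (f g : 'I_N -> R) (c : R) :
  \sum_k (f k + c + (g k + c)) = \sum_k (f k + g k) + N%:R * (2 * c).
Proof.
rewrite (eq_bigr (fun k => (f k + g k) + 2 * c)) => [|k _]; last by ring.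
by rewrite big_split /= sum_cst.
Qed.

End Speeds.

Section Spread.
Variables (R : realType) (n : nat) (M : manifold R n) (g : R -> tensor2 M).
Hypothesis ancient : complete_ancient_ricci_flow g.
Local Notation X := 'rV[R]_n.+1.
Local Notation m := (n.+1%:R : R).
Local Notation xdir := (@xdir R n).
Local Notation kappa := ((2 * m)^-1).

(** A frame is kept with its chart and coordinates and may fail to be orthonormal; [frame_gap]
    bounds the failure. *)
Record frame_at := FrameAt { fchart : chart M; fpos : X; fmx : 'M[R]_n.+1 }.
Implicit Types P Q : frame_at.
Definition fpoint P : M := psi (fchart P) (fpos P).
Definition shoot t P (Y : X) : M :=
  psi (fchart P) (moved (fun c => Gam xdir (g t (fchart P)) c (fpos P)) (fpos P) Y).
Definition frame_gap t P (a : R) := forall b c,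
  `|(fmx P *m g t (fchart P) (fpos P) *m (fmx P)^T) b c - (b == c)%:R| <= a.

(** Upper bounds [a k s] are used instead of the distances themselves, so that they add up under
    concatenation ([spread_trans]). The maximum principle needs the sum to order h ^ 2; the single
    bounds of order h keep the displaced configuration inside the cutoff. *)
Definition spread (t : R) P Q (d e : R) := exists2 h0 : R, 0 < h0 & forall h : R, 0 < h -> h < h0 ->
  exists a : 'I_n.+1 -> bool -> R,
  (forall k (s : bool), dlt (g (t - kappa * h ^+ 2)) (shoot t P (((-1) ^+ s * h) *: row k (fmx P)))
      (shoot t Q (((-1) ^+ s * h) *: row k (fmx Q))) (a k s) /\ a k s <= d + e * h) /\
  \sum_k (a k false + a k true) <= 2 * m * d + e * h ^+ 2.

Let kappa_ge0 : 0 <= kappa. Proof. by rewrite invr_ge0 mulr_ge0. Qed.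

Lemma past_le0 (t h : R) : t <= 0 -> t - kappa * h ^+ 2 <= 0.
Proof.
move=> t0; rewrite subr_le0; apply: le_trans t0 _.
by apply: mulr_ge0; [exact: kappa_ge0|exact: sqr_ge0].
Qed.

Lemma spread_trans t P Q S d d' e e' : t <= 0 -> spread t P Q d e -> spread t Q S d' e' ->
  spread t P S (d + d') (e + e').
Proof.
move=> t0 [h1 h10 H1] [h2 h20 H2]; exists (Num.min h1 h2); first by rewrite lt_min h10.
move=> h h0; rewrite lt_min => /andP[hh1 hh2].
have [a [Ha Sa]] := H1 h h0 hh1; have [b [Hb Sb]] := H2 h h0 hh2.
exists (fun k s => a k s + b k s); split.
  move=> k s; have [A1 A2] := Ha k s; have [B1 B2] := Hb k s; split.
    exact: (dlt_trans (flow_riemannian ancient (past_le0 h t0)) A1 B1).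
  by rewrite mulrDl; lra.
rewrite (eq_bigr (fun k => (a k false + a k true) + (b k false + b k true))) => [|k _]; last by ring.
by rewrite big_split /= mulrDl mulrDr; lra.
Qed.

Lemma spread_weaken t P Q d e e' : e <= e' -> spread t P Q d e -> spread t P Q d e'.
Proof.
move=> ee [h1 h10 H1]; exists h1 => // h h0 hh; have [a [Ha Sa]] := H1 h h0 hh.
exists a; split.
  move=> k s; have [A1 A2] := Ha k s; split=> //.
  have : e * h <= e' * h by rewrite ler_wpM2r // ltW.
  by lra.
have : e * h ^+ 2 <= e' * h ^+ 2 by rewrite ler_wpM2r // sqr_ge0.
by lra.
Qed.

Lemma curv_size_near (U : set ('rV[R]_n.+1 * R)%type) (H : 'rV[R]_n.+1 * R -> 'M[R]_n.+1) z0 :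
  metric_on U H -> U z0 -> \forall z \near z0, curv_size H z <= curv_size H z0 + 1.
Proof.
move=> mH Uz; have [_ sH _ _] := mH.
have sR a b : msmooth U (fun z => Rc (@sdir R n) H a b z *m H z).
  by apply: msmoothM => //; [by have [] := mH|exact: Rc_msmooth].
have C : {for z0, continuous (curv_size H)}.
  rewrite /continuous_at /curv_size; apply: cvgD; first exact: cvg_cst.
  do 4 (apply: cvg_big => [|? _]; first exact: add_continuous).
  apply: cvg_norm; exact: smooth_continuous (sR _ _ _ _) Uz.
have /cvgrPdist_le /(_ _ (ltr01 : 0 < 1 :> R)) := C.
by apply: filterS => z; rewrite ler_norml => /andP[A1 A2]; lra.
Qed.

Section LocalStep.
Variables (i : chart M) (t0 : R).
Hypothesis t00 : t0 <= 0.

Let rg : riemannian (g t0). Proof. exact: flow_riemannian. Qed.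

(** The frame [E] at [x] is continued to [y] with constant coefficients [e] in the fields of
    [field_mx]. The order of quantifiers matters: the admissible gap [rho] is independent of the
    drift [eps], so the drift can be chosen afterwards to keep the gap below [rho] along a whole
    path. *)
Lemma field_frame L tol : 0 < L -> 0 < tol -> let C := 4 * m * L in
  exists2 rho, 0 < rho & forall (U : set ('rV[R]_n.+1 * R)%type) (H : 'rV[R]_n.+1 * R -> 'M[R]_n.+1) q r1,
  flow_ext g i U H -> U (q, t0) -> good_ball (g t0) i q r1 L -> forall eps, 0 < eps ->
  exists2 r, 0 < r & forall x y E a d, `|x - q| < r -> `|y - q| < r -> a <= rho ->
   frame_gap t0 (FrameAt i x E) a -> `|y - x| <= L * d ->
   exists e : 'M[R]_n.+1, [/\ forall j, `|row j e| <= C,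
     forall b c, `|(e^T *m e) b c - invmx (H (q, t0)) b c| <= tol,
     e *m field_mx H q t0 x = E &
     frame_gap t0 (FrameAt i y (e *m field_mx H q t0 y)) (a + eps * d)].
Proof.
move=> L0 r40 C; have m0 : 0 < m by rewrite ltr0n.
have C0 : 0 < C by rewrite !mulr_gt0.
pose e2 := tol / (m ^+ 2 * C ^+ 2).
have d2 : 0 < m ^+ 2 * C ^+ 2 by rewrite mulr_gt0 ?exprn_gt0.
have [rho rho0 Hrho] := invmx_near1 n (divr_gt0 r40 d2).
exists (Num.min 1 (rho / 2)); first by rewrite lt_min ltr01 divr_gt0.
move=> U H q r1 extH Uq [r10 _ ball_img bounds] eps eps0.
have [mH _ Hg _] := extH; have [oU sH symH uH] := mH.
have [r2 r20 Hr2] : exists2 r, 0 < r & forall x, `|x - q| < r -> U (x, t0) /\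
    field_mx H q t0 x \in unitmx /\ forall b c, `|invmx (field_mx H q t0 x) b c| <= 2.
  have [rho1 rho10 Hrho1] := invmx_near1 n (ltr01 : 0 < 1 :> R).
  pose P (k : 'I_n.+1 * 'I_n.+1) (x : X) := `|field_mx H q t0 x k.1 k.2 - (k.1 == k.2)%:R| <= rho1.
  have HP k : \forall x \near q, P k x.
    have /cvgrPdist_le /(_ _ rho10) := smooth_continuous (@field_mx_smooth _ _ H q t0 setT openT k.1 k.2) (I : setT q).
    by apply: filterS => x; rewrite field_mx_q mxE distrC.
  have oUt : open [set x : X | U (x, t0)] by exact: open_slice.
  have [r r0 Hr] : exists2 r, 0 < r & forall x, `|x - q| < r -> U (x, t0) /\ forall k, P k x.
    exact: near_dist (filterI (near_open oUt Uq) (filter_forall _ HP)).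
  exists r => // x xr; have [Ux Px] := Hr x xr.
  have [u1 u2] := Hrho1 _ (fun b c => Px (b, c)); split=> //; split=> // b c.
  have D1 : (0 : R) <= (b == c)%:R by exact: ler0n.
  have D2 : (b == c)%:R <= (1 : R) by case: (b == c); [exact: lexx|exact: ler01].
  have := u2 b c; rewrite !ler_norml => /andP[A1 A2].
  by apply/andP; split; lra.
pose e1 := eps / (m ^+ 2 * C ^+ 2 * L).
have d1 : 0 < m ^+ 2 * C ^+ 2 * L by rewrite !mulr_gt0 ?exprn_gt0.
have e10 : 0 < e1 by rewrite divr_gt0.
have e1E : m ^+ 2 * C ^+ 2 * L * e1 = eps by rewrite mulrC divfK // gt_eqF.
have [r3 r30 Hr3] := field_gram_drift mH Uq e10.
have k0 : 0 < eps / L by rewrite divr_gt0.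
pose r := Num.min (Num.min 1 r1) (Num.min (Num.min r2 r3) (rho / 2 / (eps / L))).
have r_gt0 : 0 < r by rewrite /r !lt_min ltr01 r10 r20 r30 !divr_gt0.
exists r => // x y E a d xrr yrr; move: (xrr) (yrr); rewrite {1 2}/r !lt_min -!andbA => /and5P[_ x1 x2 x3 _] /and5P[_ y1 y2 y3 _] ar gapE yx.
have [Ux [ux ix]] := Hr2 x x2; have [Uy _] := Hr2 y y2.
have Hx : H (x, t0) = g t0 i x by rewrite (Hg _ Ux).
have Hy : H (y, t0) = g t0 i y by rewrite (Hg _ Uy).
pose e := E *m invmx (field_mx H q t0 x).
have eE : e *m field_mx H q t0 x = E by rewrite /e -mulmxA mulVmx // mulmx1.
have ar1 : a <= 1 by apply: le_trans ar _; rewrite ge_min lexx.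
have arho : a <= rho / 2 by apply: le_trans ar _; rewrite ge_min lexx orbT.
have rowE_ k : `|row k E| <= 2 * L.
  have [b1 _] := bounds x (row k E) x1; apply: le_trans b1 _; rewrite mulrC ler_pM2r //.
  have := gapE k k; rewrite /= eqxx frame_bil ler_norml => /andP[_ B].
  have -> : (2 : R) = Num.sqrt (2 ^+ 2) by rewrite sqrtr_sqr ger0_norm.
  have B' : bil (g t0 i x) (row k E) (row k E) - 1 <= a by exact: B.
  by rewrite /gn ler_wsqrtr //; clear - B' ar1; lra.
have rowe k : `|row k e| <= C.
  rewrite /e row_mul; apply: le_trans (norm_mulmx_le _ ix) _.
  apply: le_trans (_ : m * 2 * (2 * L) <= _); last by rewrite /C; clear - L ancient i t00; lra.
  by rewrite ler_wpM2l // mulr_ge0 // ltW.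
have gramE z : (e *m field_mx H q t0 z) *m H (z, t0) *m (e *m field_mx H q t0 z)^T =
    e *m field_gram H q t0 z *m e^T.
  by rewrite trmx_mul /field_gram !mulmxA.
have drift z z' b c : `|z - q| < r3 -> `|z' - q| < r3 ->
    `|(e *m field_gram H q t0 z' *m e^T) b c - (e *m field_gram H q t0 z *m e^T) b c| <= eps / L * `|z' - z|.
  move=> z3 z3'; rewrite !frame_bil.
  have -> : bil (field_gram H q t0 z') (row b e) (row c e) - bil (field_gram H q t0 z) (row b e) (row c e) =
     bil (field_gram H q t0 z' - field_gram H q t0 z) (row b e) (row c e).
    by rewrite /bil mulmxBr mulmxBl addmxE oppmxE.
  have ent b' c' : `|(field_gram H q t0 z' - field_gram H q t0 z) b' c'| <= e1 * `|z' - z|.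
    by rewrite addmxE oppmxE; exact: Hr3.
  apply: le_trans (bil_norm_le _ _ ent) _.
  apply: le_trans (_ : m ^+ 2 * (e1 * `|z' - z|) * (C * C) <= _).
    apply: ler_wpM2l; last by apply: ler_pM.
    exact (mulr_ge0 (exprn_ge0 _ (ltW m0)) (mulr_ge0 (ltW e10) (normr_ge0 _))).
  rewrite -e1E; apply: le_of_eq; field.
  by rewrite gt_eqF.
exists e; split=> //.
- move=> b c; pose P0 := e *m field_gram H q t0 q *m e^T.
  have P0E : P0 = e *m H (q, t0) *m e^T by rewrite /P0 /field_gram field_mx_q trmx1 mul1mx mulmx1.
  have [uP iP] : P0 \in unitmx /\ forall b c, `|invmx P0 b c - (b == c)%:R| <= e2.
    apply: Hrho => b' c'.
    have D := drift x q b' c' x3; rewrite subrr normr0 in D; have {D} := D r30.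
    have := gapE b' c'; rewrite /= -Hx -{1 2}eE gramE -/P0 => G1 G2.
    have xr : `|q - x| <= r by rewrite distrC ltW.
    have er : eps / L * `|q - x| <= eps / L * r by rewrite ler_wpM2l // ltW // divr_gt0.
    have rr : eps / L * r <= rho / 2 by rewrite mulrC -ler_pdivlMr // /r !ge_min lexx !orbT.
    apply: le_trans (ler_distD _ _ _) (le_trans (lerD (le_trans G2 (le_trans er rr)) (le_trans G1 arho)) _).
    by rewrite -splitr.
  have ue : e \in unitmx by move: uP; rewrite P0E !unitmx_mul => /andP[/andP[]].
  have uG : H (q, t0) \in unitmx by exact: uH.
  have inv : e^T *m invmx P0 *m e = invmx (H (q, t0)).
    have E1 : e *m (H (q, t0) *m (e^T *m invmx P0 *m e)) = e.
      by rewrite !mulmxA -P0E mulmxV // mul1mx.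
    have E2 : H (q, t0) *m (e^T *m invmx P0 *m e) = 1%:M.
      by rewrite -(mulKmx ue (H (q, t0) *m _)) E1 mulVmx.
    by rewrite -(mulKmx uG (e^T *m _ *m _)) E2 mulmx1.
  have -> : (e^T *m e) b c - invmx (H (q, t0)) b c = bil (1%:M - invmx P0) (row b e^T) (row c e^T).
    by rewrite -frame_bil trmxK -inv mulmxBr mulmxBl mulmx1 addmxE oppmxE.
  have ent b' c' : `|(1%:M - invmx P0) b' c'| <= e2.
    by rewrite addmxE oppmxE [X in X - _]mxE distrC; exact: iP.
  apply: le_trans (bil_norm_le _ _ ent) _.
  have colC b' : `|row b' e^T| <= C.
    apply: row_norm_le => [|j]; first exact: ltW.
    rewrite mxE trmxE; have := rowe j; apply: le_trans.
    by have := coord_le_norm (row j e) 0 b'; rewrite mxE.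
  apply: le_trans (_ : m ^+ 2 * e2 * (C * C) <= _).
    apply: ler_wpM2l; last exact: ler_pM.
    by rewrite mulr_ge0 ?exprn_ge0 // ltW // divr_gt0.
  rewrite -expr2 mulrAC mulrC /e2 divfK // gt_eqF //.
- move=> b c; rewrite /= -Hy gramE.
  have := drift x y b c x3 y3; have := gapE b c; rewrite /= -Hx -{1 2}eE gramE => G1 G2.
  have yL : eps / L * `|y - x| <= eps * d.
    apply: le_trans (_ : eps / L * (L * d) <= _); first by rewrite ler_wpM2l // ltW // divr_gt0.
    by rewrite mulrA divfK // gt_eqF.
  by rewrite [a + _]addrC; exact (le_trans (ler_distD _ _ _) (lerD (le_trans G2 yL) G1)).
Qed.

(** [eps] is the growth of the distance and [eps2] the loss of orthonormality, both per unit length.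
    Only the last radius depends on [eps2]; [rho] and [R0] do not. *)
Lemma local_step q0 eps : img i q0 -> 0 < eps -> exists rho R0, [/\ 0 < rho, 0 < R0 &
  forall q eps2, `|q - q0| < R0 -> 0 < eps2 -> exists2 r, 0 < r &
  forall x y E a d, `|x - q| < r -> `|y - q| < r -> a <= rho -> d < r ->
  frame_gap t0 (FrameAt i x E) a -> dle (g t0) (psi i x) (psi i y) d ->
  exists2 F : 'M[R]_n.+1, frame_gap t0 (FrameAt i y F) (a + eps2 * d) &
    forall s, 0 < s -> spread t0 (FrameAt i x E) (FrameAt i y F) d (eps * d + s)].
Proof.
move=> iq0 eps0; have [U [H [extH Uq0]]] := flow_extension ancient iq0 t00.
have [r0 [L [r00 L0 ball_img0 bounds0]]] := good_ball_exists rg iq0.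
have [mH _ Hg flowH] := extH; have [oU sH symH uH] := mH.
pose C := 4 * m * L; have C0 : 0 < C by rewrite !mulr_gt0.
have eta0 : 0 < eps / L ^+ 2 by rewrite divr_gt0 // exprn_gt0.
have cs z : 1 <= curv_size H z by rewrite lerDl; do 4 (apply: sumr_ge0 => ? _).
pose D := (curv_size H (q0, t0) + 1) * (2 * (m ^+ 2 * (m + 3))).
have D0 : 0 < D by apply: mulr_gt0 => //; have := cs (q0, t0); lra.
pose tol := eps / L ^+ 2 / D; have tol0 : 0 < tol by rewrite divr_gt0.
have [rho rho0 Hrho] := field_frame L0 tol0.
have [R0 R00 HR0] : exists2 r, 0 < r & forall q, `|q - q0| < r -> U (q, t0) /\
    curv_size H (q, t0) <= curv_size H (q0, t0) + 1.
  have /nbhs_ballP[r /= r_0 Hr] : nbhs (q0, t0) (fun z => U z /\ curv_size H z <= curv_size H (q0, t0) + 1).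
    exact: (filterI (near_open oU Uq0) (curv_size_near mH Uq0)).
  exists r => // q qr; apply: Hr; split; last exact: ballxx.
  by rewrite -ball_normE /= distrC.
exists rho, (Num.min R0 (r0 / 2)); split=> //; first by rewrite lt_min R00 divr_gt0.
move=> q eps2; rewrite lt_min => /andP[qR qr0] eps20; have [Uq csq] := HR0 q qR.
pose r1 := r0 / 2; have r10 : 0 < r1 by rewrite divr_gt0.
have in_ball z : `|z - q| < r1 -> `|z - q0| < r0.
  by move=> zr; apply: le_lt_trans (ler_distD q _ _) _; rewrite /r1 in zr; lra.
have ball_img z : `|z - q| < r1 -> img i z by move=> /in_ball; exact: ball_img0.
have bounds z v : `|z - q| < r1 -> `|v| <= L * gn (g t0 i z) v /\ gn (g t0 i z) v <= L * `|v|.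
  by move=> /in_ball; exact: bounds0.
have gb : good_ball (g t0) i q r1 L by split.
have tolE : tol * curv_size H (q, t0) * (2 * (m ^+ 2 * (m + 3))) <= eps / L ^+ 2.
  have -> : eps / L ^+ 2 = tol * D by rewrite divfK // gt_eqF.
  by rewrite -mulrA ler_pM2l // /D ler_pM2r.
have [r4 r40 Hr4] := local_estimate mH Uq (flowH _ Uq t00) C0 eta0 (erefl kappa) (ltW tol0) tolE.
have [r2 r20 Hr2] := Hrho U H q r1 extH Uq gb eps2 eps20.
pose r5 := Num.min r1 r4; have r51 : r5 <= r1 by rewrite ge_min lexx.
have r50 : 0 < r5 by rewrite lt_min r10.
pose r := Num.min r2 (r5 / (1 + 2 * L)).
have k0 : 0 < 1 + 2 * L by rewrite addr_gt0 // mulr_gt0.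
have r_0 : 0 < r by rewrite lt_min r20 divr_gt0.
have r2r : r <= r2 by rewrite /r ge_min lexx.
have r5r : r + L * (2 * r) <= r5.
  have : r <= r5 / (1 + 2 * L) by rewrite /r ge_min lexx orbT.
  by rewrite ler_pdivlMr //; lra.
have rr5 : r <= r5 by apply: le_trans r5r; rewrite lerDl !mulr_ge0 // ltW.
exists r => // x y E a d xr yr ar dr gapE dxy.
have L0' : 0 <= L by exact: ltW.
have xr1 : `|x - q| < r1 by apply: lt_le_trans xr _; exact: le_trans rr5 r51.
have yr1 : `|y - q| < r1 by apply: lt_le_trans yr _; exact: le_trans rr5 r51.
have ix := ball_img _ xr1; have iy := ball_img _ yr1.
have rr1 : r + L * (2 * r) <= r1 by exact: le_trans r5r r51.
have yx : `|y - x| <= L * d.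
  apply/ler_addgt0Pr => e e0; pose e' := Num.min r (e / L).
  have e'0 : 0 < e' by rewrite lt_min r_0 divr_gt0.
  have e'r : e' <= r by rewrite ge_min lexx.
  have e'e : L * e' <= e by rewrite mulrC -ler_pdivlMr // ge_min lexx orbT.
  have := chart_lower rg L0 ball_img bounds (dxy e' e'0) (psi_dom ix).
  rewrite !psiK // => HH; have [|_] := HH.
    apply: le_trans rr1; apply: lerD; first exact: ltW.
    by rewrite ler_wpM2l //; clear - dr e'r; lra.
  by rewrite mulrDr; clear - e'e; lra.
have [e [rowe gram_e eE gapF]] := Hr2 x y E a d (lt_le_trans xr r2r) (lt_le_trans yr r2r) ar gapE yx.
exists (e *m field_mx H q t0 y) => // s s0.
(* The path may be longer than [d] by c0 h ^ 2, little enough to be absorbed by [s] after summation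
   over the 2 m displacements. *)
pose c0 := Num.min r (s / (4 * m + eps + 4)).
have D4 : 0 < 4 * m + eps + 4 by rewrite !addr_gt0 // mulr_gt0.
have c00 : 0 < c0 by rewrite lt_min r_0 divr_gt0.
have c0s : c0 * (4 * m + eps + 4) <= s by rewrite -ler_pdivlMr // ge_min lexx orbT.
have c0r : c0 <= r by rewrite ge_min lexx.
pose h0 := Num.min (Num.min 1 r4) (eps^-1).
exists h0; first by rewrite !lt_min ltr01 r40 invr_gt0.
move=> h hp; rewrite !lt_min -andbA => /and3P[h1 h4 he].
have eh1 : eps * h <= 1 by rewrite mulrC -ler_pdivlMr // mul1r ltW.
pose s' := c0 * h ^+ 2.
have h2 : 0 < h ^+ 2 by rewrite exprn_gt0.
have h21 : h ^+ 2 <= h by rewrite expr2 ler_piMl // ltW.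
have s'0 : 0 < s' by rewrite mulr_gt0.
have s'r : s' <= r by apply: le_trans c0r; rewrite ler_piMr ?(ltW c00) // (le_trans h21) ?ltW.
(* The nearly minimizing path depends on [h]. *)
have [c [Phi [pc aPhi c_0 c_1 len]]] := dxy s' s'0.
have stay u : dom i (c u) /\ `|phi i (c u) - q| < r5.
  apply: (path_stays rg L0 _ _ pc aPhi).
  - by move=> z zr; apply: ball_img; exact: lt_le_trans zr r51.
  - by move=> z v zr; apply: bounds; exact: lt_le_trans zr r51.
  - by rewrite c_0; exact: psi_dom.
  - rewrite c_0 psiK //; apply: lt_le_trans r5r; apply: ltr_leD => //.
    by rewrite ler_wpM2l //; clear - len dr s'r; lra.
set tau := t0 - kappa * h ^+ 2; have tau0 : tau <= 0 by exact: past_le0.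
pose w (k : 'I_n.+1) (b : bool) : X := ((-1) ^+ b * h) *: row k e.
have r54 : r5 <= r4 by rewrite /r5 ge_min lexx orbT.
have facts u := Hr4 (phi i (c u)) h e (lt_le_trans (stay u).2 r54) hp h4 rowe gram_e.
have Ow k b u : dom i (c u) /\ shifted_dom U H q t0 ((phi i (c u), tau), w k b).
  by split; [have [] := stay u|have [HO _ _] := facts u; exact: HO].
have push k b := push_shifted ancient extH tau0 pc (Ow k b).
pose c' k b u := psi i (shifted H q t0 ((phi i (c u), tau), w k b)).
have aL k b : exists Psi, arclength (g tau) (c' k b) Psi.
  by have [pk _] := push k b; exact (path_arclength (flow_riemannian ancient tau0) pk).
pose Psi k b := projT1 (cid (aL k b)).
have HPsi k b : arclength (g tau) (c' k b) (Psi k b) := projT2 (cid (aL k b)).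
have sp u : speed (g t0) c u = gn (H (phi i (c u), t0)) (vel i c u).
  have [C1 _ _] := pc; have [ic _] := stay u; rewrite (speed_chart rg C1 ic) (Hg (phi i (c u), t0)) //.
  by have [_ [+ _]] := Ow ord0 false u.
have speeds u : (forall k b, speed (g tau) (c' k b) u <= (1 + eps * h) * speed (g t0) c u) /\
    \sum_k (speed (g tau) (c' k false) u + speed (g tau) (c' k true) u) <= (2 * m + eps * h ^+ 2) * speed (g t0) c u.
  have [_ F1 F2] := facts u.
  pose v := vel i c u; pose g0 := gn (H (phi i (c u), t0)) v.
  have Hgu : H (phi i (c u), t0) = g t0 i (phi i (c u)).
    by rewrite (Hg (phi i (c u), t0)) //; have [_ [+ _]] := Ow ord0 false u.
  have ur1 : `|phi i (c u) - q| < r1.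
    by have [_ ur] := stay u; exact: lt_le_trans ur r51.
  have pd : posdef (H (phi i (c u), t0)).
    by rewrite Hgu; apply: (riemannian_posdef rg); exact: ball_img.
  have g00 : 0 <= g0 by exact: gn_ge0.
  have vL : `|v| ^+ 2 <= L ^+ 2 * g0 ^+ 2.
    by rewrite -exprMn lerXn2r ?nnegrE ?mulr_ge0 //; rewrite /g0 Hgu; have [] := bounds _ v ur1.
  have g0E : bil (H (phi i (c u), t0)) v v = g0 ^+ 2 by rewrite gn_sqr.
  have vL2 (z : R) : 0 <= z -> eps / L ^+ 2 * z * `|v| ^+ 2 <= eps * z * g0 ^+ 2.
    move=> z0; apply: le_trans (_ : eps / L ^+ 2 * z * (L ^+ 2 * g0 ^+ 2) <= _).
      by rewrite ler_wpM2l // mulr_ge0 // ltW.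
    apply: le_of_eq; field; by rewrite gt_eqF.
  pose A k b := bil (shifted_metric H q t0 ((phi i (c u), tau), w k b)) v v.
  have [S1 S2] : (forall k b, Num.sqrt (A k b) <= (1 + eps * h) * g0) /\
      \sum_k (Num.sqrt (A k false) + Num.sqrt (A k true)) <= (2 * m + eps * h ^+ 2) * g0.
    apply: speeds_sum => //.
    - by rewrite mulr_ge0 // ltW.
    - by rewrite mulr_ge0 // ltW.
    - move=> k b; rewrite -g0E; apply: le_trans (F1 k b v) _; rewrite g0E; apply: vL2; exact: ltW.
    - rewrite -g0E; apply: le_trans (F2 v) _; rewrite g0E; apply: vL2; exact: ltW.
  have spk k b : speed (g tau) (c' k b) u = Num.sqrt (A k b) by have [_ ->] := push k b.
  split=> [k b|]; first by rewrite spk sp; exact: S1.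
  by rewrite sp; apply: le_trans S2; apply: ler_sum => k _; rewrite !spk.
pose ell := Phi 1 - Phi 0.
have scaleD (b : R) (f f' : R -> R) : (forall u : R, is_derive u 1 f (f' u)) ->
    forall u : R, is_derive u 1 (fun u => b * f u) (b * f' u).
  move=> df u; rewrite mulrC; exact: (is_derive_compR (is_derive_scale b (f u)) (df u)).
have lenk k b : Psi k b 1 - Psi k b 0 <= (1 + eps * h) * ell.
  have := increment_le (HPsi k b) (scaleD (1 + eps * h) _ _ aPhi) (fun u => (speeds u).1 k b).
  by rewrite -mulrBr.
have lenS : \sum_k ((Psi k false 1 - Psi k false 0) + (Psi k true 1 - Psi k true 0)) <= (2 * m + eps * h ^+ 2) * ell.
  have DS (u : R) : is_derive u 1 (fun u => \sum_k (Psi k false u + Psi k true u))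
      (\sum_k (speed (g tau) (c' k false) u + speed (g tau) (c' k true) u)).
    apply: is_derive_sumR => k; apply: is_deriveD; [exact: HPsi|exact: HPsi].
  have := increment_le DS (scaleD (2 * m + eps * h ^+ 2) _ _ aPhi) (fun u => (speeds u).2).
  rewrite -mulrBr -/ell; apply: le_trans; rewrite -sumrB; apply: le_of_eq.
  by apply: eq_bigr => k _; rewrite addrACA opprD.
exists (fun k b => Psi k b 1 - Psi k b 0 + s').
have ell_s : ell <= d + s' by exact: ltW.
have hs : s' * (4 * m + eps + 4) <= s * h ^+ 2.
  by rewrite /s' mulrAC ler_wpM2r // ltW.
split.
  move=> k b; split.
    have [pk _] := push k b.
    have start x' : U (x', t0) -> img i x' -> psi i (shifted H q t0 ((x', tau), w k b)) =
        shoot t0 (FrameAt i x' (e *m field_mx H q t0 x')) (((-1) ^+ b * h) *: row k (e *m field_mx H q t0 x')).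
      move=> Ux' _; rewrite /shoot /shifted /w row_mul -scalemxAl /=.
      congr (psi i (moved _ _ _)).
      by have [-> _] := flow_slice_eq oU t00 Hg Ux'.
    have Ux : U (x, t0) by have [_ [+ _]] := Ow k b 0; rewrite c_0 /= psiK.
    have Uy : U (y, t0) by have [_ [+ _]] := Ow k b 1; rewrite c_1 /= psiK.
    have S0 := start x Ux ix; rewrite eE in S0; have S1 := start y Uy iy.
    exists (c' k b), (Psi k b); split; [exact pk|exact (HPsi k b)| | |].
    - by rewrite /c' c_0 (psiK ix); exact S0.
    - by rewrite /c' c_1 (psiK iy); exact S1.
    - by rewrite ltrDl.
  have := lenk k b; move: (Psi k b 1 - Psi k b 0) => z zl.
  have : (1 + eps * h) * ell <= (1 + eps * h) * (d + s') by rewrite ler_wpM2l // addr_ge0 // mulr_ge0 // ltW.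
  have : eps * h * s' <= s' by rewrite ler_piMl // ltW.
  have : s * h ^+ 2 <= s * h by rewrite ler_wpM2l // ltW.
  have : 0 <= s' * m by rewrite mulr_ge0 // ltW.
  have : 0 <= s' * eps by rewrite mulr_ge0 // ltW.
  clear - zl hs s'0; lra.
rewrite sum_addr2.
have : (2 * m + eps * h ^+ 2) * ell <= (2 * m + eps * h ^+ 2) * (d + s').
  by rewrite ler_wpM2l // addr_ge0 // mulr_ge0 // ltW.
have : eps * h ^+ 2 * s' <= eps * s'.
  rewrite ler_wpM2r ?(ltW s'0) // ler_piMr ?(ltW eps0) //; clear - h21 h1 ancient i t00; lra.
move: lenS; move: (\sum_k _) => z zl; clear - zl hs s'0; lra.
Qed.

End LocalStep.
End Spread.

(** * Change of chart *)

Section FlatCurves.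
Variable R : realType.

Lemma smooth_id1 (W : set R) : open W -> smooth W (fun h => h).
Proof. by move=> oW; exact: (smooth_fcoord (fb := R_fbasis R) ord0 oW). Qed.

Lemma flat_curve (U : set R) (D : R -> R) : open U -> smooth U D -> U 0 -> D 0 = 0 ->
  'D_1 D 0 = 0 -> 'D_1 ('D_1 D) 0 = 0 -> forall e : R, 0 < e ->
  exists2 h0 : R, 0 < h0 & forall h : R, `|h| < h0 -> `|D h| <= e * h ^+ 2.
Proof.
move=> oU sD U0 D0 D1 D2 e e0.
have sD1 := smooth_derive (1 : R) sD; have sD2 := smooth_derive (1 : R) sD1.
have N : \forall h \near (0 : R), `|'D_1 ('D_1 D) h| <= e.
  have /cvgrPdist_le /(_ _ e0) := smooth_continuous sD2 U0.
  by apply: filterS => h; rewrite D2 sub0r normrN.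
have [h0 h00 near'] := near_dist (filterI (near_open oU U0) N).
have near h : `|h| < h0 -> U h /\ `|'D_1 ('D_1 D) h| <= e by rewrite -{1}[h]subr0; exact: near'.
have pt (s : R) : 0 + s *: 1 = s :> R by rewrite add0r; exact: mulr1.
have first_ (h : R) : `|h| < h0 -> `|'D_1 D h| <= e * `|h|.
  move=> hh; have := @segment_increment R R ('D_1 D) 0 1 h 0 e.
  rewrite pt D1 mulr0 !subr0; apply => s sh; rewrite pt subr0.
  have [Us es] := near s (le_lt_trans sh hh); split=> //; exact: (smooth_derivable sD1 Us).
exists h0 => // h hh; have := @segment_increment R R D 0 1 h 0 (e * `|h|).
rewrite pt D0 mulr0 !subr0 -mulrA -expr2 real_normK ?num_real //; apply => s sh; rewrite pt subr0.
have [Us _] := near s (le_lt_trans sh hh); split; first exact: (smooth_derivable sD Us).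
by apply: le_trans (first_ s (le_lt_trans sh hh)) _; rewrite ler_wpM2l // ltW.
Qed.

Variable n : nat.
Local Notation X := 'rV[R]_n.+1.

Definition parabola (x Y Z : X) (h : R) : X := x + h *: Y - (2^-1 * h ^+ 2) *: Z.

Lemma parabola_smooth (W : set R) (x Y Z : X) : open W -> msmooth W (parabola x Y Z).
Proof.
move=> oW; have sh := smooth_id1 oW; have cs (a : R) := smooth_cst a oW.
have cm (A : X) := msmooth_cst A oW.
have E : (fun h : R => 2^-1 * h ^+ 2) = fun h => 2^-1 * (h * h) by apply/funext => h; rewrite expr2.
have sq : smooth W (fun h : R => 2^-1 * h ^+ 2).
  by rewrite E; exact (smoothM oW (cs _) (smoothM oW sh sh)).
exact (msmoothB oW (msmoothD oW (cm x) (msmoothZ oW sh (cm Y))) (msmoothZ oW sq (cm Z))).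
Qed.

Lemma dmx_parabola (x Y Z : X) (h : R) : dmx (1 : R) (parabola x Y Z) h = Y - h *: Z.
Proof.
apply: dmx_eq => a b; rewrite !mxE.
have E : (fun h => parabola x Y Z h a b) = fun h => x a b + h * Y a b - (2^-1 * (h * h)) * Z a b.
  by apply/funext => t; rewrite !mxE expr2.
rewrite E.
have Hid : is_derive h 1 (fun h : R => h) 1 by exact: is_derive_id.
have Hc (c : R) : is_derive h 1 (fun _ : R => c) 0 by exact: is_derive_cst.
have H1 := is_deriveDR (Hc (x a b)) (is_deriveMR Hid (Hc (Y a b))).
have H2 := is_deriveMR (is_deriveMR (Hc 2^-1) (is_deriveMR Hid Hid)) (Hc (Z a b)).
have H3 : is_derive h 1 (fun h => x a b + h * Y a b - 2^-1 * (h * h) * Z a b) _ := is_deriveB H1 H2.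
by apply: (is_derive_eq H3); field.
Qed.

Lemma moved_parabola (Gm : 'I_n.+1 -> 'M[R]_n.+1) (x Y : X) (h : R) :
  moved Gm x (h *: Y) = parabola x Y (\sum_c Y 0 c *: (Y *m Gm c)) h.
Proof.
rewrite /moved /parabola; congr (_ - _); rewrite -scalerA; congr (_ *: _).
rewrite scaler_sumr; apply: eq_bigr => c _.
by rewrite mxE -scalemxAl !scalerA; congr (_ *: _); ring.
Qed.

Section CompCurve.
Variables (p q : nat) (W : set R) (U : set X) (F : X -> 'M[R]_(p, q)) (c : R -> X).
Hypotheses (oW : open W) (oU : open U) (sF : msmooth U F) (sc : msmooth W c).
Hypothesis WU : forall h, W h -> U (c h).

Lemma comp_curve_smooth : msmooth W (fun h => F (c h)).
Proof. exact: (msmooth_comp (fb := rV_fbasis R n) oW oU sF WU (fun i => sc 0 i)). Qed.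

Lemma dmx_comp_curve h : W h ->
  dmx (1 : R) (fun h => F (c h)) h = \sum_b (dmx (1 : R) c h) 0 b *: dmx (xdir R b) F (c h).
Proof.
move=> Wh; apply: (dmx_comp (fb := rV_fbasis R n) (d := fun b => (dmx (1 : R) c h) 0 b) oU sF (WU Wh)).
  by move=> i; exact: (dmx_is_derive (1 : R) 0 i sc Wh).
exact: msmooth_continuous sc Wh.
Qed.

End CompCurve.

(* Both sides are the geodesic with initial velocity Y, up to third order. *)
Lemma transition_parabola (U : set X) (T : X -> X) (J : X -> 'M[R]_n.+1)
    (x Y Z Z' : X) (e : R) :
  open U -> U x -> msmooth U T -> (forall y a b, U y -> J y a b = dmx (xdir R a) T y 0 b) ->
  Z *m J x = \sum_a Y 0 a *: (Y *m dmx (xdir R a) J x) + Z' -> 0 < e ->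
  exists2 h0 : R, 0 < h0 & forall h : R, `|h| < h0 -> U (parabola x Y Z h) /\
    `|T (parabola x Y Z h) - parabola (T x) (Y *m J x) Z' h| <= e * h ^+ 2.
Proof.
move=> oU Ux sT JE ZE e0; pose c := parabola x Y Z.
pose W := [set h : R | U (c h)].
have sc (W' : set R) : open W' -> msmooth W' c by exact: parabola_smooth.
have oW : open W.
  apply: (open_comp _ oU) => h _; exact: (msmooth_continuous (sc _ openT) (I : setT h)).
have c0 : c 0 = x by rewrite /c /parabola expr0n /= mulr0 !scale0r addr0 subr0.
have W0 : W 0 by rewrite /W /= c0.
have WU h : W h -> U (c h) by [].
have sD := comp_curve_smooth oW oU sT (sc _ oW) WU.
pose p' := parabola (T x) (Y *m J x) Z'.
have sp : msmooth W p' by exact: parabola_smooth.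
pose D h := T (c h) - p' h.
have sDD : msmooth W D by exact: msmoothB.
have E1 h : W h -> dmx (1 : R) D h = (Y - h *: Z) *m J (c h) - (Y *m J x - h *: Z').
  move=> Wh; rewrite (dmxB _ oW sD sp Wh) (dmx_comp_curve oU sT (sc _ oW) WU Wh) !dmx_parabola.
  congr (_ - _); apply/rowP => b; rewrite summxE mxE; apply: eq_bigr => a _.
  by rewrite scalemxE (JE _ _ _ Wh).
have sJ : msmooth U J.
  move=> a b; apply: (smooth_ext (f := fun y => dmx (xdir R a) T y 0 b)) => //.
    by move=> y Uy; rewrite JE.
  exact: (msmooth_dmx (xdir R a) sT 0 b).
have sJc := comp_curve_smooth oW oU sJ (sc _ oW) WU.
have sq (A B : X) : msmooth W (fun h => A - h *: B).
  exact (msmoothB oW (msmooth_cst A oW) (msmoothZ oW (smooth_id1 oW) (msmooth_cst B oW))).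
have dq (A B : X) h : dmx (1 : R) (fun h : R => A - h *: B) h = - B.
  apply: dmx_eq => a b; rewrite !mxE.
  have Eq : (fun h => (A - h *: B) a b) = fun h => A a b - h * B a b by apply/funext => t; rewrite !mxE.
  rewrite Eq.
  have Hid : is_derive h 1 (fun h : R => h) 1 by exact: is_derive_id.
  have Hc (r : R) : is_derive h 1 (fun _ : R => r) 0 by exact: is_derive_cst.
  have H3 : is_derive h 1 (fun h => A a b - h * B a b) _ := is_deriveB (Hc (A a b)) (is_deriveMR Hid (Hc (B a b))).
  apply: (is_derive_eq H3); ring.
have E2 : dmx (1 : R) (dmx (1 : R) D) 0 = 0.
  rewrite (dmx_ext (1 : R) oW E1 W0) (dmxB _ oW (msmoothM oW (sq Y Z) sJc) (sq _ _) W0).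
  rewrite (dmxM _ (sq Y Z) sJc W0) !dq (dmx_comp_curve oU sJ (sc _ oW) WU W0) dmx_parabola.
  rewrite c0 scale0r subr0 mulNmx opprK ZE mulmx_sumr.
  under [X in - _ + X]eq_bigr do rewrite -scalemxAr.
  by rewrite -addrA addNr.
have D0 : D 0 = 0.
  by rewrite /D c0 /p' /parabola expr0n /= mulr0 !scale0r addr0 subr0 subrr.
have D1 : dmx (1 : R) D 0 = 0 by rewrite (E1 _ W0) c0 !scale0r !subr0 subrr.
have flat b : exists2 h0 : R, 0 < h0 & forall h : R, `|h| < h0 -> `|D h 0 b| <= e * h ^+ 2.
  apply: (flat_curve oW (sDD 0 b)) => //; first by rewrite D0 mxE.
    by have := congr1 (fun A : X => A 0 b) D1; rewrite dmxE mxE.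
  have H2 := congr1 (fun A : X => A 0 b) E2; rewrite dmxE mxE in H2.
  have E : (fun h => dmx (1 : R) D h 0 b) = 'D_(1 : R) (fun h => D h 0 b).
    by apply/funext => h; exact: dmxE.
  by rewrite E in H2.
have N b : \forall h \near (0 : R), `|D h 0 b| <= e * h ^+ 2.
  have [h0 h00 Hh] := flat b; apply/nbhs_ballP; exists h0 => //= h.
  by rewrite -ball_normE /= sub0r normrN; exact: Hh.
pose P b h := `|D h 0 b| <= e * h ^+ 2.
have NP b : \forall h \near (0 : R), P b h by exact: N.
have /nbhs_ballP[h0 /= h00 Hh] : nbhs (0 : R) (fun h => W h /\ forall b, P b h).
  exact: (filterI (near_open oW W0) (filter_forall _ NP)).
exists h0 => // h hh; have [Wh Ph] : W h /\ forall b, P b h.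
  by apply: Hh; rewrite -ball_normE /= sub0r normrN.
split=> //; apply: row_norm_le => [|b]; last exact: Ph.
by rewrite mulr_ge0 ?(ltW e0) // sqr_ge0.
Qed.

End FlatCurves.

Section Switch.
Variables (R : realType) (n : nat) (M : manifold R n) (g : R -> tensor2 M).
Hypothesis ancient : complete_ancient_ricci_flow g.
Local Notation X := 'rV[R]_n.+1.
Local Notation m := (n.+1%:R : R).
Local Notation xdir := (@xdir R n).
Local Notation kappa := ((2 * m)^-1).

Lemma flow_good_ball (i : chart M) x0 t0 : img i x0 -> t0 <= 0 ->
  exists r L, [/\ 0 < r, 0 < L & forall t, t <= 0 -> `|t - t0| < r -> good_ball (g t) i x0 r L].
Proof.
move=> ix t00; have [U [H [[mH sub Hg _] Ux]]] := flow_extension ancient ix t00.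
have [oU sH _ _] := mH.
have rg := flow_riemannian ancient t00.
have Hx : H (x0, t0) = g t0 i x0 by exact: (Hg _ Ux).
have [_ symg _ _] := rg.
have symH : (H (x0, t0))^T = H (x0, t0) by rewrite Hx symg.
have pH : posdef (H (x0, t0)) by rewrite Hx; exact: (riemannian_posdef rg).
have cH j k : {for (x0, t0), continuous (fun z => H z j k)} by exact: smooth_continuous (sH j k) Ux.
have [L L0 NL] := near_gn_bounds cH symH pH.
have /nbhs_ballP[r /= r0 Hr] : nbhs (x0, t0) (fun z => U z /\ forall v,
    `|v| <= L * gn (H z) v /\ gn (H z) v <= L * `|v|).
  exact: filterI (near_open oU Ux) NL.
exists r, L; split=> // t tle tr.
have near x : `|x - x0| < r -> ball (x0, t0) r (x, t).
  by move=> xr; split; rewrite -ball_normE /= distrC.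
split=> // [x xr|x v xr]; have [Ux' B] := Hr _ (near x xr); first exact: (sub _ Ux').
by have := B v; rewrite (Hg _ Ux').
Qed.

Section Law.
Variables (i j : chart M) (g' : tensor2 M).
Hypothesis rg : riemannian g'.
Local Notation T := (transition i j).
Local Notation J := (jacobian (transition i j)).

Lemma jacobian_unit x : overlap i j x -> J x \in unitmx.
Proof.
move=> ox; have [ix _] := (overlapP i j x).1 ox.
have [_ _ _ uG] := riemannian_metric_on i rg; have := uG x ix.
by have [_ _ _ law] := rg; rewrite (law i j x ox) !unitmx_mul => /andP[/andP[]].
Qed.

Lemma transition_laws x : overlap i j x ->
  (forall a, Gam xdir (g' i) a x *m J x =
     dmx (xdir a) J x + J x *m \sum_b J x a b *: Gam xdir (g' j) b (T x)) /\
  Ric xdir (g' i) x = J x *m Ric xdir (g' j) (T x) *m (J x)^T.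
Proof.
move=> ox; have oO : open (overlap i j) := overlap_open i j.
have sT : msmooth (overlap i j) T := transition_msmooth i j.
have TO y : overlap i j y -> img j (T y).
  by move=> /transition_overlap /overlapP[].
have JE y a' b : overlap i j y -> J y a' b = dmx (xdir a') T y 0 b.
  by move=> oy; exact: jacobianE oO sT oy.
have sJ : msmooth (overlap i j) J.
  move=> a' b; apply: (smooth_ext (f := fun y => dmx (xdir a') T y 0 b)) => //.
    by move=> y Uy; rewrite JE.
  exact: (msmooth_dmx (xdir a') sT 0 b).
have mG' := riemannian_metric_on j rg; have [oI _ _ _] := mG'.
have ps (F : X -> 'M[R]_n.+1) : msmooth (img j) F -> msmooth (overlap i j) (fun y => F (T y)).
  move=> sF; exact: (msmooth_comp (fb := rV_fbasis R n) oO oI sF TO (fun k => sT 0 k)).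
have pc (F : X -> 'M[R]_n.+1) a' y : msmooth (img j) F -> overlap i j y ->
    dmx (xdir a') (fun y => F (T y)) y = \sum_b J y a' b *: dmx (xdir b) F (T y).
  move=> sF oy; have D k : is_derive y (xdir a') (fun y => fcoord (rV_fbasis R n) k (T y)) (J y a' k).
    by rewrite (JE _ _ _ oy); exact: (dmx_is_derive (xdir a') 0 k sT oy).
  exact: (dmx_comp oI sF (TO y oy) D (msmooth_continuous sT oy)).
have cJ a' b c y : overlap i j y -> dmx (xdir a') J y b c = dmx (xdir b) J y a' c.
  move=> oy; have E d e : dmx (xdir d) J y e c = dmx (xdir d) (dmx (xdir e) T) y 0 c.
    have := @dmx_ext _ _ _ _ (overlap i j) (xdir d) (row e \o J) (dmx (xdir e) T) y oO.
    move=> /(_ _ oy) <-; last by move=> z oz; apply/rowP => k; rewrite /= mxE JE.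
    by rewrite dmx_row mxE.
  by rewrite !E (dmxC _ _ oO sT oy).
have pe y : overlap i j y -> pullback_metric T J (g' j) y = g' i y.
  by move=> oy; have [_ _ _ law] := rg; rewrite (law i j y oy).
split=> [a|].
  have := @Gam_law _ _ _ _ xdir xdir T (overlap i j) (img j) J (g' j) oO TO ps pc sJ jacobian_unit cJ mG' a x ox.
  by rewrite /pulled_Gam => <-; congr (_ *m _); rewrite (Gam_ext xdir oO pe).
rewrite -(Ric_ext xdir oO pe ox).
exact: (@Ric_law _ _ _ _ xdir xdir T (overlap i j) (img j) J (g' j) oO TO ps pc sJ jacobian_unit cJ mG' x ox).
Qed.

End Law.

Definition switch i j (P : frame_at M) : frame_at M :=
  FrameAt j (transition i j (fpos P)) (fmx P *m jacobian (transition i j) (fpos P)).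

Lemma switch_gap t j P a : t <= 0 -> overlap (fchart P) j (fpos P) -> frame_gap g t P a ->
  frame_gap g t (switch (fchart P) j P) a.
Proof.
move=> t0 ox gap b c; have [_ _ _ law] := flow_riemannian ancient t0.
by have := gap b c; rewrite (law _ j _ ox) /switch /= trmx_mul !mulmxA.
Qed.

(** The two framed points coincide, and the curves shot in the two charts approximate the same
    geodesic, so they are o(h^2) apart ([transition_parabola]). *)
Lemma spread_switch t j P e : t <= 0 -> overlap (fchart P) j (fpos P) -> 0 < e ->
  spread g t P (switch (fchart P) j P) 0 e.
Proof.
case: P => i x E /= t0 ox e0; set y := transition i j x; set J := jacobian (transition i j) x.
have rg := flow_riemannian ancient t0.
have iy : img j y by have /overlapP[] := transition_overlap ox.
have [r [L [r0 L0 gb]]] := flow_good_ball iy t0.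
(* With this value the 2 m displacements, each bounded by 2 L e1 h^2, add up to e h^2. *)
pose e1 := e / (2 * (2 * m * L)).
have d0 : 0 < 2 * m * L by rewrite !mulr_gt0.
have e10 : 0 < e1 by rewrite divr_gt0 // mulr_gt0.
have e1E : 2 * m * L * e1 = e / 2.
  by rewrite /e1; move: d0; move: (2 * m * L) => D D0; field; rewrite gt_eqF.
pose Zi (k : 'I_n.+1) : X := \sum_c (row k E) 0 c *: (row k E *m Gam xdir (g t i) c x).
pose Zj (k : 'I_n.+1) : X := \sum_c (row k E *m J) 0 c *: (row k E *m J *m Gam xdir (g t j) c y).
have Zlaw k : Zi k *m J = \sum_a (row k E) 0 a *: (row k E *m dmx (xdir a) (jacobian (transition i j)) x) + Zj k.
  rewrite /Zi mulmx_suml.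
  rewrite (eq_bigr (fun a => (row k E) 0 a *: (row k E *m dmx (xdir a) (jacobian (transition i j)) x) +
     (row k E) 0 a *: (row k E *m J *m \sum_b J a b *: Gam xdir (g t j) b y))); last first.
    move=> a _; rewrite -scalemxAl -mulmxA ((transition_laws rg ox).1 a) mulmxDr scalerDr.
    by rewrite !mulmxA.
  rewrite big_split /=; congr (_ + _).
  transitivity (\sum_a \sum_b ((row k E) 0 a * J a b) *: (row k E *m J *m Gam xdir (g t j) b y)).
    apply: eq_bigr => a _; rewrite mulmx_sumr scaler_sumr; apply: eq_bigr => b _.
    by rewrite -scalemxAr scalerA.
  rewrite exchange_big; apply: eq_bigr => b _ /=.
  by rewrite -scaler_suml; congr (_ *: _); rewrite mxE.
have oO : open (overlap i j) := overlap_open i j.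
have sT : msmooth (overlap i j) (transition i j) := transition_msmooth i j.
have JE z a b : overlap i j z -> jacobian (transition i j) z a b = dmx (xdir a) (transition i j) z 0 b.
  by move=> oz; exact: jacobianE oO sT oz.
have TP k := transition_parabola oO ox sT JE (Zlaw k) e10.
pose Q (k : 'I_n.+1) (h : R) := [/\ overlap i j (parabola x (row k E) (Zi k) h),
  `|transition i j (parabola x (row k E) (Zi k) h) - parabola y (row k E *m J) (Zj k) h| <= e1 * h ^+ 2 &
  `|parabola y (row k E *m J) (Zj k) h - y| < r / 2].
have NQ k : \forall h \near (0 : R), Q k h.
  have [h0 h00 Hh] := TP k.
  have N1 : \forall h \near (0 : R), `|h| < h0.
    by apply/nbhs_ballP; exists h0 => //= h; rewrite -ball_normE /= sub0r normrN.
  have N2 : \forall h \near (0 : R), `|parabola y (row k E *m J) (Zj k) h - y| < r / 2.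
    have C := msmooth_continuous (parabola_smooth y (row k E *m J) (Zj k) openT) (I : setT 0).
    have P0 : parabola y (row k E *m J) (Zj k) 0 = y.
      by rewrite /parabola expr0n /= mulr0 !scale0r addr0 subr0.
    have r2 : 0 < r / 2 by rewrite divr_gt0.
    have /cvgrPdist_lt /(_ _ r2) := C; apply: filterS => h; rewrite P0 distrC.
    exact.
  by apply: filterS2 N1 N2 => h /Hh [].
have /nbhs_ballP[h1 /= h10 Hh1] : nbhs (0 : R) (fun h => forall k, Q k h) by exact: (filter_forall _ NQ).
pose h0 := Num.min (Num.min h1 1) (Num.min (r / 2) (r / (2 * (1 + e1)))).
exists h0; first by rewrite !lt_min h10 ltr01 !divr_gt0 // mulr_gt0 // addr_gt0.
move=> h hp; rewrite !lt_min => /andP[/andP[hh1 h1'] /andP[hr2 hr]].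
have h2 : 0 < h ^+ 2 by rewrite exprn_gt0.
have h2h : h ^+ 2 <= h by rewrite expr2 ler_piMl // ltW.
set tau := t - kappa * h ^+ 2; have tau0 : tau <= 0 by exact: past_le0.
have kl : kappa <= 1 by rewrite invf_le1 ?mulr_gt0 //; have : 1 <= m by [rewrite ler1n]; lra.
have tr : `|tau - t| < r.
  rewrite /tau addrAC subrr add0r normrN ger0_norm ?mulr_ge0 ?ltW //.
  have A1 : kappa * h ^+ 2 <= h ^+ 2 by rewrite ler_piMl // ltW.
  have A2 : r / 2 < r by lra.
  exact: le_lt_trans (le_trans A1 h2h) (lt_trans hr2 A2).
have [_ _ bi bd] := gb tau tau0 tr.
have e1r : e1 * h ^+ 2 < r / 2.
  have : h * (2 * (1 + e1)) < r by rewrite -ltr_pdivlMr // mulr_gt0 // addr_gt0.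
  have : e1 * h ^+ 2 <= e1 * h by rewrite ler_wpM2l // ltW.
  lra.
exists (fun _ _ => e / m * h ^+ 2 / 2); split.
  move=> k s; split; last first.
    rewrite add0r; have : e / m <= e.
      by rewrite ler_pdivrMr // ler_peMr ?ler1n // ltW.
    have em : 0 <= e / m by rewrite divr_ge0 // ltW.
    move=> eme; have := ler_pM em (ltW h2) eme h2h.
    have : 0 <= e / m * h ^+ 2 by rewrite mulr_ge0 // ltW.
    by move: (e / m * h ^+ 2) => z; lra.
  rewrite /shoot /switch /= row_mul !moved_parabola.
  set hs := (-1) ^+ s * h.
  have hsa : `|hs| = h by rewrite /hs normrMsign ger0_norm // ltW.
  have hs2 : hs ^+ 2 = h ^+ 2 by rewrite -[LHS]real_normK ?num_real // hsa.
  have [k1 k2 k3] : Q k hs.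
    by have /(_ hs) := Hh1; rewrite -ball_normE /= sub0r normrN hsa => /(_ hh1).
  rewrite hs2 in k2.
  change (dlt (g tau) (psi i (parabola x (row k E) (Zi k) hs)) (psi j (parabola y (row k E *m J) (Zj k) hs))
    (e / m * h ^+ 2 / 2)).
  rewrite -(psi_transition k1); apply: (chart_upper (flow_riemannian ancient tau0) bi bd).
  - apply: le_lt_trans (ler_distD (parabola y (row k E *m J) (Zj k) hs) _ _) _.
    by move: (le_lt_trans k2 e1r) k3; rewrite /Zi /Zj; lra.
  - by move: k3; rewrite /Zj; lra.
  - rewrite distrC; apply: le_lt_trans (_ : L * (e1 * h ^+ 2) < _).
      by rewrite ler_wpM2l // ltW.
    have -> : e / m * h ^+ 2 / 2 = 2 * (L * (e1 * h ^+ 2)).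
      rewrite (_ : e = 2 * (2 * m * L * e1)); last by rewrite e1E; field.
      by field; rewrite gt_eqF.
    by have := mulr_gt0 L0 (mulr_gt0 e10 h2); move: (L * _) => z; lra.
rewrite sum_cst mulr0 add0r; apply: le_of_eq.
by field; rewrite gt_eqF.
Qed.

End Switch.

(** * Propagation of a frame over long distances *)

Lemma near_covering_at_right (R : realType) (T : topologicalType) (K : set T) (P : R -> T -> Prop) : compact K ->
  (forall x, K x -> exists2 r : R, 0 < r & \forall y \near x, forall r', 0 < r' -> r' <= r -> P r' y) ->
  exists2 r : R, 0 < r & forall x, K x -> P r x.
Proof.
move=> /compact_near_coveringP cK H.
have [|r /= r0 Hr] := cK R (0 : R)^'+ P _.
  move=> x Kx; have [r r0 Hr] := H x Kx.
  exists ([set y | forall r', 0 < r' -> r' <= r -> P r' y], [set r' | 0 < r' /\ r' <= r]) => /=.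
    split=> //; exists r => //= r' /=; rewrite sub0r normrN => r'r r'0.
    by split=> //; rewrite ltW // -(gtr0_norm r'0).
  by move=> [y r'] /= [Py [r'0 r'r]]; exact: Py.
exists (r / 2); first by rewrite divr_gt0.
apply: Hr; last by rewrite divr_gt0.
by rewrite /= sub0r normrN gtr0_norm ?divr_gt0 //; lra.
Qed.

Section Chain.
Variables (R : realType) (n : nat) (M : manifold R n) (g : R -> tensor2 M).
Hypothesis ancient : complete_ancient_ricci_flow g.
Variable t : R.
Hypothesis t0 : t <= 0.
Implicit Types (P Q : frame_at M) (p q : M).

Let rg : riemannian (g t). Proof. exact: flow_riemannian. Qed.
Let complete_g : riem_complete (g t). Proof. exact: flow_complete. Qed.

Definition framed P p := img (fchart P) (fpos P) /\ fpoint P = p.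

(** The starting frame may be given in any chart. The property thus depends on the point alone, and
    its radius can be made uniform on compact sets. *)
Definition step_ok (eps eps2 rho r : R) (p : M) := forall P a q d, framed P p -> a <= rho -> d < r ->
  frame_gap g t P a -> dle (g t) p q d ->
  exists Q, [/\ framed Q q, frame_gap g t Q (a + eps2 * d) &
    forall s, 0 < s -> spread g t P Q d (eps * d + s)].

Lemma local_step_ok eps p0 : 0 < eps -> exists2 rho, 0 < rho & \forall p \near p0,
  forall eps2, 0 < eps2 -> exists2 r, 0 < r & \forall p' \near p, step_ok eps eps2 rho r p'.
Proof.
move=> eps0; set i := chart_at p0; have ip0 : dom i p0 by exact: dom_chart_at.
have iq0 := phi_img ip0.
have [rho [R0 [rho0 R00 HR]]] := local_step ancient t0 iq0 eps0.
exists rho => //.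
have near_ball p e : dom i p -> 0 < e -> \forall p' \near p, dom i p' /\ `|phi i p' - phi i p| < e.
  move=> ip e0; have N1 : \forall p' \near p, dom i p' by exact: (near_open (dom_open i) ip).
  have /cvgrPdist_lt /(_ _ e0) N2 := phi_cont ip.
  by apply: filterS2 N1 N2 => p' h1; rewrite distrC; split.
apply: filterS (near_ball _ _ ip0 R00) => p [ip pR] eps2 eps20.
have [r1 r10 Hr1] := HR _ eps2 pR eps20.
have [r2 [L gb]] := good_ball_exists rg (phi_img ip); have [r20 L0 bi bd] := gb.
pose r3 := Num.min r1 r2; have r30 : 0 < r3 by rewrite lt_min r10.
pose r := Num.min r1 (r3 / (4 * L)).
have r0 : 0 < r by rewrite lt_min r10 divr_gt0 // mulr_gt0.
exists r => //; have r32 : 0 < r3 / 4 by rewrite divr_gt0.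
apply: filterS (near_ball _ _ ip r32) => p' [ip' p'r] [j x E] a q d [jx /= xp] ar dr gap pq.
rewrite /= in xp jx; have ox : overlap j i x.
  by apply/overlapP; split=> //; rewrite -[psi j x]/(fpoint (FrameAt j x E)) xp.
have xi : transition j i x = phi i p' by rewrite /transition /= -xp.
have Lr : L * r <= r3 / 4.
  have : r <= r3 / (4 * L) by rewrite /r ge_min lexx orbT.
  rewrite ler_pdivlMr ?mulr_gt0 //; lra.
have [iq qp] : dom i q /\ `|phi i q - phi i p'| < L * r.
  apply: (chart_lower rg L0 bi bd (dle_dlt pq dr) ip').
  have : r3 <= r2 by rewrite /r3 ge_min lexx orbT.
  lra.
have r31 : r3 <= r1 by rewrite /r3 ge_min lexx.
have h1 : `|phi i p' - phi i p| < r1 by lra.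
have h2 : `|phi i q - phi i p| < r1.
  by apply: le_lt_trans (ler_distD (phi i p') _ _) _; lra.
have dr1 : d < r1 by apply: lt_le_trans dr _; rewrite /r ge_min lexx.
pose P := FrameAt j x E; pose P' := switch j i P.
have gap' : frame_gap g t (FrameAt i (phi i p') (fmx P')) a.
  by have := switch_gap ancient t0 (P := P) ox gap; rewrite /switch /= xi.
have pq' : dle (g t) (psi i (phi i p')) (psi i (phi i q)) d by rewrite !phiK.
have [F gapF HF] := Hr1 _ _ _ _ _ h1 h2 ar dr1 gap' pq'.
exists (FrameAt i (phi i q) F); split=> //.
  by split; [exact: phi_img|exact: phiK].
move=> s s0; have s2 : 0 < s / 2 by rewrite divr_gt0.
have S1 := spread_switch ancient t0 (P := P) ox s2; rewrite /switch /= xi in S1.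
have := spread_trans ancient t0 S1 (HF _ s2).
by rewrite add0r addrCA -splitr.
Qed.

Lemma uniform_step (K : set M) eps : compact K -> 0 < eps -> exists2 rho, 0 < rho &
  forall eps2, 0 < eps2 -> exists2 r, 0 < r & forall p, K p -> step_ok eps eps2 rho r p.
Proof.
move=> cK eps0.
pose A rho p := forall eps2, 0 < eps2 -> exists2 r, 0 < r & \forall p' \near p, step_ok eps eps2 rho r p'.
have [rho rho0 HA] : exists2 rho, 0 < rho & forall p, K p -> A rho p.
  apply: near_covering_at_right => // p0 _; have [rho rho0 Hr] := local_step_ok p0 eps0.
  exists rho => //; apply: filterS Hr => p Hp rho' _ rr eps2 eps20.
  have [r r0 Hr] := Hp eps2 eps20; exists r => //; apply: filterS Hr => p' Hp' P a q d fP ar.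
  by apply: Hp' => //; exact: le_trans rr.
exists rho => // eps2 eps20; apply: near_covering_at_right => // p Kp.
have [r r0 Hr] := HA p Kp eps2 eps20; exists r => //; apply: filterS Hr => p' Hp' r' _ rr P a q d fP ar dr.
by apply: Hp' => //; exact: lt_le_trans rr.
Qed.

Lemma spread_refl P e : 0 < e -> spread g t P P 0 e.
Proof.
move=> e0; exists 1 => // h h0 h1.
have eh : 0 < e * h ^+ 2 by rewrite mulr_gt0 ?exprn_gt0.
exists (fun _ _ => e * h ^+ 2 / (2 * n.+1%:R)); split.
  move=> k s; split.
    apply: dlt_refl.
    by rewrite divr_gt0 // mulr_gt0.
  rewrite add0r ler_pdivrMr ?mulr_gt0 // -mulrA ler_pM2l // expr2 ler_pM2l //.
  have : 1 <= n.+1%:R :> R by rewrite ler1n.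
  lra.
rewrite sum_cst mulr0 add0r; apply: le_of_eq.
by field; rewrite gt_eqF.
Qed.

(** The closed ball of radius [d] about [p] is compact, so the steps have a uniform radius [r]
    there. Exact intermediate points divide the distance into equal parts shorter than [r], and
    [eps2] is so small that the accumulated gap stays below both [b] and [rho]. *)
Lemma spread_chain p q d P e b : dle (g t) p q d -> framed P p -> frame_gap g t P 0 ->
  0 < e -> 0 < b -> exists Q, [/\ framed Q q, frame_gap g t Q b & spread g t P Q d e].
Proof.
move=> pq fP gap e0 b0; have d0 : 0 <= d by exact: dle_ge0 pq.
pose K := [set z | dle (g t) p z d]; have cK : compact K by exact: closed_ball_compact.
have d1 : 0 < 1 + d by rewrite ltr_pwDl.
pose eps := e / 2 / (1 + d); have eps0 : 0 < eps by rewrite !divr_gt0.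
have [rho rho0 Hrho] := uniform_step cK eps0.
pose eps2 := Num.min b rho / (1 + d); have eps20 : 0 < eps2 by rewrite divr_gt0 // lt_min b0.
have [r r0 Hr] := Hrho eps2 eps20.
have [N N0] : exists N : nat, d / N.+1%:R < r.
  have [N] := archi_boundP (divr_ge0 d0 (ltW r0)).
  exists (Num.bound (d / r)); rewrite ltr_pdivrMr // mulrC -ltr_pdivrMr //.
  by apply: lt_trans (archi_boundP (divr_ge0 d0 (ltW r0))) _; rewrite ltr_nat.
pose dN := d / N.+1%:R; have dN0 : 0 <= dN by rewrite divr_ge0.
have dNE : N.+1%:R * dN = d by rewrite mulrC divfK // pnatr_eq0.
have eps2d : eps2 * d <= Num.min b rho.
  rewrite /eps2 mulrAC ler_pdivrMr // ler_pM2l ?lt_min ?b0 //; lra.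
have epsd : eps * d <= e / 2.
  rewrite /eps mulrAC ler_pdivrMr // ler_pM2l ?divr_gt0 //; lra.
(* Half of [e] pays for the error per unit length, the other half for the additional errors of the
   start and of the N + 1 steps. *)
pose e1 := e / 2 / N.+2%:R; have e10 : 0 < e1 by rewrite !divr_gt0.
have main k z : (k <= N.+1)%N -> dle (g t) p z (k%:R * dN) -> exists Q, [/\ framed Q z,
    frame_gap g t Q (eps2 * (k%:R * dN)) &
    spread g t P Q (k%:R * dN) (eps * (k%:R * dN) + k.+1%:R * e1)].
  elim: k z => [|k IH] z kN.
    rewrite !mul0r => /(dle0 rg) <-; exists P; split=> //; first by rewrite mulr0.
    by rewrite mulr0 add0r mul1r; exact: spread_refl.
  rewrite -[k.+2%:R]natr1 -natr1 mulrDl mul1r => pz.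
  have [y [py yz]] := dle_split rg complete_g (mulr_ge0 (ler0n _ k) dN0) dN0 pz.
  have [Q [fQ gQ SQ]] := IH y (ltnW kN) py.
  have kd : k%:R * dN <= d by rewrite -[leRHS]dNE ler_wpM2r // ler_nat ltnW.
  have Ky : K y by exact: dle_mono kd py.
  have gr : eps2 * (k%:R * dN) <= rho.
    apply: le_trans (_ : eps2 * d <= _); first by rewrite ler_wpM2l // ltW.
    by apply: le_trans eps2d _; rewrite ge_min lexx orbT.
  have [Q' [fQ' gQ' SQ']] := Hr y Ky Q _ z dN fQ gr N0 gQ yz.
  exists Q'; split=> //; first by rewrite mulrDr.
  have := spread_trans ancient t0 SQ (SQ' _ e10).
  by congr spread; rewrite -natr1; ring.
have [Q [fQ gQ SQ]] := main N.+1 q (leqnn _) (eq_ind_r (fun d => dle (g t) p q d) pq dNE).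
exists Q; split=> //.
  move=> i j; apply: le_trans (gQ i j) _; rewrite dNE; apply: le_trans eps2d _.
  by rewrite ge_min lexx.
rewrite dNE in SQ; apply: spread_weaken SQ.
have -> : N.+2%:R * e1 = e / 2 by rewrite mulrC divfK // pnatr_eq0.
lra.
Qed.

End Chain.

(** * Existence of maxima, and the discrete maximum principle *)

Lemma attained (R : realType) (T : Type) (S : set T) (F : T -> R) : S !=set0 ->
  (forall G : set_system T, UltraFilter G -> G S ->
     exists2 s, S s & forall c, G [set u | c <= F u] -> c <= F s) ->
  exists2 s, S s & forall u, S u -> F u <= F s.
Proof.
(* The superlevel sets [B] form a filter base; along a finer ultrafilter, [F] eventually reaches
   each of its values. *)
move=> [s0 Ss0] H; pose B u0 := S `&` [set u | F u0 <= F u].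
have FB : ProperFilter (filter_from S B).
  apply: filter_from_proper; last by move=> u Su; exists u; split=> //=.
  apply: filter_from_filter; first by exists s0.
  move=> u v Su Sv; have [uv|vu] := leP (F u) (F v).
    by exists v => // w [Sw vw]; split; split=> //=; exact: le_trans uv _.
  by exists u => // w [Sw uw]; split; split=> //=; exact: le_trans (ltW vu) _.
have [G [UG FG]] := ultraFilterLemma FB.
have GB u : S u -> G (B u) by move=> Su; apply: FG; exists u.
have GS : G S by apply: filterS (GB _ Ss0) => u [].
have [s Ss Hs] := H G UG GS; exists s => // u Su; apply: Hs.
by apply: filterS (GB _ Su) => w [].
Qed.

Section RealInequality.
Variable R : realType.

Lemma inv_sqr_le (y : R) : `|y| <= 1 / 2 -> 1 <= (1 - y) ^+ 2 * (1 + 2 * y + 8 * y ^+ 2).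
Proof.
rewrite ler_norml => /andP[y1 y2].
have -> : (1 - y) ^+ 2 * (1 + 2 * y + 8 * y ^+ 2) = 1 + y ^+ 2 * ((1 - 2 * y) * (5 - 4 * y)) by ring.
rewrite lerDl mulr_ge0 ?sqr_ge0 // mulr_ge0 //; lra.
Qed.

Lemma inv_le (z : R) : 0 <= z <= 1 / 2 -> 1 <= (1 - z) * (1 + z + 2 * z ^+ 2).
Proof.
move=> /andP[z0 z1]; have -> : (1 - z) * (1 + z + 2 * z ^+ 2) = 1 + z ^+ 2 * (1 - 2 * z) by ring.
by rewrite lerDl mulr_ge0 ?sqr_ge0 //; lra.
Qed.

(* The discrete maximum principle in the limit of small steps. *)
Lemma maximum_bound (N : nat) (L tau c A C kappa : R) :
  0 < L -> 0 < tau -> 0 < c -> 0 < A -> 0 < C -> 2 * N%:R * kappa = 1 -> 0 < kappa ->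
  (forall e : R, 0 < e -> exists2 h0 : R, 0 < h0 & forall h, 0 < h -> h < h0 ->
     exists (v Y : 'I_N -> bool -> R),
     [/\ \sum_k (v k false + v k true) <= - (2 * N%:R * L) - h ^+ 2 * (L ^+ 2 - e),
      forall k s, - v k s * ((tau - kappa * h ^+ 2) * (c - Y k s / A) ^+ 2) <= L * tau * c ^+ 2,
      forall k s, `|Y k s| <= C * h &
      \sum_k (Y k false + Y k true) <= C * h ^+ 2]) ->
  L <= 2 * C / (A * c) + 8 * (2 * N%:R * (C / (A * c)) ^+ 2) + tau^-1.
Proof.
move=> L0 tau0 c0 A0 C0 Nk k0 H.
(* [y0] bounds the relative change of the cutoff per unit of [h]. *)
set y0 := C / (A * c); set B := _ + _ * (_ * _).
have y00 : 0 < y0 by rewrite divr_gt0 // mulr_gt0.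
have N0 : 0 <= N%:R :> R by exact: ler0n.
have BE : B = 2 * y0 + 8 * (2 * N%:R * y0 ^+ 2) by rewrite /B /y0 -[2 * C / _]mulrA.
have B0 : 0 <= B.
  rewrite BE; exact (addr_ge0 (mulr_ge0 (ler0n _ 2) (ltW y00))
    (mulr_ge0 (ler0n _ 8) (mulr_ge0 (mulr_ge0 (ler0n _ 2) N0) (sqr_ge0 y0)))).
apply/ler_addgt0Pr => e1 e10; pose e := L * e1 / 2.
have e0 : 0 < e by rewrite divr_gt0 // mulr_gt0.
have [h1 h10 H1] := H e e0.
(* the terms of higher order are h ^ 2 * X *)
pose X := 2 * B * (kappa / tau + 2 * (kappa / tau) ^+ 2) + 4 * N%:R * (kappa / tau) ^+ 2.
have kt0 : 0 < kappa / tau by rewrite divr_gt0.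
have X0 : 0 <= X.
  exact (addr_ge0 (mulr_ge0 (mulr_ge0 (ler0n _ 2) B0) (addr_ge0 (ltW kt0) (mulr_ge0 (ler0n _ 2) (sqr_ge0 _))))
    (mulr_ge0 (mulr_ge0 (ler0n _ 4) N0) (sqr_ge0 _))).
pose h := Num.min (Num.min (h1 / 2) 1) (Num.min (1 / (2 * y0)) (Num.min (1 / (2 * (kappa / tau))) (e1 / (2 * (1 + X))))).
have X10 : 0 < 1 + X by rewrite ltr_pwDl.
have h0 : 0 < h.
  have two : 0 < 2 :> R by rewrite ltr0n.
  rewrite !lt_min ltr01 (divr_gt0 h10 two) (divr_gt0 ltr01 (mulr_gt0 two y00)).
  by rewrite (divr_gt0 ltr01 (mulr_gt0 two kt0)) (divr_gt0 e10 (mulr_gt0 two X10)).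
have hh1 : h < h1 by have : h <= h1 / 2 by [rewrite /h !ge_min lexx]; lra.
have hle1 : h <= 1 by rewrite /h !ge_min lexx !orbT.
have hy : h * (2 * y0) <= 1.
  have : h <= 1 / (2 * y0) by rewrite /h !ge_min lexx !orbT.
  by rewrite ler_pdivlMr // (mulr_gt0 _ y00).
have hk : h * (2 * (kappa / tau)) <= 1.
  have : h <= 1 / (2 * (kappa / tau)) by rewrite /h !ge_min lexx !orbT.
  by rewrite ler_pdivlMr // (mulr_gt0 _ kt0).
have hX : h * (2 * (1 + X)) <= e1.
  have : h <= e1 / (2 * (1 + X)) by rewrite /h !ge_min lexx !orbT.
  by rewrite ler_pdivlMr // (mulr_gt0 _ X10).
have [v [Y [Sv Hv HY SY]]] := H1 h h0 hh1.
have h20 : 0 < h ^+ 2 by rewrite exprn_gt0.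
have hh : h ^+ 2 <= h by rewrite expr2 ler_piMl // ltW.
pose y k s := Y k s / (A * c).
have Ac : 0 < A * c by rewrite mulr_gt0.
have yb k s : `|y k s| <= y0 * h.
  rewrite /y normrM normfV (gtr0_norm Ac) ler_pdivrMr // /y0 mulrAC divfK ?gt_eqF //.
have y12 k s : `|y k s| <= 1 / 2 by apply: le_trans (yb k s) _; lra.
pose z := kappa / tau * h ^+ 2.
have z0 : 0 < z by rewrite mulr_gt0.
have z12 : z <= 1 / 2.
  apply: le_trans (_ : kappa / tau * h <= _); first by rewrite ler_pM2l.
  lra.
(* Maximality, divided by the moved time and cutoff factors; [inv_le] and [inv_sqr_le] expand the
   reciprocals. *)
have vle k s : - v k s <= L * (1 + z + 2 * z ^+ 2) * (1 + 2 * y k s + 8 * y k s ^+ 2).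
  have G1 := inv_sqr_le (y12 k s); have G2 : 1 <= (1 - z) * (1 + z + 2 * z ^+ 2).
    by apply: inv_le; rewrite ltW.
  have y2 : 0 < (1 - y k s) ^+ 2.
    by rewrite exprn_gt0 //; have := y12 k s; rewrite ler_norml => /andP[_]; move: (y k s) => w; clear - R; lra.
  have z1 : 0 < 1 - z by clear - z12; lra.
  have E : - v k s * ((1 - z) * (1 - y k s) ^+ 2) <= L.
    have tc : 0 < tau * c ^+ 2 by rewrite mulr_gt0 // exprn_gt0.
    rewrite -(ler_pM2r tc); have := Hv k s.
    rewrite (_ : tau - kappa * h ^+ 2 = tau * (1 - z)); last by rewrite /z; field; rewrite gt_eqF.
    rewrite (_ : c - Y k s / A = c * (1 - y k s)); last by rewrite /y; field; rewrite !gt_eqF.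
    by rewrite exprMn; congr (_ <= _); ring.
  have D0 : 0 < (1 - z) * (1 - y k s) ^+ 2 by rewrite mulr_gt0.
  rewrite -(ler_pM2r D0); apply: le_trans E _.
  rewrite (_ : L * (1 + z + 2 * z ^+ 2) * _ * _ = L * (((1 - z) * (1 + z + 2 * z ^+ 2)) * ((1 - y k s) ^+ 2 * (1 + 2 * y k s + 8 * y k s ^+ 2)))); last by ring.
  rewrite -[leLHS]mulr1 ler_pM2l // -[leLHS]mulr1; exact: ler_pM.
have Sy : \sum_k ((1 + 2 * y k false + 8 * y k false ^+ 2) + (1 + 2 * y k true + 8 * y k true ^+ 2))
    <= 2 * N%:R + B * h ^+ 2.
  have sq k s : y k s ^+ 2 <= y0 ^+ 2 * h ^+ 2.
    have yh0 : 0 <= y0 * h := mulr_ge0 (ltW y00) (ltW h0).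
    rewrite -exprMn; apply: le_trans (_ : `|y k s| ^+ 2 <= _); first by rewrite real_normK ?num_real.
    by rewrite lerXn2r ?nnegrE.
  apply: le_trans (_ : \sum_k (2 * (y k false + y k true) + (2 + 16 * (y0 ^+ 2 * h ^+ 2))) <= _).
    by apply: ler_sum => k _; have := sq k false; have := sq k true; clear - h; lra.
  rewrite big_split /= -mulr_sumr sum_cst.
  have -> : \sum_k (y k false + y k true) = (\sum_k (Y k false + Y k true)) / (A * c).
    by rewrite mulr_suml; apply: eq_bigr => k _; rewrite mulrDl.
  have SYc : (\sum_k (Y k false + Y k true)) / (A * c) <= y0 * h ^+ 2.
    by rewrite ler_pdivrMr // /y0 mulrAC divfK ?gt_eqF.
  rewrite BE; lra.
pose Z := 1 + z + 2 * z ^+ 2.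
have Z0 : 0 <= Z by rewrite /Z; have := sqr_ge0 z; clear - z0; lra.
have Sall : - \sum_k (v k false + v k true) <= L * Z * (2 * N%:R + B * h ^+ 2).
  apply: le_trans (_ : L * Z * \sum_k ((1 + 2 * y k false + 8 * y k false ^+ 2) + (1 + 2 * y k true + 8 * y k true ^+ 2)) <= _).
    rewrite mulr_sumr -sumrN; apply: ler_sum => k _; rewrite mulrDr opprD.
    exact: lerD (vle k false) (vle k true).
  by rewrite ler_wpM2l // mulr_ge0 // ltW.
have main : h ^+ 2 * (L ^+ 2 - e) <= L * (Z * (2 * N%:R + B * h ^+ 2) - 2 * N%:R).
  by move: Sall Sv; rewrite -mulrA mulrBr; lra.
have ZE : Z * (2 * N%:R + B * h ^+ 2) - 2 * N%:R <= h ^+ 2 * (B + tau^-1 + h * X).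
  have -> : Z * (2 * N%:R + B * h ^+ 2) - 2 * N%:R = h ^+ 2 * (B * Z + 2 * N%:R * (kappa / tau) + 4 * N%:R * (kappa / tau) ^+ 2 * h ^+ 2).
    by rewrite /Z /z; ring.
  rewrite ler_pM2l //.
  have -> : 2 * N%:R * (kappa / tau) = tau^-1 by rewrite mulrA Nk mul1r.
  have zh : z <= kappa / tau * h by rewrite ler_pM2l.
  have z2h : z ^+ 2 <= (kappa / tau) ^+ 2 * h.
    rewrite /z exprMn ler_wpM2l ?sqr_ge0 //; apply: (le_trans _ hh); rewrite expr2 ler_piMl ?(ltW h20) //.
    exact: le_trans hh hle1.
  have B1 : B * Z <= B + B * ((kappa / tau + 2 * (kappa / tau) ^+ 2) * h).
    rewrite -[X in X + _]mulr1 -mulrDr ler_wpM2l // /Z; clear - zh z2h; lra.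
  have N1 : 4 * N%:R * (kappa / tau) ^+ 2 * h ^+ 2 <= 4 * N%:R * (kappa / tau) ^+ 2 * h.
    exact (ler_wpM2l (mulr_ge0 (mulr_ge0 (ler0n _ 4) N0) (sqr_ge0 _)) hh).
  have B2 : 0 <= B * ((kappa / tau + 2 * (kappa / tau) ^+ 2) * h).
    exact (mulr_ge0 B0 (mulr_ge0 (addr_ge0 (ltW kt0) (mulr_ge0 (ler0n _ 2) (sqr_ge0 _))) (ltW h0))).
  rewrite /X; move: B1 N1 B2; move: (kappa / tau) => kt; clear - h; lra.
have {}main : L ^+ 2 - e <= L * (B + tau^-1 + h * X).
  rewrite -(ler_pM2l h20); apply: le_trans main _.
  by rewrite [leRHS]mulrCA ler_pM2l.
have hXe : h * X <= e1 / 2 by rewrite mulrDr in hX; lra.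
rewrite -(ler_pM2l L0) -expr2; rewrite /e in main.
have : L * (h * X) <= L * (e1 / 2) by rewrite ler_pM2l.
clear - main; lra.
Qed.

End RealInequality.

(** * Distances at nearby times *)

Section TimeComparison.
Variables (R : realType) (n : nat) (M : manifold R n) (g : R -> tensor2 M).
Hypothesis ancient : complete_ancient_ricci_flow g.
Variable t0 : R.
Hypothesis t00 : t0 <= 0.
Implicit Types (p q : M).

Let rg0 : riemannian (g t0). Proof. exact: flow_riemannian. Qed.
Let complete_g0 : riem_complete (g t0). Proof. exact: flow_complete. Qed.
Lemma local_time_comparison (e : R) q : 0 < e -> exists2 r, 0 < r & \forall z \near q,
  forall r', 0 < r' -> r' <= r -> forall t w a, t <= 0 -> `|t - t0| < r' -> a < r' ->
  dlt (g t) z w a -> dlt (g t0) z w ((1 + e) * a).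
Proof.
move=> e0; set i := chart_at q; have iq : dom i q by exact: dom_chart_at.
set x0 := phi i q; have ix := phi_img iq.
have [U [H [[mH sub Hg _] Ux]]] := flow_extension ancient ix t00.
have [oU sH _ _] := mH; have [_ symg _ _] := rg0.
have Hx : H (x0, t0) = g t0 i x0 by exact: (Hg _ Ux).
have symH : (H (x0, t0))^T = H (x0, t0) by rewrite Hx symg.
have pH : posdef (H (x0, t0)) by rewrite Hx; exact: (riemannian_posdef rg0).
have cH j k : {for (x0, t0), continuous (fun z => H z j k)} by exact: smooth_continuous (sH j k) Ux.
have e10 : 0 < 1 + e by rewrite addr_gt0.
(* Both metrics are compared with the one at (x0, t0); for this value, (1 + e') / (1 - e') = 1 + 2 e
   <= (1 + e) ^ 2. *)
pose e' := e / (1 + e); have e'0 : 0 < e' by rewrite divr_gt0.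
have e'E : e' * (1 + e) = e by rewrite divfK // gt_eqF.
have /nbhs_ballP[r1 /= r10 Hr1] : nbhs (x0, t0) (fun z => U z /\ forall v,
    `|bil (H z) v v - bil (H (x0, t0)) v v| <= e' * bil (H (x0, t0)) v v).
  exact: filterI (near_open oU Ux) (near_bil_compare cH symH pH e'0).
have compare x t v : `|x - x0| < r1 -> t <= 0 -> `|t - t0| < r1 ->
    gn (g t0 i x) v <= (1 + e) * gn (g t i x) v.
  move=> xr t_0 tr.
  have [Uxt B1] : U (x, t) /\ forall v, `|bil (H (x, t)) v v - bil (H (x0, t0)) v v| <= e' * bil (H (x0, t0)) v v.
    by apply: Hr1; split; rewrite -ball_normE /= distrC.
  have [Uxt0 B2] : U (x, t0) /\ forall v, `|bil (H (x, t0)) v v - bil (H (x0, t0)) v v| <= e' * bil (H (x0, t0)) v v.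
    by apply: Hr1; split; [rewrite -ball_normE /= distrC|exact: ballxx].
  have := B1 v; have := B2 v; rewrite (Hg _ Uxt t_0) (Hg _ Uxt0 t00) /= !ler_norml => /andP[_ C2] /andP[C1 _].
  have b0 : 0 <= bil (H (x0, t0)) v v by exact: bil_ge0.
  have E : (1 + e) * gn (g t i x) v = Num.sqrt ((1 + e) ^+ 2 * bil (g t i x) v v).
    by rewrite sqrtrM ?sqr_ge0 // sqrtr_sqr gtr0_norm.
  rewrite E /gn ler_wsqrtr //; move: C1 C2 b0.
  move: (bil (H _) v v) (bil (g t i x) v v) (bil (g t0 i x) v v) => b b1 b2 C1 C2 b0.
  have F1 : b2 <= (1 + e') * b by lra.
  have F2 : (1 - e') * b <= b1 by lra.
  apply: le_trans F1 _; apply: le_trans (_ : (1 + e) ^+ 2 * ((1 - e') * b) <= _); last first.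
    by rewrite ler_wpM2l // sqr_ge0.
  rewrite mulrA ler_wpM2r // -(ler_pM2r e10).
  have -> : (1 + e') * (1 + e) = 1 + 2 * e by rewrite mulrDl e'E; ring.
  have -> : (1 + e) ^+ 2 * (1 - e') * (1 + e) = (1 + e) ^+ 2.
    by rewrite -mulrA mulrBl mul1r e'E addrK mulr1.
  rewrite sqrrD; have := sqr_ge0 e; lra.
have [r2 [L [r20 L0 gb]]] := flow_good_ball ancient ix t00.
pose r3 := Num.min r1 r2; have r30 : 0 < r3 by rewrite lt_min r10.
pose r := Num.min r3 (r3 / (2 * L)).
have r0 : 0 < r by rewrite lt_min r30 divr_gt0 // mulr_gt0.
exists r => //; have r32 : 0 < r3 / 2 by rewrite divr_gt0.
have N1 : \forall z \near q, dom i z by exact: (near_open (dom_open i) iq).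
have /cvgrPdist_lt /(_ _ r32) N2 := phi_cont iq.
apply: filterS2 N1 N2 => z iz zr r' r'0 r'r t w a t_0 tr ar [c [Phi [pc aPhi c0 c1 len]]].
have rr3 : r <= r3 by rewrite ge_min lexx.
have r31 : r3 <= r1 by rewrite ge_min lexx.
have r32' : r3 <= r2 by rewrite ge_min lexx orbT.
have [_ _ bi bd] := gb t t_0 (lt_le_trans tr (le_trans r'r (le_trans rr3 r32'))).
have rgt := flow_riemannian ancient t_0.
have stay u : dom i (c u) /\ `|phi i (c u) - x0| < r3.
  apply: (path_stays rgt L0 _ _ pc aPhi).
  - by move=> y yr; apply: bi; exact: lt_le_trans yr _.
  - by move=> y v yr; apply: bd; exact: lt_le_trans yr _.
  - by rewrite c0.
  - rewrite c0 distrC; have : L * (Phi 1 - Phi 0) <= r3 / 2.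
      have : a <= r3 / (2 * L) by apply: le_trans (ltW ar) _; apply: le_trans r'r _; rewrite ge_min lexx orbT.
      rewrite ler_pdivlMr ?mulr_gt0 // => aL.
      by have : L * (Phi 1 - Phi 0) <= L * a by [rewrite ler_pM2l // ltW]; lra.
    by move: zr; rewrite -/x0; lra.
have [Psi aPsi] := path_arclength rg0 pc.
exists c, Psi; split=> //.
have S u : speed (g t0) c u <= (1 + e) * speed (g t) c u.
  have [C1 _ _] := pc; have [ic cr] := stay u.
  rewrite (speed_chart rg0 C1 ic) (speed_chart rgt C1 ic); apply: compare => //.
    exact: lt_le_trans cr _.
  by apply: lt_le_trans tr _; apply: le_trans r'r _; exact: le_trans rr3 _.
have D (u : R) : is_derive u 1 (fun u => (1 + e) * Phi u) ((1 + e) * speed (g t) c u).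
  rewrite mulrC; exact: (is_derive_compR (is_derive_scale (1 + e) (Phi u)) (aPhi u)).
apply: le_lt_trans (increment_le aPsi D S) _.
by rewrite -mulrBr ltr_pM2l.
Qed.

(** A path measured at time t is not known in advance to stay in a given ball of time t0. It is
    subdivided: each piece starts in the compact ball of time t0 that the previous pieces have been
    shown to reach, and there the local comparison is uniform. *)
Lemma time_comparison (e A : R) p0 : 0 < e -> 0 < A -> exists2 r, 0 < r &
  forall t p x d, t <= 0 -> `|t - t0| < r -> dlt (g t0) p0 p 1 -> d <= A ->
  dlt (g t) p x d -> dlt (g t0) p x ((1 + e) * d).
Proof.
move=> e0 A0; pose K := [set z | dle (g t0) p0 z (1 + (1 + e) * A)].
have cK : compact K by exact: closed_ball_compact.
have e10 : 0 < 1 + e by rewrite addr_gt0.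
have [r r0 Hr] := near_covering_at_right cK (fun q _ => local_time_comparison q e0).
exists r => // t p x d t_0 tr pp dA px; have d0 := dlt_gt0 px.
have [N N0] : exists N : nat, d / N.+1%:R < r.
  exists (Num.bound (d / r)); rewrite ltr_pdivrMr // mulrC -ltr_pdivrMr //.
  by apply: lt_trans (archi_boundP (divr_ge0 (ltW d0) (ltW r0))) _; rewrite ltr_nat.
pose dN := d / N.+1%:R; have dN0 : 0 < dN by rewrite divr_gt0.
have dNE : N.+1%:R * dN = d by rewrite mulrC divfK // pnatr_eq0.
have main k z : (k <= N)%N -> dlt (g t) p z (k.+1%:R * dN) -> dlt (g t0) p z ((1 + e) * (k.+1%:R * dN)).
  elim: k z => [|k IH] z kN.
    rewrite mul1r; apply: (Hr p) => //.
    by apply: dle_mono (dlt_dle pp); rewrite lerDl mulr_ge0 // ltW.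
  rewrite -natr1 mulrDl mul1r => pz.
  have kd0 : 0 < k.+1%:R * dN by rewrite mulr_gt0.
  have [y [py yz]] := dlt_split (flow_riemannian ancient t_0) kd0 dN0 pz.
  have py0 := IH y (ltnW kN) py; rewrite mulrDr; apply: (dlt_trans rg0 py0).
  have Ky : dle (g t0) p0 y (1 + (1 + e) * A).
    apply: dle_mono (dlt_dle (dlt_trans rg0 pp py0)).
    rewrite lerD2l ler_wpM2l ?(ltW e10) //; apply: le_trans dA; rewrite -[leRHS]dNE.
    by rewrite ler_wpM2r ?(ltW dN0) // ler_nat ltnS ltnW.
  exact: (Hr y Ky t z dN t_0 tr N0 yz).
by have := main N x (leqnn _); rewrite dNE; apply.
Qed.

(** Compactness in space-time without curvature bounds: points at bounded distance, at times tending
    to t0, stay in a precompact ball of time t0. This gives the existence of the maximum. *)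
Lemma ultra_limit (T : Type) (F : set_system T) (p x : T -> M) (t d : T -> R) p0 (d0 A : R) : UltraFilter F ->
  p @ F --> p0 -> t @ F --> t0 -> d @ F --> d0 ->
  F [set u | [/\ t u <= 0, d u <= A & dle (g (t u)) (p u) (x u) (d u)]] ->
  exists2 x0, x @ F --> x0 & dle (g t0) p0 x0 d0.
Proof.
move=> UF pF tF dF HF.
have near_e e : 0 < e -> e <= 1 -> F [set u | dlt (g t0) p0 (x u) (d u + e * (`|A| + 4))].
  move=> e0 e1; have A1 : 0 < `|A| + 1 by rewrite ltr_wpDl.
  have [r r0 Hr] := time_comparison p0 e0 A1.
  have N1 : F [set u | `|t u - t0| < r].
    by have /cvgrPdist_lt /(_ _ r0) := tF; apply: filterS => u; rewrite distrC.
  have N2 : F [set u | dlt (g t0) p0 (p u) e] by exact: (pF _ (near_dlt rg0 p0 e0)).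
  apply: filterS3 HF N1 N2 => u [tu du pxu] tr pp.
  have dA : d u + e <= `|A| + 1 by have := ler_norm A; lra.
  have := Hr _ _ _ _ tu tr (dlt_mono e1 pp) dA (pxu e e0) => px.
  apply: dlt_mono (dlt_trans rg0 pp px).
  have : e * (d u + e) <= e * (`|A| + 1) by rewrite ler_pM2l.
  by rewrite !mulrDr !mulrDl; lra.
have Nd e : 0 < e -> F [set u | d u <= d0 + e].
  move=> e0; have /cvgrPdist_le /(_ _ e0) := dF.
  by apply: filterS => u /=; rewrite ler_norml => /andP[A1 A2]; lra.
have UFx := ultra_fmap x UF.
have [x0 xF] : exists l : M, x @ F --> l.
  have HR : ultra_precompact [set q | dlt (g t0) p0 q (d0 + 1 + (`|A| + 4))] by exact: hopf_rinow.
  apply: (HR _ UFx).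
  rewrite /fmap /=; apply: filterS2 (near_e 1 ltr01 (lexx _)) (Nd 1 ltr01) => u /=.
  rewrite mul1r => H1 H2; apply: dlt_mono H1; lra.
exists x0 => //; apply: (ultra_dle rg0 _ xF) => e e0.
pose e1 := Num.min 1 (e / 2 / (`|A| + 4)).
have e10 : 0 < e1 by rewrite lt_min ltr01 !divr_gt0.
have e11 : e1 <= 1 by rewrite ge_min lexx.
have e1A : e1 * (`|A| + 4) <= e / 2 by rewrite -ler_pdivlMr // ge_min lexx orbT.
have e2 : 0 < e / 2 by rewrite divr_gt0.
rewrite /fmap /=; apply: filterS2 (near_e e1 e10 e11) (Nd _ e2) => u /= H1 H2; apply: dlt_mono H1.
by apply: le_trans (lerD H2 e1A) _; rewrite -addrA -splitr.
Qed.

End TimeComparison.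

(** * Values of the Ricci tensor on planes *)

Lemma plane_trace_ge (R : realType) m (K S E J : 'M[R]_m.+2) (r : 'I_m.+2 -> R) i j :
  K^T = K -> S^T = S -> posdef K -> E *m K *m E^T = 1%:M ->
  (forall a b, (E *m S *m E^T) a b = r a *+ (a == b)) ->
  (forall a b : 'I_m.+2, (a <= b)%N -> r a <= r b) ->
  let G := J *m K *m J^T in G i i * G j j - G i j * G i j != 0 ->
  r ord0 + r (lift ord0 ord0) <= plane_trace G (J *m S *m J^T) i j.
Proof.
move=> symK symS pK EK ES rs G; rewrite /G /plane_trace !frame_bil.
set u := row i J; set v := row j J; set a := bil K u u; set b := bil K v v; set c := bil K u v => d0.
have a0 : 0 < a.
  apply: pK; apply/eqP => u0; move/eqP: d0; apply.
  by rewrite /a /c u0 /bil !mul0mx !mxE !mul0r subrr.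
(* Gram-Schmidt: the plane trace is the sum over the orthonormal pair made from [u] and [w], to
   which [ky_fan] applies. *)
pose w := v - (c / a) *: u; pose d := a * b - c * c.
have wb (T : 'M[R]_m.+2) : T^T = T -> bil T w w = bil T v v - 2 * (c / a) * bil T u v + (c / a) ^+ 2 * bil T u u.
  by move=> symT; rewrite /w -scaleNr !(bilDl, bilDr, bilZl, bilZr) (bilC v u symT); ring.
have an : a != 0 by rewrite gt_eqF.
have ww : bil K w w = d / a by rewrite (wb K symK) -/a -/b -/c /d; field.
have uw : bil K u w = 0 by rewrite /w -scaleNr bilDr bilZr -/a -/c; field.
have da0 : 0 < d / a.
  rewrite -ww; apply: pK; apply/eqP => w0; move/eqP: d0; apply.
  have : d / a = 0 by rewrite -ww w0 /bil !mul0mx mxE.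
  by move/eqP; rewrite mulf_eq0 invr_eq0 (negbTE an) orbF => /eqP.
have d1 : 0 < d by have := mulr_gt0 da0 a0; rewrite divfK.
have nrm (T : 'M[R]_m.+2) x y : 0 < y -> bil T ((Num.sqrt y)^-1 *: x) ((Num.sqrt y)^-1 *: x) = bil T x x / y.
  move=> y0; rewrite bilZl bilZr mulrA -invfM -expr2 sqr_sqrtr ?ltW //; exact: mulrC.
have := ky_fan (u := (Num.sqrt a)^-1 *: u) (v := (Num.sqrt (d / a))^-1 *: w) EK ES rs.
rewrite !nrm // ww -/a (divff an) divff ?gt_eqF // bilZl bilZr uw !mulr0 => /(_ erefl erefl erefl) H.
apply: le_trans H _; apply: le_of_eq.
have dn : a * b - c * c != 0 by rewrite gt_eqF.
by rewrite (wb S symS) /d; field; rewrite ?an ?dn.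
Qed.

Section Values.
Variables (R : realType) (M : manifold R 3) (g : R -> tensor2 M).
Hypothesis ancient : complete_ancient_ricci_flow g.
Hypothesis nonneg_ic : forall t : R, t <= 0 -> nonneg_isotropic_curvature (g t).
Local Notation X := 'rV[R]_4.
Local Notation xdir := (@xdir R 3).
Local Notation sdir := (@sdir R 3).
Local Notation kappa := ((2 * 4%:R)^-1 : R).
Implicit Types P Q : frame_at M.

Definition frame_ricci t P := ricci_frame (g t (fchart P)) (fpos P) (fmx P).

Definition plane_value t P : R := frame_ricci t P 0 0 + frame_ricci t P 1 1.

Definition has_value t (p : M) v := exists P, [/\ framed P p, frame_gap g t P 0 & plane_value t P = v].

Let one4 : lift ord0 ord0 = 1 :> 'I_4. Proof. exact/val_inj. Qed.

Lemma gap0_orthonormal t P : frame_gap g t P 0 <-> orthonormal_frame (g t (fchart P)) (fpos P) (fmx P).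
Proof.
split=> [gap|ortho b c]; last by rewrite ortho mxE subrr normr0.
by apply/matrixP => b c; have := gap b c; rewrite normr_le0 subr_eq0 => /eqP ->; rewrite mxE.
Qed.

Lemma frame_ricci_switch t j P : t <= 0 -> overlap (fchart P) j (fpos P) ->
  frame_ricci t (switch (fchart P) j P) = frame_ricci t P.
Proof.
move=> t0 ox; have rg := flow_riemannian ancient t0; have [ix _] := (overlapP _ j _).1 ox.
have [_ iy] := (overlapP _ _ _).1 (transition_overlap ox).
have jy : img j (transition (fchart P) j (fpos P)) by have [] := (overlapP _ _ _).1 (transition_overlap ox).
rewrite /frame_ricci /switch /ricci_frame /= (flow_Ric ancient t0 ix) (flow_Ric ancient t0 jy).
by rewrite (transition_laws rg ox).2 trmx_mul !mulmxA.
Qed.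

Definition eigenframe t P (r : 'I_4 -> R) := [/\ img (fchart P) (fpos P), frame_gap g t P 0,
  forall a b, frame_ricci t P a b = r a *+ (a == b) & forall a b : 'I_4, (a <= b)%N -> r a <= r b].

Lemma ricci_sym t i x : t <= 0 -> img i x -> (ricci (g t i) x)^T = ricci (g t i) x.
Proof.
move=> t0 ix; have rg := flow_riemannian ancient t0.
have [E [r [EK _ _]]] := spectral_sorted (let: And4 _ s _ _ := rg in s i x ix) (riemannian_posdef rg ix)
  (let: And4 _ s _ _ := rg in s i x ix).
have := ricci_frame_sym (riemannian_metric_on i rg) ix EK; rewrite /ricci_frame !trmx_mul trmxK => H.
have uE := frame_unitmx EK.
have uT : E^T \in unitmx by rewrite unitmx_tr.
by apply: (can_inj (mulKmx uE)); apply: (can_inj (mulmxK uT)); rewrite -[in RHS]H mulmxA.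
Qed.

Lemma eigenframe_exists t i x : t <= 0 -> img i x -> exists E r, eigenframe t (FrameAt i x E) r.
Proof.
move=> t0 ix; have rg := flow_riemannian ancient t0; have [_ symg _ _] := rg.
have [E [r [EK ES rs]]] := spectral_sorted (symg i x ix) (riemannian_posdef rg ix) (ricci_sym t0 ix).
by exists E, r; split=> //; apply/gap0_orthonormal.
Qed.

Lemma eigenframe_value t P r : eigenframe t P r -> plane_value t P = r 0 + r 1.
Proof. by move=> [_ _ rE _]; rewrite /plane_value !rE !eqxx. Qed.

Lemma eigenframe_le t P r v : t <= 0 -> eigenframe t P r -> has_value t (fpoint P) v -> r 0 + r 1 <= v.
Proof.
move=> t0 [ix gap rE rs] [Q [[iq pq] gapQ <-]].
have ox : overlap (fchart Q) (fchart P) (fpos Q).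
  by apply/overlapP; split=> //; rewrite -[psi _ _]/(fpoint Q) pq; exact: psi_dom.
have /gap0_orthonormal orthoQ := switch_gap ancient t0 ox gapQ.
have yx : fpos (switch (fchart Q) (fchart P) Q) = fpos P.
  by rewrite /switch /= /transition /= -[psi _ _]/(fpoint Q) pq /fpoint psiK.
move: orthoQ; rewrite /plane_value -(frame_ricci_switch t0 ox) /frame_ricci /orthonormal_frame /ricci_frame yx /=.
set E := _ *m jacobian _ _ => EK; rewrite !frame_bil -one4 -[0]/ord0.
have B a b : bil (g t (fchart P) (fpos P)) (row a E) (row b E) = (a == b)%:R by rewrite -frame_bil EK mxE.
by apply: (ky_fan ((gap0_orthonormal t P).1 gap) rE rs); rewrite B.
Qed.

Lemma isotropic_frame t i x E : t <= 0 -> img i x -> orthonormal_frame (g t i) x E ->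
  let K a b := riem_frame (g t i) x E a b a b in
  [/\ 0 <= (K 0 1 + K 2 3) + (K 0 2 + K 1 3), 0 <= (K 0 1 + K 2 3) + (K 0 3 + K 1 2) &
      0 <= (K 0 2 + K 1 3) + (K 0 3 + K 1 2)] /\
  (pos_isotropic_curvature (g t) ->
  [/\ 0 < (K 0 1 + K 2 3) + (K 0 2 + K 1 3), 0 < (K 0 1 + K 2 3) + (K 0 3 + K 1 2) &
      0 < (K 0 2 + K 1 3) + (K 0 3 + K 1 2)]).
Proof.
move=> t0 ix ortho K; have rg := flow_riemannian ancient t0; have mG := riemannian_metric_on i rg.
have [E' [ortho' det' KE]] : exists E', [/\ orthonormal_frame (g t i) x E', 0 < \det E' &
    forall a b, riem_frame (g t i) x E' a b a b = K a b].
  have := frame_unitmx ortho; rewrite unitmxE unitfE => uE.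
  have [d0|d0] := ltP 0 (\det E); first by exists E; split.
  exists (flip E); split; [exact: orthonormal_flip|by rewrite det_flip oppr_gt0 lt_def eq_sym uE|].
  by move=> a b; rewrite sectional_flip.
have [] := isotropic_sums mG ix E'; rewrite !KE => S1 S2 S3; split.
  have [A C] := nonneg_ic t0 ix ortho' det'; have s0 := addr_ge0 A C.
  by split; [exact (le_trans s0 S1)|exact (le_trans s0 S2)|exact (le_trans s0 S3)].
move=> pic; have [A C] := pic i x E' ix ortho' det'; have s0 := addr_gt0 A C.
by split; [exact (lt_le_trans s0 S1)|exact (lt_le_trans s0 S2)|exact (lt_le_trans s0 S3)].
Qed.

(** The eigenvalue sum is not smooth, but the plane trace in normal coordinates is an upper barrier:
    it agrees with the sum at the center and dominates it at the displaced points by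
    [plane_trace_ge]. Its heat step is known, and [isotropic_reaction] bounds the reaction [c]. *)
Lemma value_step t P r : t <= 0 -> eigenframe t P r -> r 0 + r 1 <= 0 -> exists c,
  [/\ (r 0 + r 1) ^+ 2 <= c, pos_isotropic_curvature (g t) -> 0 < c &
   forall e : R, 0 < e -> exists2 h0 : R, 0 < h0 & forall h : R, 0 < h -> h < h0 -> exists v : 'I_4 -> bool -> R,
    (forall k (s : bool), has_value (t - kappa * h ^+ 2) (shoot g t P (((-1) ^+ s * h) *: row k (fmx P))) (v k s)) /\
    \sum_k (v k false + v k true) <= 2 * 4%:R * (r 0 + r 1) - h ^+ 2 * (c - e)].
Proof.
case: P => i x E t0 [/= ix gap rE rs] lam0; have rg := flow_riemannian ancient t0.
have /= ortho := (gap0_orthonormal t (FrameAt i x E)).1 gap.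
have mG := riemannian_metric_on i rg.
have [U [H [extH Ux]]] := flow_extension ancient ix t0; have [mH sub Hg flowH] := extH.
have [oU sH symH uH] := mH.
have flowS y : U (y, t) -> dmx (@tdir R 3) H (y, t) = (-2) *: Ric sdir H (y, t).
  by move=> Uy; exact: flowH.
have Hx : H (x, t) = g t i x by rewrite (Hg _ Ux t0).
have orthoH : E *m H (x, t) *m E^T = 1%:M by rewrite Hx.
have [GamE RicE] := flow_slice_eq oU t0 Hg Ux.
have ricE a b : (E *m Ric sdir H (x, t) *m E^T) a b = r a *+ (a == b).
  by rewrite -RicE -(flow_Ric ancient t0 ix); exact: rE.
pose K a b := riem_frame (g t i) x E a b a b.
have fcE a b : frame_curv H x t E a b = K a b.
  rewrite /frame_curv /K /riem_frame; apply: eq_bigr => c _; apply: eq_bigr => d _.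
  have RcE : Rc sdir H c d (x, t) *m H (x, t) = Rc xdir (g t i) c d x *m g t i x.
    rewrite -Rc_slice Hx; congr (_ *m _).
    have HG y : [set y | U (y, t)] y -> H (y, t) = g t i y by move=> Uy; rewrite (Hg _ Uy t0).
    exact: (Rc_ext xdir (open_slice (t := t) oU) HG).
  rewrite RcE frame_bil bilE mulr_sumr exchange_big; apply: eq_bigr => e _ /=.
  rewrite mulr_sumr; apply: eq_bigr => f _; rewrite (riemE mG) // !mxE; ring.
have [F1 F2 F3 _] := riem_frame_symmetries mG ix E.
have Ksym a b : K a b = K b a by rewrite /K F1 F2 opprK.
have Kaa a : K a a = 0 by have := F1 a a a a; rewrite /K; lra.
have rK a : r a = \sum_b K b a.
  by have := ricci_frameE mG ix ortho a a; rewrite [LHS]rE eqxx mulr1n => ->.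
pose c := 2 * \sum_a r a * (frame_curv H x t E a 0 + frame_curv H x t E a 1).
have cE : c = 2 * (r 0 * K 0 1 + r 1 * K 0 1 + r 2 * (K 0 2 + K 1 2) + r 3 * (K 0 3 + K 1 3)).
  by rewrite /c sum4 !fcE !Kaa (Ksym 1 0) (Ksym 2 0) (Ksym 2 1) (Ksym 3 0) (Ksym 3 1); ring.
have R0 : r 0 = K 0 1 + K 0 2 + K 0 3.
  by rewrite rK sum4 Kaa (Ksym 1 0) (Ksym 2 0) (Ksym 3 0); ring.
have R1 : r 1 = K 0 1 + K 1 2 + K 1 3 by rewrite rK sum4 Kaa (Ksym 2 1) (Ksym 3 1); ring.
have R2 : r 2 = K 0 2 + K 1 2 + K 2 3 by rewrite rK sum4 Kaa (Ksym 3 2); ring.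
have R3 : r 3 = K 0 3 + K 1 3 + K 2 3 by rewrite rK sum4 Kaa; ring.
have [[I1 I2 I3] Ipos] := isotropic_frame t0 ix ortho.
have := @isotropic_reaction R (K 0 1) (K 0 2) (K 0 3) (K 1 2) (K 1 3) (K 2 3).
rewrite /= -R0 -R1 -R2 -R3 => HQ; have [Q1 Q2] := HQ lam0 I1 I2 I3.
exists c; split; [by rewrite cE|by move=> /Ipos[J1 J2 J3]; rewrite cE; exact: Q2|].
move=> e e0; have ij : (0 : 'I_4) != 1 by [].
have [h0 h00 Hh] := heat_step mH Ux flowS orthoH ricE ij (erefl kappa) e0.
exists h0 => // h hp hh; have [det tot] := Hh h hp hh.
set tau := t - kappa * h ^+ 2 in det tot *.
have tau0 : tau <= 0 by exact: (past_le0 3 h t0).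
pose z (k : 'I_4) (s : bool) : X * R := (((-1) ^+ s * h) *: xdir k, tau).
pose N (k : 'I_4) (s : bool) := ncoord H x t E (z k s).
pose J (k : 'I_4) (s : bool) := ncoord_jac H x t E (z k s).
have UN k s : U (N k s) by have [] := det k s.
have iN k s : img i (N k s).1 := sub _ (UN k s).
have ex k s : exists Er : 'M[R]_4 * ('I_4 -> R), eigenframe tau (FrameAt i (N k s).1 Er.1) Er.2.
  by have [E' [r' ef]] := eigenframe_exists tau0 (iN k s); exists (E', r').
pose Er k s := projT1 (cid (ex k s)).
have Erp k s : eigenframe tau (FrameAt i (N k s).1 (Er k s).1) (Er k s).2 := projT2 (cid (ex k s)).
pose v k s := (Er k s).2 0 + (Er k s).2 1.
exists v; split.
  move=> k s; exists (FrameAt i (N k s).1 (Er k s).1).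
  have [_ gp _ _] := Erp k s; split=> //; last exact: eigenframe_value (Erp k s).
  split; first exact (iN k s).
  rewrite /fpoint /shoot /=; congr (psi i _).
  by rewrite /N /ncoord /= -scalemxAl -rowE GamE.
have vT k s : v k s <= plane_trace (J k s *m H (N k s) *m (J k s)^T) (J k s *m Ric sdir H (N k s) *m (J k s)^T) 0 1.
  have [_ gp Rr srt] := Erp k s.
  have HN : H (N k s) = g tau i (N k s).1 by rewrite (Hg _ (UN k s)).
  have RN : Ric sdir H (N k s) = ricci (g tau i) (N k s).1.
    rewrite (flow_Ric ancient tau0 (iN k s)); have UNt : U ((N k s).1, tau) by exact: UN.
    by have [_ ->] := flow_slice_eq oU tau0 Hg UNt.
  rewrite HN RN /v -one4; have rgt := flow_riemannian ancient tau0; have [_ symg _ _] := rgt.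
  apply: (plane_trace_ge (symg i _ (iN k s)) (ricci_sym tau0 (iN k s)) (riemannian_posdef rgt (iN k s))
     ((gap0_orthonormal tau _).1 gp) Rr srt).
  by have [_] := det k s; rewrite -/(z k s) -/(N k s) -/(J k s) HN one4.
apply: le_trans tot; apply: ler_sum => k _; apply: lerD.
  by have := vT k false; rewrite /J /N /z expr0 mul1r.
by have := vT k true; rewrite /J /N /z expr1 mulN1r.
Qed.

End Values.

(** * Limits of values, and uniform bounds near the center *)

Section UltraReal.
Variables (R : realType) (T : Type) (F : set_system T).
Hypothesis UF : UltraFilter F.

Lemma ultra_bounded (f : T -> R) b : F [set u | `|f u| <= b] -> exists l : R, f @ F --> l.
Proof.
move=> Fb; have := @segment_compact R (- b) b; rewrite compact_ultra => /(_ _ (ultra_fmap f UF)) [|l [_ fl]].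
  by rewrite /fmap /=; apply: filterS Fb => u /=; rewrite in_itv /= -ler_norml.
by exists l.
Qed.

Lemma ultra_le (f h : T -> R) (a b : R) : f @ F --> a -> h @ F --> b -> F [set u | f u <= h u] -> a <= b.
Proof.
move=> fa hb Fc; apply/ler_addgt0Pr => e e0; have e2 : 0 < e / 2 by rewrite divr_gt0.
have /cvgrPdist_le /(_ _ e2) A := fa; have /cvgrPdist_le /(_ _ e2) B := hb.
have [u [hA [hB /= C]]] := filter_ex (filterI A (filterI B Fc)).
move: hA hB C; rewrite /= !ler_norml => /andP[A1 A2] /andP[B1 B2] C; lra.
Qed.

Lemma ultra_row n (f : T -> 'rV[R]_n.+1) b : F [set u | `|f u| <= b] -> exists l : 'rV[R]_n.+1, f @ F --> l.
Proof.
move=> Fb; have ex j : exists l : R, (fun u => f u 0 j) @ F --> l.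
  by apply: (ultra_bounded (b := b)); apply: filterS Fb => u; apply: le_trans; exact: coord_le_norm.
pose l := \row_j projT1 (cid (ex j)).
have Hl j : (fun u => f u 0 j) @ F --> (l 0 j : R) by rewrite mxE; exact: projT2 (cid (ex j)).
exists l; apply/cvgrPdist_le => e e0.
pose P (j : 'I_n.+1) u := `|l 0 j - f u 0 j| <= e.
have HP j : F (P j) by have /cvgrPdist_le /(_ _ e0) := Hl j.
apply: filterS (filter_forall _ HP) => u Hu; apply: row_norm_le => [|j]; first exact: ltW.
by rewrite addmxE oppmxE; exact: Hu j.
Qed.

End UltraReal.

Section Maximum.
Variables (R : realType) (M : manifold R 3) (g : R -> tensor2 M).
Hypothesis ancient : complete_ancient_ricci_flow g.
Local Notation X := 'rV[R]_4.
Local Notation xdir := (@xdir R 3).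
Local Notation sdir := (@sdir R 3).

Lemma frame_row_le t i (x x0 : X) (E : 'M[R]_4) a r L k : good_ball (g t) i x0 r L -> `|x - x0| < r ->
  a <= 3 -> frame_gap g t (FrameAt i x E) a -> `|row k E| <= 2 * L.
Proof.
move=> [_ L0 _ bd] xr a3 gap; have [b1 _] := bd x (row k E) xr; apply: le_trans b1 _; rewrite mulrC ler_pM2r //.
have := gap k k; rewrite /= eqxx frame_bil ler_norml => /andP[_ B].
have B' : bil (g t i x) (row k E) (row k E) - 1 <= a by exact: B.
have -> : (2 : R) = Num.sqrt (2 ^+ 2) by rewrite sqrtr_sqr ger0_norm.
by rewrite /gn ler_wsqrtr //; lra.
Qed.

Lemma value_in_chart t i p v : t <= 0 -> dom i p -> has_value g t p v -> exists E,
  frame_gap g t (FrameAt i (phi i p) E) 0 /\ plane_value g t (FrameAt i (phi i p) E) = v.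
Proof.
move=> t0 ip [[j x E] [[/= jx xp] gap <-]]; rewrite /fpoint /= in xp.
have ox : overlap j i x by apply/overlapP; rewrite xp.
have xi : transition j i x = phi i p by rewrite /transition /= xp.
exists (E *m jacobian (transition j i) x); rewrite -xi; split.
  exact: (switch_gap ancient t0 (P := FrameAt j x E) ox gap).
by rewrite /plane_value -(frame_ricci_switch ancient t0 (P := FrameAt j x E) ox).
Qed.

(** Orthonormal frames over a small coordinate ball have bounded entries, so they converge along the
    ultrafilter; orthonormality and the trace pass to the limit. *)
Lemma value_limit (T : Type) (F : set_system T) (x : T -> M) (t v : T -> R) x0 (t0 : R) : UltraFilter F ->
  t0 <= 0 -> x @ F --> x0 -> t @ F --> t0 -> F [set u | t u <= 0 /\ has_value g (t u) (x u) (v u)] ->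
  exists2 v0 : R, v @ F --> v0 & has_value g t0 x0 v0.
Proof.
move=> UF t00 xF tF HF; set i := chart_at x0; have ix : dom i x0 by exact: dom_chart_at.
have iq := phi_img ix; have [r [L [r0 L0 gb]]] := flow_good_ball ancient iq t00.
have [U [H [[mH sub Hg _] Uq]]] := flow_extension ancient iq t00; have [oU sH _ _] := mH.
have ex u : exists E, t u <= 0 -> has_value g (t u) (x u) (v u) -> dom i (x u) ->
    frame_gap g (t u) (FrameAt i (phi i (x u)) E) 0 /\ plane_value g (t u) (FrameAt i (phi i (x u)) E) = v u.
  have [[tu [hv iu]]|N] := pselect (t u <= 0 /\ has_value g (t u) (x u) (v u) /\ dom i (x u)).
    by have [E HE] := value_in_chart tu iu hv; exists E.
  by exists 0 => tu hv iu; case: N.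
pose E u := projT1 (cid (ex u)).
have HE u := projT2 (cid (ex u)); rewrite -/(E _) in HE.
pose z u := (phi i (x u), t u).
have zF : z @ F --> (phi i x0, t0).
  have c1 : (fun u => phi i (x u)) @ F --> phi i x0 by exact: (cvg_comp _ _ xF (phi_cont ix)).
  exact (cvg_pair c1 tF).
have /nbhs_ballP[r1 /= r10 Hr1] : nbhs (phi i x0, t0) U by exact: (near_open oU Uq).
have r20 : 0 < Num.min r r1 by rewrite lt_min r0.
have near_ : F [set u | [/\ t u <= 0, dom i (x u), `|phi i (x u) - phi i x0| < r, `|t u - t0| < r & U (z u)] /\
    has_value g (t u) (x u) (v u)].
  have N1 : F [set u | dom i (x u)] by exact: (xF _ (near_open (dom_open i) ix)).
  have /cvgrPdist_lt /(_ _ r20) N2 : phi i \o x @ F --> phi i x0 by exact: (cvg_comp _ _ xF (phi_cont ix)).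
  have /cvgrPdist_lt /(_ _ r20) N3 := tF.
  apply: filterS2 (filterI N1 N2) (filterI N3 HF) => u [/= h1 h2] [/= h3 [h4 h5]].
  move: h2 h3; rewrite /= !lt_min => /andP[h2 h2'] /andP[h3 h3'].
  split=> //; split=> //; [by rewrite distrC|by rewrite distrC|apply: Hr1].
  by split; rewrite -ball_normE.
have facts : F [set u | [/\ U (z u), frame_gap g (t u) (FrameAt i (phi i (x u)) (E u)) 0,
    plane_value g (t u) (FrameAt i (phi i (x u)) (E u)) = v u, t u <= 0 & forall k, `|row k (E u)| <= 2 * L]].
  apply: filterS near_ => u [[tu iu ur tr Uu] hv] /=; have [gp vl] := HE u tu hv iu; split=> // k.
  by apply: (frame_row_le (a := 0) k (gb _ tu tr) ur) => //.
have exE a b : exists l : R, (fun u => E u a b) @ F --> l.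
  apply: (ultra_bounded UF (b := 2 * L)); apply: filterS facts => u /= [_ _ _ _ /(_ a)]; apply: le_trans.
  by have := coord_le_norm (row a (E u)) 0 b; rewrite mxE.
pose E0 : 'M[R]_4 := \matrix_(a, b) projT1 (cid (exE a b)).
have EF a b : (fun u => E u a b) @ F --> (E0 a b : R) by rewrite mxE; exact: projT2 (cid (exE a b)).
have form (K : X * R -> 'M[R]_4) a b : msmooth U K ->
    (fun u => (E u *m K (z u) *m (E u)^T) a b) @ F --> ((E0 *m K (phi i x0, t0) *m E0^T) a b : R).
  move=> sK; rewrite frame_bil bilE; under eq_fun do rewrite frame_bil bilE.
  apply: cvg_big => [|c _]; first exact: add_continuous.
  apply: cvg_big => [|d _]; first exact: add_continuous.
  apply: cvgM; last by under eq_fun do rewrite mxE; rewrite mxE; exact: EF.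
  apply: cvgM; first by under eq_fun do rewrite mxE; rewrite mxE; exact: EF.
  exact: (cvg_comp _ _ zF (smooth_continuous (sK c d) Uq)).
have RicH y t' : t' <= 0 -> U (y, t') -> ricci (g t' i) y = Ric sdir H (y, t').
  move=> t'0 Uy; rewrite (flow_Ric ancient t'0 (sub _ Uy)).
  by have [_ ->] := flow_slice_eq oU t'0 Hg Uy.
have sRic : msmooth U (Ric sdir H) by exact: Ric_msmooth mH.
exists (plane_value g t0 (FrameAt i (phi i x0) E0)).
  pose S u := (E u *m Ric sdir H (z u) *m (E u)^T) 0 0 + (E u *m Ric sdir H (z u) *m (E u)^T) 1 1.
  have C : S @ F --> ((E0 *m Ric sdir H (phi i x0, t0) *m E0^T) 0 0 + (E0 *m Ric sdir H (phi i x0, t0) *m E0^T) 1 1 : R).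
    by apply: cvgD; exact: form.
  rewrite /plane_value /frame_ricci /ricci_frame /= (RicH _ _ t00 Uq).
  apply: cvg_trans C; apply: near_eq_cvg; apply: filterS facts => u /= [Uu _ <- tu _].
  by rewrite /plane_value /frame_ricci /ricci_frame /= (RicH _ _ tu Uu).
exists (FrameAt i (phi i x0) E0); split=> //; first by split=> //; exact: phiK.
move=> a b; rewrite /= -(Hg _ Uq t00) normr_le0 subr_eq0; apply/eqP.
have D : (fun u => (E u *m H (z u) *m (E u)^T) a b) @ F --> ((a == b)%:R : R).
  have C : (fun _ : T => (a == b)%:R : R) @ F --> ((a == b)%:R : R) by exact: cvg_cst.
  apply: cvg_trans C; apply: near_eq_cvg; apply: filterS facts => u /= [Uu gp _ tu _].
  by have := gp a b; rewrite /= -(Hg _ Uu tu) normr_le0 subr_eq0 => /eqP ->.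
exact: (cvg_unique _ (form H a b sH) D).
Qed.

(** A single number [r] serves as radius and, inverted, as the bound of the metric and of the
    Christoffel symbols. All requirements then weaken as [r] decreases, and compactness of the time
    interval applies. *)
Lemma center_bounds i x0 T0 t1 : img i x0 -> t1 <= 0 -> exists2 r, 0 < r & forall t, T0 <= t <= t1 ->
  good_ball (g t) i x0 r r^-1 /\ forall x c a b, `|x - x0| < r -> `|Gam xdir (g t i) c x a b| <= r^-1.
Proof.
move=> ix t10; pose P (r t : R) := t <= 0 -> good_ball (g t) i x0 r r^-1 /\
  forall x c a b, `|x - x0| < r -> `|Gam xdir (g t i) c x a b| <= r^-1.
have [r r0 Hr] : exists2 r, 0 < r & forall t, `[T0, t1]%classic t -> P r t.
  apply: near_covering_at_right; first exact: segment_compact.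
  move=> t /=; rewrite in_itv /= => /andP[_ tt1]; have t0 : t <= 0 by exact: le_trans tt1 t10.
  have [r1 [L [r10 L0 gb]]] := flow_good_ball ancient ix t0.
  have [U [H [[mH sub Hg _] Ux]]] := flow_extension ancient ix t0; have [oU sH _ _] := mH.
  pose Q (k : 'I_4 * ('I_4 * 'I_4)) (z : X * R) := `|Gam sdir H k.1 z k.2.1 k.2.2| <= 1 + `|Gam sdir H k.1 (x0, t)|.
  have HQ k : \forall z \near (x0, t), Q k z.
    have /cvgrPdist_le /(_ _ (ltr01 : 0 < 1 :> R)) := smooth_continuous (Gam_msmooth sdir mH k.1 k.2.1 k.2.2) Ux.
    apply: filterS => z zz; rewrite /Q -[X in `|X|](subrK (Gam sdir H k.1 (x0, t) k.2.1 k.2.2)).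
    apply: le_trans (ler_normD _ _) _; rewrite distrC; apply: lerD => //; exact: coord_le_norm.
  have /nbhs_ballP[r2 /= r20 Hr2] : nbhs (x0, t) (fun z => U z /\ forall k, Q k z).
    exact: (filterI (near_open oU Ux) (filter_forall _ HQ)).
  pose B := 1 + \sum_c `|Gam sdir H c (x0, t)|.
  have B0 : 0 < B by rewrite ltr_pwDl // sumr_ge0.
  pose r3 := Num.min (Num.min r1 r2) (Num.min L^-1 B^-1).
  exists r3; first by rewrite !lt_min r10 r20 !invr_gt0 L0 B0.
  apply/nbhs_ballP; exists r3 => /=; first by rewrite !lt_min r10 r20 !invr_gt0 L0 B0.
  move=> t'; rewrite -ball_normE /= distrC !lt_min -!andbA => /and4P[h1 h2 _ _] r r0.
  rewrite !le_min -!andbA => /and4P[rr1 rr2 rL rB] t'0.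
  have invle (y : R) : 0 < y -> r <= y^-1 -> y <= r^-1.
    by move=> y0 ry; rewrite -[y]invrK lef_pV2 // posrE invr_gt0.
  have [_ _ bi bd] := gb t' t'0 h1; split.
    split=> //; first by rewrite invr_gt0.
      by move=> x xr; apply: bi; exact: lt_le_trans xr rr1.
    move=> x w xr; have [b1 b2] := bd x w (lt_le_trans xr rr1); have Lr := invle L L0 rL.
    by split; [apply: le_trans b1 _|apply: le_trans b2 _]; rewrite ler_wpM2r // gn_ge0.
  move=> x c a b xr; have [Ux' Hx] : U (x, t') /\ forall k, Q k (x, t').
    by apply: Hr2; split; rewrite -ball_normE /= distrC //; exact: lt_le_trans xr rr2.
  have [GE _] := flow_slice_eq oU t'0 Hg Ux'; have -> : Gam xdir (g t' i) c x = Gam sdir H c (x, t') by exact: (congr1 (fun f => f c) GE).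
  apply: le_trans (Hx (c, (a, b))) _; apply: le_trans (invle B B0 rB); rewrite /B lerD2l (bigD1 c) //= lerDl.
  exact: sumr_ge0.
exists r => // t /andP[t1' t2]; apply: Hr; last exact: le_trans t2 t10.
by rewrite /= in_itv /= t1' t2.
Qed.

End Maximum.

(** * The cost of moving the center *)

Section Moves.
Variable R : realType.

(** Increments of the distance have no lower bound of order [h], but may be replaced by larger ones.
    If one of them is below -(2 N + 1) b, it is raised to -2 N b and all others to [b], and the
    total is -b. *)
Lemma clip_sum N (o : 'I_N -> bool -> R) (b B : R) : 0 < b -> 0 <= B -> (forall k s, o k s <= b) ->
  \sum_k (o k false + o k true) <= B -> exists Y : 'I_N -> bool -> R,
  [/\ forall k s, o k s <= Y k s, forall k s, Y k s <= b, forall k s, `|Y k s| <= (2 * N%:R + 1) * b &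
    \sum_k (Y k false + Y k true) <= B].
Proof.
move=> b0 B0 ob So; have N0 : 0 <= N%:R * b by rewrite mulr_ge0 // ltW.
have [H|/existsNP[k0 /existsNP[s0 /negP]]] := pselect (forall k s, - ((2 * N%:R + 1) * b) <= o k s).
  by exists o; split=> // k s; rewrite ler_norml H /=; apply: le_trans (ob k s) _; lra.
rewrite -ltNge => o0; pose d k s : R := ((k == k0) && (s == s0))%:R.
exists (fun k s => b - (2 * N%:R + 1) * b * d k s); split.
- move=> k s; rewrite /d; have [->|kk] := eqVneq k k0; have [->|ss] := eqVneq s s0; rewrite /= ?mulr1 ?mulr0 ?subr0 //; lra.
- by move=> k s; rewrite gerBl mulr_ge0 ?ler0n // mulr_ge0 ?(ltW b0) // addr_ge0 // mulr_ge0.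
- move=> k s; have [->|->] : d k s = 0 \/ d k s = 1 by rewrite /d; case: ((k == k0) && (s == s0)); [right|left].
    by rewrite ler_norml mulr0 subr0; apply/andP; split; lra.
  by rewrite ler_norml mulr1; apply/andP; split; lra.
- have -> : \sum_k ((b - (2 * N%:R + 1) * b * d k false) + (b - (2 * N%:R + 1) * b * d k true)) =
     \sum_(k < N) 2 * b - (2 * N%:R + 1) * b * \sum_k (d k false + d k true).
    by rewrite mulr_sumr -sumrB; apply: eq_bigr => k _; ring.
  have -> : \sum_k (d k false + d k true) = 1.
    rewrite (bigD1 k0) //= big1 => [|k kk]; last by rewrite /d (negbTE kk) /= addr0.
    by rewrite /d eqxx addr0; case: s0 {o0 d}; rewrite ?addr0 ?add0r.
  rewrite sum_cst; lra.
Qed.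

Lemma square_moves (w y z h W Y Z : R) : `|w| <= W -> `|y| <= Y -> `|z| <= Z -> 0 < h -> h <= 1 ->
  let K := 2 * W * (Y + Z) + (Y + Z) ^+ 2 + 2 * Y ^+ 2 + 2 * W * Z + Z ^+ 2 in
  (forall s : bool, (w + (-1) ^+ s * h * y - 2^-1 * h ^+ 2 * z) ^+ 2 - w ^+ 2 <= K * h) /\
  ((w + h * y - 2^-1 * h ^+ 2 * z) ^+ 2 - w ^+ 2) + ((w - h * y - 2^-1 * h ^+ 2 * z) ^+ 2 - w ^+ 2) <= K * h ^+ 2.
Proof.
move=> wW yY zZ h0 h1 K; have W0 := le_trans (normr_ge0 _) wW; have Y0 := le_trans (normr_ge0 _) yY.
have Z0 := le_trans (normr_ge0 _) zZ; have h20 : 0 < h ^+ 2 by rewrite exprn_gt0.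
have hh : h ^+ 2 <= h by rewrite expr2 ler_piMl // ltW.
have WZ : 0 <= W * Z by exact: mulr_ge0.
have YZ : 0 <= Y + Z by exact: addr_ge0.
have WYZ : 0 <= W * (Y + Z) by exact: mulr_ge0.
have [Y2 Z2 YZ2] : [/\ 0 <= Y ^+ 2, 0 <= Z ^+ 2 & 0 <= (Y + Z) ^+ 2] by split; exact: sqr_ge0.
have sqr_le (a b : R) : `|a| <= b -> a ^+ 2 <= b ^+ 2.
  by move=> ab; rewrite -[a ^+ 2]real_normK ?num_real // lerXn2r ?nnegrE //; exact: le_trans ab.
split=> [s|].
  set d := (-1) ^+ s * h * y - 2^-1 * h ^+ 2 * z.
  have dD : `|d| <= h * (Y + Z).
    have h20' : 0 <= 2^-1 * h ^+ 2 by rewrite mulr_ge0 ?invr_ge0 // ltW.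
    apply: le_trans (ler_normB _ _) _; rewrite normrM normrMsign (gtr0_norm h0) normrM (ger0_norm h20') mulrDr.
    apply: lerD; first by rewrite ler_pM2l.
    by apply: ler_pM => //; lra.
  have D2 : d ^+ 2 <= h * (Y + Z) ^+ 2.
    apply: le_trans (sqr_le _ _ dD) _; rewrite exprMn; exact: ler_wpM2r.
  have wd : w * d <= W * (h * (Y + Z)) by apply: le_trans (ler_norm _) _; rewrite normrM; exact: ler_pM.
  rewrite (_ : w + _ - _ = w + d); last by rewrite /d addrA.
  have E : (w + d) ^+ 2 - w ^+ 2 = 2 * (w * d) + d ^+ 2 by ring.
  rewrite E /K; have : 0 <= h * (2 * Y ^+ 2 + 2 * (W * Z) + Z ^+ 2) by rewrite mulr_ge0 ?(ltW h0) //; lra.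
  move: wd D2; rewrite !mulrDl !mulrDr; lra.
have y2 := sqr_le _ _ yY; have z2 := sqr_le _ _ zZ.
have wz : - (w * z) <= W * Z.
  by apply: le_trans (ler_norm _) _; rewrite normrN normrM; exact: ler_pM.
have -> : ((w + h * y - 2^-1 * h ^+ 2 * z) ^+ 2 - w ^+ 2) + ((w - h * y - 2^-1 * h ^+ 2 * z) ^+ 2 - w ^+ 2) =
   h ^+ 2 * (2 * y ^+ 2 + 2 * - (w * z) + 2^-1 * (h ^+ 2 * z ^+ 2)) by field.
rewrite [leRHS]mulrC ler_pM2l // /K.
have hz : h ^+ 2 * z ^+ 2 <= Z ^+ 2.
  by apply: le_trans z2; rewrite ler_piMl ?sqr_ge0 //; exact: le_trans hh h1.
lra.
Qed.

End Moves.

Section CenterMoves.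
Variables (R : realType) (M : manifold R 3) (g : R -> tensor2 M).
Local Notation X := 'rV[R]_4.
Local Notation xdir := (@xdir R 3).

Definition sqdist (x0 x : X) : R := \sum_j ((x - x0) 0 j) ^+ 2.

(** The frame needs to be orthonormal only up to 1/2, since no trace is taken at the center and only
    lengths are bounded. The constants are uniform in the time, the frame and the position of the
    center. *)
Definition center_cost i (x0 : X) (r Cr C1 h1 : R) := forall t x E h, good_ball (g t) i x0 r r^-1 ->
    (forall c a b, `|Gam xdir (g t i) c x a b| <= r^-1) -> `|x - x0| <= r / 4 ->
    frame_gap g t (FrameAt i x E) (1 / 2) -> 0 < h -> h < h1 ->
    let y k (s : bool) := moved (fun c => Gam xdir (g t i) c x) x (((-1) ^+ s * h) *: row k E) in
    (forall k s, `|y k s - x0| <= r / 2 /\ Cr * sqdist x0 (y k s) - Cr * sqdist x0 x <= C1 * h) /\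
    \sum_k ((Cr * sqdist x0 (y k false) - Cr * sqdist x0 x) + (Cr * sqdist x0 (y k true) - Cr * sqdist x0 x)) <= C1 * h ^+ 2.

Lemma center_moves i x0 (r Cr : R) : 0 < r -> 0 <= Cr -> exists C1 h1, [/\ 0 < C1, 0 < h1 &
  center_cost i x0 r Cr C1 h1].
Proof.
(* [Y0] bounds the frame vectors and [Z0] the quadratic term of the approximate geodesics. *)
move=> r0 Cr0; pose Y0 := 2 * r^-1; pose Z0 := 4 * (Y0 * (4 * r^-1 * Y0)).
have ri : 0 < r^-1 by rewrite invr_gt0.
have Y00 : 0 < Y0 by rewrite mulr_gt0.
have Z00 : 0 < Z0 by rewrite !mulr_gt0.
pose K := 2 * r * (Y0 + Z0) + (Y0 + Z0) ^+ 2 + 2 * Y0 ^+ 2 + 2 * r * Z0 + Z0 ^+ 2.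
have YZ : 0 < Y0 + Z0 by rewrite addr_gt0.
have K0 : 0 < K by rewrite /K !addr_gt0 // ?exprn_gt0 // !mulr_gt0 ?exprn_gt0.
have CK : 0 <= Cr * K by rewrite mulr_ge0 // ltW.
exists (16 * (Cr * K) + 1), (Num.min 1 (r / 4 / (Y0 + Z0))); split.
- by rewrite ltr_wpDl // mulr_ge0.
- by rewrite lt_min ltr01 !divr_gt0.
move=> t x E h gb Gb xr gap h0; rewrite lt_min => /andP[h1 hr] y.
rewrite ltr_pdivlMr // in hr.
have hh : h ^+ 2 <= h by rewrite expr2 ler_piMl // ltW.
have xr' : `|x - x0| < r by lra.
have a3 : 1 / 2 <= 3 :> R by lra.
have Yb k : `|row k E| <= Y0 := frame_row_le k gb xr' a3 gap.
pose Z k : X := \sum_c (row k E) 0 c *: (row k E *m Gam xdir (g t i) c x).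
have Zb k : `|Z k| <= Z0.
  apply: le_trans (ler_norm_sum _ _ _) _; apply: le_trans (_ : \sum_(c < 4) Y0 * (4 * r^-1 * Y0) <= _).
    apply: ler_sum => c _; rewrite normrZ; apply: ler_pM => //.
      exact: le_trans (coord_le_norm _ _ _) (Yb k).
    by apply: le_trans (norm_mulmx_le _ (Gb c)) _; rewrite ler_wpM2l // mulr_ge0 // ltW.
  by rewrite sum_cst.
have yE k s : y k s = x + ((-1) ^+ s * h) *: row k E - (2^-1 * h ^+ 2) *: Z k.
  by rewrite /y moved_parabola /parabola exprMn sqrr_sign mul1r.
have wb j : `|(x - x0) 0 j| <= r by apply: le_trans (coord_le_norm _ _ _) _; lra.
have moves k j := square_moves (wb j) (le_trans (coord_le_norm _ 0 j) (Yb k)) (le_trans (coord_le_norm _ 0 j) (Zb k)) h0 (ltW h1).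
have coord k s j : (y k s - x0) 0 j = (x - x0) 0 j + (-1) ^+ s * h * (row k E) 0 j - 2^-1 * h ^+ 2 * (Z k) 0 j.
  by rewrite yE !addmxE !oppmxE !scalemxE; ring.
have diff k s : Cr * sqdist x0 (y k s) - Cr * sqdist x0 x = Cr * \sum_j (((y k s - x0) 0 j) ^+ 2 - ((x - x0) 0 j) ^+ 2).
  by rewrite -mulrBr /sqdist sumrB.
split=> [k s|].
  split.
    have D : `|y k s - x| <= h * (Y0 + Z0).
      have -> : y k s - x = ((-1) ^+ s * h) *: row k E - (2^-1 * h ^+ 2) *: Z k by rewrite yE addrAC [x + _]addrC addrK.
      have h20' : 0 <= 2^-1 * h ^+ 2 by rewrite mulr_ge0 ?invr_ge0 // sqr_ge0.
      apply: le_trans (ler_normB _ _) _; rewrite normrZ normrMsign (gtr0_norm h0) mulrDr.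
      apply: lerD; first by rewrite ler_pM2l.
      by rewrite normrZ (ger0_norm h20'); apply: ler_pM => //; lra.
    apply: le_trans (ler_distD x _ _) _; lra.
  rewrite diff; apply: le_trans (_ : Cr * \sum_(j < 4) K * h <= _).
    by apply: ler_wpM2l => //; apply: ler_sum => j _; rewrite coord; have [+ _] := moves k j; exact.
  rewrite sum_cst.
  have := mulr_ge0 CK (ltW h0); move: (Cr * K) (mulrA Cr K h) => CK' E'.
  rewrite (_ : Cr * (4%:R * (K * h)) = 4 * (Cr * (K * h))); last by ring.
  rewrite E'; lra.
apply: le_trans (_ : \sum_(k < 4) Cr * \sum_(j < 4) K * h ^+ 2 <= _).
  apply: ler_sum => k _; rewrite !diff -mulrDr -big_split /=; apply: ler_wpM2l => //; apply: ler_sum => j _.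
  by rewrite !coord expr0 expr1 mul1r !mulN1r mulNr; have [_] := moves k j.
have s4 (z : R) : \sum_(k < 4) z = 4 * z by rewrite sum_cst.
rewrite s4 s4 (_ : 4 * (Cr * (4 * (K * h ^+ 2))) = 16 * (Cr * K) * h ^+ 2); last by ring.
by apply: ler_wpM2r; [exact: sqr_ge0|rewrite lerDl].
Qed.

End CenterMoves.

(** * Nonnegativity of the values *)

Section Nonnegativity.
Variables (R : realType) (M : manifold R 3) (g : R -> tensor2 M).
Hypothesis ancient : complete_ancient_ricci_flow g.
Hypothesis nonneg_ic : forall t : R, t <= 0 -> nonneg_isotropic_curvature (g t).
Local Notation X := 'rV[R]_4.
Local Notation xdir := (@xdir R 3).
Local Notation kappa := ((2 * 4%:R)^-1 : R).

Let sqdist_ge0 (x0 x : X) : 0 <= sqdist x0 x.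
Proof. by apply: sumr_ge0 => j _; exact: sqr_ge0. Qed.

Let sqdist_norm (x0 x : X) : `|x - x0| ^+ 2 <= sqdist x0 x.
Proof.
rewrite -[leRHS]sqr_sqrtr // lerXn2r ?nnegrE ?sqrtr_ge0 //; apply: row_norm_le => [|j]; first exact: sqrtr_ge0.
rewrite -sqrtr_sqr ler_wsqrtr // /sqdist (bigD1 j) //= lerDl; apply: sumr_ge0 => k _; exact: sqr_ge0.
Qed.

(** The chain from the far point ends in an unknown chart, whereas the penalty of the center is
    written in the chart [i]. *)
Lemma spread_to_chart t p i z d P : t <= 0 -> img i z -> dle (g t) (psi i z) p d -> framed P p -> frame_gap g t P 0 ->
  exists2 E, frame_gap g t (FrameAt i z E) (1 / 2) & spread g t P (FrameAt i z E) d 1.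
Proof.
move=> t0 iz zp Pp P0; have rg := flow_riemannian ancient t0.
have pz : dle (g t) p (psi i z) d by move=> e e0; exact: (dlt_sym rg (zp e e0)).
have h0 : 0 < 1 / 2 :> R by lra.
have [Q [[iQ Qz] Q0 PQ]] := spread_chain ancient t0 pz Pp P0 h0 h0.
have oQ : overlap (fchart Q) i (fpos Q).
  exists (psi (fchart Q) (fpos Q)); last exact: psiK.
  by split; [exact: psi_dom|rewrite -[psi _ _]/(fpoint Q) Qz; exact: psi_dom].
have zE : transition (fchart Q) i (fpos Q) = z by rewrite /transition /= -[psi _ _]/(fpoint Q) Qz psiK.
exists (fmx (switch (fchart Q) i Q)); rewrite -[in FrameAt i z _]zE; first exact: (switch_gap ancient t0 oQ Q0).
have := spread_trans ancient t0 PQ (spread_switch ancient t0 oQ h0).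
by rewrite addr0 (_ : 1 / 2 + 1 / 2 = 1) //; lra.
Qed.

Let cost_le (q q' a d y : R) : q - q' + (a - d) <= y -> a <= q' + d + y - q.
Proof. by move=> H; lra. Qed.

Let sqdist0 (x0 : X) : sqdist x0 x0 = 0.
Proof. by apply: big1 => j _; rewrite subrr mxE expr0n. Qed.

Section Contradiction.
Variables (t1 v1 : R) (p1 : M).
Hypotheses (t10 : t1 <= 0) (hv1 : has_value g t1 p1 v1) (v10 : v1 < 0).

Let i := chart_at p1.
Let x1 : X := phi i p1.
Let nu := - v1.
Let ip1 : dom i p1. Proof. exact: dom_chart_at. Qed.
Let psi1 : psi i x1 = p1. Proof. exact: phiK. Qed.
(** With this starting time, [F] is 3 at the initial tuple, whereas the estimate at a maximum yields
    at most 2 for large [A]. *)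
Let T0 := t1 - 3 / nu.
Let nu0 : 0 < nu. Proof. by rewrite oppr_gt0. Qed.

(* The center of the cutoff is free to move in a ball of a chart, at the cost
   Cr |zeta - x1| ^ 2: a tuple is (x, t, zeta, delta, v). *)
Let tuple := (M * R * X * R * R)%type.
Let px (u : tuple) := u.1.1.1.1.
Let tm (u : tuple) := u.1.1.1.2.
Let zt (u : tuple) := u.1.1.2.
Let dt (u : tuple) := u.1.2.
Let vl (u : tuple) := u.2.

Section Cutoff.
Variables (r A : R).
Hypotheses (r0 : 0 < r) (A0 : 0 < A).
Hypothesis bounds : forall t, T0 <= t <= t1 ->
  good_ball (g t) i x1 r r^-1 /\ forall x c a b, `|x - x1| < r -> `|Gam xdir (g t i) c x a b| <= r^-1.
(** Returning the center to [x1] costs at most |zt - x1| / r in distance; a penalty not exceeding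
    this cost means |zt - x1| <= r / 4. *)
Let Cr := 4 * r^-1 / r.
Let D u := Cr * sqdist x1 (zt u) + dt u.
(** [dt] is any upper bound of the distance: [S] is then stable under limits, and moved tuples can
    carry the raised increments of [clip_sum]. *)
Let S : set tuple := [set u | [/\ T0 <= tm u <= t1, `|zt u - x1| <= r / 2,
  dle (g (tm u)) (psi i (zt u)) (px u) (dt u), has_value g (tm u) (px u) (vl u) & D u <= A]].
(** [F] vanishes at the time [T0] and where D = A, so a positive maximum leaves room for small
    displacements. *)
Let F u := - vl u * ((tm u - T0) * (1 - D u / A) ^+ 2).

Let Cr0 : 0 < Cr. Proof. by rewrite !divr_gt0 // mulr_gt0 // invr_gt0. Qed.

Let half_r : r / 2 < r. Proof. by rewrite gtr_pMr // invf_lt1 // ltr1n. Qed.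

Let T01 : T0 <= t1 <= t1. Proof. by rewrite lexx andbT /T0 gerBl divr_ge0 // ltW. Qed.

Let near_img z : `|z - x1| <= r / 2 -> img i z.
Proof.
move=> zr; have [[_ _ bi _] _] := bounds T01; apply: (bi z); exact: le_lt_trans zr half_r.
Qed.

Let start : tuple := (p1, t1, x1, 0, v1).

Let start_in : S start.
Proof.
split=> //=.
- by rewrite /zt /= subrr normr0 divr_ge0 // ltW.
- rewrite -[zt start]/x1 -[px start]/p1 -[dt start]/0 psi1 => e e0; rewrite add0r; exact: dlt_refl.
- by rewrite /D /zt /dt /= sqdist0 mulr0 addr0 ltW.
Qed.

Let start_value : F start = 3.
Proof.
rewrite /F /D /vl /tm /zt /dt /= sqdist0 mulr0 addr0 mul0r subr0 expr1n mulr1 /T0 opprB addrCA subrr addr0.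
by rewrite -/nu mulrC divfK // gt_eqF.
Qed.

Let maximum_exists : exists2 u, S u & forall w, S w -> F w <= F u.
Proof.
apply: attained; first by exists start.
move=> G UG GS.
have [t tG] : exists t : R, tm @ G --> t.
  apply: (ultra_bounded UG (b := `|T0| + `|t1|)); apply: filterS GS => u [/andP[a1 a2] _ _ _ _] /=.
  have := ler_norm (- T0); have := ler_norm t1; have := normr_ge0 T0; have := normr_ge0 t1; rewrite normrN ler_norml => *.
  by apply/andP; split; lra.
have [z zG] : exists z : X, zt @ G --> z.
  apply: (ultra_row UG (b := r / 2 + `|x1|)); apply: filterS GS => u [_ a _ _ _] /=.
  by rewrite -[X in `|X|](subrK x1); apply: le_trans (ler_normD _ _) _; rewrite lerD2r.
have [d dG] : exists d : R, dt @ G --> d.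
  apply: (ultra_bounded UG (b := A)); apply: filterS GS => u [_ _ a _ b] /=.
  rewrite ger0_norm; last exact: dle_ge0 a.
  by apply: le_trans b; rewrite lerDr mulr_ge0 // ltW.
have T0t : T0 <= t.
  by apply: (ultra_le UG (@cvg_cst _ T0 _ G _) tG); apply: filterS GS => u [/andP[]].
have tt1 : t <= t1.
  by apply: (ultra_le UG tG (@cvg_cst _ t1 _ G _)); apply: filterS GS => u [/andP[]].
have t0 : t <= 0 by exact: le_trans t10.
have zr : `|z - x1| <= r / 2.
  have c : (fun u => `|zt u - x1|) @ G --> (`|z - x1| : R).
    by apply: cvg_norm; apply: cvgB => //; exact: cvg_cst.
  by apply: (ultra_le UG c (@cvg_cst _ (r / 2) _ G _)); apply: filterS GS => u [].
have pG : (fun u => psi i (zt u)) @ G --> psi i z by exact: (cvg_comp _ _ zG (psi_cont (near_img zr))).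
have [x xG dx] := ultra_limit ancient t0 (x := px) (A := A) UG pG tG dG (ltac:(
  apply: filterS GS => u [/andP[_ a1] _ a2 _ a3] /=; split=> //; [exact: le_trans a1 t10|];
  apply: le_trans a3; by rewrite lerDr mulr_ge0 // ltW)).
have [v vG hv] := value_limit ancient UG t0 xG tG (v := vl) (ltac:(
  apply: filterS GS => u [/andP[_ a1] _ _ a2 _] /=; split=> //; exact: le_trans a1 t10)).
have sG : (fun u => sqdist x1 (zt u)) @ G --> (sqdist x1 z : R).
  apply: cvg_big => [|j _]; first exact: add_continuous.
  have c : (fun u => (zt u - x1) 0 j) @ G --> ((z - x1) 0 j : R).
    have c1 : (fun u => zt u - x1) @ G --> z - x1 by apply: cvgB => //; exact: cvg_cst.
    exact: (cvg_comp _ _ c1 (@coord_continuous _ _ _ 0 j _)).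
  exact: (cvgM c c).
have DG : D @ G --> (Cr * sqdist x1 z + d : R).
  by apply: cvgD => //; apply: cvgM => //; exact: cvg_cst.
exists (x, t, z, d, v).
  split=> //=; first by rewrite /tm /= T0t.
  by apply: (ultra_le UG DG (@cvg_cst _ A _ G _)); apply: filterS GS => u [].
move=> c Gc; have FG : F @ G --> (F (x, t, z, d, v) : R).
  apply: cvgM; first exact: cvgN.
  have c1 : (fun u => tm u - T0) @ G --> (t - T0 : R) by apply: cvgB => //; exact: cvg_cst.
  have c2 : (fun u => 1 - D u / A) @ G --> (1 - D (x, t, z, d, v) / A : R).
    by apply: cvgB; [exact: cvg_cst|apply: cvgM => //; exact: cvg_cst].
  exact: (cvgM c1 (cvgM c2 c2)).
exact: (ultra_le UG (@cvg_cst _ c _ G _) FG Gc).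
Qed.

Let value_signs u : S u -> 3 <= F u -> [/\ vl u < 0, 0 < tm u - T0, tm u - T0 <= 3 / nu, 0 < 1 - D u / A & 1 - D u / A <= 1].
Proof.
move=> [/andP[T0t tt1] _ hd _ DA] F3.
have D0 : 0 <= D u by rewrite addr_ge0 ?(dle_ge0 hd) // mulr_ge0 // ltW.
have c0 : 0 <= 1 - D u / A by rewrite subr_ge0 ler_pdivrMr // mul1r.
have tau0 : 0 <= tm u - T0 by rewrite subr_ge0.
have F0 : 0 < F u by exact: lt_le_trans F3.
have nz : F u != 0 by rewrite gt_eqF.
have /and3P[nv nt nc] : [&& - vl u != 0, tm u - T0 != 0 & 1 - D u / A != 0].
  by move: nz; rewrite /F !mulf_eq0 !negb_or => /and4P[-> -> -> _].
have tp : 0 < tm u - T0 by rewrite lt_neqAle eq_sym nt.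
have cp : 0 < 1 - D u / A by rewrite lt_neqAle eq_sym nc.
split=> //.
- by move: F0; rewrite /F pmulr_lgt0 ?oppr_gt0 // mulr_gt0 // exprn_gt0.
- by rewrite /T0 opprB addrCA gerDl subr_le0.
- by rewrite gerBl divr_ge0 // ltW.
Qed.

(* Moving the center back to x1 costs less than the quadratic term gains, unless it is close to x1. *)
Let center_near u : S u -> (forall w, S w -> F w <= F u) -> 3 <= F u -> `|zt u - x1| <= r / 4.
Proof.
move=> Su max F3; have [v0 tau0 _ c0 _] := value_signs Su F3.
have [/andP[T0t tt1] zr hd hv DA] := Su.
have t0 : tm u <= 0 by exact: le_trans t10.
have rg := flow_riemannian ancient t0.
have [[_ _ bi bd] _] : good_ball (g (tm u)) i x1 r r^-1 /\ _ := bounds (introT andP (conj T0t tt1)).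
pose d' := r^-1 * `|zt u - x1| + dt u.
pose w : tuple := (px u, tm u, x1, d', vl u).
have Dw : D w = d' by rewrite /D /zt /dt /= sqdist0 mulr0 add0r.
have key : D u <= d'.
  rewrite leNgt; apply/negP => dD.
  have Sw : S w.
    split=> //; first by rewrite /tm /= T0t.
    - by rewrite /zt /= subrr normr0 divr_ge0 // ltW.
    - move=> e e0; rewrite -[zt w]/x1 -[px w]/(px u) -[dt w]/d' -[tm w]/(tm u).
      rewrite (_ : d' + e = (r^-1 * `|zt u - x1| + e / 2) + (dt u + e / 2)); last by rewrite /d'; lra.
      apply: (dlt_trans rg (q := psi i (zt u))); last by apply: hd; rewrite divr_gt0.
      apply: (chart_upper rg bi bd); rewrite ?subrr ?normr0 //; last by rewrite ltrDl divr_gt0.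
      exact: le_lt_trans zr half_r.
    - by rewrite Dw; exact: le_trans (ltW dD) DA.
  have := max w Sw; rewrite leNgt => /negP; apply.
  rewrite /F -[vl w]/(vl u) -[tm w]/(tm u) Dw ltr_pM2l ?oppr_gt0 // ltr_pM2l //.
  rewrite ltr_pXn2r // ?nnegrE ?(ltW c0) //; first by rewrite ltrD2l ltrN2 ltr_pM2r ?invr_gt0.
  by rewrite subr_ge0 ler_pdivrMr // mul1r (le_trans (ltW dD)).
move: key; rewrite /D /d' lerD2r => key.
have := le_trans (ler_wpM2l (ltW Cr0) (sqdist_norm x1 (zt u))) key.
have [->|z0] := eqVneq `|zt u - x1| 0; first by move=> _; rewrite divr_ge0 // ltW.
have zp : 0 < `|zt u - x1| by rewrite lt_neqAle eq_sym z0 normr_ge0.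
rewrite expr2 mulrA ler_pM2r // /Cr => k2.
rewrite -(ler_pM2l (mulr_gt0 r0 r0)) in k2.
have rr : r * r^-1 = 1 by rewrite mulfV // gt_eqF.
have E1 : r * r * (4 * r^-1 / r * `|zt u - x1|) = 4 * (r * r^-1) ^+ 2 * `|zt u - x1| by ring.
have E2 : r * r * r^-1 = r * (r * r^-1) by ring.
by rewrite ler_pdivlMr // mulrC; move: k2; rewrite E1 E2 rr expr1n !mulr1.
Qed.

(** The competitors displace the far point along an eigenframe and the center along the propagated
    frame, both back in time; [value_step], [spread] and [center_cost] then provide the hypotheses
    of [maximum_bound]. The factor 9 is 2 * 4 + 1, from [clip_sum]. *)
Let maximum_estimate u (C1 h1 : R) : 0 < C1 -> 0 < h1 ->
  center_cost g i x1 r Cr C1 h1 ->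
  S u -> (forall w, S w -> F w <= F u) -> 3 <= F u ->
  forall c C : R, c = 1 - D u / A -> C = 9 * (C1 + 1) ->
  - vl u <= 2 * C / (A * c) + 8 * (2 * 4%:R * (C / (A * c)) ^+ 2) + (tm u - T0)^-1.
Proof.
move=> C10 h10 move_center Su max F3 c C cE CE; have near := center_near Su max F3.
have [v0 tau0 _ + _] := value_signs Su F3; rewrite -cE => c0; have [/andP[T0t tt1] zr hd hv DA] := Su.
have t0 : tm u <= 0 by exact: le_trans t10.
have [gb Gb] := bounds (introT andP (conj T0t tt1)).
have DA' : D u < A by move: c0; rewrite cE subr_gt0 ltr_pdivrMr // mul1r.
pose j := chart_at (px u); have jx : dom j (px u) by exact: dom_chart_at.
have [E2 [rr ef]] := eigenframe_exists ancient t0 (phi_img jx).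
pose P := FrameAt j (phi j (px u)) E2.
have Pp : fpoint P = px u by exact: phiK.
have Pf : framed P (px u) by split=> //; exact: phi_img.
have [_ P0 _ _] := ef; pose lam := rr 0 + rr 1.
have hlam : has_value g (tm u) (px u) lam by exists P; split=> //; exact: eigenframe_value.
(* At a maximum the plane is already optimal: a smaller value would increase [F]. *)
have lamE : vl u = lam.
  apply/le_anti/andP; split; last by apply: (eigenframe_le ancient t0 ef); rewrite Pp.
  pose w : tuple := (px u, tm u, zt u, dt u, lam).
  have /max : S w by split=> //; rewrite /tm /= T0t.
  by rewrite /F -[vl w]/lam -[tm w]/(tm u) -[D w]/(D u) ler_pM2r ?lerN2 // mulr_gt0 // exprn_gt0 // -cE.
have lam0 : lam <= 0 by rewrite -lamE ltW.
have [E Egap [h2 h20 Hsp]] := spread_to_chart t0 (near_img zr) hd Pf P0.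
have [c' [cl _ Hv]] := value_step ancient nonneg_ic t0 ef lam0.
have k0 : 0 < kappa by rewrite invr_gt0 mulr_gt0.
have AD : 0 < (A - D u) / (C1 + 1) by rewrite divr_gt0 ?subr_gt0 // addr_gt0.
apply: (maximum_bound (kappa := kappa)) => //.
- by rewrite oppr_gt0.
- by rewrite CE mulr_gt0 // addr_gt0.
- by rewrite mulfV // gt_eqF // mulr_gt0.
move=> e e0; have [h3 h30 Hv3] := Hv e e0.
exists (Num.min h1 (Num.min h2 (Num.min h3 (Num.min 1 (Num.min (tm u - T0) ((A - D u) / (C1 + 1))))))).
  by rewrite !lt_min h10 h20 h30 ltr01 tau0.
move=> h h0; rewrite !lt_min => /and5P[hh1 hh2 hh3 hh4 /andP[hh5 hh6]].
have [vv [hvv Sv]] := Hv3 h h0 hh3; have [a [ha Sa]] := Hsp h h0 hh2.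
pose y k (s : bool) := moved (fun c => Gam xdir (g (tm u) i) c (zt u)) (zt u) (((-1) ^+ s * h) *: row k E).
have [Hy Sy] : (forall k s, `|y k s - x1| <= r / 2 /\ Cr * sqdist x1 (y k s) - Cr * sqdist x1 (zt u) <= C1 * h) /\
    \sum_k ((Cr * sqdist x1 (y k false) - Cr * sqdist x1 (zt u)) + (Cr * sqdist x1 (y k true) - Cr * sqdist x1 (zt u))) <= C1 * h ^+ 2.
  exact (move_center _ _ _ h gb (fun c a b => Gb _ c a b (le_lt_trans zr half_r)) near Egap h0 hh1).
pose o k s := (Cr * sqdist x1 (y k s) - Cr * sqdist x1 (zt u)) + (a k s - dt u).
have C11 : 0 < C1 + 1 by rewrite addr_gt0.
have ob k s : o k s <= (C1 + 1) * h.
  have [_ Hy1] := Hy k s; have [_ Ha] := ha k s; rewrite /o mulrDl; apply: lerD => //.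
  by rewrite lerBlDl.
have So : \sum_k (o k false + o k true) <= (C1 + 1) * h ^+ 2.
  have -> : \sum_k (o k false + o k true) = \sum_k ((Cr * sqdist x1 (y k false) - Cr * sqdist x1 (zt u)) +
      (Cr * sqdist x1 (y k true) - Cr * sqdist x1 (zt u))) + (\sum_k (a k false + a k true) - \sum_(k < 4) 2 * dt u).
    by rewrite -sumrB -big_split; apply: eq_bigr => k _; rewrite /o /= mulr_natl mulr2n opprD addrACA; congr (_ + _); rewrite addrACA.
  rewrite [leRHS]mulrDl; apply: lerD => //; rewrite sum_cst lerBlDl.
  by apply: le_trans Sa _; rewrite lerD2r mulrCA mulrA.
have b0 : 0 < (C1 + 1) * h by rewrite mulr_gt0.
have B0 : 0 <= (C1 + 1) * h ^+ 2 by rewrite mulr_ge0 ?sqr_ge0 // ltW.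
have [Y [oY Yb Yn SY]] := clip_sum b0 B0 ob So.
have past : T0 <= tm u - kappa * h ^+ 2.
  rewrite lerBrDl -lerBrDr; apply: le_trans (ltW hh5); rewrite expr2 mulrA ler_piMl // ?(ltW h0) //.
  by apply: mulr_ile1; rewrite ?(ltW h0) ?(ltW k0) ?(ltW hh4) // invf_le1 // -natrM ler1n.
have past1 : tm u - kappa * h ^+ 2 <= tm u by rewrite gerBl mulr_ge0 ?sqr_ge0 // ltW.
exists vv, Y; split.
- apply: le_trans Sv _; rewrite lamE; move: cl; rewrite -/lam sqrrN mulrN opprK => cl.
  rewrite lerD2l lerN2 ler_wpM2l ?sqr_ge0 // lerD2r //.
(* The distance entry is set so that [D] becomes exactly D u + Y k s; it bounds the distance because
   [Y] dominates [o]. *)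
- move=> k s; pose w : tuple := (shoot g (tm u) P (((-1) ^+ s * h) *: row k (fmx P)), tm u - kappa * h ^+ 2, y k s,
    D u + Y k s - Cr * sqdist x1 (y k s), vv k s).
  have Dw : D w = D u + Y k s by rewrite /D -[zt w]/(y k s) /dt /= addrC subrK.
  have Sw : S w.
    split.
    + by rewrite -[tm w]/(tm u - kappa * h ^+ 2) past (le_trans past1).
    + by have [] := Hy k s.
    + have [hd' _] := ha k s; apply: dlt_dle; apply: (dlt_sym (flow_riemannian ancient (past_le0 3 h t0))).
      by apply: dlt_mono hd'; exact: cost_le (oY k s).
    + exact: hvv.
    + rewrite Dw -lerBrDl; apply: le_trans (Yb k s) _; rewrite ltr_pdivlMr // in hh6.
      by rewrite mulrC ltW.
  have := max w Sw; rewrite {1}/F -[vl w]/(vv k s) -[tm w]/(tm u - kappa * h ^+ 2) Dw /F mulrA.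
  have -> : tm u - kappa * h ^+ 2 - T0 = tm u - T0 - kappa * h ^+ 2 by ring.
  have -> : 1 - (D u + Y k s) / A = c - Y k s / A by rewrite cE mulrDl opprD addrA.
  by rewrite -cE !mulrA.
- move=> k s; apply: le_trans (Yn k s) _; rewrite CE -mulrA; apply: ler_wpM2r; first exact: ltW.
  by rewrite -natrM natr1.
- apply: le_trans SY _; apply: ler_wpM2r; first exact: sqr_ge0.
  by rewrite CE ler_peMl ?ltW // ltr1n.
Qed.

(* Multiplying the estimate by tau c ^ 2 bounds the maximum by (tau / A) (2 C + 64 C ^ 2) + 1. *)
Lemma no_large_cutoff (C1 h1 : R) : 0 < C1 -> 0 < h1 ->
  center_cost g i x1 r Cr C1 h1 ->
  forall C : R, C = 9 * (C1 + 1) -> A < 1 + 3 / nu * (2 * C + 64 * C ^+ 2).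
Proof.
move=> C10 h10 move_center C CE; rewrite ltNge; apply/negP => AA.
have [u Su max] := maximum_exists.
have F3 : 3 <= F u by rewrite -start_value; exact: max start_in.
have [v0 tau0 tau1 c0 cle1] := value_signs Su F3.
have C0 : 0 < C by rewrite CE mulr_gt0 // addr_gt0.
have := maximum_estimate C10 h10 move_center Su max F3 erefl CE.
move: F3; rewrite /F; move: c0 cle1 tau0 tau1 v0; move: (1 - D u / A) (tm u - T0) (- vl u) => c tau L c0 cle1 tau0 tau1 _ F3.
rewrite -(ler_pM2r (mulr_gt0 tau0 (exprn_gt0 2 c0))) => est.
have := le_trans F3 est.
have Ai : 0 < A^-1 by rewrite invr_gt0.
have -> : (2 * C / (A * c) + 8 * (2 * 4%:R * (C / (A * c)) ^+ 2) + tau^-1) * (tau * c ^+ 2) =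
   tau * (c * (2 * C) / A + 64 * C ^+ 2 / A / A) + c ^+ 2.
  by field; rewrite !gt_eqF.
have C20 : 0 < 64 * C ^+ 2 by rewrite mulr_gt0 // exprn_gt0.
have n3 : 0 < 3 / nu by rewrite divr_gt0.
have A1 : 1 <= A by apply: le_trans AA; rewrite lerDl mulr_ge0 ?ltW // addr_gt0 // mulr_gt0.
have b1 : c * (2 * C) / A + 64 * C ^+ 2 / A / A <= (2 * C + 64 * C ^+ 2) / A.
  rewrite [leRHS]mulrDl; apply: lerD; rewrite ler_pM2r //.
    by rewrite ler_piMl // mulr_ge0 // ltW.
  by rewrite ler_pdivrMr // ler_peMr // ltW.
have b2 : tau * (c * (2 * C) / A + 64 * C ^+ 2 / A / A) <= 3 / nu * ((2 * C + 64 * C ^+ 2) / A).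
  apply: ler_pM => //; first exact: ltW.
  by rewrite addr_ge0 // ?divr_ge0 ?mulr_ge0 ?ltW // mulr_gt0.
have b3 : 3 / nu * ((2 * C + 64 * C ^+ 2) / A) <= 1.
  by rewrite mulrA ler_pdivrMr // mul1r; apply: le_trans AA; rewrite lerDr.
have b4 : c ^+ 2 <= 1 by rewrite exprn_ile1 // ltW.
lra.
Qed.

End Cutoff.

Lemma negative_value_absurd : False.
Proof.
have [r r0 bounds] := center_bounds ancient T0 (phi_img ip1) t10.
have Cr0 : 0 <= 4 * r^-1 / r by rewrite !divr_ge0 // ?mulr_ge0 // ?invr_ge0 ltW.
have [C1 [h1 [C10 h10 mc]]] := center_moves g i x1 r0 Cr0.
pose C := 9 * (C1 + 1).
have C0 : 0 < C by rewrite mulr_gt0 // addr_gt0.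
(* [C1] does not depend on the cutoff radius, so [A] can be the very value that [no_large_cutoff]
   excludes. *)
have A0 : 0 < 1 + 3 / nu * (2 * C + 64 * C ^+ 2).
  by rewrite addr_gt0 // mulr_gt0 ?divr_gt0 // addr_gt0 // mulr_gt0 // exprn_gt0.
by have := no_large_cutoff r0 A0 bounds C10 h10 mc (erefl C); rewrite ltxx.
Qed.

End Contradiction.

Lemma values_ge0 t p v : t <= 0 -> has_value g t p v -> 0 <= v.
Proof. by move=> t0 hv; rewrite leNgt; apply/negP => v0; exact: negative_value_absurd t0 hv v0. Qed.

(** A strong maximum principle in one step: by strict positivity of the reaction, a zero value would
    force a negative value a little earlier. *)
Lemma values_gt0 t p v : pos_isotropic_curvature (g t) -> t <= 0 -> has_value g t p v -> 0 < v.
Proof.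
move=> pic t0 hv; rewrite lt_neqAle (values_ge0 t0 hv) andbT eq_sym; apply/eqP => v0.
have jx := dom_chart_at p; have [E [rr ef]] := eigenframe_exists ancient t0 (phi_img jx).
set P := FrameAt _ _ _ in ef; have Pp : fpoint P = p by exact: phiK.
have lam0 : rr 0 + rr 1 <= 0 by rewrite -v0; apply: (eigenframe_le ancient t0 ef); rewrite Pp.
have lam1 : 0 <= rr 0 + rr 1.
  have [iP P0 _ _] := ef; apply: (values_ge0 t0 (p := p)).
  by exists P; split=> //; exact: eigenframe_value.
have [c [_ /(_ pic) c0 Hv]] := value_step ancient nonneg_ic t0 ef lam0.
have [h0 h00 H] := Hv (c / 2) (divr_gt0 c0 (ltr0Sn _ _)).
have h1 : 0 < h0 / 2 by rewrite divr_gt0.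
have h2 : h0 / 2 < h0 by rewrite gtr_pMr // invf_lt1 // ltr1n.
have [w [hw]] := H _ h1 h2; apply/negP; rewrite -ltNge.
apply: (@lt_le_trans _ _ 0); last by apply: sumr_ge0 => k _; rewrite addr_ge0 //; apply: (values_ge0 (past_le0 3 _ t0) (hw _ _)).
have -> : rr 0 + rr 1 = 0 by apply/le_anti/andP.
by rewrite mulr0 sub0r oppr_lt0 mulr_gt0 ?exprn_gt0 // subr_gt0 gtr_pMr // invf_lt1 // ltr1n.
Qed.

Lemma sum_two_smallest_value t i x E : t <= 0 -> img i x -> orthonormal_frame (g t i) x E ->
  has_value g t (psi i x) (sum_two_smallest (ricci_frame (g t i) x E)).
Proof.
move=> t0 ix EO; have mG := riemannian_metric_on i (flow_riemannian ancient t0).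
have [P [r [PO PS rs]]] := spectral_orthogonal (ricci_frame_sym mG ix EO).
exists (FrameAt i x (P *m E)); split=> //.
  apply/gap0_orthonormal; rewrite /orthonormal_frame /= trmx_mul !mulmxA -(mulmxA P) -(mulmxA P) EO mulmx1 //.
have one4 : lift ord0 ord0 = 1 :> 'I_4 by exact/val_inj.
rewrite (sum_two_smallest_diag PO PS rs) one4 /plane_value /frame_ricci /=.
have E1 : ricci_frame (g t i) x (P *m E) = P *m ricci_frame (g t i) x E *m P^T.
  by rewrite /ricci_frame trmx_mul !mulmxA.
by rewrite E1 !PS !eqxx.
Qed.

End Nonnegativity.
Theorem theorem1p1 (R : realType) (M : manifold R 3) (g : R -> tensor2 M)
  (orientedM : oriented M)
  (ancient_g : complete_ancient_ricci_flow g)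
  (nonneg_ic : forall t : R, t <= 0 -> nonneg_isotropic_curvature (g t)) :
  (forall t : R, t <= 0 -> two_nonneg_ricci (g t) /\ curvature_estimate (g t))
  /\
  ((forall t : R, t <= 0 -> pos_isotropic_curvature (g t)) ->
    forall t : R, t <= 0 -> two_pos_ricci (g t)).
Proof.
have value t i x E (t0 : t <= 0) := sum_two_smallest_value (E := E) ancient_g (i := i) (x := x) t0.
split=> [t t0|pic t t0 i x E ix EO]; last exact: (values_gt0 ancient_g nonneg_ic (pic t t0) t0 (value t i x E t0 ix EO)).
have ric0 i x E : img i x -> orthonormal_frame (g t i) x E -> 0 <= sum_two_smallest (ricci_frame (g t i) x E).
  by move=> ix EO; exact: (values_ge0 ancient_g nonneg_ic t0 (value t i x E t0 ix EO)).
split=> // i x E ix EO; have mG := riemannian_metric_on i (flow_riemannian ancient_g t0).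
have estimate E' : orthonormal_frame (g t i) x E' -> 0 < \det E' -> curv_norm (g t i) x E' <= scal (g t i) x.
  move=> EO' dE; have [Ap Cp] := nonneg_ic t t0 i x E' ix EO' dE.
  exact: (curv_norm_le_scal mG ix EO' Ap Cp (ric0 i x E' ix EO')).
(* The curvature hypothesis concerns positively oriented frames; otherwise [flip] changes the
   orientation and neither side of the estimate. *)
have [d0|d0] := ltP 0 (\det E); first exact: estimate.
rewrite -curv_norm_flip; apply: estimate; first exact: orthonormal_flip.
rewrite det_flip oppr_gt0 lt_neqAle d0 andbT.
by rewrite -unitfE -unitmxE (frame_unitmx EO).
Qed.
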